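(* Let $p\ge 2$ be an integer and $q=e^{i\pi/p}$. The $SL(2,\mathbb Z)$-representation on the $(3p-1)$-dimensional space $\mathfrak Z_{\rm cft}$ of extended characters of the $(1,p)$ logarithmic conformal field theory model is equivalent to the standard $SL(2,\mathbb Z)$-representation on the center $\mathfrak Z$ of the restricted quantum group $\overline{\mathcal U}$ (the restricted $\overline{\mathcal U}_q s\ell(2)$ at $q=e^{i\pi/p}$). Both representations are defined in the context.
   Context: Notation. $p\ge2$, $q=e^{i\pi/p}$, $q^{1/2}=e^{i\pi/(2p)}$, $[n]=\frac{q^n-q^{-n}}{q-q^{-1}}$, $[n]!=[1]\cdots[n]$, $[0]!=1$. $SL(2,\mathbb Z)$ is generated by $\left(\begin{smallmatrix}0&1\\-1&0\end{smallmatrix}\right)$ and $\left(\begin{smallmatrix}1&1\\0&1\end{smallmatrix}\right)$; in any representation the corresponding operators are denoted by $\mathscr S$ and $\mathscr T$. The space $\mathfrak Z_{\rm cft}$. It is the $(3p-1)$-dimensional complex vector space with basis $\chi^{+}_s,\chi^-_s$ ($1\le s\le p$) and $\varphi_s$ ($1\le s\le p-1$). (Here $\chi_s^\pm(\tau)$ are the characters of the $2p$ irreducible representations of the triplet W-algebra $\mathcal W(p)$, $\varphi_s(\tau)=\tau\rho_s(\tau)$, and $\mathscr S,\mathscr T$ act by $\tau\mapsto-1/\tau$ and $\tau\mapsto\tau+1$.) Put $\rho_s=\frac{p-s}{p}\chi^+_s-\frac sp\chi^-_{p-s}$ for $1\le s\le p-1$, $q^{a}_{\pm}=q^{a}\pm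 q^{-a}$, and $\lambda_{p,s}=e^{i\pi\left(\frac{(p-s)^2}{2p}-\frac1{12}\right)}$. The action is $$\mathscr S\chi^+_s=\tfrac1{\sqrt{2p}}\Bigl(\tfrac sp\bigl[\chi^+_p+(-1)^{p-s}\chi^-_p+\sum_{s'=1}^{p-1}q_+^{(p-s)s'}(\chi^+_{p-s'}+\chi^-_{s'})\bigr]-\sum_{s'=1}^{p-1}(-1)^{p+s+s'}q_-^{ss'}\varphi_{s'}\Bigr),$$ $$\mathscr S\chi^-_s=\tfrac1{\sqrt{2p}}\Bigl(\tfrac sp\bigl[\chi^+_p+(-1)^{s}\chi^-_p+\sum_{s'=1}^{p-1}q_+^{ss'}(\chi^+_{p-s'}+\chi^-_{s'})\bigr]+\sum_{s'=1}^{p-1}(-1)^{s+1}q_-^{ss'}\varphi_{s'}\Bigr),$$ $$\mathscr S\varphi_s=\tfrac1{\sqrt{2p}}\sum_{s'=1}^{p-1}(-1)^{p+s+s'}q_-^{ss'}\rho_{s'},$$ $\mathscr T\chi^+_s=\lambda_{p,s}\chi^+_s$ for $1\le s\le p$, $\mathscr T\chi^-_{p-s}=\lambda_{p,s}\chi^-_{p-s}$ for $0\le s\le p-1$, and $\mathscr T\varphi_s=\lambda_{p,s}(\varphi_s+\rho_s)$. The quantum group. $\overline{\mathcal U}$ is the $2p^3$-dimensional complex Hopf algebra with generators $E,F,K$, relations $E^p=F^p=0$, $K^{2p}=1$, $KEK^{-1}=q^2E$, $KFK^{-1}=q^{-2}F$, $[E,F]=\frac{K-K^{-1}}{q-q^{-1}}$,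 and $\Delta(E)=1\otimes E+E\otimes K$, $\Delta(F)=K^{-1}\otimes F+F\otimes1$, $\Delta(K)=K\otimes K$, $\epsilon(E)=\epsilon(F)=0$, $\epsilon(K)=1$, $S(E)=-EK^{-1}$, $S(F)=-KF$, $S(K)=K^{-1}$. Its center is $\mathfrak Z$, and $\mathfrak{Ch}=\{\beta\in\overline{\mathcal U}^*:\beta(xy)=\beta(S^2(y)x)\ \forall x,y\}$ is the space of $q$-characters. Drinfeld mapping: $\chi(\beta)=(\beta\otimes\mathrm{id})(\bar M)$ with $$\bar M=\tfrac1{2p}\sum_{m,n=0}^{p-1}\sum_{i,j=0}^{2p-1}\tfrac{(q-q^{-1})^{m+n}}{[m]![n]!}q^{m(m-1)/2+n(n-1)/2-m^2-mj+2nj-2ni-ij+mi}F^mE^nK^j\otimes E^mF^nK^i;$$ it restricts to a linear isomorphism $\mathfrak{Ch}\to\mathfrak Z$. Radford mapping: $\hat\phi(\beta)=(\beta\otimes\mathrm{id})\Delta(c)$, where $c=\zeta F^{p-1}E^{p-1}\sum_{j=0}^{2p-1}K^j$ is the two-sided cointegral and $\zeta=\sqrt{p/2}\,\frac1{([p-1]!)^2}$; it also restricts to a linear isomorphism $\mathfrak{Ch}\to\mathfrak Z$. Ribbon element: $$v=\tfrac{1-i}{2\sqrt p}\sum_{m=0}^{p-1}\sum_{j=0}^{2p-1}\tfrac{(q-q^{-1})^m}{[m]!}q^{-\frac m2+mj+\frac12(j+p+1)^2}F^mE^mK^j\in\mathfrak Z.$$ The standard $SL(2,\mathbb Z)$-representation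 on $\mathfrak Z$: $\mathscr S(a)=\hat\phi(\chi^{-1}(a))$ and $\mathscr T(a)=b\,\mathscr S^{-1}(v^{-1}\mathscr S(a))$ for $a\in\mathfrak Z$, where $b=e^{i\pi\left(\frac{(p+1)^2}{2p}-\frac1{12}\right)}$. *)

(* Defs.v *)
(* The complex numbers are [R[i]] for [R : realType]. *)
From HB Require Import structures.
From mathcomp Require Import all_boot all_order all_algebra all_field.
From mathcomp Require Import all_classical all_reals all_analysis.
From mathcomp Require Import complex.

Set Implicit Arguments.
Unset Strict Implicit.
Unset Printing Implicit Defensive.

Import Order.TTheory GRing.Theory Num.Theory.
Local Open Scope classical_set_scope.
Local Open Scope ring_scope.

(* [V (x) W] is realised as the space of coefficient matrices with respect to
   the bases [vbasis {:V}] and [vbasis {:W}]; [tlift_pure] and [tens_sum_pure]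
   show that [tpure], [tlift] have the universal property of (x). *)
Notation tens K V W := 'M[K]_(\dim {:V}, \dim {:W}).

Definition tpure (K : fieldType) (V W : vectType K) (a : V) (b : W) :
    tens K V W :=
  \matrix_(i, j) (coord (vbasis {:V}) i a * coord (vbasis {:W}) j b).

Definition tlift (K : fieldType) (V W : vectType K) (X : lmodType K)
    (f : V -> W -> X) (t : tens K V W) : X :=
  \sum_i \sum_j t i j *: f (vbasis {:V})`_i (vbasis {:W})`_j.

Lemma tlift_pure (K : fieldType) (V W : vectType K) (X : lmodType K)
    (f : V -> W -> X) (a : V) (b : W) :
  (forall y, linear (f^~ y)) -> (forall x, linear (f x)) ->
  tlift f (tpure a b) = f a b.
Proof.
move=> fl fr.
pose gl y : {linear V -> X} :=
  HB.pack (f^~ y) (GRing.isLinear.Build _ _ _ _ _ (fl y)).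
pose gr x : {linear W -> X} :=
  HB.pack (f x) (GRing.isLinear.Build _ _ _ _ _ (fr x)).
rewrite [in RHS](coord_vbasis (memvf a)) -[RHS]/(gl b _) linear_sum.
apply: eq_bigr => i _; rewrite linearZ /=.
rewrite [in RHS](coord_vbasis (memvf b)) -[f _ _]/(gr _ _) linear_sum.
rewrite scaler_sumr; apply: eq_bigr => j _.
by rewrite linearZ /= scalerA mxE.
Qed.

Lemma tens_sum_pure (K : fieldType) (V W : vectType K)
    (t : tens K V W) :
  t = \sum_i \sum_j t i j *: tpure (vbasis {:V})`_i (vbasis {:W})`_j.
Proof.
apply/matrixP => k l; rewrite summxE (bigD1 k) //= summxE (bigD1 l) //=.
have fV := basis_free (vbasisP {:V}); have fW := basis_free (vbasisP {:W}).
rewrite !mxE !coord_free // !eqxx !mulr1 big1 => [|j /negPf jl]; last first.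
  by rewrite !mxE !coord_free // jl !mulr0.
rewrite addr0 big1 ?addr0 // => i /negPf ik; rewrite summxE big1 // => j _.
by rewrite !mxE !coord_free // ik mul0r mulr0.
Qed.

Definition tmul (K : fieldType) (A : falgType K)
    (x y : tens K A A) : tens K A A :=
  tlift (fun a b => tlift (fun a' b' => tpure (a * a') (b * b')) y) x.

(* In [hopf_coassoc], (Delta (x) id) o Delta and (id (x) Delta) o Delta are
   compared in (A (x) A) (x) A.  [hopf_antipM] and [hopf_antip1] follow from the
   other axioms; they are the reason why the values of the antipode on
   generators determine it. *)
Record hopf_algebra (K : fieldType) (A : falgType K) := HopfAlgebra {
  hopf_comul : 'Hom(A, tens K A A);
  hopf_counit : 'Hom(A, K^o);
  hopf_antip : 'End(A);
  hopf_comulM : forall x y,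
    hopf_comul (x * y) = tmul (hopf_comul x) (hopf_comul y);
  hopf_comul1 : hopf_comul 1 = tpure 1 1;
  hopf_counitM : forall x y,
    hopf_counit (x * y) = hopf_counit x * hopf_counit y;
  hopf_counit1 : hopf_counit 1 = 1;
  hopf_coassoc : forall x,
    tlift (fun a b => tpure (hopf_comul a) b) (hopf_comul x) =
    tlift (fun a b => tlift (fun b' b'' => tpure (tpure a b') b'')
                            (hopf_comul b)) (hopf_comul x);
  hopf_counit_l : forall x,
    tlift (fun a b => hopf_counit a *: b) (hopf_comul x) = x;
  hopf_counit_r : forall x,
    tlift (fun a b => hopf_counit b *: a) (hopf_comul x) = x;
  hopf_antipM : forall x y, hopf_antip (x * y) = hopf_antip y * hopf_antip x;
  hopf_antip1 : hopf_antip 1 = 1;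
  hopf_antip_l : forall x,
    tlift (fun a b => hopf_antip a * b) (hopf_comul x) = (hopf_counit x)%:A;
  hopf_antip_r : forall x,
    tlift (fun a b => a * hopf_antip b) (hopf_comul x) = (hopf_counit x)%:A
}.

Definition expi (R : realType) (t : R) : R[i] := (cos t +i* sin t)%C.

(* q^x for real x, with the branch q^x = exp(i pi x / p). *)
Definition qpow (R : realType) (p : nat) (x : R) : R[i] :=
  expi (pi * x / p%:R).

Definition qroot (R : realType) (p : nat) : R[i] := expi (pi / p%:R).

Definition qint (R : realType) (p n : nat) : R[i] :=
  let q := qroot R p in (q ^+ n - q ^- n) / (q - q^-1).

Definition qfact (R : realType) (p n : nat) : R[i] :=
  \prod_(1 <= k < n.+1) qint R p k.

(* The relations bound the dimension of an algebra generated by E, F, K by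
   2 p^3, so [Udim] says that they are defining relations. *)
Record restricted_Usl2 (R : realType) (p : nat) (A : falgType R[i]) :=
    RestrictedUsl2 {
  Uhopf : hopf_algebra A;
  UE : A;
  UF : A;
  UK : A;
  Ugen : agenv <<[:: UE; UF; UK]>>%VS = {:A}%VS;
  Udim : \dim {:A} = (2 * p ^ 3)%N;
  Uexp_E : UE ^+ p = 0;
  Uexp_F : UF ^+ p = 0;
  Uexp_K : UK ^+ (2 * p) = 1;
  Urel_KE : UK * UE * UK^-1 = (qroot R p ^+ 2) *: UE;
  Urel_KF : UK * UF * UK^-1 = (qroot R p ^- 2) *: UF;
  Urel_EF : UE * UF - UF * UE
    = (qroot R p - (qroot R p)^-1)^-1 *: (UK - UK^-1);
  Ucomul_E : hopf_comul Uhopf UE = tpure 1 UE + tpure UE UK;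
  Ucomul_F : hopf_comul Uhopf UF = tpure UK^-1 UF + tpure UF 1;
  Ucomul_K : hopf_comul Uhopf UK = tpure UK UK;
  Ucounit_E : hopf_counit Uhopf UE = 0;
  Ucounit_F : hopf_counit Uhopf UF = 0;
  Ucounit_K : hopf_counit Uhopf UK = 1;
  Uantip_E : hopf_antip Uhopf UE = - (UE * UK^-1);
  Uantip_F : hopf_antip Uhopf UF = - (UK * UF);
  Uantip_K : hopf_antip Uhopf UK = UK^-1
}.

Definition qcharacters (R : realType) (p : nat) (A : falgType R[i])
    (U : restricted_Usl2 p A) : set 'Hom(A, R[i]^o) :=
  [set beta | forall x y : A,
     beta (x * y) = beta (hopf_antip (Uhopf U) (hopf_antip (Uhopf U) y) * x)].

Definition Mbar (R : realType) (p : nat) (A : falgType R[i])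
    (U : restricted_Usl2 p A) : tens R[i] A A :=
  let E := UE U in let F := UF U in let K := UK U in
  let q := qroot R p in
  (2 * p%:R)^-1 *:
  \sum_(0 <= m < p) \sum_(0 <= n < p)
  \sum_(0 <= i < 2 * p) \sum_(0 <= j < 2 * p)
    ((q - q^-1) ^+ (m + n) / (qfact R p m * qfact R p n) *
     qpow p (m%:R * (m%:R - 1) / 2 + n%:R * (n%:R - 1) / 2 - m%:R ^+ 2
             - m%:R * j%:R + 2 * n%:R * j%:R - 2 * n%:R * i%:R
             - i%:R * j%:R + m%:R * i%:R)) *:
    tpure (F ^+ m * E ^+ n * K ^+ j) (E ^+ m * F ^+ n * K ^+ i).

Definition drinfeld (R : realType) (p : nat) (A : falgType R[i])
    (U : restricted_Usl2 p A) (beta : 'Hom(A, R[i]^o)) : A :=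
  tlift (fun a b => beta a *: b) (Mbar U).

Definition cointegral (R : realType) (p : nat) (A : falgType R[i])
    (U : restricted_Usl2 p A) : A :=
  ((Num.sqrt (p%:R / 2 : R))%:C%C / qfact R p p.-1 ^+ 2) *:
  (UF U ^+ p.-1 * UE U ^+ p.-1 * \sum_(0 <= j < 2 * p) UK U ^+ j).

Definition radford (R : realType) (p : nat) (A : falgType R[i])
    (U : restricted_Usl2 p A) (beta : 'Hom(A, R[i]^o)) : A :=
  tlift (fun a b => beta a *: b) (hopf_comul (Uhopf U) (cointegral U)).

Definition ribbon (R : realType) (p : nat) (A : falgType R[i])
    (U : restricted_Usl2 p A) : A :=
  let q := qroot R p in
  ((1 - 'i%C) / (2 * (Num.sqrt (p%:R : R))%:C%C)) *:
  \sum_(0 <= m < p) \sum_(0 <= j < 2 * p)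
    ((q - q^-1) ^+ m / qfact R p m *
     qpow p (- (m%:R / 2) + m%:R * j%:R + (j%:R + p%:R + 1) ^+ 2 / 2)) *:
    (UF U ^+ m * UE U ^+ m * UK U ^+ j).

Definition mx22 (a b c d : int) : 'M[int]_2 :=
  \matrix_(i < 2, j < 2)
    if i == 0 then (if j == 0 then a else b) else (if j == 0 then c else d).

Definition SL2Z_S : 'M[int]_2 := mx22 0 1 (-1) 0.
Definition SL2Z_T : 'M[int]_2 := mx22 1 1 0 1.

(* SL(2,Z) is the set of integer matrices of determinant 1; the values of [rho]
   on other matrices are irrelevant. *)
Definition SL2Z_rep (K : fieldType) (V : vectType K)
    (rho : 'M[int]_2 -> 'End(V)) : Prop :=
  rho 1 = \1%VF /\
  forall g h, \det g = 1 -> \det h = 1 -> rho (g * h) = (rho g \o rho h)%VF.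

Definition SL2Z_equivalent (K : fieldType) (V W : vectType K)
    (rho : 'M[int]_2 -> 'End(V)) (sigma : 'M[int]_2 -> 'End(W)) : Prop :=
  exists f : 'Hom(V, W), bijective f /\
    forall g, \det g = 1 -> forall x, f (rho g x) = sigma g (f x).

Definition modular_S (R : realType) (p : nat) (A : falgType R[i])
    (U : restricted_Usl2 p A) (a : A) : A :=
  radford U ('pinv_(fun=> 0) (qcharacters U) (drinfeld U) a).

Definition modular_T (R : realType) (p : nat) (A : falgType R[i])
    (U : restricted_Usl2 p A) (a : A) : A :=
  expi (pi * ((p%:R + 1) ^+ 2 / (2 * p%:R) - 12^-1)) *:
  'pinv_(fun=> 0) [set z | z \in 'Z({:A})%VS] (modular_S U)
    ((ribbon U)^-1 * modular_S U a).

Definition center_SL2Z_rep (R : realType) (p : nat) (A : falgType R[i])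
    (U : restricted_Usl2 p A)
    (rho : 'M[int]_2 -> 'End(subvs_of 'Z({:A})%VS)) : Prop :=
  [/\ SL2Z_rep rho,
      forall z, vsval (rho SL2Z_S z) = modular_S U (vsval z)
    & forall z, vsval (rho SL2Z_T z) = modular_T U (vsval z)].

(* [inl (true, j)], [inl (false, j)] and [inr j] index chi^+_(j+1), chi^-_(j+1)
   and phi_(j+1). *)
Definition Zcft (R : realType) (p : nat) : vectType R[i] :=
  {ffun bool * 'I_p + 'I_p.-1 -> R[i]^o}.

Definition chi (R : realType) (p : nat) (e : bool) (s : nat) : Zcft R p :=
  [ffun k : bool * 'I_p + 'I_p.-1 =>
     (if k is inl (e', j) then (e' == e) && (j.+1 == s) else false)%:R].

Definition chip (R : realType) (p s : nat) : Zcft R p := chi R p true s.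

Definition chim (R : realType) (p s : nat) : Zcft R p := chi R p false s.

Definition phi (R : realType) (p s : nat) : Zcft R p :=
  [ffun k : bool * 'I_p + 'I_p.-1 =>
     (if k is inr j then j.+1 == s else false)%:R].

(* The linear extension of chi^+_s |-> fp s, chi^-_s |-> fm s, phi_s |-> fphi s. *)
Definition cft_extend (R : realType) (p : nat) (fp fm fphi : nat -> Zcft R p)
    (x : Zcft R p) : Zcft R p :=
  \sum_(j < p) x (inl (true, j)) *: fp j.+1
  + \sum_(j < p) x (inl (false, j)) *: fm j.+1
  + \sum_(j < p.-1) x (inr j) *: fphi j.+1.

Definition rho_cft (R : realType) (p s : nat) : Zcft R p :=
  ((p%:R - s%:R) / p%:R) *: chip R p s - (s%:R / p%:R) *: chim R p (p - s).

Definition qplus (R : realType) (p a : nat) : R[i] :=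
  qroot R p ^+ a + qroot R p ^- a.

Definition qminus (R : realType) (p a : nat) : R[i] :=
  qroot R p ^+ a - qroot R p ^- a.

Definition lambda (R : realType) (p s : nat) : R[i] :=
  expi (pi * ((p%:R - s%:R) ^+ 2 / (2 * p%:R) - 12^-1)).

Definition cft_S_chip (R : realType) (p s : nat) : Zcft R p :=
  ((Num.sqrt (2 * p%:R : R))%:C%C)^-1 *:
  ((s%:R / p%:R) *:
     (chip R p p + (-1) ^+ (p - s) *: chim R p p
      + \sum_(1 <= s' < p)
          qplus R p ((p - s) * s') *: (chip R p (p - s') + chim R p s'))
   - \sum_(1 <= s' < p)
       ((-1) ^+ (p + s + s') * qminus R p (s * s')) *: phi R p s').

Definition cft_S_chim (R : realType) (p s : nat) : Zcft R p :=
  ((Num.sqrt (2 * p%:R : R))%:C%C)^-1 *: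
  ((s%:R / p%:R) *:
     (chip R p p + (-1) ^+ s *: chim R p p
      + \sum_(1 <= s' < p)
          qplus R p (s * s') *: (chip R p (p - s') + chim R p s'))
   + \sum_(1 <= s' < p)
       ((-1) ^+ (s + 1) * qminus R p (s * s')) *: phi R p s').

Definition cft_S_phi (R : realType) (p s : nat) : Zcft R p :=
  ((Num.sqrt (2 * p%:R : R))%:C%C)^-1 *:
  \sum_(1 <= s' < p)
    ((-1) ^+ (p + s + s') * qminus R p (s * s')) *: rho_cft R p s'.

Definition cft_S (R : realType) (p : nat) : Zcft R p -> Zcft R p :=
  cft_extend (cft_S_chip R p) (cft_S_chim R p) (cft_S_phi R p).

(* [lambda R p (p - s)] for chi^-_s is the rule for chi^-_(p-s) reindexed. *)
Definition cft_T (R : realType) (p : nat) : Zcft R p -> Zcft R p :=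
  cft_extend
    (fun s => lambda R p s *: chip R p s)
    (fun s => lambda R p (p - s) *: chim R p s)
    (fun s => lambda R p s *: (phi R p s + rho_cft R p s)).

Definition cft_SL2Z_rep (R : realType) (p : nat)
    (rho : 'M[int]_2 -> 'End(Zcft R p)) : Prop :=
  [/\ SL2Z_rep rho,
      forall x, rho SL2Z_S x = cft_S x
    & forall x, rho SL2Z_T x = cft_T x].

(* Main.v *)
(* Let e = (q - q^-1) E, f = (q - q^-1) F, and let 1_u be the projection to the
   q^u-eigenspace of K, for u in Z/2p.  In the PBW basis f^m e^n 1_u a central
   element is a sum over m < p and u of g(m, u + m + 1) / c_m f^m e^m 1_u, where
   c_m = (q - q^-1)^m [m]! and
     g(m, u + 1) - g(m, u - 1) = (q^u - q^-u) g(m + 1, u).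
   In these coordinates the composite of the Radford map with the inverse of the
   Drinfeld map is a Fourier transform on Z/2p combined with m |-> p - 1 - m.
   The traces of the simple modules give explicit families P_s, M_s which are
   transformed like chi^+_s and chi^-_s; put K_s = P_s + M_(p-s),
   R_s = P_s - (s/p) K_s, and let phi_s correspond to F_s, the Fourier transform
   of the R's.  The ribbon element v acts on these families through the Casimir
   element, diagonally except for a Jordan block on R_s, F_s.  So the linear map
   L from the characters to the center satisfies L S = S L and v L T = b L, whence
   L o S intertwines both actions.  On the K's the relation (S T)^3 = 1 is the
   evaluation of the quadratic Gauss sum on Z/2p, and on the R's and F's it follows
   from the same Gauss sum.  Since S^2 = 1, one gets a representation of SL(2,Z)
   from the normal form of words in Z/2 * Z/3 = PSL(2,Z). *)
Require Import Defs.
From HB Require Import structures.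
From mathcomp Require Import all_boot all_order all_algebra all_field.
From mathcomp Require Import all_classical all_reals all_analysis.
From mathcomp Require Import complex.
From mathcomp Require Import ring lra zify.
Set Implicit Arguments.
Unset Strict Implicit.
Unset Printing Implicit Defensive.
Import Order.TTheory GRing.Theory Num.Theory.
Local Open Scope ring_scope.

(** * Central coefficients at a root of unity *)

(** No module of the quantum group is constructed: the families are written down as functions of (m,
    u), and every property is checked on coefficients. Rigidity makes this possible. The recursion
    divides by q^u - q^-u, which vanishes at u = 0 and u = p only, so a central family is determined
    by its row m = 0 and these two columns, and it is even in u. Evenness is what turns Fourier
    inversion into S^2 = 1. An eigenvector of the Casimir element with eigenvalue q^t + q^-t is
    determined by its components at the weights t - 1 and -t - 1. Since f^m e^m 1_u is a polynomial
    in the Casimir element times 1_u, the ribbon element acts at such a weight by the value of an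
    interpolation polynomial, and on a Jordan block also by its derivative. Existence of both
    representations is part of the claim, while the operators are given on two generators only;
    hence the relations of PSL(2,Z) have to be complete. The phase -1/12 enters through the cube of
    b, where it becomes -1/4 and cancels the eighth root of unity in the Gauss sum. *)

Definition even_root (F : fieldType) (p : nat) (q : F) : Prop :=
  [/\ (1 < p)%N, (2 * p).-primitive_root q & (2 * p)%:R != 0 :> F].

(** * Characters, sines and factorials on Z/2p *)

Section RootCalculus.
Variables (F : fieldType) (p : nat) (q : F).
Local Notation Z := 'Z_(2 * p).
Local Notation pz := (p%:R : Z).

(* [fac n] is (q - q^-1)^n [n]!. *)
Definition chr (u : Z) : F := q ^+ u.
Definition sn (u : Z) : F := chr u - chr (- u).
Definition cs (u : Z) : F := chr u + chr (- u).
Definition sgn (u : Z) : F := chr (pz * u).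
Definition fac (n : nat) : F := \prod_(1 <= k < n.+1) sn k%:R.

Hypothesis H : even_root p q.

Lemma even_root_gt1 : (1 < p)%N. Proof. by case: H. Qed.
Lemma even_root_gt0 : (0 < p)%N. Proof. exact: ltnW even_root_gt1. Qed.
Lemma even_root_gt1N : (1 < 2 * p)%N. Proof. have := even_root_gt1; lia. Qed.
Lemma even_root_prim : (2 * p).-primitive_root q. Proof. by case: H. Qed.
Lemma even_root_char : (2 * p)%:R != 0 :> F. Proof. by case: H. Qed.
Let p_gt1 := even_root_gt1.
Let N_gt1 := even_root_gt1N.
Let prim := even_root_prim.

Lemma card_Z : #|{: Z}| = (2 * p)%N.
Proof. by rewrite card_ord Zp_cast. Qed.

Lemma valZ n : (n%:R : Z) = (n %% (2 * p))%N :> nat.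
Proof. exact: val_Zp_nat. Qed.

Lemma natrZ (u : Z) : (u : nat)%:R = u.
Proof. by apply/val_inj; rewrite /= valZ modn_small // -[X in (_ < X)%N](Zp_cast N_gt1) ltn_ord. Qed.

Lemma ltnZ (u : Z) : (u < 2 * p)%N.
Proof. by rewrite -[X in (_ < X)%N](Zp_cast N_gt1) ltn_ord. Qed.

Lemma eqZ_nat m n : (m%:R == n%:R :> Z) = (m == n %[mod 2 * p])%N.
Proof. by rewrite -val_eqE /= !valZ. Qed.

Lemma N0Z : (2 * p)%:R = 0 :> Z.
Proof. by apply/eqP; rewrite (eqZ_nat _ 0) modnn mod0n. Qed.

Lemma pp0 : pz + pz = 0.
Proof. by rewrite -natrD addnn -mul2n N0Z. Qed.

Lemma oppp : - pz = pz.
Proof. by apply: (addrI pz); rewrite pp0 subrr. Qed.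

Lemma q_neq0 : q != 0.
Proof.
apply/eqP => q0; have := prim_expr_order prim.
by rewrite q0 expr0n eqn0Ngt (ltnW N_gt1) => /esym/eqP; rewrite oner_eq0.
Qed.

Lemma chr0 : chr 0 = 1. Proof. by rewrite /chr expr0. Qed.

Lemma chr_nat n : chr n%:R = q ^+ n.
Proof. by rewrite /chr valZ prim_expr_mod. Qed.

Lemma chrD u v : chr (u + v) = chr u * chr v.
Proof. by rewrite -[u]natrZ -[v]natrZ -natrD !chr_nat exprD. Qed.

Lemma chr_neq0 u : chr u != 0.
Proof. by rewrite expf_neq0 ?q_neq0. Qed.

Lemma chrN u : chr (- u) = (chr u)^-1.
Proof.
by apply: (mulIf (chr_neq0 u)); rewrite -chrD addNr chr0 mulVf ?chr_neq0.
Qed.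

Lemma chrMn u n : chr (u *+ n) = chr u ^+ n.
Proof. by elim: n => [|n IH]; rewrite ?mulr0n ?chr0 // mulrS chrD IH exprS. Qed.

Lemma chr_inj : injective chr.
Proof.
move=> u v /eqP; rewrite /chr (eq_prim_root_expr prim) => /eqP.
by rewrite !modn_small ?ltnZ // => /val_inj.
Qed.

Lemma chr_eq1 u : (chr u == 1) = (u == 0).
Proof. by rewrite -chr0 (inj_eq chr_inj). Qed.

Lemma pz_neq0 : pz != 0.
Proof.
by rewrite (eqZ_nat p 0) mod0n modn_small; have := p_gt1; lia.
Qed.

Lemma chrp : chr pz = -1.
Proof.
have: chr pz ^+ 2 == 1 by rewrite -chrMn mulr2n pp0 chr0.
by rewrite sqrf_eq1 chr_eq1 (negPf pz_neq0) => /eqP.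
Qed.

Lemma sgnD u v : sgn (u + v) = sgn u * sgn v.
Proof. by rewrite /sgn mulrDr chrD. Qed.

Lemma sgn_nat n : sgn n%:R = (-1) ^+ n.
Proof. by rewrite /sgn mulr_natr chrMn chrp. Qed.

Lemma sgnN u : sgn (- u) = sgn u.
Proof. by rewrite /sgn mulrN -mulNr oppp. Qed.

Lemma sgn2 u : sgn u * sgn u = 1.
Proof. by rewrite -{1}[u]opprK sgnN -sgnD addNr /sgn mulr0 chr0. Qed.

Lemma sgn_neq0 u : sgn u != 0. Proof. exact: chr_neq0. Qed.

Lemma snN u : sn (- u) = - sn u.
Proof. by rewrite /sn opprK opprB. Qed.

Lemma csN u : cs (- u) = cs u.
Proof. by rewrite /cs opprK addrC. Qed.

Lemma sn0 : sn 0 = 0. Proof. by rewrite /sn oppr0 subrr. Qed.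

Lemma chrDp u : chr (pz + u) = - chr u.
Proof. by rewrite chrD chrp mulN1r. Qed.

Lemma snDp u : sn (pz + u) = - sn u.
Proof. by rewrite /sn opprD oppp !chrDp opprB addrC opprK. Qed.

Lemma csDp u : cs (pz + u) = - cs u.
Proof. by rewrite /cs opprD oppp !chrDp opprD. Qed.

Lemma snp : sn pz = 0.
Proof. by rewrite -[pz]addr0 snDp sn0 oppr0. Qed.

(** Since [chr] is injective, the zeros are the fixed points of u |-> -u on Z/2p. In these two
    columns the recursion for central families does not determine the next row. *)
Lemma sn_eq0 u : (sn u == 0) = (u == 0) || (u == pz).
Proof.
apply/idP/idP => [|/orP[]/eqP->]; rewrite ?sn0 ?snp //.
rewrite /sn subr_eq0 (inj_eq chr_inj) => /eqP e.
have {e}: (u + u) = 0 by rewrite {1}e addNr.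
rewrite -[u]natrZ -natrD => /eqP; rewrite (eqZ_nat _ 0) mod0n => d.
have ltu := ltnZ u; rewrite (eqZ_nat _ 0) eqZ_nat mod0n !(modn_small ltu).
rewrite (modn_small (_ : (p < 2 * p)%N)) -?val_eqE /=; last by have := p_gt1; lia.
move: d => /dvdnP[k]; have := p_gt1.
case: (val u) ltu => [|n] //; case: k => [|[|k]]; nia.
Qed.

Lemma sn_nat_neq0 n : (0 < n < p)%N -> sn n%:R != 0.
Proof.
move=> /andP[n0 np]; rewrite sn_eq0 (eqZ_nat _ 0) eqZ_nat mod0n.
by rewrite !modn_small; have := p_gt1; lia.
Qed.

Lemma fac0 : fac 0 = 1. Proof. by rewrite /fac big_geq. Qed.

Lemma facS n : fac n.+1 = fac n * sn n.+1%:R.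
Proof. by rewrite /fac big_nat_recr. Qed.

Lemma fac_neq0 n : (n < p)%N -> fac n != 0.
Proof.
elim: n => [|n IH] np; first by rewrite fac0 oner_neq0.
by rewrite facS mulf_neq0 ?IH ?sn_nat_neq0 //; lia.
Qed.

Lemma sn_compl n : (n <= p)%N -> sn (p - n)%:R = sn n%:R.
Proof. by move=> le; rewrite natrB // snDp snN opprK. Qed.

(** The reflection [sn (p - n) = sn n] lets each step trade one factor between the two
    factorials. *)
Lemma fac_compl n : (n < p)%N -> fac n * fac (p.-1 - n) = fac p.-1.
Proof.
elim: n => [|n IH] np; first by rewrite fac0 mul1r subn0.
rewrite -IH 1?ltnW //; have -> : (p.-1 - n = (p.-1 - n.+1).+1)%N by lia.
rewrite !facS -!mulrA; congr (_ * _); rewrite mulrC; congr (_ * _).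
by rewrite -sn_compl ?(ltnW np) //; congr (sn _%:R); lia.
Qed.

Lemma facp : fac p = 0.
Proof.
have := facS p.-1; rewrite (prednK even_root_gt0) => ->.
by rewrite snp mulr0.
Qed.

Lemma chr_sum (x : Z) : \sum_(u : Z) chr (u * x) = if x == 0 then (2 * p)%:R else 0.
Proof.
case: eqP => [->|/eqP x0].
  rewrite (eq_bigr (fun=> 1)) => [|u _]; last by rewrite mulr0 chr0.
  by rewrite sumr_const card_Z.
have c1 : chr x != 1 by rewrite chr_eq1.
apply: (mulIf (_ : chr x - 1 != 0)); first by rewrite subr_eq0.
rewrite mul0r mulrBr mulr1 mulr_suml.
rewrite [X in _ - X](reindex_inj (addIr 1)) /=.
apply/eqP; rewrite subr_eq0; apply/eqP/eq_bigr => u _.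
by rewrite mulrDl mul1r chrD.
Qed.

(** Evaluation of (X^p - 1) / (X - 1) at 1, once as a product and once as a geometric sum. *)
Lemma prod_1sub_root (w : F) :
  p.-primitive_root w -> \prod_(1 <= k < p) (1 - w ^+ k) = p%:R.
Proof.
move=> pw; have := factor_Xn_sub_1 pw.
rewrite subrX1 big_ltn ?even_root_gt0 // expr0.
move=> /(mulfI (monic_neq0 (monicXsubC 1))) /(congr1 (horner^~ 1)).
rewrite horner_prod horner_sum => e.
rewrite (eq_bigr (fun i => ('X - (w ^+ i)%:P).[1])) => [|i _]; last by rewrite !hornerE.
rewrite e (eq_bigr (fun=> 1)) => [|i _]; last by rewrite hornerXn expr1n.
by rewrite sumr_const card_ord.
Qed.

(** With Q = q^2, the square of [sn k] is -(1 - Q^k)(1 - Q^(p-k)), and both products over k equal p.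
    This constant normalises S so that its square is 1. *)
Lemma fac_sq : fac p.-1 ^+ 2 = (-1) ^+ p.-1 * p%:R ^+ 2.
Proof.
have pQ : p.-primitive_root (q ^+ 2).
  by have := exp_prim_root prim 2; rewrite (gcdn_idPl _) ?dvdn_mulr // mulKn.
have Qp : (q ^+ 2) ^+ p = 1 by rewrite prim_expr_order.
rewrite /fac prednK ?even_root_gt0 // expr2 -big_split /=.
rewrite (eq_big_nat _ _ (F2 := fun k => -1 * ((1 - (q ^+ 2) ^+ k) * (1 - (q ^+ 2) ^+ (p - k))))); last first.
  move=> k /andP[k0 kp]; rewrite /sn chrN chr_nat -!exprM.
  have -> : q ^+ (2 * (p - k)) = q ^- (2 * k).
    apply: (mulfI (_ : q ^+ (2 * k) != 0)); first by rewrite expf_neq0 ?q_neq0.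
    rewrite divff ?expf_neq0 ?q_neq0 // -exprD -mulnDr subnKC ?(ltnW kp) //.
    by rewrite exprM Qp.
  rewrite mulnC exprM; field; exact: (expf_neq0 k q_neq0).
rewrite big_split /= big_split /=; congr (_ * _).
  by rewrite prodr_const_nat subn1.
rewrite [RHS]expr2; congr (_ * _); first by rewrite prod_1sub_root.
rewrite -(prod_1sub_root pQ) [RHS]big_nat_rev /=.
by apply: eq_big_nat => k kp; congr (1 - _ ^+ _); lia.
Qed.

End RootCalculus.

(** * The recursion of central families, the operator S and the Casimir operator *)

Section CentralCoefficients.
Variables (F : fieldType) (p : nat) (q : F).
Local Notation Z := 'Z_(2 * p).
Local Notation pz := (p%:R : Z).
Local Notation chr := (@chr F p q).
Local Notation sn := (@sn F p q).
Local Notation cs := (@cs F p q).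
Local Notation sgn := (@sgn F p q).
Local Notation fac := (@fac F p q).

(* The condition under which [el g] below is central. *)
Definition central_coef (g : nat -> Z -> F) : Prop :=
  forall m u, (m.+1 < p)%N -> g m (u + 1) - g m (u - 1) = sn u * g m.+1 u.

(* The action of S on coefficients. *)
Definition coefS (r : F) (g : nat -> Z -> F) (m : nat) (u : Z) : F :=
  fac p.-1 / (p%:R * r) *
  \sum_(v : Z) sgn (u + v + pz + m%:R) * chr (u * v) * g (p.-1 - m)%N v.

(* Multiplication by the Casimir element. *)
Definition coefY (g : nat -> Z -> F) (m : nat) (u : Z) : F :=
  sn m%:R * g m.-1 (u - 1) + cs (u + m%:R) * g m u.

Hypothesis H : even_root p q.

(** Where [sn u] is nonzero, row m determines row m + 1; the two exceptional columns are supplied by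
    the last two hypotheses. *)
Lemma central_coef_uniq g : central_coef g ->
    (forall u, g 0%N u = 0) ->
    (forall m, (m < p)%N -> g m 0 = 0) ->
    (forall m, (m < p)%N -> g m pz = 0) ->
  forall m u, (m < p)%N -> g m u = 0.
Proof.
move=> sg g0 gz gp; elim=> [|m IH] u mp; first exact: g0.
have := sg m u mp; rewrite !IH 1?ltnW // subr0 => /esym/eqP.
rewrite mulf_eq0 sn_eq0 // -orbA => /or3P[/eqP->|/eqP->|/eqP//]; [exact: gz|exact: gp].
Qed.

Lemma two_neq0 : 2%:R != 0 :> F.
Proof.
by have := even_root_char H; rewrite natrM mulf_eq0 negb_or => /andP[].
Qed.

Lemma p_neq0 : p%:R != 0 :> F.
Proof.
by have := even_root_char H; rewrite natrM mulf_eq0 negb_or => /andP[].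
Qed.

Lemma eq_opp0 (x : F) : x = - x -> x = 0.
Proof.
move=> /eqP; rewrite -subr_eq0 opprK -mulr2n -mulr_natl mulf_eq0.
by rewrite (negPf two_neq0) => /eqP.
Qed.

(** At a fixed point o of negation oddness gives 0, and the recursion there gives equal, hence zero,
    neighbours because [sn o = 0]. Stepping outward from o = 0 and o = p by two at a time kills the
    triangles m + j < p, which contain row 0 and both exceptional columns. *)
Lemma central_coef_odd g : central_coef g ->
    (forall m u, g m (- u) = - g m u) ->
  forall m u, (m < p)%N -> g m u = 0.
Proof.
move=> sg og.
have key (o : Z) : - o = o -> sn o = 0 ->
    forall j m, (m + j < p)%N -> g m (o + j%:R) = 0.
  move=> oo so j; elim/ltn_ind: j => -[|[|j]] IH m mp.
  - by apply: eq_opp0; rewrite addr0 -og oo.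
  - apply: eq_opp0; rewrite -og opprD oo; apply/eqP.
    by rewrite -subr_eq0 sg ?so ?mul0r //; lia.
  - have := @sg m (o + j.+1%:R); rewrite (IH j.+1) //; last by lia.
    rewrite mulr0 -!addrA -(natrD _ _ 1) -(natrB _ (_ : 1 <= j.+1)%N) // addn1 subn1 /=.
    by rewrite (IH j) ?subr0; [apply; lia|lia|lia].
have k0 := key 0 (oppr0 _) (sn0 p q).
have kp := key pz (oppp H) (snp H).
apply: central_coef_uniq => //.
- move=> u; have u2 := ltnZ H u; case: (ltnP u p) => [up|pu].
    by have := k0 u 0%N up; rewrite add0r (natrZ H).
  have := kp (u - p)%N 0%N; rewrite -natrD subnKC // (natrZ H).
  by apply; rewrite add0n; lia.
- by move=> m mp; have := k0 0%N m; rewrite addr0 addn0; apply.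
- by move=> m mp; have := kp 0%N m; rewrite addr0 addn0; apply.
Qed.

(** As [sn] is odd, the odd part of g satisfies the same recursion. *)
Lemma central_coef_even g : central_coef g ->
  forall m u, (m < p)%N -> g m (- u) = g m u.
Proof.
move=> sg m u mp; apply/esym/eqP; rewrite -subr_eq0; apply/eqP.
apply: (@central_coef_odd (fun m u => g m u - g m (- u))) => // {mp u}m u.
  move=> mp; rewrite mulrBr -(sg m u) //.
  have := sg m (- u) mp; rewrite snN mulNr => /(congr1 (@GRing.opp F)).
  rewrite opprK => <-; rewrite (opprB u 1) opprD [1 - u]addrC; ring.
by rewrite opprK opprB.
Qed.

(** Summation by parts: the transform exchanges differences in u with multiplication by [sn], and m
    |-> p - 1 - m exchanges the roles of the rows m and m + 1, so the recursion is mapped to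
    itself. *)
Lemma central_coefS r g : central_coef g -> central_coef (coefS r g).
Proof.
move=> sg m u mp; rewrite /coefS -mulrBr mulrCA; congr (_ * _).
have em : (p.-1 - m = (p.-1 - m.+1).+1)%N by lia.
have shift (a : Z) (f : Z -> F) : \sum_(v : Z) f v = \sum_(v : Z) f (v + a).
  by rewrite (reindex_inj (addIr a)).
set n := (p.-1 - m.+1)%N in em *.
have sgn1 : sgn 1 = -1 by rewrite (sgn_nat H 1) expr1.
pose K v := sgn (u + v + pz + m.+1%:R) * chr (u * v).
have e1 : \sum_(v : Z) K v * (g n (v + 1) - g n (v - 1)) = sn u * \sum_(v : Z) K v * g n v.
  under eq_bigr do rewrite mulrBr.
  rewrite sumrB (shift (-1) (fun v => K v * g n (v + 1))).
  rewrite (shift 1 (fun v => K v * g n (v - 1))) -sumrB mulr_sumr.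
  apply: eq_bigr => v _; rewrite addrK subrK -mulrBl mulrA; congr (_ * _).
  rewrite /K !addrA.
  have sg1 (w : Z) x : sgn (u + v + x + pz + w) = sgn (u + v + pz + w) * sgn x.
    by rewrite -sgnD //; congr (sgn _); ring.
  have -> : u * (v - 1) = u * v - u by ring.
  have -> : u * (v + 1) = u * v + u by ring.
  by rewrite !sg1 sgnN // sgn1 !chrD // /sn; ring.
rewrite -[RHS]e1 -sumrB; apply: eq_bigr => v _; rewrite em sg; last by lia.
rewrite mulrCA !mulrA -mulrBl; congr (_ * _).
rewrite /K -[m.+1]addn1 natrD ![u + _ + v]addrAC.
have sg1 (x : Z) : sgn (u + v + x + pz + m%:R) = sgn (u + v + pz + m%:R) * sgn x.
  by rewrite -sgnD //; congr (sgn _); ring.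
have -> : (u + 1) * v = u * v + v by ring.
have -> : (u - 1) * v = u * v - v by ring.
have -> : sgn (u + v + pz + (m%:R + 1)) = sgn (u + v + pz + m%:R) * sgn 1.
  by rewrite -sgnD //; congr (sgn _); ring.
by rewrite !sg1 sgnN // sgn1 !chrD // /sn; ring.
Qed.

Lemma coefS_const r : r ^+ 2 = (2 * p)%:R ->
  (fac p.-1 / (p%:R * r)) ^+ 2 * (2 * p)%:R = (-1) ^+ p.-1.
Proof.
move=> r2; rewrite expr_div_n exprMn r2 fac_sq // -r2.
have r0 : r != 0 by rewrite -sqrf_eq0 r2 (even_root_char H).
have p0 := p_neq0; set e := (-1) ^+ _; by field; rewrite r0.
Qed.

(** Fourier inversion returns the value at -u, and central families are even. The two sign kernels
    multiply to a sign that does not depend on the intermediate variable. *)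
Lemma coefSK r g m u : r ^+ 2 = (2 * p)%:R -> central_coef g -> (m < p)%N ->
  coefS r (coefS r g) m u = g m u.
Proof.
move=> r2 sg mp; rewrite /coefS; have -> : (p.-1 - (p.-1 - m) = m)%N by lia.
move: (coefS_const r2); move: (_ / _) => c c2.
have sg2 v w : sgn (u + v + pz + m%:R) * sgn (v + w + pz + (p.-1 - m)%:R)
    = sgn (u + w) * sgn p.-1%:R.
  rewrite -!sgnD //; have -> : p.-1%:R = m%:R + (p.-1 - m)%:R :> Z.
    by rewrite -natrD subnKC //; lia.
  have vv : sgn (v + v + (pz + pz)) = 1 by rewrite !sgnD // !sgn2 // mul1r.
  rewrite -[RHS]mulr1 -vv -sgnD //; congr (sgn _); ring.
transitivity (c ^+ 2 * sgn p.-1%:R *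
    \sum_(w : Z) sgn (u + w) * (\sum_(v : Z) chr (v * (u + w))) * g m w).
  rewrite expr2 -!mulrA; congr (_ * _).
  under eq_bigr => v _ do rewrite mulrCA mulr_sumr.
  rewrite -mulr_sumr exchange_big; congr (_ * _); rewrite mulr_sumr.
  apply: eq_bigr => w _ /=; rewrite -mulrA mulr_suml !mulr_sumr.
  apply: eq_bigr => v _.
  by rewrite mulrDr chrD // [v * u]mulrC; ring: (sg2 v w).
rewrite (bigD1 (- u)) //= [X in _ + X]big1 ?addr0 => [|w wu]; last first.
  by rewrite (chr_sum H) addrC addr_eq0 (negPf wu) mulr0 mul0r.
rewrite subrr (chr_sum H) eqxx /sgn mulr0 chr0 mul1r central_coef_even //.
have -> x : c ^+ 2 * sgn p.-1%:R * ((2 * p)%:R * x)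
    = c ^+ 2 * (2 * p)%:R * sgn p.-1%:R * x by ring.
by rewrite c2 sgn_nat // -expr2 sqrr_sign mul1r.
Qed.

Lemma cs_eq u v : (cs u == cs v) = (u == v) || (u == - v).
Proof.
have cu := chr_neq0 H u; have cv := chr_neq0 H v.
have -> : (cs u == cs v) = ((chr u - chr v) * (1 - chr (- v) / chr u) == 0).
  rewrite -subr_eq0; congr (_ == 0); rewrite /cs !chrN //.
  by field; rewrite cu cv.
rewrite mulf_eq0 !subr_eq0 (inj_eq (chr_inj H)); congr (_ || _).
by rewrite -(inj_eq (mulIf cu)) divfK // mul1r (inj_eq (chr_inj H)).
Qed.

Lemma cs_subD u v : cs (u + v) - cs (u - v) = sn u * sn v.
Proof.
rewrite /cs /sn !opprD opprK !chrD // !chrN //.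
by field; rewrite !chr_neq0.
Qed.

(** The recursion trades the neighbour at u - 1 for the one at u + 1. *)
Lemma coefY_sym g m u : central_coef g -> (m < p)%N ->
  coefY g m u = sn m%:R * g m.-1 (u + 1) + cs (u - m%:R) * g m u.
Proof.
move=> sg; case: m => [|m] mp; first by rewrite /coefY mulr0n sn0 !mul0r addr0 subr0.
have /eqP := sg m u mp; have /eqP := cs_subD u m.+1%:R; rewrite /coefY /=.
by rewrite !subr_eq => /eqP-> /eqP->; ring.
Qed.

(** The last two hypotheses say that the central element vanishes at the weights t - 1 and -t - 1.
    Row 0 is zero because the Casimir operator is diagonal there with eigenvalues [cs u], and
    [cs u = cs t] only for u = t or u = -t; the columns 0 and p follow by induction on m. *)
Lemma coefY_eigen_uniq g (t : Z) : central_coef g ->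
    (forall m u, (m < p)%N -> coefY g m u = cs t * g m u) ->
    (forall m, (m < p)%N -> g m (t + m%:R) = 0) ->
    (forall m, (m < p)%N -> g m (- t + m%:R) = 0) ->
  forall m u, (m < p)%N -> g m u = 0.
Proof.
move=> sg yg gt gN; have p0 := even_root_gt0 H.
have cancel (x y z : F) : x != y -> x * z = y * z -> z = 0.
  move=> xy /eqP; rewrite -subr_eq0 -mulrBl mulf_eq0 subr_eq0 (negPf xy).
  by move=> /eqP.
have g0 u : g 0%N u = 0.
  have := yg 0%N u p0; rewrite /coefY mulr0n sn0 mul0r add0r addr0.
  have [/eqP|ne /(cancel _ _ _ ne)//] := eqVneq (cs u) (cs t).
  rewrite cs_eq => /orP[]/eqP-> _.
    by have := gt 0%N p0; rewrite addr0.
  by have := gN 0%N p0; rewrite addr0.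
have key (o : Z) : - o = o -> forall m, (m < p)%N -> g m o = 0.
  move=> oo m; elim/ltn_ind: m => -[|m] IH mp; first exact: g0.
  have [/eqP|ne] := eqVneq (cs (o + m.+1%:R)) (cs t).
    rewrite cs_eq => /orP[]/eqP e.
      by have := gN _ mp; rewrite -e opprD oo subrK.
    have := gt _ mp; rewrite -[t]opprK -e opprD oo subrK //.
  (* The eigenvalue equation at o - 1, in its symmetric form, involves row m - 1 only at o, where it
     is already zero. The equation for row m + 1 at o then has a single term left. *)
  have e1 : g m (o - 1) = 0.
    have := yg m (o - 1); rewrite coefY_sym ?(ltnW mp) // subrK => /(_ isT).
    have -> : o - 1 - m%:R = - (o + m.+1%:R).
      by rewrite opprD oo mulrS; ring.
    rewrite csN; suff -> : sn m%:R * g m.-1 o = 0.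
      by rewrite add0r => /(cancel _ _ _ ne).
    case: m {ne} IH mp => [|m] IH mp; first by rewrite sn0 mul0r.
    by rewrite IH ?mulr0 //; lia.
  by have := yg _ o mp; rewrite /coefY /= e1 mulr0 add0r => /(cancel _ _ _ ne).
apply: central_coef_uniq => //; apply: key; [exact: oppr0|exact: (oppp H)].
Qed.

End CentralCoefficients.

Lemma sum_ord_shift (R : pzSemiRingType) (n : nat) (f g : nat -> R) :
  f n.-1 * g n = 0 ->
  \sum_(i < n) f i * g i.+1 =
  \sum_(i < n) (if i : nat is j.+1 then f j else 0) * g i.
Proof.
case: n => [|n] /= e; first by rewrite !big_ord0.
rewrite big_ord_recr big_ord_recl /= e addr0 mul0r add0r.
by apply: eq_bigr.
Qed.

(** * The families of the simple modules and their Casimir eigenvalues *)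

Section SimpleTraces.
Variables (F : fieldType) (p : nat) (q : F).
Local Notation Z := 'Z_(2 * p).
Local Notation pz := (p%:R : Z).
Local Notation sn := (@sn F p q).
Local Notation cs := (@cs F p q).
Local Notation fac := (@fac F p q).

Definition coefB (m a b : nat) : F :=
  if (a <= m)%N && (b <= m)%N
  then fac p.-1 * fac m / (fac a * fac b * fac (m - a) * fac (m - b)) else 0.

Definition indP (s m a b : nat) (u : Z) : F :=
  ((a + b + p == s + m)%N && (u == pz + a%:R - b%:R))%:R.

(* [coefP s] and [coefM s] are the coefficients of the images of chi^+_s, chi^-_s. *)
Definition coefP (s m : nat) (u : Z) : F :=
  \sum_(a < p) \sum_(b < p) coefB m a b * indP s m a b u.

(** The action on coefficients of the automorphism e |-> -e, f |-> f, k |-> -k, which changes the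
    sign of the Casimir element. It passes from the simple modules of + type to those of - type. *)
Definition twist (g : nat -> Z -> F) (m : nat) (u : Z) : F :=
  (-1) ^+ m * g m (u + pz).

Definition coefM (s m : nat) (u : Z) : F :=
  (-1) ^+ p.-1 * twist (coefP s) m u.

Hypothesis H : even_root p q.

Lemma coefBC m a b : coefB m a b = coefB m b a.
Proof. by rewrite /coefB andbC; case: ifP => // _; congr (_ / _); ring. Qed.

(** A ratio of factorials; the boundary cases b = 0 and a = m + 1 are covered because a factor
    [sn 0] appears. *)
Lemma coefB_predr m a b : (m.+1 < p)%N ->
  (if b is b'.+1 then coefB m a b' else 0) =
  coefB m.+1 a b * (sn b%:R * sn (m.+1%:R - a%:R) / sn m.+1%:R).
Proof.
move=> mp; case: b => [|b]; first by rewrite sn0 !mul0r mulr0.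
rewrite /coefB ltnS; case: (leqP b m) => bm; last by rewrite !andbF mul0r.
rewrite !andbT [(a <= m.+1)%N]leq_eqVlt; case: eqP => [->|_].
  by rewrite subrr sn0 mulr0 mul0r mulr0 ltnn.
rewrite orFb ltnS; case: leqP => am; last by rewrite mul0r.
rewrite subSS -natrB ?(leqW am) // subSn // !facS.
have nz k : (k < p)%N -> fac k != 0 by exact: fac_neq0.
have sz k : (k.+1 < p)%N -> sn k.+1%:R != 0 by move=> kp; rewrite sn_nat_neq0.
field; rewrite !nz ?sz //; lia.
Qed.

Lemma coefB_predl m a b : (m.+1 < p)%N ->
  (if a is a'.+1 then coefB m a' b else 0) =
  coefB m.+1 a b * (sn a%:R * sn (m.+1%:R - b%:R) / sn m.+1%:R).
Proof.
by move=> mp; rewrite coefBC -coefB_predr //; case: a => // a; rewrite coefBC.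
Qed.

Lemma indP_addr s m a b u : indP s m a b (u + 1) = indP s m.+1 a b.+1 u.
Proof.
rewrite /indP addnS addSn addnS eqSS mulrS; congr ((_ && _)%:R).
by apply/eqP/eqP => [e|->]; [apply: (addIr 1); rewrite e|]; ring.
Qed.

Lemma indP_subr s m a b u : indP s m a b (u - 1) = indP s m.+1 a.+1 b u.
Proof.
rewrite /indP !addSn addnS eqSS mulrS; congr ((_ && _)%:R).
by apply/eqP/eqP => [e|->]; [apply: (addIr (-1)); rewrite e|]; ring.
Qed.

Lemma coefP_addr s m u : (m.+1 < p)%N -> coefP s m (u + 1) =
  \sum_(a < p) \sum_(b < p)
    coefB m.+1 a b * (sn b%:R * sn (m.+1%:R - a%:R) / sn m.+1%:R) *
    indP s m.+1 a b u.
Proof.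
move=> mp; apply: eq_bigr => a _.
under eq_bigr do rewrite indP_addr.
rewrite (@sum_ord_shift _ p (coefB m a) (fun b => indP s m.+1 a b u)).
  by apply: eq_bigr => b _; rewrite coefB_predr.
by rewrite /coefB [(p.-1 <= m)%N]leqNgt (_ : (m < p.-1)%N) ?andbF ?mul0r //; lia.
Qed.

Lemma coefP_subr s m u : (m.+1 < p)%N -> coefP s m (u - 1) =
  \sum_(a < p) \sum_(b < p)
    coefB m.+1 a b * (sn a%:R * sn (m.+1%:R - b%:R) / sn m.+1%:R) *
    indP s m.+1 a b u.
Proof.
move=> mp; rewrite [LHS]exchange_big [RHS]exchange_big /=; apply: eq_bigr => b _.
under eq_bigr do rewrite indP_subr.
rewrite (@sum_ord_shift _ p (coefB m ^~ b) (fun a => indP s m.+1 a b u)).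
  by apply: eq_bigr => a _; rewrite coefB_predl.
by rewrite /coefB [(p.-1 <= m)%N]leqNgt (_ : (m < p.-1)%N) ?mul0r //; lia.
Qed.

(** On the support of [indP] one has u = p + a - b, and term by term the recursion becomes the sine
    identity [e] for a, b and m + 1. *)
Lemma central_coefP s : central_coef q (coefP s).
Proof.
move=> m u mp; rewrite coefP_addr // coefP_subr // -sumrB /coefP mulr_sumr.
apply: eq_bigr => a _; rewrite -sumrB mulr_sumr; apply: eq_bigr => b _.
rewrite /indP; case: andP => [[_ /eqP->]|_]; last by rewrite !mulr0 subrr.
have sz : sn m.+1%:R != 0 by rewrite sn_nat_neq0.
rewrite !mulr1; apply: (mulfI sz).
have -> : sn (pz + a%:R - b%:R) = - sn (a%:R - b%:R) by rewrite -addrA snDp.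
have e : sn b%:R * sn (m.+1%:R - a%:R) - sn a%:R * sn (m.+1%:R - b%:R) =
   - sn (a%:R - b%:R) * sn m.+1%:R.
  rewrite /sn !opprB !chrD // !chrN //; field; by rewrite !chr_neq0.
rewrite [RHS](_ : _ = (- sn (a%:R - b%:R) * sn m.+1%:R) * coefB m.+1 a b); last by ring.
by rewrite -e; field.
Qed.

(** On the support s = p + a + b - m in Z/2p, and the two terms combine by the product formula
    [cs_subD]. *)
Lemma coefY_coefP s m u : (m < p)%N -> coefY q (coefP s) m u = cs s%:R * coefP s m u.
Proof.
move=> mp; rewrite /coefY.
have -> : sn m%:R * coefP s m.-1 (u - 1) = \sum_(a < p) \sum_(b < p)
    coefB m a b * (sn a%:R * sn (m%:R - b%:R)) * indP s m a b u.
  case: m mp => [|m] mp.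
    rewrite sn0 mul0r big1 // => a _; rewrite big1 // => b _.
    rewrite /coefB !leqn0; case: andP => [[/eqP-> /eqP->]|]; last by rewrite !mul0r.
    by rewrite sn0 mul0r mulr0 mul0r.
  rewrite coefP_subr // mulr_sumr; apply: eq_bigr => a _.
  rewrite mulr_sumr; apply: eq_bigr => b _.
  by field; rewrite sn_nat_neq0.
rewrite /coefP !mulr_sumr -big_split; apply: eq_bigr => a _ /=.
rewrite !mulr_sumr -big_split; apply: eq_bigr => b _ /=.
rewrite /indP; case: andP => [[/eqP e /eqP->]|_]; last by rewrite !mulr0 addr0.
have -> : s%:R = pz + (a%:R + b%:R - m%:R).
  by have := congr1 (fun n => n%:R : Z) e; rewrite !natrD => e'; apply: (addIr m%:R); rewrite -e'; ring.
have -> : pz + a%:R - b%:R + m%:R = pz + (a%:R - b%:R + m%:R) by ring.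
rewrite !csDp //.
have -> : a%:R - b%:R + m%:R = a%:R + (m%:R - b%:R) :> Z by ring.
have -> : a%:R + b%:R - m%:R = a%:R - (m%:R - b%:R) :> Z by ring.
by rewrite -cs_subD //; ring.
Qed.

Lemma central_coef_twist g : central_coef q g -> central_coef q (twist g).
Proof.
move=> sg m u mp; rewrite /twist exprS -mulrBr.
have -> : u + 1 + pz = (u + pz) + 1 by ring.
have -> : u - 1 + pz = (u + pz) - 1 by ring.
by rewrite sg // [u + pz]addrC snDp //; ring.
Qed.

Lemma coefY_twist g m u :
  coefY q (twist g) m u = - twist (coefY q g) m u.
Proof.
rewrite /coefY /twist; have -> : u - 1 + pz = u + pz - 1 by ring.
have -> : cs (u + pz + m%:R) = - cs (u + m%:R).
  have -> : u + pz + m%:R = pz + (u + m%:R) by ring.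
  by rewrite csDp.
by case: m => [|m] /=; rewrite ?sn0 ?exprS; ring.
Qed.

Lemma central_coefM s : central_coef q (coefM s).
Proof.
move=> m u mp; rewrite /coefM -mulrBr central_coef_twist //; first by ring.
exact: central_coefP.
Qed.

Lemma coefY_coefM s m u : (m < p)%N ->
  coefY q (coefM s) m u = cs (pz - s%:R) * coefM s m u.
Proof.
move=> mp; have -> : cs (pz - s%:R) = - cs s%:R.
  by rewrite csDp // csN.
transitivity ((-1) ^+ p.-1 * coefY q (twist (coefP s)) m u).
  by rewrite /coefY /coefM; ring.
by rewrite coefY_twist /coefM /twist coefY_coefP //; ring.
Qed.

End SimpleTraces.

(** * Transforms of the simple families and their Chebyshev recurrence *)

Section Chebyshev.
Variables (F : fieldType) (p : nat) (q : F).
Local Notation Z := 'Z_(2 * p).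
Local Notation pz := (p%:R : Z).
Local Notation chr := (@chr F p q).
Local Notation sn := (@sn F p q).
Local Notation cs := (@cs F p q).
Local Notation sgn := (@sgn F p q).
Local Notation fac := (@fac F p q).
Local Notation coefB := (@coefB F p q).
Local Notation coefP := (@coefP F p q).

(** Up to a sign and a constant, the transform of [coefP s]. The condition a + b + m + 1 = s makes
    it a sum over weight vectors of the simple module of dimension s. *)
Definition coefU (s m : nat) (u : Z) : F :=
  \sum_(a < p) \sum_(b < p) coefB (p.-1 - m) a b *
    ((a + b + m.+1 == s)%N%:R * chr (u * (a%:R - b%:R))).

Hypothesis H : even_root p q.

Lemma sum_delta (x : Z) (f : Z -> F) : \sum_(v : Z) f v * (v == x)%:R = f x.
Proof.
rewrite (bigD1 x) //= eqxx mulr1 [X in _ + X]big1 ?addr0 // => v /negPf->.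
by rewrite mulr0.
Qed.

Lemma coefS_coefP r s m u : (m < p)%N ->
  coefS q r (coefP s) m u = fac p.-1 / (p%:R * r) * ((-1) ^+ s.-1 * coefU s m u).
Proof.
move=> mp; rewrite /coefS; congr (_ * _).
under eq_bigr do rewrite /coefP mulr_sumr.
rewrite exchange_big mulr_sumr /=; apply: eq_bigr => a _.
under eq_bigr do rewrite mulr_sumr.
rewrite exchange_big mulr_sumr /=; apply: eq_bigr => b _.
set B := coefB _ _ _.
transitivity (\sum_(v : Z) (sgn (u + v + pz + m%:R) * chr (u * v) * B *
   (a + b + p == s + (p.-1 - m))%N%:R) * (v == pz + a%:R - b%:R)%:R).
  by apply: eq_bigr => v _; rewrite /indP -mulnb natrM; ring.
rewrite sum_delta.
have -> : (a + b + p == s + (p.-1 - m))%N = (a + b + m.+1 == s)%N by lia.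
case: eqP => [e|_]; last by rewrite mul0r !mulr0.
have -> : u * (pz + a%:R - b%:R) = pz * u + u * (a%:R - b%:R) by ring.
rewrite chrD //.
have -> : sgn (u + (pz + a%:R - b%:R) + pz + m%:R) = sgn u * (-1) ^+ s.-1.
  have -> : u + (pz + a%:R - b%:R) + pz + m%:R =
      u + s.-1%:R + (pz + pz) + (- b%:R + - b%:R).
    by rewrite -e addnS /= !natrD; ring.
  by rewrite !sgnD // !sgn2 // !mulr1 sgn_nat.
rewrite -/(sgn u) (_ : true%:R = 1) // [LHS](_ : _ = sgn u * sgn u *
  ((-1) ^+ s.-1 * (B * chr (u * (a%:R - b%:R))))); last by ring.
by rewrite (sgn2 H) !mul1r.
Qed.

(** In a simple module of dimension a + b + m + 1, the operator f^m e^m multiplies the weight vector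
    with a + m vectors above it by [fac (m + a) * fac (m + b) / (fac a * fac b)]; here this is
    divided by [fac m]. *)
Definition coefC (m a b : nat) : F := fac (m + a) * fac (m + b) / (fac m * fac a * fac b).

Lemma coefB_compl m a b : (m + a < p)%N -> (m + b < p)%N ->
  coefB (p.-1 - m) a b = coefC m a b.
Proof.
move=> ma mb; rewrite /coefB /coefC ifT; last by apply/andP; split; lia.
have e k : (m + k < p)%N -> fac (p.-1 - m - k) = fac p.-1 / fac (m + k).
  move=> mk; rewrite -subnDA -(fac_compl H mk) mulrAC divff ?mul1r //.
  exact: fac_neq0.
rewrite !e //; have := e 0%N; rewrite subn0 addn0 => ->; last by lia.
have nz k : (k < p)%N -> fac k != 0 by exact: fac_neq0.
by field; rewrite !nz //; have := even_root_gt1 H; lia.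
Qed.

(** The coefficientwise form of the Chebyshev recurrence below. The bound a + b + m < p keeps the
    factorials that are divided by nonzero. *)
Lemma coefC_rec m a b : (0 < a + b + m < p)%N ->
  coefC m a b +
    (if a is a'.+1 then if b is b'.+1 then coefC m a' b' else 0 else 0) =
  sn m%:R * (chr (b%:R - a%:R) * coefC m.-1 a b)
  + chr m%:R * (if a is a'.+1 then coefC m a' b else 0)
  + chr (- m%:R) * (if b is b'.+1 then coefC m a b' else 0).
Proof.
move=> /andP[s0 sp].
have nz k : (k < p)%N -> fac k != 0 by exact: fac_neq0.
case: m s0 sp => [|m] s0 sp.
  have c1 i j : (i < p)%N -> (j < p)%N -> coefC 0 i j = 1.
    by move=> ip jp; rewrite /coefC fac0 mul1r divff // mulf_neq0 ?nz.
  rewrite sn0 mul0r add0r oppr0 chr0 !mul1r.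
  case: a b s0 sp => [|a] [|b] // s0 sp; rewrite !c1; try lia; ring.
(* A common factor of all five terms. Each of them is X times sines and a power of q, also for a = 0
   or b = 0 where [sn 0] produces the missing zero; what remains is an identity of Laurent
   polynomials in q^m, q^a, q^b. *)
set X := fac (m + a) * fac (m + b) / (fac m.+1 * fac a * fac b).
have e0 : coefC m.+1 a b = X * sn (m.+1%:R + a%:R) * sn (m.+1%:R + b%:R).
  by rewrite /coefC /X !addSn !facS -!natrD !addSn; ring.
have e1 : sn m.+1%:R * (chr (b%:R - a%:R) * coefC m a b) =
    X * sn m.+1%:R * sn m.+1%:R * chr (b%:R - a%:R).
  rewrite /coefC /X facS; field; rewrite !nz ?sn_nat_neq0 //; lia.
have e2 : (if a is a'.+1 then coefC m.+1 a' b else 0) =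
    X * sn a%:R * sn (m.+1%:R + b%:R).
  rewrite /X; case: a {e0 e1 X s0} sp => [|a] sp; first by rewrite sn0; ring.
  rewrite /coefC !addSn !addnS !facS -!natrD !addSn; field.
  by rewrite !nz ?sn_nat_neq0 //; lia.
have e3 : (if b is b'.+1 then coefC m.+1 a b' else 0) =
    X * sn b%:R * sn (m.+1%:R + a%:R).
  rewrite /X; case: b {e0 e1 e2 X s0} sp => [|b] sp; first by rewrite sn0; ring.
  rewrite /coefC !addSn !addnS !facS -!natrD !addSn; field.
  by rewrite !nz ?sn_nat_neq0 //; lia.
have e4 : (if a is a'.+1 then if b is b'.+1 then coefC m.+1 a' b' else 0 else 0)
    = X * sn a%:R * sn b%:R.
  rewrite /X; case: a {e0 e1 e2 e3 X s0} sp => [|a] sp; first by rewrite sn0; ring.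
  case: b sp => [|b] sp; first by rewrite sn0; ring.
  rewrite /coefC !addSn !addnS !facS; field.
  by rewrite !nz ?sn_nat_neq0 //; lia.
rewrite [m.+1.-1]/= e0 e1 e2 e3 e4; move: m.+1%:R a%:R b%:R => M A B.
rewrite /sn !opprD !chrD // !chrN //; field.
by rewrite !chr_neq0.
Qed.

(** The trace of the rule that the two-dimensional simple module times the one of dimension s < p is
    the sum of those of dimensions s + 1 and s - 1. All five terms are re-indexed to sums over a + b
    + m = s and compared coefficientwise. *)
Lemma coefY_coefU s m u : (0 < s < p)%N -> (m < p)%N ->
  coefY q (coefU s) m u = coefU s.+1 m u + coefU s.-1 m u.
Proof.
move=> /andP[s0 sp] mp.
pose G a b : F := (a + b + m == s)%N%:R * chr (u * (a%:R - b%:R)).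
pose B := coefB (p.-1 - m).
have G0 a b : (p <= a + b)%N -> G a b = 0.
  by move=> ab; rewrite /G (_ : (_ == _) = false) ?mul0r //; lia.
have eU1 : coefU s.+1 m u = \sum_(a < p) \sum_(b < p) B a b * G a b.
  by apply: eq_bigr => a _; apply: eq_bigr => b _; rewrite addnS eqSS.
have shr a (f : nat -> F) : \sum_(b < p) f b * G a b.+1 =
    \sum_(b < p) (if b : nat is j.+1 then f j else 0) * G a b.
  by rewrite (sum_ord_shift (g := G a)) // G0 ?mulr0 //; lia.
have shl b (f : nat -> F) : \sum_(a < p) f a * G a.+1 b =
    \sum_(a < p) (if a : nat is j.+1 then f j else 0) * G a b.
  by rewrite (sum_ord_shift (g := G ^~ b)) // G0 ?mulr0 //; lia.
have eU0 : coefU s.-1 m u = \sum_(a < p) \sum_(b < p)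
    (if a : nat is a'.+1 then if b : nat is b'.+1 then B a' b' else 0 else 0) * G a b.
  transitivity (\sum_(a < p) \sum_(b < p) B a b * G a.+1 b.+1).
    apply: eq_bigr => a _; apply: eq_bigr => b _; congr (_ * (_%:R * chr _)).
      by lia.
    by rewrite !mulrS; ring.
  under eq_bigr do rewrite shr.
  rewrite exchange_big /=; under eq_bigr => b _ do rewrite (shl b (fun a => if b : nat is b'.+1 then B a b' else 0)).
  rewrite exchange_big /=; apply: eq_bigr => a _; apply: eq_bigr => b _.
  by case: (val a) => [|a'] //; case: (val b).
have eL : chr (u + m%:R) * coefU s m u = \sum_(a < p) \sum_(b < p)
    (chr m%:R * (if a : nat is a'.+1 then B a' b else 0)) * G a b.
  transitivity (\sum_(b < p) \sum_(a < p) (chr m%:R * B a b) * G a.+1 b).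
    rewrite exchange_big /= mulr_sumr; apply: eq_bigr => a _.
    rewrite mulr_sumr; apply: eq_bigr => b _; rewrite /G addnS !addSn chrD //.
    have -> : u * (a.+1%:R - b%:R) = u + u * (a%:R - b%:R) by rewrite mulrS; ring.
    by rewrite chrD // -/B; ring.
  under eq_bigr => b _ do rewrite (shl b (fun a => chr m%:R * B a b)).
  rewrite exchange_big; apply: eq_bigr => a _; apply: eq_bigr => b _.
  by case: (val a) => [|a'] //; rewrite mulr0.
have eR : chr (- (u + m%:R)) * coefU s m u = \sum_(a < p) \sum_(b < p)
    (chr (- m%:R) * (if b : nat is b'.+1 then B a b' else 0)) * G a b.
  transitivity (\sum_(a < p) \sum_(b < p) (chr (- m%:R) * B a b) * G a b.+1).
    rewrite mulr_sumr; apply: eq_bigr => a _.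
    rewrite mulr_sumr; apply: eq_bigr => b _; rewrite /G !addnS !addSn opprD chrD //.
    have -> : u * (a%:R - b.+1%:R) = - u + u * (a%:R - b%:R) by rewrite mulrS; ring.
    by rewrite chrD // -/B; ring.
  under eq_bigr => a _ do rewrite (shr a (fun b => chr (- m%:R) * B a b)).
  apply: eq_bigr => a _; apply: eq_bigr => b _.
  by case: (val b) => [|b'] //; rewrite mulr0.
have eM : sn m%:R * coefU s m.-1 (u - 1) = \sum_(a < p) \sum_(b < p)
    (sn m%:R * (chr (b%:R - a%:R) * coefC m.-1 a b)) * G a b.
  case: m mp @G @B G0 eU1 shr shl eU0 eL eR => [|m] mp G B _ _ _ _ _ _ _.
    by rewrite sn0 mul0r big1 // => a _; rewrite big1 // => b _; rewrite !mul0r.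
  rewrite mulr_sumr; apply: eq_bigr => a _.
  rewrite mulr_sumr; apply: eq_bigr => b _.
  rewrite /G /=; case: eqP => [e|_]; last by rewrite !mul0r !mulr0.
  rewrite coefB_compl; [|lia|lia].
  have -> : (u - 1) * (a%:R - b%:R) = (b%:R - a%:R) + u * (a%:R - b%:R) by ring.
  by rewrite chrD //; ring.
have eC : cs (u + m%:R) * coefU s m u =
    chr (u + m%:R) * coefU s m u + chr (- (u + m%:R)) * coefU s m u.
  exact: mulrDl.
rewrite /coefY eC eL eR eM eU1 eU0 -!big_split; apply: eq_bigr => a _ /=.
rewrite -!big_split; apply: eq_bigr => b _ /=.
rewrite -!mulrDl /G; case: eqP => [e|_]; last by rewrite mul0r !mulr0.
congr (_ * _).
have eB i j : (i <= a)%N -> (j <= b)%N -> B i j = coefC m i j.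
  by move=> ia jb; rewrite /B coefB_compl //; lia.
have := @coefC_rec m a b; rewrite e s0 sp => /(_ isT).
move: eB; case: (val a) => [|a']; case: (val b) => [|b'] eB; rewrite !eB // => ->; ring.
Qed.

End Chebyshev.

(** * The families K_t and their double Fourier transform *)

Section ProjectiveTraces.
Variables (F : fieldType) (p : nat) (q : F).
Local Notation Z := 'Z_(2 * p).
Local Notation pz := (p%:R : Z).
Local Notation chr := (@chr F p q).
Local Notation sn := (@sn F p q).
Local Notation sgn := (@sgn F p q).
Local Notation fac := (@fac F p q).
Local Notation coefB := (@coefB F p q).
Local Notation coefC := (@coefC F p q).

(* [coefK s%:R] is coefP s + coefM (p - s) for s <= p; it is even in t. *)
Definition coefK (t : Z) (m : nat) (u : Z) : F :=
  \sum_(a < p) \sum_(b < p) coefB m a b *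
    (((t == pz + (m%:R - a%:R - b%:R)) && (u == pz + a%:R - b%:R))%:R
     + (-1) ^+ (p.-1 + m) *
       ((t == m%:R - a%:R - b%:R) && (u == a%:R - b%:R))%:R).

Definition qbin (m a : nat) : F :=
  if (a <= m)%N then fac m / (fac a * fac (m - a)) else 0.

Hypothesis H : even_root p q.

Lemma qbinS m a : (m.+1 < p)%N -> qbin m.+1 a =
  q ^+ a * qbin m a + (if a is a'.+1 then q ^- m * q ^+ a' * qbin m a' else 0).
Proof.
move=> mp.
have nz k : (k < p)%N -> fac k != 0 by exact: fac_neq0.
have q0 := q_neq0 H.
have sE k : sn k%:R = q ^+ k - q ^- k by rewrite /sn chrN // chr_nat.
case: a => [|a]; first by rewrite /qbin !subn0 fac0 !mul1r !divff ?nz ?mulr1 ?addr0 // ltnW.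
rewrite /qbin ltnS; case: (leqP a m) => [am|ma]; last by rewrite ltnNge (ltnW ma) !mulr0 addr0.
case: (ltnP a m) => [am'|ma'].
  have am2 : (m - a = (m - a.+1).+1)%N by lia.
  have em : (m = (m - a.+1) + a.+1)%N by lia.
  rewrite subSS am2 !facS.
  have nz1 := sn_nat_neq0 H (_ : 0 < (m - a.+1).+1 < p)%N.
  have nz2 := sn_nat_neq0 H (_ : 0 < a.+1 < p)%N.
  have es : sn m.+1%:R = q ^+ a.+1 * sn (m - a.+1).+1%:R + q ^- m * q ^+ a * sn a.+1%:R.
    have {em} := em; move: (m - a.+1)%N => k ->; rewrite !sE.
    by rewrite !exprS !exprD !exprS; field; rewrite ?expf_neq0 ?q0.
  rewrite es; field.
  by rewrite !expf_neq0 // !nz ?nz1 ?nz2 //; lia.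
have -> : m = a by lia.
rewrite !subnn fac0 !mulr1 !divff ?nz //; try lia.
by rewrite mulr0 add0r mulr1 mulVf // expf_neq0.
Qed.

(** The q-binomial theorem of Gauss in symmetric form; the induction splits off the factor j = m and
    replaces x by q x in the rest. *)
Lemma qbinomial m x : (m < p)%N ->
  \sum_(a < p) qbin m a * x ^+ a = \prod_(j < m) (1 + chr (m%:R - 1 - 2%:R * j%:R) * x).
Proof.
elim: m x => [|m IH] x mp.
  rewrite big_ord0 (bigD1 (Ordinal mp)) //= expr0 mulr1 [X in _ + X]big1 ?addr0.
    by rewrite /qbin /= fac0 mulr1 divff ?oner_neq0.
  move=> a; rewrite -val_eqE /= /qbin leqn0 => /negPf->; by rewrite mul0r.
have q0 := q_neq0 H.
transitivity ((1 + q ^- m * x) * \sum_(a < p) qbin m a * (q * x) ^+ a).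
  rewrite mulrDl mul1r mulr_sumr.
  have -> : \sum_(a < p) q ^- m * x * (qbin m a * (q * x) ^+ a) =
      \sum_(a < p) (q ^- m * q ^+ a * qbin m a) * (fun k => x ^+ k) a.+1.
    by apply: eq_bigr => a _; rewrite exprMn exprS; ring.
  rewrite (@sum_ord_shift _ p (fun a => q ^- m * q ^+ a * qbin m a)).
    rewrite -big_split; apply: eq_bigr => a _ /=.
    by rewrite qbinS // exprMn mulrDl; congr (_ + _); ring.
  by rewrite /qbin ifF ?mulr0 ?mul0r //; lia.
rewrite (IH _ (ltnW mp)) big_ord_recr /= mulrC; congr (_ * _).
  apply: eq_bigr => j _; rewrite mulrA; congr (1 + _ * _).
  have -> : m.+1%:R - 1 - 2%:R * j%:R = m%:R - 1 - 2%:R * j%:R + 1%:R :> Z.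
    by rewrite mulrS; ring.
  by rewrite [RHS]chrD // chr_nat // expr1.
congr (1 + _ * _); rewrite -(chr_nat H m) -(chrN H); congr chr.
by rewrite mulrS; ring.
Qed.

Lemma coefB_qbin m a b : (m < p)%N ->
  coefB m a b = fac p.-1 / fac m * (qbin m a * qbin m b).
Proof.
move=> mp; rewrite /coefB /qbin.
case: leqP => am; case: leqP => bm /=; rewrite ?mul0r ?mulr0 //.
have nz k : (k < p)%N -> fac k != 0 by exact: fac_neq0.
by field; rewrite !nz //; lia.
Qed.

(** At these points the factors of the product are 1 - q^(2 (j + 1 + a)), hence sines up to powers
    of q, and the product is a quotient of factorials. *)
Lemma qbinomial_root m a : (m < p)%N -> (a < p)%N ->
  \sum_(i < p) qbin m i * chr (pz + m.+1%:R + 2%:R * a%:R) ^+ i =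
  (-1) ^+ m * chr (m%:R * a%:R + 'C(m.+1, 2)%:R) * (fac (m + a) / fac a).
Proof.
move=> mp ap; rewrite qbinomial //.
have key n : \prod_(j < n) (1 - chr (2%:R * (j.+1 + a)%:R)) =
   (-1) ^+ n * chr (n%:R * a%:R + 'C(n.+1, 2)%:R) * (fac (n + a) / fac a).
  elim: n => [|n IH].
    by rewrite big_ord0 mul0r add0r chr0 // expr0 !mul1r divff // fac_neq0.
  rewrite big_ord_recr IH /= !addSn facS.
  have -> : n.+1%:R * a%:R + 'C(n.+2, 2)%:R =
     n%:R * a%:R + 'C(n.+1, 2)%:R + (n + a).+1%:R :> Z.
    by rewrite binS bin1 natrD -addSn natrD !mulrS; ring.
  rewrite [in RHS](chrD H (n%:R * a%:R + _)) exprS.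
  have -> : 2%:R * (n + a).+1%:R = (n + a).+1%:R *+ 2 :> Z by rewrite mulr_natl.
  rewrite (chrMn H _ 2) /sn chrN //; have c0 := chr_neq0 H (n + a).+1%:R.
  have f0 : fac a != 0 by exact: fac_neq0.
  by field; rewrite f0.
rewrite -key (reindex_inj rev_ord_inj) /=; apply: eq_bigr => j _.
rewrite -chrD // -(chrDp H); congr (1 + _).
congr chr; rewrite natrB // !natrD !mulrS; ring.
Qed.

Lemma sgn1_double (x : Z) : sgn x = 1 -> exists2 a, (a < p)%N & x = 2%:R * a%:R.
Proof.
have ex := natrZ H x; have xN := ltnZ H x.
rewrite -ex; move: (x : nat) xN {ex} => n nN; rewrite sgn_nat // -signr_odd.
case o : (odd n); rewrite ?expr1 => e.
  by move/esym/(eq_opp0 H)/eqP: e; rewrite oner_eq0.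
exists n./2; first by lia.
by rewrite -natrM; congr (_%:R); lia.
Qed.

Lemma double_inj a b : (a < p)%N -> (b < p)%N -> 2%:R * a%:R = 2%:R * b%:R :> Z -> a = b.
Proof.
move=> ap bp /eqP; rewrite -!natrM (eqZ_nat H) !modn_small; lia.
Qed.

(** The indicators fix i + j and i - j in Z/2p, so 2i is known, hence i < p, hence j: only the term
    (b, a) survives. The boolean tells which of the two indicators contributes. *)
Lemma coefK_root m a b (e : bool) : (m < p)%N -> (a < p)%N -> (b < p)%N ->
  coefK (pz *+ e - (m.+1 + a + b)%:R) (p.-1 - m) (pz *+ ~~ e + b%:R - a%:R) =
  (-1) ^+ (m * e) * coefC m b a.
Proof.
move=> mp ap bp; have p0 := even_root_gt0 H.
have em : (p.-1 - m)%:R = pz - m.+1%:R :> Z.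
  have -> : (p.-1 - m = p - m.+1)%N by lia.
  by rewrite natrB.
have key (i j : nat) : (i < p)%N -> (j < p)%N ->
    i%:R - j%:R = b%:R - a%:R :> Z -> i%:R + j%:R = a%:R + b%:R :> Z -> i = b /\ j = a.
  move=> ip jp e1 e2; have ib : i = b.
    apply: double_inj => //; transitivity ((i%:R - j%:R) + (i%:R + j%:R) : Z); first by ring.
    by rewrite e1 e2; ring.
  split=> //; move: e2; rewrite ib => /eqP; rewrite addrC (inj_eq (addIr _)).
  by rewrite (eqZ_nat H) !modn_small; lia.
have key' (i j : nat) : (i < p)%N -> (j < p)%N ->
    i%:R - j%:R = pz + b%:R - a%:R :> Z -> i%:R + j%:R = pz + a%:R + b%:R :> Z -> False.
  move=> ip jp e1 e2; have ib : i = b.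
    apply: double_inj => //; transitivity ((i%:R - j%:R) + (i%:R + j%:R) : Z); first by ring.
    rewrite e1 e2; have := pp0 H => h; ring: h.
  move: e2; rewrite ib => /eqP; rewrite addrC (inj_eq (addIr _)).
  by rewrite -natrD (eqZ_nat H) !modn_small; lia.
(* When m + a or m + b reaches p both sides are zero: the factorial then contains the factor
   [sn p = 0]. *)
have -> : coefC m b a = coefB (p.-1 - m) b a.
  have [mb|mb] := ltnP (m + b) p; last first.
    rewrite /coefB ifF; last by apply/negP => /andP[]; lia.
    rewrite /coefC; suff -> : fac (m + b) = 0 by rewrite !mul0r.
    rewrite -(subnK mb); elim: (m + b - p)%N => [|n IH]; first exact: facp.
    by rewrite addSn facS IH mul0r.
  have [ma|ma] := ltnP (m + a) p; first by rewrite coefB_compl.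
  rewrite /coefB ifF; last by apply/negP => /andP[]; lia.
  rewrite /coefC; suff -> : fac (m + a) = 0 by rewrite mulr0 mul0r.
  rewrite -(subnK ma); elim: (m + a - p)%N => [|n IH]; first exact: facp.
  by rewrite addSn facS IH mul0r.
have ppK x : pz + (pz + x) = x by rewrite addrA (pp0 H) add0r.
have np : (pz == 0) = false by apply/negbTE/(pz_neq0 H).
pose s : Z := pz *+ e - (m.+1 + a + b)%:R; pose v : Z := pz *+ ~~ e + b%:R - a%:R.
have es : s = pz *+ e - m.+1%:R - a%:R - b%:R by rewrite /s !natrD; ring.
have t1 i j : (i < p)%N -> (j < p)%N ->
    (s == - m.+1%:R - i%:R - j%:R) && (v == pz + i%:R - j%:R)
    = [&& ~~ e, i == b & j == a].
  move=> ip jp; apply/andP/and3P; rewrite es /v => -[].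
    move=> /eqP e1 /eqP e2.
    have e3 : i%:R + j%:R = - m.+1%:R - (pz *+ e - m.+1%:R - a%:R - b%:R) :> Z.
      by rewrite e1; ring.
    have e4 : i%:R - j%:R = pz + (pz *+ ~~ e + b%:R - a%:R) :> Z.
      by rewrite e2 -addrA ppK.
    case: (e) e3 e4 => /= e3 e4.
      case: (key' i j ip jp); first by rewrite e4; ring.
      by rewrite e3 -[X in _ = X + _ + _](oppp H); ring.
    have [||-> ->] := key i j ip jp; first by rewrite e4 -addrA ppK; ring.
      by rewrite e3; ring.
    by split.
  by case: (e) => //= _ /eqP-> /eqP->; split; apply/eqP; ring.
have t2 i j : (i < p)%N -> (j < p)%N ->
    (s == pz - m.+1%:R - i%:R - j%:R) && (v == i%:R - j%:R)
    = [&& e, i == b & j == a].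
  move=> ip jp; apply/andP/and3P; rewrite es /v => -[].
    move=> /eqP e1 /eqP e2.
    have e3 : i%:R + j%:R = pz - m.+1%:R - (pz *+ e - m.+1%:R - a%:R - b%:R) :> Z.
      by rewrite e1; ring.
    have e4 : i%:R - j%:R = pz *+ ~~ e + b%:R - a%:R :> Z by rewrite e2.
    case: (e) e3 e4 => /= e3 e4; last first.
      case: (key' i j ip jp); first by rewrite e4; ring.
      by rewrite e3; ring.
    have [||-> ->] := key i j ip jp; first by rewrite e4; ring.
      by rewrite e3; ring.
    by split.
  by case: (e) => //= _ /eqP-> /eqP->; split; apply/eqP; ring.
rewrite /coefK -/s -/v em.
transitivity (\sum_(i < p) \sum_(j < p) coefB (p.-1 - m) i j *
   ((-1) ^+ (m * e) * ((i == b :> nat) && (j == a :> nat))%:R)).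
  apply: eq_bigr => i _; apply: eq_bigr => j _.
  rewrite -!addrA ppK !addrA t1 // t2 //.
  congr (_ * _); case: (e) => /=; last by rewrite muln0 expr0 mulr0 addr0 mul1r.
  rewrite add0r muln1; congr (_ * _); rewrite -signr_odd -[in RHS]signr_odd.
  by congr (_ ^+ _); lia.
rewrite (bigD1 (Ordinal bp)) //= [X in _ + X]big1 ?addr0; last first.
  move=> i; rewrite -val_eqE /= => /negPf ib; rewrite big1 // => j _.
  by rewrite ib /= !mulr0.
rewrite (bigD1 (Ordinal ap)) //= [X in _ + X]big1 ?addr0; last first.
  move=> i; rewrite -val_eqE /= => /negPf ib.
  by rewrite ib andbF /= !mulr0.
by rewrite !eqxx mulr1 mulrC.
Qed.

Lemma sgn_dbl x : sgn (x + x) = 1.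
Proof. by rewrite sgnD // sgn2. Qed.

Lemma coefK_support t m u : sgn (t + u + m%:R) != 1 -> coefK t m u = 0.
Proof.
move=> ne; rewrite /coefK big1 // => a _; rewrite big1 // => b _.
case: andP => [[/eqP et /eqP eu]|_].
  case/eqP: ne; rewrite et eu -(sgn_dbl (pz + m%:R - b%:R)); congr sgn; ring.
case: andP => [[/eqP et /eqP eu]|_]; last by rewrite mulr0 addr0 mulr0.
case/eqP: ne; rewrite et eu -(sgn_dbl (m%:R - b%:R)); congr sgn; ring.
Qed.

Lemma sum_coefK_eval (X : Z -> Z -> F) m :
  \sum_(u : Z) \sum_(t : Z) X u t * coefK t m u =
  \sum_(a < p) \sum_(b < p) coefB m a b *
    (X (pz + a%:R - b%:R) (pz + (m%:R - a%:R - b%:R)) +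
     (-1) ^+ (p.-1 + m) * X (a%:R - b%:R) (m%:R - a%:R - b%:R)).
Proof.
have pick (x y : Z) (G : Z -> Z -> F) :
    \sum_(u : Z) \sum_(t : Z) G u t * ((t == x) && (u == y))%:R = G y x.
  rewrite -[RHS](sum_delta y (G ^~ x)); apply: eq_bigr => u _.
  rewrite -[in RHS](sum_delta x (G u)) mulr_suml; apply: eq_bigr => t _.
  by rewrite -mulnb natrM mulrA.
pose I (a b : nat) (t u : Z) : F := ((t == pz + (m%:R - a%:R - b%:R)) && (u == pz + a%:R - b%:R))%:R.
pose J (a b : nat) (t u : Z) : F := ((t == m%:R - a%:R - b%:R) && (u == a%:R - b%:R))%:R.
transitivity (\sum_(a < p) \sum_(b < p) \sum_(u : Z) \sum_(t : Z)
   (X u t * coefB m a b * I a b t u + X u t * coefB m a b * (-1) ^+ (p.-1 + m) * J a b t u)).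
  under eq_bigr do under eq_bigr do rewrite /coefK mulr_sumr.
  under eq_bigr do rewrite exchange_big.
  rewrite exchange_big; apply: eq_bigr => a _ /=.
  under eq_bigr do under eq_bigr do rewrite mulr_sumr.
  under eq_bigr do rewrite exchange_big.
  rewrite exchange_big; apply: eq_bigr => b _ /=.
  by apply: eq_bigr => u _; apply: eq_bigr => t _; rewrite -/(I a b t u) -/(J a b t u); ring.
apply: eq_bigr => a _; apply: eq_bigr => b _.
under eq_bigr do rewrite big_split /=.
rewrite big_split /= (pick _ _ (fun u t => X u t * coefB m a b)).
rewrite (pick _ _ (fun u t => X u t * coefB m a b * (-1) ^+ (p.-1 + m))); ring.
Qed.

Lemma double_eq0 (w : Z) : w + w = 0 -> exists e : bool, w = pz *+ e.
Proof.
move=> e; have : sn w == 0.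
  by rewrite /sn subr_eq0; apply/eqP; apply: (congr1 chr); apply/eqP; rewrite -subr_eq0 opprK e.
by rewrite sn_eq0 // => /orP[]/eqP->; [exists false|exists true].
Qed.

Lemma sgn_pm x : sgn x = 1 \/ sgn x = -1.
Proof.
have /eqP := sgn2 H x; rewrite -expr2 sqrf_eq1 => /orP[]/eqP; [by left|by right].
Qed.

Lemma signr_pred : (-1) ^+ p.-1 = - sgn pz.
Proof.
rewrite sgn_nat // -[in RHS](prednK (even_root_gt0 H)) exprS mulN1r opprK //.
Qed.

(** Each of the two indicators evaluates the double sum at one point, and the result factors into a
    difference of signs and a product of two q-binomial sums, one over a and one over b. *)
Lemma sum_coefK (s v : Z) m : (m < p)%N ->
  \sum_(u : Z) \sum_(t : Z)
     chr ((pz - v) * u) * (sgn (pz + s + t) * chr (s * t)) * coefK t m u =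
  2%:R * fac p.-1 * sgn (v + pz + m%:R) * coefK s (p.-1 - m) v.
Proof.
move=> mp.
rewrite (sum_coefK_eval (fun u t => chr ((pz - v) * u) * (sgn (pz + s + t) * chr (s * t)))).
pose Phi x := \sum_(i < p) qbin m i * chr x ^+ i.
transitivity ((sgn (v + pz + m%:R) - sgn s) * chr (s * m%:R) * (fac p.-1 / fac m) *
   (Phi (- (s + v)) * Phi (v - s))).
  rewrite /Phi mulr_suml mulr_sumr; apply: eq_bigr => a _.
  rewrite mulr_sumr mulr_sumr; apply: eq_bigr => b _.
  have chrX x n : chr x ^+ n = chr (x * n%:R) by rewrite mulr_natr chrMn.
  rewrite coefB_qbin // !chrX.
  have e1 : chr ((pz - v) * (pz + a%:R - b%:R)) *
       (sgn (pz + s + (pz + (m%:R - a%:R - b%:R))) *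
        chr (s * (pz + (m%:R - a%:R - b%:R)))) =
      sgn (v + pz + m%:R) * chr (s * m%:R) * chr (- (s + v) * a%:R) * chr ((v - s) * b%:R).
    rewrite /sgn -!(chrD H); apply: (congr1 chr).
    apply/eqP; rewrite -subr_eq0; apply/eqP.
    transitivity ((pz + pz) * (pz - b%:R + s - v)); first by ring.
    by rewrite (pp0 H) mul0r.
  have e2 : (-1) ^+ (p.-1 + m) * (chr ((pz - v) * (a%:R - b%:R)) *
       (sgn (pz + s + (m%:R - a%:R - b%:R)) *
        chr (s * (m%:R - a%:R - b%:R)))) =
      - sgn s * chr (s * m%:R) * chr (- (s + v) * a%:R) * chr ((v - s) * b%:R).
    rewrite exprD signr_pred -(sgn_nat H m) !mulNr; congr (- _).
    rewrite /sgn -!(chrD H); apply: (congr1 chr).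
    apply/eqP; rewrite -subr_eq0; apply/eqP.
    transitivity ((pz + pz) * (pz - b%:R + m%:R)); first by ring.
    by rewrite (pp0 H) mul0r.
  by rewrite e1 e2; ring.
have sm1 : sgn m.+1%:R = - sgn m%:R by rewrite !sgn_nat // exprS mulN1r.
have em : (p.-1 - m)%:R = pz - m.+1%:R :> Z.
  have -> : (p.-1 - m = p - m.+1)%N by lia.
  by rewrite natrB.
(* With equal signs the prefactor vanishes, and so does the right side by parity of the support.
   With opposite signs both arguments have the form p + m + 1 + 2a required by [qbinomial_root]. *)
have [es|es] : sgn s = sgn (v + pz + m%:R) \/ sgn s = - sgn (v + pz + m%:R).
    by case: (sgn_pm s) => ->; case: (sgn_pm (v + pz + m%:R)) => ->; rewrite ?opprK; auto.
  rewrite es subrr !mul0r coefK_support ?mulr0 // em.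
  have -> : s + v + (pz - m.+1%:R) = s + (v + pz - m.+1%:R) by ring.
  rewrite sgnD // es -sgnD //.
  have -> : v + pz + m%:R + (v + pz - m.+1%:R) = (v + pz + m%:R) + (v + pz + m%:R) - m.+1%:R - m%:R by ring.
  rewrite (sgnD H _ (- m%:R)) (sgnD H _ (- m.+1%:R)) sgn_dbl mul1r.
  rewrite !sgnN // sm1 mulNr sgn2 //.
  by rewrite eq_sym -subr_eq0 opprK -mulr2n (two_neq0 H).
have dbl x : sgn x = sgn (s + v) -> exists2 a, (a < p)%N & x = pz + m.+1%:R + 2%:R * a%:R.
  move=> sx; have [|a ap ea] := @sgn1_double (x - (pz + m.+1%:R)).
    rewrite sgnD // sx sgnN // !sgnD // sm1 es !sgnD //.
    transitivity ((sgn v * sgn v) * (sgn pz * sgn pz) * (sgn m%:R * sgn m%:R)); first by ring.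
    by rewrite !sgn2 // !mul1r.
  by exists a => //; rewrite -ea; ring.
have [|a ap ea] := dbl (- (s + v)); first by rewrite sgnN.
have [|b bp eb] := dbl (v - s); first by rewrite addrC !sgnD // sgnN.
have [e ee] : exists e : bool, s + (m.+1 + a + b)%:R = pz *+ e.
  apply: double_eq0; rewrite !natrD.
  transitivity ((pz + m.+1%:R + 2 * a%:R) + (pz + m.+1%:R + 2%:R * b%:R) + s + s - (pz + pz)); first by ring.
  by rewrite -ea -eb (pp0 H); ring.
have eS : s = pz *+ e - (m.+1 + a + b)%:R by rewrite -ee addrK.
have eV : v = pz *+ ~~ e + b%:R - a%:R.
  have -> : v = - (s + (m.+1 + a + b)%:R) - pz + b%:R - a%:R.
    transitivity (- s - - (s + v)); first by ring.
    by rewrite ea !natrD; ring.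
  by rewrite ee; case: (e) => /=; rewrite ?(oppp H) ?(pp0 H) // oppr0 add0r.
rewrite [in RHS]eS [coefK _ _ _](_ : _ = (-1) ^+ (m * e) * coefC m b a); last first.
  by rewrite [in LHS]eV coefK_root.
rewrite /Phi ea eb !qbinomial_root // es opprK.
have eX : chr (s * m%:R) * chr (m%:R * a%:R + 'C(m.+1, 2)%:R) *
    chr (m%:R * b%:R + 'C(m.+1, 2)%:R) = (-1) ^+ (m * e).
  rewrite -!chrD //; have -> : (-1) ^+ (m * e) = chr (pz *+ e * m%:R) :> F.
    case: (e); first by rewrite muln1 mulr1n -/(sgn _) sgn_nat.
    by rewrite muln0 mulr0n mul0r chr0.
  apply: (congr1 chr); have bn : 'C(m.+1, 2)%:R + 'C(m.+1, 2)%:R = m%:R * m.+1%:R :> Z.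
    by rewrite -natrD -natrM addnn -mul2n mul_bin_left /= bin1; congr (_%:R); lia.
  rewrite eS; transitivity (s * m%:R + m%:R * a%:R + m%:R * b%:R + ('C(m.+1, 2)%:R + 'C(m.+1, 2)%:R)).
    by rewrite eS; ring.
  by rewrite bn eS !natrD; ring.
have m0 : fac m != 0 by exact: fac_neq0.
have a0 : fac a != 0 by exact: fac_neq0.
have b0 : fac b != 0 by exact: fac_neq0.
rewrite -eX /coefC; have : (-1) ^+ m * (-1) ^+ m = 1 :> F by rewrite -expr2 sqrr_sign.
move: ((-1) ^+ m) => x x2.
move: (chr (s * _)) (chr (_ + _)) (chr (_ + _)) (sgn _) => c1 c2 c3 c4.
transitivity (x * x * (2 * c4 * c1 * c2 * c3 * fac p.-1 * fac (m + a) * fac (m + b) / (fac m * fac a * fac b))).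
  by field; rewrite m0 a0 b0.
by rewrite x2; field; rewrite m0 a0 b0.
Qed.

End ProjectiveTraces.

Lemma eqn_mod_close (n x y : nat) : (x < y + n)%N -> (y < x + n)%N ->
  (x == y %[mod n])%N = (x == y).
Proof.
move=> xy yx; apply/idP/eqP => [|-> //].
wlog le : x y xy yx / (y <= x)%N => [hw|].
  case: (leqP y x) => [|/ltnW] le e; first exact: hw.
  by apply/esym/hw => //; rewrite eq_sym.
by rewrite eqn_mod_dvd // => /dvdnP[[|k] e]; nia.
Qed.

(** * The S-matrix on the families K_t *)

Section FourierOfProjectives.
Variables (F : fieldType) (p : nat) (q : F).
Local Notation Z := 'Z_(2 * p).
Local Notation pz := (p%:R : Z).
Local Notation chr := (@chr F p q).
Local Notation sgn := (@sgn F p q).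
Local Notation fac := (@fac F p q).
Local Notation coefB := (@coefB F p q).
Local Notation coefP := (@coefP F p q).
Local Notation coefM := (@coefM F p q).
Local Notation coefK := (@coefK F p q).
Hypothesis H : even_root p q.

(** [sum_coefK] is this identity after a Fourier transform in u; summing over v inverts that
    transform. *)
Lemma coefS_coefK r s m u : r ^+ 2 = (2 * p)%:R -> (m < p)%N ->
  coefS q r (coefK s) m u =
  r^-1 * \sum_(t : Z) sgn (pz + s + t) * chr (s * t) * coefK t m u.
Proof.
move=> r2 mp; have r0 : r != 0 by rewrite -sqrf_eq0 r2 (even_root_char H).
have p0 := p_neq0 H; have N0 := even_root_char H.
set L := \sum_(t : Z) _.
pose D v := \sum_(w : Z) \sum_(t : Z)
     chr ((pz - v) * w) * (sgn (pz + s + t) * chr (s * t)) * coefK t m w.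
have eD v : D v = 2%:R * fac p.-1 * sgn (v + pz + m%:R) * coefK s (p.-1 - m) v.
  exact: sum_coefK.
have eL : \sum_(v : Z) chr (- ((pz - v) * u)) * D v = (2 * p)%:R * L.
  transitivity (\sum_(w : Z) (\sum_(v : Z) chr ((pz - v) * (w - u))) *
     \sum_(t : Z) sgn (pz + s + t) * chr (s * t) * coefK t m w).
    under eq_bigr do rewrite mulr_sumr.
    rewrite exchange_big; apply: eq_bigr => w _ /=.
    rewrite mulr_suml; apply: eq_bigr => v _.
    rewrite !mulr_sumr; apply: eq_bigr => t _.
    have -> : (pz - v) * (w - u) = - ((pz - v) * u) + (pz - v) * w by ring.
    by rewrite chrD //; ring.
  rewrite (bigD1 u) //= [X in _ + X]big1 ?addr0; last first.
    move=> w wu; rewrite (reindex_inj (subrI pz)) /=.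
    under eq_bigr do rewrite opprB addrC subrK.
    by rewrite (chr_sum H) subr_eq0 (negPf wu) mul0r.
  rewrite subrr; under eq_bigr do rewrite mulr0 chr0.
  by rewrite sumr_const (card_Z H).
apply: (mulfI N0); rewrite [RHS]mulrCA -eL /coefS !mulr_sumr; apply: eq_bigr => v _.
have -> : chr (- ((pz - v) * u)) = sgn u * chr (u * v).
  have -> : - ((pz - v) * u) = - (pz * u) + u * v by ring.
  by rewrite chrD // -mulNr (oppp H).
have -> : u + v + pz + m%:R = u + (v + pz + m%:R) by ring.
rewrite eD sgnD // [(2 * p)%:R]natrM; field.
by rewrite r0 p0.
Qed.

(** The substitution of (m - b, m - a) for (a, b) preserves the weight [coefB]. It keeps a - b and
    changes the sign of m - a - b, which makes [coefK] even in t. *)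
Lemma coefB_reflect m (f : nat -> nat -> F) : (m < p)%N ->
  \sum_(a < p) \sum_(b < p) coefB m a b * f a b =
  \sum_(a < p) \sum_(b < p) coefB m a b * f (m - b)%N (m - a)%N.
Proof.
move=> mp.
have trunc (g : nat -> nat -> F) : \sum_(a < p) \sum_(b < p) coefB m a b * g a b =
    \sum_(a < m.+1) \sum_(b < m.+1) coefB m a b * g a b.
  rewrite [RHS](big_ord_widen p (fun a => \sum_(b < m.+1) coefB m a b * g a b)) //.
  rewrite [RHS]big_mkcond; apply: eq_bigr => a _; case: ltnP => am; last first.
    by rewrite big1 // => b _; rewrite /coefB leqNgt am mul0r.
  rewrite [RHS](big_ord_widen p (fun b => coefB m a b * g a b)) //.
  rewrite [RHS]big_mkcond; apply: eq_bigr => b _; case: ltnP => bm //.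
  by rewrite /coefB [(b <= m)%N]leqNgt bm andbF mul0r.
rewrite (trunc f) (trunc (fun a b => f (m - b)%N (m - a)%N)) [LHS]exchange_big [LHS](reindex_inj rev_ord_inj) /=; apply: eq_bigr => a _.
rewrite [LHS](reindex_inj rev_ord_inj) /=; apply: eq_bigr => b _.
rewrite !subSS; congr (_ * _); have := ltn_ord a; have := ltn_ord b.
rewrite !ltnS => bm am; rewrite /coefB !leq_subr am bm /= !subKn //.
by congr (_ / _); ring.
Qed.

Lemma coefK_even t m u : (m < p)%N -> coefK (- t) m u = coefK t m u.
Proof.
move=> mp; rewrite /coefK (@coefB_reflect m (fun a b =>
    (((- t == pz + (m%:R - a%:R - b%:R)) && (u == pz + a%:R - b%:R))%:R
     + (-1) ^+ (p.-1 + m) *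
       ((- t == m%:R - a%:R - b%:R) && (u == a%:R - b%:R))%:R))) //.
apply: eq_bigr => a _; apply: eq_bigr => b _.
have [/andP[am bm]|out] := boolP ((a <= m)%N && (b <= m)%N); last first.
  by rewrite /coefB (negPf out) !mul0r.
rewrite !natrB //; congr (_ * (_%:R + _ * _%:R)).
  congr (_ && _).
    apply/eqP/eqP => e; first by rewrite -[t]opprK e -[in RHS](oppp H); ring.
    by rewrite e -[X in _ = X + _](oppp H); ring.
  by congr (_ == _); ring.
congr (_ && _); last by congr (_ == _); ring.
apply/eqP/eqP => e; first by rewrite -[t]opprK e; ring.
by rewrite e; ring.
Qed.

(** The indicators of [coefK] are congruences modulo 2p, those of [coefP] equalities of natural
    numbers; within the support both sides differ by less than 2p, so they agree. *)
Lemma coefK_nat t m u : (t <= p)%N -> (m < p)%N ->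
  coefK t%:R m u = coefP t m u + coefM (p - t) m u.
Proof.
move=> tp mp; rewrite /coefK /coefM /twist /coefP.
rewrite mulrA -exprD.
under eq_bigr do under eq_bigr do rewrite mulrDr.
under eq_bigr do rewrite big_split /=.
rewrite big_split /=; congr (_ + _).
  rewrite (@coefB_reflect m (fun a b => ((t%:R == pz + (m%:R - a%:R - b%:R)) && (u == pz + a%:R - b%:R))%:R)) //.
  apply: eq_bigr => a _; apply: eq_bigr => b _; rewrite /coefB.
  case: andP => [[am bm]|_]; last by rewrite !mul0r.
  rewrite /indP !natrB //; congr (_ * (_ && _)%:R); last by congr (_ == _); ring.
  have -> : (t%:R == pz + (m%:R - (m%:R - b%:R) - (m%:R - a%:R))) = ((a + b + p)%:R == (t + m)%:R :> Z).
    rewrite !natrD; apply/eqP/eqP => e; first by rewrite e; ring.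
    by apply: (addIr m%:R); rewrite -e; ring.
  by rewrite (eqZ_nat H) eqn_mod_close //; lia.
rewrite mulr_sumr; apply: eq_bigr => a _; rewrite mulr_sumr; apply: eq_bigr => b _.
rewrite mulrCA /coefB.
case: andP => [[am bm]|_]; last by rewrite !mul0r.
congr (_ * (_ * _)); rewrite /indP; congr (_ && _)%:R.
  have -> : (t%:R == m%:R - a%:R - b%:R :> Z) = ((a + b + p)%:R == (p - t + m)%:R :> Z).
    rewrite !natrD natrB //; apply/eqP/eqP => e; first by rewrite e; ring.
    have e' : a%:R + b%:R = m%:R - t%:R :> Z by apply: (addIr pz); rewrite e; ring.
    by transitivity (m%:R - (a%:R + b%:R) : Z); [rewrite e'|]; ring.
  by rewrite (eqZ_nat H) eqn_mod_close //; lia.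
apply/eqP/eqP => [->|e]; first by ring.
by apply: (addIr pz); rewrite e; ring.
Qed.

Lemma eq_coefS r (g g' : nat -> Z -> F) m u : (forall n v, (n < p)%N -> g n v = g' n v) ->
  coefS q r g m u = coefS q r g' m u.
Proof.
move=> e; congr (_ * _); apply: eq_bigr => v _; rewrite e //.
by have := even_root_gt0 H; lia.
Qed.

End FourierOfProjectives.

(** * The families R_s, F_t and the Jordan block of the Casimir operator *)

Section PseudoTraces.
Variables (F : fieldType) (p : nat) (q r : F).
Local Notation Z := 'Z_(2 * p).
Local Notation pz := (p%:R : Z).
Local Notation chr := (@chr F p q).
Local Notation sn := (@sn F p q).
Local Notation cs := (@cs F p q).
Local Notation sgn := (@sgn F p q).
Local Notation fac := (@fac F p q).
Local Notation coefB := (@coefB F p q).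
Local Notation coefP := (@coefP F p q).
Local Notation coefM := (@coefM F p q).
Local Notation coefK := (@coefK F p q).
Local Notation coefU := (@coefU F p q).
Local Notation coefS := (@coefS F p q r).
Local Notation coefY := (@coefY F p q).

Definition sineA (t s : Z) : F := r^-1 * sgn (pz + t + s) * sn (t * s).

(* [coefR s] and [coefF t] are the coefficients of the images of rho_s, phi_t. *)
Definition coefR (s m : nat) (u : Z) : F :=
  coefP s m u - s%:R / p%:R * coefK s%:R m u.

Definition coefF (t m : nat) (u : Z) : F :=
  \sum_(1 <= s < p) sineA t%:R s%:R * coefS (coefR s) m u.

Hypothesis H : even_root p q.
Hypothesis r2 : r ^+ 2 = (2 * p)%:R.

Lemma r_neq0 : r != 0.
Proof. by rewrite -sqrf_eq0 r2 (even_root_char H). Qed.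

Lemma sum_even_zmod (V : zmodType) (f : Z -> V) : (forall s, f (- s) = f s) ->
  \sum_(s : Z) f s = f 0 + f pz + (\sum_(1 <= s < p) f s%:R) *+ 2.
Proof.
move=> fe; have p0 := even_root_gt0 H.
have -> : \sum_(s : Z) f s = \sum_(0 <= s < 2 * p) f s%:R.
  transitivity (\sum_(s : Z) f ((s : nat)%:R)); first by apply: eq_bigr => s _; rewrite (natrZ H).
  rewrite -(big_mkord xpredT (fun s => f s%:R)).
  by congr (\sum_(0 <= s < _) _); exact: Zp_cast (even_root_gt1N H).
rewrite (big_cat_nat (n := p)) //=; last by lia.
rewrite big_ltn // [X in _ + X]big_ltn; last by lia.
have -> : \sum_(p.+1 <= s < 2 * p) f s%:R = \sum_(1 <= s < p) f s%:R.
  rewrite (_ : \sum_(p.+1 <= s < 2 * p) f s%:R = \sum_(1 + p <= s < 2 * p) f s%:R) // big_addn.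
  have -> : (2 * p - p = p)%N by lia.
  rewrite big_nat_rev; apply: eq_big_nat => s /andP[s0 sp].
  rewrite -fe; congr f; apply/eqP; rewrite -subr_eq0 -opprD oppr_eq0 -natrD.
  by rewrite (_ : _ + _ = 2 * p)%N ?(N0Z H) //; lia.
by rewrite addrACA -mulr2n.
Qed.

Lemma sum_even (f : Z -> F) : (forall s, f (- s) = f s) ->
  \sum_(s : Z) f s = f 0 + f pz + 2%:R * \sum_(1 <= s < p) f s%:R.
Proof. by move=> fe; rewrite sum_even_zmod // mulr_natl. Qed.

Lemma sum_even0 (f : Z -> F) : (forall s, f (- s) = f s) -> f 0 = 0 -> f pz = 0 ->
  \sum_(1 <= s < p) f s%:R = 2%:R^-1 * \sum_(s : Z) f s.
Proof.
move=> fe f0 fp; rewrite sum_even // f0 fp !add0r mulKf //.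
exact: two_neq0 H.
Qed.

Lemma Z_pm (t : Z) : exists2 n, (n <= p)%N & t = n%:R \/ t = - n%:R.
Proof.
have tN := ltnZ H t; have [tp|pt] := leqP t p.
  by exists t => //; left; rewrite (natrZ H).
exists (2 * p - t)%N; first by lia.
by right; rewrite natrB 1?ltnW // (N0Z H) sub0r opprK (natrZ H).
Qed.

Lemma sn_mulp (t : nat) : sn (t%:R * pz) = 0.
Proof. by rewrite /sn mulrC -[chr (- _)]/(chr (- (pz * t%:R))) -mulrN -!/(sgn _) sgnN // subrr. Qed.

Lemma sineA0 t : sineA t 0 = 0.
Proof. by rewrite /sineA mulr0 sn0 mulr0. Qed.

Lemma sineAp (t : nat) : sineA t%:R pz = 0.
Proof. by rewrite /sineA sn_mulp mulr0. Qed.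

Lemma sineAN t s : sineA t (- s) = - sineA t s.
Proof. by rewrite /sineA mulrN snN !sgnD // sgnN // mulrN. Qed.

Lemma sn_mulC t s : sineA t s = sineA s t.
Proof. by rewrite /sineA [t * s]mulrC -[pz + t + s]addrA [t + s]addrC addrA. Qed.

(** As a function of s on Z/2p the summand is even and vanishes at 0 and p, so the sum is half of a
    full character sum. The signs combine to one independent of s, and T + V is nonzero in the given
    range. *)
Lemma sineA_sq (t u : nat) : (0 < t < p)%N -> (0 < u < p)%N ->
  \sum_(1 <= s < p) sineA t%:R s%:R * sineA s%:R u%:R = - (t == u)%:R.
Proof.
move=> tp up; have r0 := r_neq0.
rewrite (@sum_even0 (fun s => sineA t%:R s * sineA s u%:R)); first last.
- by rewrite sineAp mul0r.
- by rewrite sineA0 mul0r.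
- by move=> s; rewrite (sn_mulC (- s)) (sn_mulC s u%:R) !sineAN mulrNN.
pose T := t%:R : Z; pose V := u%:R : Z.
transitivity (2%:R^-1 * (r^-1 ^+ 2 * sgn (T + V) *
   \sum_(s : Z) (chr (s * (T + V)) + chr (s * (- (T + V))) - chr (s * (T - V)) - chr (s * (V - T))))).
  congr (_ * _); rewrite mulr_sumr; apply: eq_bigr => s _; rewrite /sineA -/T -/V.
  have -> : sgn (T + V) = sgn (pz + T + s) * sgn (pz + s + V).
    rewrite -sgnD //; have -> : pz + T + s + (pz + s + V) = (pz + s) + (pz + s) + (T + V) by ring.
    by rewrite [RHS]sgnD // sgn_dbl // mul1r.
  have -> : s * (T + V) = s * T + s * V by ring.
  have -> : s * (- (T + V)) = - (s * T) - s * V by ring.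
  have -> : s * (T - V) = s * T - s * V by ring.
  have -> : s * (V - T) = - (s * T) + s * V by ring.
  by rewrite !(chrD H) /sn [T * s]mulrC; ring.
rewrite !sumrB big_split /= !(chr_sum H) oppr_eq0.
have -> : (T + V == 0) = false.
  by rewrite -natrD (eqZ_nat H _ 0) mod0n modn_small; lia.
have eTV : (T - V == 0) = (t == u).
  by rewrite subr_eq0 (eqZ_nat H) !modn_small; lia.
rewrite -[V - T]opprB oppr_eq0 eTV; case: eqP => [tu|_]; last by rewrite addr0 !subr0 !mulr0 oppr0.
have -> : T + V = V + V by rewrite /T tu.
rewrite sgn_dbl // exprVn r2; have := even_root_char H; rewrite natrM; have := two_neq0 H; have := p_neq0 H.
by move=> a b c; rewrite mulr1n; field; rewrite a b.
Qed.

Lemma coefY_ext (g g' : nat -> Z -> F) m u : (m < p)%N ->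
  (forall n v, (n < p)%N -> g n v = g' n v) -> coefY g m u = coefY g' m u.
Proof. by move=> mp e; rewrite /coefY !e //; lia. Qed.

Lemma coefY_coefK t m u : (m < p)%N -> coefY (coefK t) m u = cs t * coefK t m u.
Proof.
move=> mp; have [n np et] := Z_pm t.
have key : coefY (coefK n%:R) m u = cs n%:R * coefK n%:R m u.
  rewrite (coefY_ext _ mp (fun k v kp => coefK_nat H v np kp)) coefK_nat //.
  have e1 := coefY_coefP H n u mp; have e2 := coefY_coefM H (p - n) u mp.
  rewrite natrB // opprB addrCA subrr addr0 in e2.
  by rewrite mulrDr -e1 -e2 /coefY; ring.
case: et => ->; rewrite ?key // csN coefK_even // -key.
by apply: coefY_ext => // k v kp; rewrite coefK_even.
Qed.

Lemma central_coef_ext (g g' : nat -> Z -> F) :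
  (forall n v, (n < p)%N -> g n v = g' n v) -> central_coef q g' -> central_coef q g.
Proof. by move=> e sg m u mp; rewrite !e ?sg // ltnW. Qed.

Lemma central_coef_sum (I : Type) (l : seq I) (P : pred I) (c : I -> F) (g : I -> nat -> Z -> F) :
  (forall i, P i -> central_coef q (g i)) ->
  central_coef q (fun m u => \sum_(i <- l | P i) c i * g i m u).
Proof.
move=> sg m u mp; rewrite -sumrB mulr_sumr; apply: eq_bigr => i Pi.
by rewrite -mulrBr sg // mulrCA.
Qed.

Lemma central_coefD (g g' : nat -> Z -> F) c d :
  central_coef q g -> central_coef q g' ->
  central_coef q (fun m u => c * g m u + d * g' m u).
Proof.
move=> sg sg' m u mp; rewrite mulrDr [sn u * _]mulrCA [sn u * (d * _)]mulrCA -sg // -sg' //; ring.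
Qed.

Lemma central_coefK t : central_coef q (coefK t).
Proof.
have [n np et] := Z_pm t.
apply: (@central_coef_ext _ (fun m u => 1 * coefP n m u + 1 * coefM (p - n) m u)).
  by move=> m u mp; rewrite !mul1r -coefK_nat //; case: et => ->; rewrite ?coefK_even.
by apply: central_coefD; [exact: central_coefP|exact: central_coefM].
Qed.

Lemma central_coefR s : central_coef q (coefR s).
Proof.
move=> m u mp; have := central_coefD 1 (- (s%:R / p%:R)) (central_coefP H s) (central_coefK s%:R) u mp.
by rewrite !mul1r !mulNr.
Qed.

Lemma central_coefF t : central_coef q (coefF t).
Proof.
have := @central_coef_sum nat (index_iota 1 p) xpredT (fun s => sineA t%:R s%:R) (fun s => coefS (coefR s)).
by apply=> s _; apply: central_coefS => //; exact: central_coefR.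
Qed.

Lemma coefS_sum (I : Type) (l : seq I) (P : pred I) (c : I -> F) (g : I -> nat -> Z -> F) m u :
  coefS (fun m u => \sum_(i <- l | P i) c i * g i m u) m u =
  \sum_(i <- l | P i) c i * coefS (g i) m u.
Proof.
rewrite /coefS; under eq_bigr do rewrite mulr_sumr.
rewrite exchange_big mulr_sumr /=; apply: eq_bigr => i _.
rewrite mulrCA; congr (_ * _); rewrite mulr_sumr; apply: eq_bigr => v _.
by rewrite mulrCA.
Qed.

Lemma coefY_sum (I : Type) (l : seq I) (P : pred I) (c : I -> F) (g : I -> nat -> Z -> F) m u :
  coefY (fun m u => \sum_(i <- l | P i) c i * g i m u) m u =
  \sum_(i <- l | P i) c i * coefY (g i) m u.
Proof.
rewrite /coefY !mulr_sumr -big_split; apply: eq_bigr => i _ /=; ring.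
Qed.

Lemma coefSD (g g' : nat -> Z -> F) c d m u :
  coefS (fun m u => c * g m u + d * g' m u) m u = c * coefS g m u + d * coefS g' m u.
Proof.
rewrite /coefS mulrCA [d * _]mulrCA -mulrDr; congr (_ * _).
by rewrite !mulr_sumr -big_split; apply: eq_bigr => v _ /=; ring.
Qed.

Lemma coefS_coefR s m u :
  coefS (coefR s) m u = coefS (coefP s) m u - s%:R / p%:R * coefS (coefK s%:R) m u.
Proof.
rewrite -mulNr -[coefS (coefP s) m u]mul1r -coefSD.
by congr (_ * _); apply: eq_bigr => v _; rewrite /coefR mul1r mulNr.
Qed.

Lemma coefY_SK (s : Z) m u : (m < p)%N -> coefY (coefS (coefK s)) m u =
  - (coefS (coefK (s + 1)) m u + coefS (coefK (s - 1)) m u).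
Proof.
move=> mp; rewrite !coefS_coefK //.
have e n v : (n < p)%N -> coefS (coefK s) n v =
   \sum_(t : Z) (r^-1 * (sgn (pz + s + t) * chr (s * t))) * coefK t n v.
  by move=> np; rewrite coefS_coefK // mulr_sumr; apply: eq_bigr => t _; rewrite mulrA.
rewrite (coefY_ext _ mp e) coefY_sum -mulrDr -mulrN -big_split -sumrN mulr_sumr /=.
 apply: eq_bigr => t _; rewrite coefY_coefK //.
have s1 : sgn 1 = -1 by rewrite (sgn_nat H 1) expr1.
have -> : (s + 1) * t = s * t + t by ring.
have -> : (s - 1) * t = s * t - t by ring.
have -> : pz + (s + 1) + t = pz + s + t + 1 by ring.
have -> : pz + (s - 1) + t = pz + s + t - 1 by ring.
by rewrite !(chrD H) !(sgnD H _ 1) !(sgnD H _ (-1)) sgnN // s1 /cs; ring.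
Qed.

Lemma coefP0 m u : (m < p)%N -> coefP 0 m u = 0.
Proof.
move=> mp; rewrite /coefP big1 // => a _; rewrite big1 // => b _.
by rewrite /indP (_ : (_ == _)%N = false) ?mulr0 //; lia.
Qed.

Lemma coefS0 (g : nat -> Z -> F) m u : (forall n v, (n < p)%N -> g n v = 0) -> coefS g m u = 0.
Proof.
move=> e; rewrite /coefS big1 ?mulr0 // => v _; rewrite e ?mulr0 //.
by have := even_root_gt0 H; lia.
Qed.

Lemma coefY_SP s m u : (0 < s < p)%N -> (m < p)%N -> coefY (coefS (coefP s)) m u =
  - (coefS (coefP s.+1) m u + coefS (coefP s.-1) m u).
Proof.
move=> sp mp; rewrite (coefY_ext _ mp (fun n v np => coefS_coefP H r s v np)).
rewrite !coefS_coefP //; set c := _ / _.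
transitivity (c * (-1) ^+ s.-1 * coefY (coefU s) m u); first by rewrite /coefY; ring.
rewrite coefY_coefU //; case: s sp => // -[|s] _ /=; last by rewrite !exprS; ring.
have -> : coefU 0 m u = 0 by rewrite /coefU big1 // => a _; rewrite big1 // => b _; rewrite addnS mul0r mulr0.
ring.
Qed.

Lemma coefR0 m u : (m < p)%N -> coefR 0 m u = 0.
Proof. by move=> mp; rewrite /coefR coefP0 // !mul0r subrr. Qed.

Lemma coefRp m u : (m < p)%N -> coefR p m u = 0.
Proof.
move=> mp; rewrite /coefR coefK_nat // subnn divff ?(p_neq0 H) // mul1r.
by rewrite /coefM /twist coefP0 // !mulr0 addr0 subrr.
Qed.

Lemma sum_by_parts (f g : nat -> F) : f 0%N = 0 -> g p = 0 ->
  \sum_(1 <= s < p) f s * g s.+1 = \sum_(1 <= s < p) f s.-1 * g s.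
Proof.
move=> f0 gp; have p0 := even_root_gt0 H.
transitivity (\sum_(1 <= s < p.+1) f s.-1 * g s).
  by rewrite [RHS]big_ltn //= f0 mul0r add0r [RHS]big_add1.
by rewrite big_nat_recr //= gp mulr0 addr0.
Qed.

(** The transforms of the P_s and of the K_s obey the same recurrence in s, but the factor s/p in
    R_s leaves the defect (K_(s+1) - K_(s-1)) / p, transformed. Summation by parts moves the shifts
    to the sine, where they produce the eigenvalue [cs t]; the defect sums to a multiple of K_t
    because S^2 = 1. *)
Lemma coefY_coefF (t : nat) m u : (0 < t < p)%N -> (m < p)%N ->
  coefY (coefF t) m u = cs t%:R * coefF t m u - sn t%:R / p%:R * coefK t%:R m u.
Proof.
move=> tp mp; have p1 := even_root_gt1 H; have p0 := p_neq0 H.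
pose A s := sineA t%:R s; pose X s := coefS (coefR s) m u.
pose K s := coefS (coefK s) m u.
have X0 : X 0%N = 0 by apply: coefS0 => n v np; exact: coefR0.
have Xp : X p = 0 by apply: coefS0 => n v np; exact: coefRp.
have YX s : (0 < s < p)%N ->
    coefY (coefS (coefR s)) m u = - (X s.+1 + X s.-1) - p%:R^-1 * (K (s%:R + 1) - K (s%:R - 1)).
  move=> sp.
  have e n v : (n < p)%N -> coefS (coefR s) n v =
    1 * coefS (coefP s) n v + - (s%:R / p%:R) * coefS (coefK s%:R) n v.
    by move=> _; rewrite coefS_coefR mul1r mulNr.
  rewrite (coefY_ext _ mp e).
  transitivity (coefY (coefS (coefP s)) m u - s%:R / p%:R * coefY (coefS (coefK s%:R)) m u).
    by rewrite /coefY; ring.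
  rewrite coefY_SP // coefY_SK // /X !coefS_coefR /K.
  case: s {e} sp => // s _ /=.
  have -> : s.+1%:R + 1 = s.+2%:R :> Z by rewrite [in RHS]mulrS addrC.
  have -> : s.+1%:R - 1 = s%:R :> Z by rewrite mulrS; ring.
  have -> : s.+2%:R = s%:R + 2%:R :> F by rewrite -natrD addn2.
  have -> : s.+1%:R = s%:R + 1%:R :> F by rewrite -natrD addn1.
  by field.
have A0 : A 0 = 0 by exact: sineA0.
have Ap : A pz = 0 by exact: sineAp.
have e1 : \sum_(1 <= s < p) A s%:R * X s.+1 = \sum_(1 <= s < p) A (s%:R - 1) * X s.
  rewrite (sum_by_parts (f := fun s => A s%:R)) //; apply: eq_big_nat => -[|s] // _ /=.
  by congr (A _ * _); rewrite mulrS; ring.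
have e2 : \sum_(1 <= s < p) A s%:R * X s.-1 = \sum_(1 <= s < p) A (s%:R + 1) * X s.
  under eq_bigr do rewrite mulrC.
  rewrite -(sum_by_parts (g := fun s => A s%:R)) //; apply: eq_big_nat => s _ /=.
  by rewrite mulrC; congr (A _ * _); rewrite mulrS addrC.
have s1 : sgn 1 = -1 by rewrite (sgn_nat H 1) expr1.
have sA1 s e : sgn e = -1 -> sgn (pz + t%:R + (s + e)) = - sgn (pz + t%:R + s).
  by move=> se; rewrite addrA (sgnD H _ e) se mulrN1.
have eA s : A (s - 1) + A (s + 1) = - (cs t%:R * A s).
  rewrite /A /sineA !sA1 ?sgnN //.
  have -> : t%:R * (s - 1) = t%:R * s - t%:R by ring.
  have -> : t%:R * (s + 1) = t%:R * s + t%:R by ring.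
  by rewrite /sn /cs !opprD !opprK !(chrD H); ring.
have eD s : A (s - 1) - A (s + 1) = sn t%:R * (r^-1 * (sgn (pz + t%:R + s) * cs (t%:R * s))).
  rewrite /A /sineA !sA1 ?sgnN //.
  have -> : t%:R * (s - 1) = t%:R * s - t%:R by ring.
  have -> : t%:R * (s + 1) = t%:R * s + t%:R by ring.
  by rewrite /sn /cs !opprD !opprK !(chrD H); ring.
have KN s : K (- s) = K s.
  by apply: (eq_coefS H) => n v np; rewrite coefK_even.
have AN s : A (- s) = - A s by exact: sineAN.
have SK : \sum_(s : Z) r^-1 * (sgn (pz + t%:R + s) * chr (t%:R * s)) * K s = coefK t%:R m u.
  rewrite -coefS_sum -[RHS](coefSK H u r2 (central_coefK t%:R) mp).
  apply: eq_coefS => // n v np; rewrite coefS_coefK // mulr_sumr.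
  by apply: eq_bigr => s _; rewrite !mulrA.
(* The summand is even in s, so the sum is half of the one over Z/2p; the exponentials of both signs
   contribute equally because K is even. *)
have half : \sum_(1 <= s < p) A s%:R * (K (s%:R + 1) - K (s%:R - 1)) = sn t%:R * coefK t%:R m u.
  rewrite (@sum_even0 (fun s => A s * (K (s + 1) - K (s - 1)))); first last.
  - by rewrite Ap mul0r.
  - by rewrite A0 mul0r.
  - move=> s; have -> : - s + 1 = - (s - 1) by ring.
    have -> : - s - 1 = - (s + 1) by ring.
    by rewrite AN !KN; ring.
  have -> : \sum_(s : Z) A s * (K (s + 1) - K (s - 1)) = \sum_(s : Z) (A (s - 1) - A (s + 1)) * K s.
    under eq_bigr do rewrite mulrBr.
    rewrite sumrB [X in X - _](reindex_inj (addIr (-1))) [X in _ - X](reindex_inj (addIr 1)) /=.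
    by rewrite -sumrB; apply: eq_bigr => s _; rewrite subrK addrK; ring.
  have eC : \sum_(s : Z) r^-1 * (sgn (pz + t%:R + s) * chr (- (t%:R * s))) * K s = coefK t%:R m u.
    rewrite -SK (reindex_inj oppr_inj); apply: eq_bigr => s _ /=.
    by rewrite KN mulrN opprK sgnD // sgnN // -sgnD.
  have -> : \sum_(s : Z) (A (s - 1) - A (s + 1)) * K s = sn t%:R * (coefK t%:R m u + coefK t%:R m u).
    rewrite -{1}SK -eC -big_split mulr_sumr; apply: eq_bigr => s _ /=.
    by rewrite eD /cs; ring.
  by have := two_neq0 H => t0; field.
rewrite /coefF coefY_sum.
transitivity (- (\sum_(1 <= s < p) A s%:R * X s.+1 + \sum_(1 <= s < p) A s%:R * X s.-1)
   - p%:R^-1 * \sum_(1 <= s < p) A s%:R * (K (s%:R + 1) - K (s%:R - 1))).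
  rewrite mulr_sumr -big_split -sumrN -sumrB; apply: eq_big_nat => s sp.
  by rewrite YX // -/(A s%:R) /=; ring.
rewrite half e1 e2 -big_split /= -sumrN; congr (_ - _); last by field.
rewrite mulr_sumr; apply: eq_bigr => s _; rewrite -mulrDl eA -/(A s%:R) -/(X s); ring.
Qed.

Lemma coefB_0 a b : coefB 0 a b = fac p.-1 * ((a == 0) && (b == 0))%N%:R.
Proof.
rewrite /coefB !leqn0; case: andP => [[/eqP-> /eqP->]|_]; last by rewrite mulr0.
by rewrite !fac0 !mulr1 invr1 mulr1.
Qed.

Lemma coefP_0 s u : coefP s 0 u = fac p.-1 * ((s == p) && (u == pz))%:R.
Proof.
have p0 := even_root_gt0 H.
rewrite /coefP (bigD1 (Ordinal p0)) //= [X in _ + X]big1 ?addr0; last first.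
  move=> a; rewrite -val_eqE /= => /negPf a0; rewrite big1 // => b _.
  by rewrite coefB_0 a0 mulr0 mul0r.
rewrite (bigD1 (Ordinal p0)) //= [X in _ + X]big1 ?addr0; last first.
  move=> b; rewrite -val_eqE /= => /negPf b0.
  by rewrite coefB_0 b0 andbF mulr0 mul0r.
by rewrite coefB_0 /= mulr1n mulr1 /indP add0n addn0 [in p == s]eq_sym mulr0n addr0 subr0.
Qed.

Lemma coefM_0 s u : coefM s 0 u = (-1) ^+ p.-1 * fac p.-1 * ((s == p) && (u == 0))%:R.
Proof.
rewrite /coefM /twist expr0 mul1r coefP_0 mulrA.
by rewrite -[u + pz == pz]subr_eq0 addrK.
Qed.

Lemma coefK_0 (t : nat) u : (0 < t < p)%N -> coefK t%:R 0 u = 0.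
Proof.
move=> tp; rewrite (coefK_nat H); [|lia|lia].
rewrite coefP_0 coefM_0 (_ : (t == p) = false); last by lia.
by rewrite (_ : (p - t == p)%N = false) ?mulr0 ?addr0 //; lia.
Qed.

Lemma coefF_0 (t : nat) u : (0 < t < p)%N -> u != t%:R -> u != - t%:R ->
  coefF t 0 u = 0.
Proof.
move=> tp u1 u2; have p0 := even_root_gt0 H.
have := coefY_coefF u tp p0; rewrite coefK_0 // mulr0 subr0.
rewrite /coefY sn0 mul0r add0r addr0 => /eqP.
rewrite -subr_eq0 -mulrBl mulf_eq0 subr_eq0 cs_eq // (negPf u1) (negPf u2).
by move=> /eqP.
Qed.

(** In row 0 these are the Chebyshev polynomials of the second kind, sin(us) / sin(u). *)
Lemma coefU_0 s u : (s <= p)%N -> sn u * coefU s 0 u = sn (u * s%:R).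
Proof.
elim/ltn_ind: s => -[|[|s]] IH sp.
- rewrite mulr0 sn0 /coefU big1 ?mulr0 // => a _; rewrite big1 // => b _.
  by rewrite addn1 mul0r mulr0.
- have p0 := even_root_gt0 H; rewrite mulr1.
  rewrite /coefU (bigD1 (Ordinal p0)) //= [X in _ + X]big1 ?addr0; last first.
    move=> a; rewrite -val_eqE /= => a0; rewrite big1 // => b _.
    by rewrite (_ : (_ == _)%N = false) ?mul0r ?mulr0 //; lia.
  rewrite (bigD1 (Ordinal p0)) //= [X in _ + X]big1 ?addr0; last first.
    move=> b; rewrite -val_eqE /= => b0.
    by rewrite (_ : (_ == _)%N = false) ?mul0r ?mulr0 //; lia.
  rewrite subr0 mulr0 chr0 // mulr1 -[X in _ * X]/(coefB (p.-1 - 0) 0 0 * 1).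
  by rewrite coefB_compl // /coefC !addn0 fac0 !mulr1 invr1 !mulr1.
have p0 := even_root_gt0 H.
have := @coefY_coefU _ _ _ H s.+1 0 u; rewrite /coefY sn0 mul0r add0r addr0.
move=> /(_ sp p0) e.
have : cs u * (sn u * coefU s.+1 0 u) = sn u * coefU s.+2 0 u + sn u * coefU s 0 u.
  by rewrite mulrCA e mulrDr.
rewrite (IH s.+1) ?(IH s); try lia.
move=> /eqP; rewrite -subr_eq => /eqP <-.
have -> : u * s.+2%:R = u * s.+1%:R + u by rewrite [in LHS]mulrS; ring.
have -> : u * s%:R = u * s.+1%:R - u by rewrite mulrS; ring.
by rewrite /cs /sn !opprD !opprK !(chrD H); ring.
Qed.

(** After multiplication by [sn t] the value is a nonzero multiple of a diagonal entry of the
    squared sine matrix, which is -1; the K part does not contribute in row 0. *)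
Lemma coefF_0t (t : nat) : (0 < t < p)%N -> coefF t 0 t%:R != 0.
Proof.
move=> tp; have p0 := even_root_gt0 H; have pn := p_neq0 H; have rn := r_neq0.
have sk s : coefS (coefK s) 0 t%:R = 0.
  rewrite coefS_coefK // big1 ?mulr0 // => x _.
  have [n np en] := Z_pm x; have : coefK n%:R 0 t%:R = 0.
    have h1 : (t%:R == pz) = false by rewrite (eqZ_nat H) !modn_small; lia.
    have h2 : (t%:R == 0 :> Z) = false.
      by rewrite (eqZ_nat H t 0) mod0n modn_small; lia.
    by rewrite (coefK_nat H) // coefP_0 coefM_0 h1 h2 !andbF !mulr0 addr0.
  by case: en => ->; rewrite ?coefK_even // => ->; rewrite mulr0.
have st : sn t%:R != 0 by exact: sn_nat_neq0.
have f0 : fac p.-1 != 0 by apply: fac_neq0 => //; lia.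
suff : sn t%:R * coefF t 0 t%:R != 0 by rewrite mulf_eq0 negb_or => /andP[].
have -> : sn t%:R * coefF t 0 t%:R = - (fac p.-1 / (p%:R * r)) * (r * sgn (pz + t%:R)) *
    \sum_(1 <= s < p) sineA t%:R s%:R * sineA s%:R t%:R.
  rewrite /coefF !mulr_sumr; apply: eq_big_nat => s sp.
  rewrite coefS_coefR sk mulr0 subr0 coefS_coefP // [LHS]mulrCA.
  rewrite [sn t%:R * _](_ : _ = fac p.-1 / (p%:R * r) * ((-1) ^+ s.-1 * (sn t%:R * coefU s 0 t%:R))); last by ring.
  rewrite coefU_0; last by lia.
  have -> : (-1) ^+ s.-1 = - (sgn (pz + t%:R) * sgn (pz + s%:R + t%:R)).
    rewrite -sgnD // (_ : _ + _ = (pz + t%:R) + (pz + t%:R) + s%:R); last by ring.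
    rewrite (sgnD H _ s%:R) sgn_dbl // mul1r sgn_nat //.
    by case: s sp => // s _ /=; rewrite exprS mulN1r opprK.
  have -> : sineA s%:R t%:R = r^-1 * sgn (pz + s%:R + t%:R) * sn (t%:R * s%:R).
    by rewrite /sineA [s%:R * _]mulrC.
  by field; rewrite pn rn.
rewrite sineA_sq // eqxx mulr1n mulrN1 !mulNr opprK !mulf_neq0 //.
  by rewrite invr_neq0 // mulf_neq0.
exact: sgn_neq0.
Qed.

End PseudoTraces.

(** From n to n + 1 the j-th term grows by T j - T (j + 1), and these increments telescope to 1.
    This is the source of the integer n in the derivative of the ribbon polynomial. *)
Lemma qsum_eq_nat (F : fieldType) (x : F) n :
  (forall k, (0 < k <= n)%N -> x ^+ k != 1) ->
  \sum_(j < n) (\prod_(i < j.+1) (1 - x ^+ (n - i))) / (1 - x ^+ j.+1) = n%:R.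
Proof.
elim: n => [|n IH] x1; first by rewrite big_ord0.
pose T j := \prod_(i < j) (1 - x ^+ (n - i)).
have T0 : T n.+1 = 0 by rewrite /T big_ord_recr /= subnn expr0 subrr mulr0.
have -> : n.+1%:R = n%:R + \sum_(j < n.+1) (T j - T j.+1) :> F.
  rewrite -(big_mkord xpredT (fun j => T j - T j.+1)).
  rewrite (eq_bigr (fun j => - (T j.+1 - T j))) => [|j _]; last by rewrite opprB.
  rewrite sumrN telescope_sumr // T0 sub0r opprK /T big_ord0.
  by rewrite [in LHS]mulrSr.
rewrite -IH; last by move=> k kn; apply: x1; lia.
have -> : \sum_(j < n) (\prod_(i < j.+1) (1 - x ^+ (n - i))) / (1 - x ^+ j.+1) =
    \sum_(j < n.+1) T j.+1 / (1 - x ^+ j.+1).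
  by rewrite big_ord_recr /= T0 mul0r addr0.
rewrite -big_split; apply: eq_bigr => j _ /=; have jn := ltn_ord j.
rewrite big_ord_recl /= subn0.
have -> : \prod_(i < j) (1 - x ^+ (n.+1 - bump 0 i)) = T j.
  by apply: eq_bigr => i _; rewrite /bump add1n subSS.
have -> : T j.+1 = T j * (1 - x ^+ (n - j)) by rewrite /T big_ord_recr.
have xj : 1 - x ^+ j.+1 != 0 by rewrite subr_eq0 eq_sym x1 //; lia.
have -> : x ^+ n.+1 = x ^+ (n - j) * x ^+ j.+1 by rewrite -exprD; congr (_ ^+ _); lia.
by field.
Qed.

(** * Linear independence of the families; coefficients of the ribbon element *)

Section IndependenceAndRibbon.
Variables (F : fieldType) (p : nat) (q r : F).
Local Notation Z := 'Z_(2 * p).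
Local Notation pz := (p%:R : Z).
Local Notation chr := (@chr F p q).
Local Notation sn := (@sn F p q).
Local Notation cs := (@cs F p q).
Local Notation sgn := (@sgn F p q).
Local Notation fac := (@fac F p q).
Local Notation coefB := (@coefB F p q).
Local Notation coefP := (@coefP F p q).
Local Notation coefM := (@coefM F p q).
Local Notation coefF := (@coefF F p q r).

Hypothesis H : even_root p q.
Hypothesis r2 : r ^+ 2 = (2 * p)%:R.

Lemma coefP_pz0 s m : (s + m < p)%N -> coefP s m pz = 0.
Proof.
move=> sm; rewrite /coefP big1 // => a _; rewrite big1 // => b _.
by rewrite /indP (_ : (_ == _)%N = false) ?mulr0 //; lia.
Qed.

Lemma coefP_pz_neq0 s m : (s + m = p)%N -> (m < p)%N -> coefP s m pz != 0.
Proof.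
move=> sm mp; have p0 := even_root_gt0 H.
rewrite /coefP (bigD1 (Ordinal p0)) //= [X in _ + X]big1 ?addr0; last first.
  move=> a; rewrite -val_eqE /= => a0; rewrite big1 // => b _.
  by rewrite /indP (_ : (_ == _)%N = false) ?mulr0 //; lia.
rewrite (bigD1 (Ordinal p0)) //= [X in _ + X]big1 ?addr0; last first.
  move=> b; rewrite -val_eqE /= => b0.
  by rewrite /indP (_ : (_ == _)%N = false) ?mulr0 //; lia.
rewrite /indP sm eqxx mulr0n addr0 subr0 eqxx mulr1 /coefB /= fac0 !mul1r !subn0.
have nz k : (k < p)%N -> fac k != 0 by exact: fac_neq0.
by rewrite !mulf_neq0 ?invr_neq0 ?mulf_neq0 ?nz //; lia.
Qed.

Lemma coefP_m0 s m : (m < p)%N -> coefP s m 0 = 0.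
Proof.
move=> mp; rewrite /coefP big1 // => a _; rewrite big1 // => b _.
rewrite /coefB; case: andP => [[am bm]|]; last by rewrite mul0r.
rewrite /indP (_ : (0 == pz + a%:R - b%:R) = false) ?andbF ?mulr0 //.
by rewrite eq_sym subr_eq0 -natrD (eqZ_nat H) !modn_small; lia.
Qed.

Lemma coefM_pz s m : (m < p)%N -> coefM s m pz = 0.
Proof. by move=> mp; rewrite /coefM /twist (pp0 H) coefP_m0 ?mulr0. Qed.

Lemma coefM_m0 s m : coefM s m 0 = (-1) ^+ p.-1 * (-1) ^+ m * coefP s m pz.
Proof. by rewrite /coefM /twist add0r mulrA. Qed.

(** Row m sees only s >= p - m, with a nonzero entry at s = p - m; the system is solved downward
    from s = p. *)
Lemma triangular_coefP (a : nat -> F) :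
  (forall m, (m < p)%N -> \sum_(1 <= s < p.+1) a s * coefP s m pz = 0) ->
  forall s, (0 < s <= p)%N -> a s = 0.
Proof.
move=> e; suff key k : (k < p)%N -> a (p - k)%N = 0.
  by move=> s sp; rewrite -[s](subKn (n := p)) ?key //; lia.
elim/ltn_ind: k => k IH kp.
have := e k kp; rewrite (big_cat_nat (n := (p - k)%N)) //=; [|lia|lia].
rewrite big_nat_cond big1 ?add0r; last first.
  by move=> s /andP[sp _]; rewrite coefP_pz0 ?mulr0 //; lia.
rewrite big_ltn; last by lia.
rewrite big_nat_cond big1 ?addr0; last first.
  move=> s /andP[sp _]; rewrite -[s](subKn (n := p)) ?IH ?mul0r //; lia.
move=> /eqP; rewrite mulf_eq0 (negPf (coefP_pz_neq0 _ _)) ?orbF //; last by lia.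
by move=> /eqP.
Qed.

(** Row 0 at t isolates F_t. Once the F part is gone, column p sees only the P family and column 0
    only the M family. *)
Lemma central_family_free (a b c : nat -> F) :
  let g m u := \sum_(1 <= s < p.+1) (a s * coefP s m u + b s * coefM s m u)
               + \sum_(1 <= t < p) c t * coefF t m u in
  (forall t, (0 < t < p)%N -> g 0%N t%:R = 0) ->
  (forall m, (m < p)%N -> g m 0 = 0) -> (forall m, (m < p)%N -> g m pz = 0) ->
  [/\ forall s, (0 < s <= p)%N -> a s = 0, forall s, (0 < s <= p)%N -> b s = 0
    & forall t, (0 < t < p)%N -> c t = 0].
Proof.
move=> g g0 gz gp.
have c0 t : (0 < t < p)%N -> c t = 0.
  move=> tp; have := g0 t tp; rewrite /g big_nat_cond big1 ?add0r; last first.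
    move=> s /andP[sp _]; rewrite coefP_0 // coefM_0 //.
    have -> : (t%:R == pz) = false by rewrite (eqZ_nat H) !modn_small; lia.
    have -> : (t%:R == 0 :> Z) = false.
      by rewrite (eqZ_nat H t 0) mod0n modn_small; lia.
    by rewrite !andbF !mulr0 addr0.
  rewrite (bigD1_seq t) ?mem_index_iota ?iota_uniq //= big_nat_cond big1 ?addr0.
    by move=> /eqP; rewrite mulf_eq0 (negPf (coefF_0t H r2 tp)) orbF => /eqP.
  move=> s /andP[sp st]; rewrite coefF_0 ?mulr0 //.
    by rewrite (eqZ_nat H) !modn_small; lia.
  rewrite -subr_eq0 opprK -natrD (eqZ_nat H _ 0) mod0n modn_small; lia.
have eg m u : g m u = \sum_(1 <= s < p.+1) (a s * coefP s m u + b s * coefM s m u).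
  rewrite /g [X in _ + X]big_nat_cond [X in _ + X]big1 ?addr0 // => t /andP[tp _].
  by rewrite c0 ?mul0r.
split=> //; apply: triangular_coefP => m mp.
  rewrite -[RHS](gp m mp) eg; apply: eq_bigr => s _.
  by rewrite coefM_pz // mulr0 addr0.
have sg : (-1) ^+ p.-1 * (-1) ^+ m != 0 :> F by rewrite mulf_neq0 // signr_eq0.
apply: (mulfI sg); rewrite mulr0 -[RHS](gz m mp) eg mulr_sumr; apply: eq_bigr => s _.
by rewrite coefP_m0 // mulr0 add0r coefM_m0; ring.
Qed.

Variable h : F.
Hypothesis h2 : h ^+ 2 = q.

(** The function q^(u^2 / 2), well defined on Z/2p because u^2 modulo 4p depends only on u modulo
    2p. *)
Definition gauss (u : Z) : F := h ^+ (u * u).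

(* The coefficients of the ribbon element; [h] is q^(1/2). *)
Definition coefV (m : nat) (u : Z) : F := - sgn u * h / (gauss u * h ^+ m).

Lemma h_neq0 : h != 0.
Proof. by have := q_neq0 H; rewrite -h2 sqrf_eq0. Qed.

Lemma gauss_nat n : gauss n%:R = h ^+ (n * n).
Proof.
rewrite /gauss (valZ H); have := divn_eq n (2 * p).
move: (n %/ (2 * p))%N (n %% (2 * p))%N => k l ->.
have -> : ((k * (2 * p) + l) * (k * (2 * p) + l) = 2 * ((2 * p) * (k * k * p + k * l)) + l * l)%N by ring.
by rewrite exprD (exprM h 2) h2 (exprM q (2 * p)) (prim_expr_order (even_root_prim H)) expr1n mul1r.
Qed.

Lemma gaussD u v : gauss (u + v) = gauss u * gauss v * chr (u * v).
Proof.
have eu := natrZ H u; have ev := natrZ H v.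
move: (u : nat) (v : nat) eu ev => m n <- <-.
rewrite -natrD -natrM !gauss_nat chr_nat // -h2 -exprM -!exprD.
by congr (_ ^+ _); ring.
Qed.

Lemma gauss_neq0 u : gauss u != 0.
Proof. by rewrite expf_neq0 ?h_neq0. Qed.

Lemma gauss1 : gauss 1 = h.
Proof. by have := gauss_nat 1; rewrite expr1. Qed.

Lemma gaussN u : gauss (- u) = gauss u.
Proof.
have eu := natrZ H u; have uN := ltnZ H u.
move: (u : nat) eu uN => n <- nN.
have -> : - n%:R = (2 * p - n)%:R :> Z by rewrite natrB 1?ltnW // (N0Z H) sub0r.
rewrite !gauss_nat; apply: (mulIf (_ : h ^+ (2 * ((2 * p) * n)) != 0)).
  by rewrite expf_neq0 ?h_neq0.
rewrite [RHS]mulrC -exprD (exprM h 2) h2.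
have -> : q ^+ (2 * p * n) = q ^+ (2 * p * p).
  by rewrite (exprM q (2 * p) n) (exprM q (2 * p) p) (prim_expr_order (even_root_prim H)) !expr1n.
rewrite -h2 -exprM -!exprD; congr (_ ^+ _); nia.
Qed.

Lemma gaussDp u : gauss (pz + u) = gauss pz * sgn u * gauss u.
Proof. by rewrite gaussD /sgn mulrAC. Qed.

Lemma central_coefV : central_coef q coefV.
Proof.
move=> m u mp; rewrite /coefV.
have s1 : sgn 1 = -1 by rewrite (sgn_nat H 1) expr1.
rewrite !gaussD mulrN mulr1 gaussN gauss1 !sgnD // sgnN // s1 chrN // exprS /sn chrN //.
have c0 := chr_neq0 H u; have g0 := gauss_neq0 u; have h0 := h_neq0.
by field; rewrite c0 g0 expf_neq0 // h0.
Qed.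

Lemma cs_sub_step (t : Z) (i : nat) : cs t - cs (t + 2%:R * i%:R) = - (sn i%:R * sn (t + i%:R)).
Proof.
have := cs_subD H (t + i%:R) i%:R.
have -> : t + i%:R - i%:R = t by ring.
have -> : t + i%:R + i%:R = t + 2%:R * i%:R by ring.
by move=> e; rewrite -[LHS]opprB e mulrC.
Qed.

(** Along the line t + m consecutive ribbon coefficients have ratio -1 / (q chr(t + m)), and
    [sn (t + m) / chr (t + m)] is 1 - q^(2 (n - m)). Beyond m = n both sides vanish. *)
Lemma coefV_step (t : Z) (n : nat) (e : bool) m : t = pz *+ e - n%:R ->
  coefV m (t + m%:R) * (\prod_(i < m) sn (t + i%:R)) * (- q) ^+ m =
  coefV 0 t * \prod_(i < m) (1 - (q ^+ 2) ^+ (n - i)).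
Proof.
move=> et; elim: m => [|m IH]; first by rewrite !big_ord0 !mulr1 addr0.
rewrite !big_ord_recr /= [RHS]mulrA -IH.
have g0 := gauss_neq0 (t + m%:R); have h0 := h_neq0; have c0 := chr_neq0 H (t + m%:R).
have s1 : sgn 1 = -1 by rewrite (sgn_nat H 1) expr1.
have -> : coefV m.+1 (t + m.+1%:R) = - coefV m (t + m%:R) / (q * chr (t + m%:R)).
  have -> : t + m.+1%:R = t + m%:R + 1 by rewrite mulrS; ring.
  rewrite /coefV gaussD gauss1 mulr1 (sgnD H _ 1) s1 exprS -h2; field.
  by rewrite h2 h0 g0 c0 expf_neq0.
have q0 := q_neq0 H; rewrite exprS.
have [nm|mn] := ltnP n m.
  have -> : \prod_(i < m) sn (t + i%:R) = 0.
    rewrite (bigD1 (Ordinal nm)) //= et subrK.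
    by case: (e); rewrite ?mulr1n ?mulr0n ?snp ?sn0 ?mul0r.
  by rewrite !(mulr0, mul0r).
suff -> : 1 - (q ^+ 2) ^+ (n - m) = sn (t + m%:R) / chr (t + m%:R).
  by field; rewrite q0 c0.
rewrite /sn mulrBl divff // -exprM -(chr_nat H (2 * (n - m))) -(chrN H (t + m%:R)) -(chrD H).
congr (1 - _); apply: (congr1 chr); rewrite et natrM natrB //.
case: e {et g0 c0}; rewrite ?mulr1n ?mulr0n; last by ring.
apply: (addrI (pz + pz)); rewrite {1}(pp0 H) add0r; ring.
Qed.

(* The derivative at a double node of the interpolation polynomial that
   describes the ribbon element. *)
Lemma coefV_derivative (t : Z) (n : nat) (e : bool) : (0 < n < p)%N -> t = pz *+ e - n%:R ->
  \sum_(1 <= m < p) coefV m (t + m%:R) / fac m *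
      \prod_(1 <= i < m) (cs t - cs (t + 2%:R * i%:R)) =
  n%:R * coefV 0 t / sn t.
Proof.
move=> np et; have q0 := q_neq0 H.
have st : sn t != 0.
  have sn0 := sn_nat_neq0 H np; rewrite et; case: (e); rewrite ?mulr1n ?mulr0n ?add0r.
    by rewrite snDp // snN opprK.
  by rewrite snN oppr_eq0.
have Q1 k : (0 < k < p)%N -> (q ^+ 2) ^+ k != 1.
  move=> kp; have := sn_nat_neq0 H kp; apply: contraNneq => Qk.
  rewrite /sn chrN // chr_nat //; apply/eqP; apply: (mulIf (expf_neq0 k q0)).
  by rewrite mul0r mulrBl mulVf ?expf_neq0 // -exprD addnn -mul2n exprM Qk subrr.
have pr m : (0 < m)%N -> \prod_(1 <= i < m) (cs t - cs (t + 2%:R * i%:R)) =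
    (-1) ^+ m.-1 * fac m.-1 * (\prod_(i < m) sn (t + i%:R)) / sn t.
  case: m => // m _; rewrite big_ord_recl /= addr0.
  elim: m => [|m IH]; first by rewrite big_geq // big_ord0 fac0; field.
  rewrite big_nat_recr //= IH cs_sub_step big_ord_recr /= facS exprS.
  by rewrite /bump /= add1n; field.
have term m : (0 < m < p)%N -> coefV m (t + m%:R) / fac m *
    \prod_(1 <= i < m) (cs t - cs (t + 2%:R * i%:R)) =
    coefV 0 t / sn t * ((\prod_(i < m) (1 - (q ^+ 2) ^+ (n - i))) / (1 - (q ^+ 2) ^+ m)).
  move=> mp; rewrite pr; last by lia.
  have := coefV_step m et; set X := \prod_(i < m) sn _; set Y := \prod_(i < m) _ => eXY.
  have sm := sn_nat_neq0 H mp; have Qm := Q1 m mp.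
  have -> : 1 - (q ^+ 2) ^+ m = - (q ^+ m * sn m%:R).
    by rewrite /sn chrN // chr_nat // mulrBr divff ?expf_neq0 // -expr2 -!exprM mulnC; ring.
  have -> : coefV 0 t / sn t * (Y / - (q ^+ m * sn m%:R)) =
     - (coefV 0 t * Y) / (sn t * q ^+ m * sn m%:R).
    by field; rewrite oppr_eq0 mulf_neq0 ?sm ?st ?expf_neq0.
  have fm : fac m = fac m.-1 * sn m%:R.
    by have := facS p q m.-1; rewrite prednK //; lia.
  have sgm : (-1) ^+ m = - (-1) ^+ m.-1 :> F.
    by have := exprS (-1 : F) m.-1; rewrite mulN1r prednK //; lia.
  have fn : fac m.-1 != 0 by apply: fac_neq0 => //; lia.
  rewrite -eXY (exprNn q m) sgm fm.
  by field; rewrite fn sm st expf_neq0.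
rewrite (eq_big_nat _ _ term) -mulr_sumr.
(* For m > n the product contains the factor i = n, which is 1 - 1; the terms up to n are summed by
   [qsum_eq_nat] with x = q^2. *)
rewrite (big_cat_nat (n := n.+1)) //=; try lia.
rewrite [X in _ + X]big_nat_cond [X in _ + X]big1 ?addr0; last first.
  move=> m /andP[/andP[nm mp] _]; rewrite (bigD1 (Ordinal nm)) //=.
  by rewrite subnn expr0 subrr !mul0r.
rewrite big_add1 /= big_mkord qsum_eq_nat; first by field.
by move=> k kn; apply: Q1; lia.
Qed.

End IndependenceAndRibbon.

(** * Gauss sums *)

Section GaussIdentity.
Variables (F : fieldType) (x : F) (N : nat).
Hypothesis xN : N.-primitive_root (x ^+ 2).

Definition gfac (n : nat) : F := \prod_(i < n) (1 - (x ^+ 2) ^+ i.+1).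

Definition gauss_bin (m j : nat) : F :=
  if (j <= m)%N then gfac m / (gfac j * gfac (m - j)) else 0.

Let xn_neq1 k : (0 < k < N)%N -> 1 - (x ^+ 2) ^+ k != 0.
Proof.
by move=> /andP[k0 kN]; rewrite subr_eq0 eq_sym -(prim_order_dvd xN) gtnNdvd.
Qed.

Let gbase_neq0 : x != 0.
Proof.
apply/eqP => x0; have := prim_expr_order xN; have := prim_order_gt0 xN.
by rewrite x0 expr0n /= expr0n => /lt0n_neq0/negPf-> /esym/eqP; rewrite oner_eq0.
Qed.

Let gfac_neq0 k : (k < N)%N -> gfac k != 0.
Proof.
move=> kN; apply/prodf_neq0 => i _; apply: xn_neq1.
by have := ltn_ord i; lia.
Qed.

Let gfacS k : gfac k.+1 = gfac k * (1 - (x ^+ 2) ^+ k.+1).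
Proof. by rewrite /gfac big_ord_recr. Qed.

Lemma gauss_bin_sym m j : (j <= m)%N -> gauss_bin m (m - j) = gauss_bin m j.
Proof.
by move=> jm; rewrite /gauss_bin jm leq_subr subKn // [gfac j * _]mulrC.
Qed.

Lemma gauss_binS m j : (m.+1 < N)%N ->
  gauss_bin m.+1 j.+1 = gauss_bin m j.+1 + (x ^+ 2) ^+ (m - j) * gauss_bin m j.
Proof.
move=> mN; rewrite /gauss_bin ltnS; have [jm|mj|->] := ltngtP j m.
- have nz k : (k < N)%N -> gfac k != 0 by exact: gfac_neq0.
  have e : (m - j = (m - j.+1).+1)%N by lia.
  rewrite subSS e !gfacS; have d1 := xn_neq1 (_ : 0 < j.+1 < N)%N.
  have d2 := xn_neq1 (_ : 0 < (m - j.+1).+1 < N)%N.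
  have -> : (x ^+ 2) ^+ m.+1 = (x ^+ 2) ^+ (m - j.+1).+1 * (x ^+ 2) ^+ j.+1.
    by rewrite -exprD; congr (_ ^+ _); lia.
  by field; rewrite !nz ?d1 ?d2 //; lia.
- by rewrite mulr0 addr0.
- have nz k : (k < N)%N -> gfac k != 0 by exact: gfac_neq0.
  rewrite !subnn /= expr0 mul1r add0r; have -> : gfac 0 = 1 by rewrite /gfac big_ord0.
  by rewrite !mulr1 !divff ?nz //; lia.
Qed.

(** Pascal's rule splits the sum for m + 1 in two. Reversed by the symmetry of the binomials, the
    second part is x^(m+1) times the sum for m. *)
Lemma gauss_identity m : (m < N)%N ->
  \sum_(j < m.+1) gauss_bin m j * x ^+ j = \prod_(j < m) (1 + x ^+ j.+1).
Proof.
have g0 n : (n < N)%N -> gauss_bin n 0 = 1.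
  move=> nN; rewrite /gauss_bin /= subn0 [gfac 0]big_ord0 mul1r divff //.
  exact: gfac_neq0.
elim: m => [|m IH] mN; first by rewrite big_ord_recr /= !big_ord0 g0 // add0r expr0 mulr1.
rewrite [RHS]big_ord_recr /= -IH 1?ltnW // [LHS]big_ord_recl /= g0 //.
under eq_bigr => j _ do rewrite /bump /= add1n gauss_binS // mulrDl.
rewrite big_split /= addrA mulrDr mulr1; congr (_ + _).
  rewrite [RHS]big_ord_recl /= g0 1?ltnW //; congr (_ + _).
  rewrite big_ord_recr /= {2}/gauss_bin ltnn mul0r addr0.
  by apply: eq_bigr => j _; rewrite /bump /= add1n.
rewrite mulr_suml (reindex_inj rev_ord_inj) /=; apply: eq_bigr => j _.
have jm : (j <= m)%N by rewrite -ltnS.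
rewrite subSS subKn // gauss_bin_sym // -exprM.
have e : x ^+ (2 * j) * x ^+ (m - j).+1 = x ^+ j * x ^+ m.+1.
  by rewrite -!exprD; congr (_ ^+ _); lia.
by rewrite mulrAC e; ring.
Qed.

(** Since (x^2)^N = 1, each numerator 1 - x^(2 (N - 1 - j)) equals 1 - x^(-2 (j + 1)), which is the
    denominator up to a sign and a power of x. So for m = N - 1 the binomials become quadratic
    exponentials. *)
Lemma gauss_bin_last j : (j < N)%N -> x ^+ (j * j.+1) * gauss_bin N.-1 j = (-1) ^+ j.
Proof.
elim: j => [|j IH] jN.
  rewrite mul1r /gauss_bin /= subn0 [gfac 0]big_ord0 mul1r divff ?expr0 //.
  by apply: gfac_neq0; lia.
have e : gauss_bin N.-1 j.+1 = gauss_bin N.-1 j * (1 - (x ^+ 2) ^+ (N.-1 - j)) / (1 - (x ^+ 2) ^+ j.+1).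
  have jN' : (j.+1 <= N.-1)%N by lia.
  rewrite /gauss_bin jN' (ltnW jN').
  have -> : (N.-1 - j = (N.-1 - j.+1).+1)%N by lia.
  rewrite !gfacS; have nz k : (k < N)%N -> gfac k != 0 by exact: gfac_neq0.
  by field; rewrite !nz ?xn_neq1 //; lia.
have {}IH := IH (ltnW jN); rewrite e [RHS]exprS -IH.
have d1 : 1 - (x ^+ 2) ^+ j.+1 != 0 by apply: xn_neq1; lia.
have x0 : x != 0.
  exact: gbase_neq0.
have -> : (x ^+ 2) ^+ (N.-1 - j) = (x ^+ 2) ^- j.+1.
  apply: (mulIf (expf_neq0 j.+1 (expf_neq0 2 x0))); rewrite mulVf ?expf_neq0 //.
  by rewrite -exprD (_ : _ + _ = N)%N ?(prim_expr_order xN) //; lia.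
have -> : x ^+ (j.+1 * j.+2) = x ^+ (j * j.+1) * (x ^+ 2) ^+ j.+1.
  by rewrite -exprM -exprD; congr (_ ^+ _); lia.
by field; rewrite d1 !expf_neq0.
Qed.

Lemma gauss_product : (0 < N)%N ->
  \sum_(j < N) (-1) ^+ j * x ^- (j * j) = \prod_(1 <= j < N) (1 + x ^+ j).
Proof.
move=> N0; have x0 : x != 0.
  exact: gbase_neq0.
have NN : (N.-1 < N)%N by rewrite prednK.
have := gauss_identity NN; rewrite prednK // => e.
rewrite big_add1 big_mkord -e; apply: eq_bigr => j _.
rewrite -(gauss_bin_last (ltn_ord j)) mulrAC mulrC mulnS exprD.
by field; rewrite expf_neq0.
Qed.

End GaussIdentity.

(** * The complex root of unity and the value of its Gauss sum *)

Section ComplexConstants.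
Variable R : realType.

Lemma expiD (x y : R) : expi (x + y) = expi x * expi y.
Proof. by rewrite /expi cosD sinD; simpc; congr (_ +i* _)%C; rewrite addrC. Qed.

Lemma expi0 : expi (0 : R) = 1.
Proof. by rewrite /expi cos0 sin0. Qed.

Lemma expi_neq0 (x : R) : expi x != 0.
Proof.
apply/eqP => e; have := expiD x (- x).
by rewrite subrr expi0 e mul0r => /eqP; rewrite oner_eq0.
Qed.

Lemma expiN (x : R) : expi (- x) = (expi x)^-1.
Proof.
by apply: (mulIf (expi_neq0 x)); rewrite -expiD addNr expi0 mulVf ?expi_neq0.
Qed.

Lemma expiMn (x : R) n : expi (x *+ n) = expi x ^+ n.
Proof. by elim: n => [|n IH]; rewrite ?mulr0n ?expi0 // mulrS expiD IH exprS. Qed.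

Lemma expi_natr (x : R) n : expi (x * n%:R) = expi x ^+ n.
Proof. by rewrite mulr_natr expiMn. Qed.

Lemma expi_pi : expi (pi : R) = -1.
Proof. by rewrite /expi cospi sinpi; apply/eqP; rewrite eq_complex /= oppr0 !eqxx. Qed.

Lemma expi_pihalf : expi (pi / 2 : R) = 'i%C.
Proof. by rewrite /expi cos_pihalf sin_pihalf. Qed.

Lemma conj_expi (x : R) : ((expi x)^*)%C = expi (- x).
Proof. by rewrite /expi cosN sinN. Qed.

Lemma expi_eq1 (x : R) : 0 < x < pi *+ 2 -> expi x != 1.
Proof.
move=> /andP[x0 x2]; rewrite /expi eq_complex /= negb_and; apply/orP; left.
have s0 : 0 < sin (x / 2).
  by apply: sin_gt0_pi; rewrite divr_gt0 //= ltr_pdivrMr // mulr_natr.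
have -> : cos x = 1 - sin (x / 2) ^+ 2 *+ 2.
  have {1}-> : x = (x / 2) *+ 2 by rewrite -mulr_natr divfK.
  rewrite cos_mulr2n cos2sin2; ring.
by rewrite -subr_eq0 addrC addKr oppr_eq0 mulrn_eq0 /= expf_neq0 // gt_eqF.
Qed.

Variable p : nat.
Hypothesis p1 : (1 < p)%N.
Let p0 : (0 : R) < p%:R. Proof. by rewrite ltr0n; lia. Qed.
Let pR : p%:R != 0 :> R. Proof. by rewrite gt_eqF. Qed.

Lemma qroot_even_root : even_root p (qroot R p).
Proof.
split=> //; last by rewrite pnatr_eq0; lia.
rewrite /primitive_root_of_unity; apply/andP; split; first by lia.
apply/forallP => k; rewrite unity_rootE /qroot -expiMn.
have [->|kN] := eqVneq k.+1 (2 * p)%N.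
  have -> : pi / p%:R *+ (2 * p) = pi *+ 2 :> R by rewrite mulrnA mulrnAC -[_ *+ p]mulr_natr divfK.
  by rewrite /expi cos2pi sin2pi !eqxx.
rewrite eqbF_neg; apply: expi_eq1; rewrite pmulrn_lgt0 // divr_gt0 ?pi_gt0 //=.
have -> : pi / p%:R *+ k.+1 = pi * k.+1%:R / p%:R :> R by rewrite -mulr_natr mulrAC.
rewrite ltr_pdivrMr // -[pi *+ 2]mulr_natr -mulrA ltr_pM2l ?pi_gt0 //.
by rewrite -natrM ltr_nat; have := ltn_ord k; lia.
Qed.

Definition hroot : R[i] := expi (pi / (2 * p)%:R).

Lemma hroot_sq : hroot ^+ 2 = qroot R p.
Proof.
by rewrite /hroot -expiMn /qroot; congr expi; rewrite natrM -mulr_natr; field.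
Qed.

Local Notation Z := 'Z_(2 * p).
Let H := qroot_even_root.

Lemma gauss_norm : let G := \sum_(u : Z) gauss hroot u in G * (G^*)%C = (2 * p)%:R.
Proof.
move=> G; have hc : (hroot^*)%C = hroot^-1 by rewrite /hroot conj_expi expiN.
have -> : (G^*)%C = \sum_(u : Z) (gauss hroot u)^-1.
  rewrite /G rmorph_sum; apply: eq_bigr => u _.
  by rewrite /gauss rmorphXn -exprVn; congr (_ ^+ _); exact: hc.
rewrite /G mulr_suml.
transitivity (\sum_(u : Z) \sum_(v : Z) gauss hroot u * chr (qroot R p) (v * u)).
  rewrite [RHS]exchange_big /=.
  under eq_bigr do rewrite mulr_sumr.
  rewrite exchange_big; apply: eq_bigr => v _ /=.
  rewrite (reindex_inj (addIr v)); apply: eq_bigr => u _ /=.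
  rewrite (gaussD H hroot_sq) [u * v]mulrC.
  by have g0 := gauss_neq0 H hroot_sq v; field.
under eq_bigr do rewrite -mulr_sumr.
rewrite (bigD1 0) //= [X in _ + X]big1 ?addr0; last first.
  by move=> u u0; rewrite (chr_sum H) (negPf u0) mulr0.
by rewrite (chr_sum H) eqxx /gauss expr0 mul1r.
Qed.

(** The product formula with base -h^-1: the sign of (-1)^(j^2) cancels (-1)^j, and the square of
    the base is q^-1, of exact order 2p. *)
Lemma gauss_prod : \sum_(u : Z) gauss hroot u = \prod_(1 <= j < 2 * p) (1 + (- hroot^-1) ^+ j).
Proof.
have N0 : (0 < 2 * p)%N by lia.
have prim : (2 * p).-primitive_root ((- hroot^-1) ^+ 2).
  rewrite sqrrN exprVn hroot_sq.
  have qp := even_root_prim H; have q0 := q_neq0 H.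
  have -> : (qroot R p)^-1 = qroot R p ^+ (2 * p).-1.
    by apply: (mulIf q0); rewrite mulVf // -exprSr prednK // prim_expr_order.
  have := exp_prim_root qp (2 * p).-1.
  by rewrite (eqP (_ : coprime (2 * p).-1 (2 * p))) ?divn1 // coprimePn.
rewrite -(gauss_product prim N0).
transitivity (\sum_(u : Z) hroot ^+ (u * u)%N) => //.
rewrite -(big_mkord xpredT (fun u => hroot ^+ (u * u)%N)) -[RHS](big_mkord xpredT (fun u => (-1) ^+ u * (- hroot^-1) ^- (u * u))).
rewrite (Zp_cast (even_root_gt1N H)); apply: eq_bigr => j _.
have e : (-1) ^+ (j * j) = (-1) ^+ j :> R[i].
  by rewrite -signr_odd oddM andbb signr_odd.
by rewrite (exprNn (hroot^-1)) e (exprVn hroot) invfM invrK mulrA divff ?mul1r // signr_eq0.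
Qed.

(** With theta = pi / (4p), the j-th factor is e^(-i theta j) times 2 cos(theta j) for even j and 2i
    sin(theta j) for odd j, with angles between 0 and pi/2. The p odd indices contribute i^p and the
    exponentials -pi (2p - 1) / 4, together pi/4. *)
Lemma gauss_phase : exists2 x : R, 0 < x &
  \prod_(1 <= j < 2 * p) (1 + (- hroot^-1) ^+ j) = x%:C%C * expi (pi / 4).
Proof.
pose th : R := pi / (4 * p)%:R.
have pi0 := pi_gt0 R.
have hk : hroot = expi th ^+ 2.
  by rewrite -expiMn /hroot; congr expi; rewrite /th -mulr_natr !natrM; field.
have key n : (n < 2 * p)%N -> exists2 x : R, 0 < x &
    \prod_(1 <= j < n.+1) (1 + (- hroot^-1) ^+ j) =
    x%:C%C * expi (- (th * 'C(n.+1, 2)%:R)) * 'i%C ^+ uphalf n.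
  elim: n => [|n IH] nN.
    exists 1 => //; rewrite big_geq // mulr0 oppr0 expi0 !mulr1; by [].
  rewrite big_nat_recr //=; have [x x0 ->] := IH (ltnW nN).
  have thj : 0 < th * n.+1%:R < pi / 2.
    have th0 : 0 < th by rewrite divr_gt0 // ltr0n; lia.
    have -> : pi / 2 = th * (2 * p)%:R by rewrite /th !natrM; field.
    by rewrite mulr_gt0 ?ltr0n //= ltr_pM2l // ltr_nat.
  have c0 : 0 < cos (th * n.+1%:R).
    apply: cos_gt0_pihalf; case/andP: thj => j0 ->; rewrite andbT.
    by apply: lt_trans j0; rewrite oppr_lt0 divr_gt0.
  have s0 : 0 < sin (th * n.+1%:R) by exact: sin_gt0_pihalf.
  have ek : hroot^-1 ^+ n.+1 = expi (- (th * n.+1%:R)) * expi (- (th * n.+1%:R)).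
    by rewrite -expiD exprVn hk -exprM -expiMn -expiN; congr expi; rewrite -[th *+ _]mulr_natr natrM; ring.
  have e1 : 1 = expi (- (th * n.+1%:R)) * expi (th * n.+1%:R) by rewrite -expiD addNr expi0.
  have eC : expi (- (th * 'C(n.+2, 2)%:R)) =
      expi (- (th * 'C(n.+1, 2)%:R)) * expi (- (th * n.+1%:R)).
    by rewrite -expiD binS bin1 natrD; congr expi; ring.
  have eu : n./2.+1 = (uphalf n + odd n.+1)%N by lia.
  rewrite eC eu exprD exprNn ek {1}e1 -signr_odd; case: (odd n.+1).
    exists (x * (2 * sin (th * n.+1%:R))); first by rewrite mulr_gt0 // mulr_gt0.
    have es : expi (th * n.+1%:R) - expi (- (th * n.+1%:R)) = (2 * sin (th * n.+1%:R))%:C%C * 'i%C.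
      by rewrite /expi cosN sinN; apply/eqP; rewrite eq_complex /=; apply/andP; split; apply/eqP; ring.
    rewrite expr1 mulN1r -mulrBr es rmorphM /=; ring.
  exists (x * (2 * cos (th * n.+1%:R))); first by rewrite mulr_gt0 // mulr_gt0.
  have es : expi (th * n.+1%:R) + expi (- (th * n.+1%:R)) = (2 * cos (th * n.+1%:R))%:C%C.
    by rewrite /expi cosN sinN; apply/eqP; rewrite eq_complex /=; apply/andP; split; apply/eqP; ring.
  rewrite expr0 mul1r -mulrDr es rmorphM /=; ring.
have N0 : (0 < 2 * p)%N by lia.
have [|x x0] := key (2 * p).-1; first by lia.
rewrite prednK // => ->; exists x => //; rewrite -mulrA; congr (_ * _).
have -> : uphalf (2 * p).-1 = p by lia.
rewrite -expi_pihalf -expiMn -expiD; congr expi; rewrite bin2 -mulr_natr.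
have -> : (2 * p * (2 * p).-1)./2 = (p * (2 * p).-1)%N by lia.
rewrite /th !natrM -subn1 natrB // natrM; field.
by [].
Qed.

(** The modulus comes from [gauss_norm], the argument from [gauss_phase]. *)
Lemma gauss_sum : \sum_(u : Z) gauss hroot u = (Num.sqrt (2 * p%:R : R))%:C%C * expi (pi / 4).
Proof.
have [x x0 e] := gauss_phase.
have := gauss_norm; rewrite /= gauss_prod e; set w := expi _.
have ww : w * (w^*)%C = 1 by rewrite /w conj_expi -expiD subrr expi0.
have -> : (x%:C%C * w)^*%C = x%:C%C * (w^*)%C by rewrite rmorphM; congr (_ * _); exact: conjc_real.
move=> ex; have : x ^+ 2 = 2 * p%:R.
  have {}ex : x%:C%C * x%:C%C * (w * (w^*)%C) = (2 * p)%:R by rewrite -ex; ring.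
  move: ex; rewrite ww mulr1 -rmorphM /= -(rmorph_nat (real_complex R)) => /complexI.
  by rewrite expr2 natrM.
by move=> <-; rewrite sqrtr_sqr gtr0_norm.
Qed.

(** As 1 - i = sqrt 2 e^(-i pi/4), the scalar in front of the ribbon element is the reciprocal of
    the Gauss sum. *)
Lemma ribbon_const : (1 - 'i%C) / (2 * (Num.sqrt (p%:R : R))%:C%C) *
  \sum_(u : Z) gauss hroot u = 1.
Proof.
rewrite gauss_sum; pose c : R := cos (pi / 4).
have pi0 := pi_gt0 R.
have c0 : 0 < c.
  apply: cos_gt0_pihalf; apply/andP; split; last by rewrite ltr_pM2l // ltf_pV2 ?posrE //; lra.
  by apply: lt_trans (_ : 0 < _); rewrite ?oppr_lt0 divr_gt0.
have sc : sin (pi / 4) = c.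
  by rewrite -cosBpihalf /c -[RHS]cosN; congr cos; field.
have c2 : 2 * c ^+ 2 = 1.
  by have := cos2Dsin2 (pi / 4 : R); rewrite sc -/c => e; rewrite -[RHS]e; ring.
have ew : expi (pi / 4 : R) = c%:C%C * (1 + 'i%C).
  rewrite /expi sc -/c; apply/eqP; rewrite eq_complex /=; apply/andP; split; apply/eqP; ring.
have es : Num.sqrt (2 * p%:R) * c = Num.sqrt p%:R.
  rewrite -{1}(ger0_norm (ltW c0)) -sqrtr_sqr -sqrtrM; last by rewrite mulr_ge0 // ltW.
  by congr Num.sqrt; rewrite mulrAC c2 mul1r.
have sp : (Num.sqrt (p%:R : R))%:C%C != 0.
  by rewrite -(rmorph0 (real_complex R)) (inj_eq (@complexI R)) gt_eqF // sqrtr_gt0.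
rewrite ew [_%:C%C * (_ * _)]mulrA -rmorphM /= es.
have i2 : 'i%C * 'i%C = -1 :> R[i] by rewrite -expr2 sqr_i.
have t2 : 2 != 0 :> R[i] by rewrite pnatr_eq0.
apply: (mulIf sp); apply: (mulIf t2).
transitivity (((1 - 'i%C) * (1 + 'i%C)) * (Num.sqrt (p%:R : R))%:C%C).
  by field; rewrite ?t2 ?pnatr_eq0 ?sp //.
rewrite mulrBl !mulrDr !mul1r !mulr1 i2; ring.
Qed.

End ComplexConstants.

(** * PBW basis and center *)

(* [e] and [f] are (q - q^-1) E and (q - q^-1) F. *)
Record uq_generators (F : fieldType) (p : nat) (q : F) (A : falgType F)
    (e f k : A) : Prop := UqGenerators {
  uq_gen : agenv <<[:: e; f; k]>>%VS = {:A}%VS;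
  uq_dim : \dim {:A} = (2 * p ^ 3)%N;
  uq_expe : e ^+ p = 0;
  uq_expf : f ^+ p = 0;
  uq_expk : k ^+ (2 * p) = 1;
  uq_ke : k * e = (q ^+ 2) *: (e * k);
  uq_kf : k * f = (q ^- 2) *: (f * k);
  uq_ef : e * f - f * e = (q - q^-1) *: (k - k ^+ (2 * p).-1)
}.

(** * Weight projections and commutation rules *)

Section PBW.
Variables (F : fieldType) (p : nat) (q : F) (A : falgType F) (e f k : A).
Local Notation Z := 'Z_(2 * p).
Local Notation chr := (@chr F p q).
Local Notation sn := (@sn F p q).
Hypothesis H : even_root p q.
Hypothesis U : uq_generators p q e f k.

(* The projection to the q^u-eigenspace of k. *)
Definition wproj (u : Z) : A :=
  locked ((2 * p)%:R^-1 *: \sum_(j : Z) chr (- (u * j)) *: k ^+ j).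

Lemma wprojE u : wproj u = (2 * p)%:R^-1 *: \sum_(j : Z) chr (- (u * j)) *: k ^+ j.
Proof. by rewrite /wproj -lock. Qed.

Let N0 := even_root_char H.

Lemma kpow_nat n : k ^+ (n%:R : Z) = k ^+ n.
Proof.
rewrite (valZ H) [in RHS](divn_eq n (2 * p)) exprD (mulnC (n %/ _)%N) exprM (uq_expk U).
by rewrite expr1n mul1r.
Qed.

Lemma kpowD (i j : Z) : k ^+ (i + j)%R = k ^+ i * k ^+ j.
Proof.
rewrite -exprD -(kpow_nat (i + j)%N); congr (k ^+ _); congr nat_of_ord.
by rewrite natrD !(natrZ H).
Qed.

Lemma kpowN1 : k ^+ (2 * p).-1 = k ^+ ((- 1)%R : Z).
Proof.
rewrite -kpow_nat; congr (k ^+ _); congr nat_of_ord.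
apply/eqP; rewrite -subr_eq0 opprK -(natrD _ _ 1) addn1 prednK ?(N0Z H) //.
by have := even_root_gt1N H; lia.
Qed.

Lemma kpow_wproj (j : Z) u : k ^+ j * wproj u = chr (u * j) *: wproj u.
Proof.
rewrite !wprojE -scalerAr scalerA [chr _ * _]mulrC -scalerA; congr (_ *: _).
rewrite scaler_sumr mulr_sumr [RHS](reindex_inj (addrI j)) /=.
apply: eq_bigr => i _; rewrite scalerA -(chrD H) -scalerAr -kpowD.
by congr (chr _ *: _); ring.
Qed.

Lemma wproj_kpow (j : Z) u : wproj u * k ^+ j = chr (u * j) *: wproj u.
Proof.
rewrite -kpow_wproj !wprojE -scalerAr -scalerAl; congr (_ *: _).
rewrite mulr_sumr mulr_suml; apply: eq_bigr => i _.
by rewrite -scalerAr -scalerAl -!exprD addnC.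
Qed.

Lemma kn_wproj n u : k ^+ n * wproj u = chr (u * n%:R) *: wproj u.
Proof. by rewrite -kpow_wproj kpow_nat. Qed.

Lemma k_wproj u : k * wproj u = chr u *: wproj u.
Proof. by have := kn_wproj 1 u; rewrite expr1 mulr1. Qed.

Lemma kpow_sum n : k ^+ n = \sum_(u : Z) chr (u * n%:R) *: wproj u.
Proof.
under eq_bigr do rewrite wprojE scalerA mulrC -scalerA.
rewrite -scaler_sumr; apply: (scalerI N0); rewrite scalerA divff // scale1r.
transitivity (\sum_(j : Z) (\sum_(u : Z) chr (u * (n%:R - j))) *: k ^+ j).
  rewrite (bigD1 (n%:R : Z)) //= subrr (chr_sum H) eqxx kpow_nat.
  rewrite [X in _ + X]big1 ?addr0 // => j jn.
  by rewrite (chr_sum H) subr_eq0 eq_sym (negPf jn) scale0r.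
under eq_bigr do rewrite scaler_suml.
rewrite exchange_big; apply: eq_bigr => u _; rewrite scaler_sumr.
apply: eq_bigr => j _; rewrite scalerA -(chrD H); congr (chr _ *: _); ring.
Qed.

Lemma sum_wproj : \sum_(u : Z) wproj u = 1.
Proof.
have := kpow_sum 0; rewrite expr0 => ->; apply: eq_bigr => u _.
by rewrite mulr0 chr0 scale1r.
Qed.

Lemma wprojM u v : wproj u * wproj v = (u == v)%:R *: wproj v.
Proof.
rewrite {1}wprojE -scalerAl mulr_suml.
under eq_bigr do rewrite -scalerAl kpow_wproj scalerA -(chrD H).
rewrite -scaler_suml scalerA; congr (_ *: _).
have -> : \sum_(j : Z) chr (- (u * j) + v * j) = \sum_(j : Z) chr (j * (v - u)).
  by apply: eq_bigr => j _; congr chr; ring.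
by rewrite (chr_sum H) subr_eq0 eq_sym; case: eqP => _; rewrite ?mulr0 // mulVf.
Qed.

Lemma kn_e n : k ^+ n * e = q ^+ (2 * n) *: (e * k ^+ n).
Proof.
elim: n => [|n IH]; first by rewrite muln0 !expr0 scale1r mul1r mulr1.
rewrite exprSr -[_ * k * e]mulrA (uq_ke U) -scalerAr [k ^+ n * (e * k)]mulrA IH.
rewrite -scalerAl scalerA -exprD mulrA.
by congr (q ^+ _ *: _); lia.
Qed.

Lemma kn_f n : k ^+ n * f = q ^- (2 * n) *: (f * k ^+ n).
Proof.
elim: n => [|n IH]; first by rewrite muln0 !expr0 invr1 scale1r mul1r mulr1.
rewrite exprSr -[_ * k * f]mulrA (uq_kf U) -scalerAr [k ^+ n * (f * k)]mulrA IH.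
rewrite -scalerAl scalerA -invfM -exprD mulrA.
by congr ((q ^+ _)^-1 *: _); lia.
Qed.

Lemma e_wproj u : e * wproj u = wproj (u + 2%:R) * e.
Proof.
rewrite !wprojE -scalerAr -scalerAl; congr (_ *: _).
rewrite mulr_sumr mulr_suml; apply: eq_bigr => j _.
rewrite -scalerAr -scalerAl kn_e scalerA -(chr_nat H) -(chrD H).
by congr (chr _ *: _); rewrite natrM (natrZ H); ring.
Qed.

Lemma f_wproj u : f * wproj u = wproj (u - 2%:R) * f.
Proof.
rewrite !wprojE -scalerAr -scalerAl; congr (_ *: _).
rewrite mulr_sumr mulr_suml; apply: eq_bigr => j _.
rewrite -scalerAr -scalerAl kn_f scalerA -(chr_nat H) -(chrN H) -(chrD H).
by congr (chr _ *: _); rewrite natrM (natrZ H); ring.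
Qed.

Lemma en_wproj n u : e ^+ n * wproj u = wproj (u + 2%:R * n%:R) * e ^+ n.
Proof.
elim: n u => [|n IH] u; first by rewrite mulr0 addr0 mul1r mulr1.
rewrite exprSr -mulrA e_wproj mulrA IH -mulrA -exprSr; congr (wproj _ * _).
by rewrite mulrS; ring.
Qed.

Lemma fn_wproj n u : f ^+ n * wproj u = wproj (u - 2%:R * n%:R) * f ^+ n.
Proof.
elim: n u => [|n IH] u; first by rewrite mulr0 subr0 mul1r mulr1.
rewrite exprSr -mulrA f_wproj mulrA IH -mulrA -exprSr; congr (wproj _ * _).
by rewrite mulrS; ring.
Qed.

Lemma ef_wproj u : e * f * wproj u = f * e * wproj u + (sn 1 * sn u) *: wproj u.
Proof.
rewrite -[e * f](subrK (f * e)) (uq_ef U) mulrDl addrC; congr (_ + _).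
rewrite -scalerAl mulrBl k_wproj kpowN1 kpow_wproj -scalerBl scalerA.
by rewrite mulrN1 -/(sn u) [in RHS]/sn chrN // (chr_nat H 1) expr1.
Qed.

Lemma e_fn_wproj n u :
  e * f ^+ n * wproj u = f ^+ n * e * wproj u
    + (sn n%:R * sn (u - n%:R + 1)) *: (f ^+ n.-1 * wproj u).
Proof.
elim: n u => [|n IH] u; first by rewrite sn0 mul0r scale0r addr0 mulr1 mul1r.
rewrite exprSr mulrA -mulrA f_wproj mulrA IH mulrDl.
rewrite -!mulrA -!f_wproj -scalerAl -mulrA -f_wproj.
rewrite [in LHS](mulrA e) ef_wproj mulrDr -addrA; congr (_ + _).
  by rewrite !mulrA.
case: n {IH} => [|n] /=.
  by rewrite sn0 mul0r scale0r addr0 mul1r -[1%:R]/1 subrK mul1r.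
rewrite !mulrA -!exprSr -scalerAr -scalerDl; congr (_ *: _).
have -> : u - 2 - n.+1%:R + 1 = (u - n.+1%:R) - 1 by ring.
have -> : u - n.+2%:R + 1 = u - n.+1%:R by rewrite [n.+2%:R]mulrS; ring.
have -> : n.+2%:R = 1 + n.+1%:R :> Z by rewrite mulrS.
move: (n.+1%:R : Z) => m; rewrite /sn !(opprD, opprK) !(chrD H) !(chrN H).
by field; rewrite !(chr_neq0 H).
Qed.

Lemma en_f_wproj n u :
  e ^+ n * f * wproj u = f * e ^+ n * wproj u
    + (sn n%:R * sn (u + n%:R - 1)) *: (e ^+ n.-1 * wproj u).
Proof.
elim: n u => [|n IH] u; first by rewrite sn0 mul0r scale0r addr0 mulr1 mul1r.
have h1 : e * (f * e ^+ n * wproj u) = f * e ^+ n.+1 * wproj u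
    + (sn 1 * sn (u + 2%:R * n%:R)) *: (e ^+ n * wproj u).
  rewrite !mulrA -[e * f * _ * _]mulrA en_wproj mulrA ef_wproj mulrDl.
  rewrite -scalerAl -en_wproj -[f * e * _ * _]mulrA -en_wproj.
  by rewrite exprS !mulrA.
have -> : e ^+ n.+1 * f * wproj u = e * (e ^+ n * f * wproj u).
  by rewrite exprS !mulrA.
rewrite IH mulrDr h1 -scalerAr mulrA -addrA; congr (_ + _).
case: n {IH h1} => [|n] /=.
  rewrite sn0 mul0r scale0r addr0 mulr0 addr0 -[1%:R]/1.
  by rewrite (_ : u + 1 - 1 = u) //; ring.
rewrite -exprS -scalerDl; congr (_ *: _).
have -> : u + n.+2%:R - 1 = u + n.+1%:R by rewrite [n.+2%:R]mulrS; ring.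
have -> : n.+2%:R = 1 + n.+1%:R :> Z by rewrite mulrS.
move: (n.+1%:R : Z) => m; rewrite /sn !(opprD, opprK, mulrDl, mul1r) !(chrD H) !(chrN H).
by field; rewrite !(chr_neq0 H).
Qed.

End PBW.

(** * The PBW basis *)

Section PBWBasis.
Variables (F : fieldType) (p : nat) (q : F) (A : falgType F) (e f k : A).
Local Notation Z := 'Z_(2 * p).
Local Notation chr := (@chr F p q).
Local Notation sn := (@sn F p q).
Local Notation wproj := (@wproj F p q A k).
Hypothesis H : even_root p q.
Hypothesis U : uq_generators p q e f k.
Local Notation I := ('I_p * 'I_p * Z)%type.

Definition mono (m n : nat) (u : Z) : A := f ^+ m * e ^+ n * wproj u.

Definition pbw (i : I) : A := mono i.1.1 i.1.2 i.2.

Let X := [tuple pbw (enum_val j) | j < #|{: I}|].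

Lemma expe0 n : (p <= n)%N -> e ^+ n = 0.
Proof. by move=> pn; rewrite -(subnK pn) exprD (uq_expe U) mulr0. Qed.

Lemma expf0 n : (p <= n)%N -> f ^+ n = 0.
Proof. by move=> pn; rewrite -(subnK pn) exprD (uq_expf U) mulr0. Qed.

Lemma pbw_in i : pbw i \in <<X>>%VS.
Proof.
apply: memv_span; apply/tnthP; exists (enum_rank i).
by rewrite tnth_mktuple enum_rankK.
Qed.

Lemma mono_in m n u : mono m n u \in <<X>>%VS.
Proof.
have [mp|mp] := ltnP m p; last by rewrite /mono expf0 // !mul0r mem0v.
have [np|np] := ltnP n p; last by rewrite /mono expe0 // mulr0 mul0r mem0v.
exact: (pbw_in (Ordinal mp, Ordinal np, u)).
Qed.

Lemma e_mono m n u : e * mono m n u =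
  mono m n.+1 u + (sn m%:R * sn (u + 2%:R * n%:R - m%:R + 1)) *: mono m.-1 n u.
Proof.
rewrite /mono -mulrA (en_wproj H U) !mulrA (e_fn_wproj H U) mulrDl -scalerAl.
by rewrite -!mulrA -!(en_wproj H U) !mulrA -[f ^+ m * e * _]mulrA -exprS.
Qed.

Lemma f_mono m n u : f * mono m n u = mono m.+1 n u.
Proof. by rewrite /mono !mulrA -exprS. Qed.

Lemma k_mono m n u : k * mono m n u = chr (u + 2%:R * n%:R - 2%:R * m%:R) *: mono m n u.
Proof.
rewrite /mono -[_ * wproj u]mulrA (en_wproj H U) [f ^+ m * _]mulrA (fn_wproj H U).
by rewrite !mulrA (k_wproj H U) !scalerAl.
Qed.

Lemma mono_k m n u : mono m n u * k = chr u *: mono m n u.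
Proof.
rewrite /mono -mulrA -[k]expr1 -(kpow_nat H U) (wproj_kpow H U) -scalerAr.
by rewrite mulr1.
Qed.

Lemma mono_e m n u : mono m n u * e = mono m n.+1 (u - 2%:R).
Proof.
by rewrite /mono -mulrA -{1}[u](subrK 2%:R) -(e_wproj H U) mulrA exprSr !mulrA.
Qed.

Lemma mono_f m n u : mono m n u * f =
  mono m.+1 n (u + 2%:R) + (sn n%:R * sn (u + n%:R + 1)) *: mono m n.-1 (u + 2%:R).
Proof.
rewrite /mono -mulrA -{1}[u](addrK 2%:R) -(f_wproj H U) -mulrA [e ^+ n * _]mulrA (en_f_wproj H U).
rewrite mulrDr -scalerAr !mulrA -exprSr; congr (_ + (_ * sn _) *: _); ring.
Qed.

(** The span contains 1, the sum of the weight projections, and is stable under left multiplication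
    by the three generators. Having 2p^3 members, the spanning family is then a basis by the
    dimension. *)
Lemma pbw_span_full : <<X>>%VS = {:A}%VS.
Proof.
apply/eqP; rewrite eqEsubv subvf -(uq_gen U).
have hX g : (forall i, g * pbw i \in <<X>>%VS) -> (<[g]> * <<X>> <= <<X>>)%VS.
  move=> gX; apply/prodvP => a b /vlineP[c ->] bX.
  rewrite (coord_span bX) mulr_sumr memv_suml // => j _.
  by rewrite -scalerAl -scalerAr !memvZ // -tnth_nth tnth_mktuple.
apply: agenv_sub_modl.
  rewrite -memvE -(sum_wproj H U) memv_suml // => u _.
  by have := mono_in 0 0 u; rewrite /mono !mul1r.
rewrite !span_cons span_nil addv0 !prodvDl !subv_add.
apply/and3P; split; apply: hX => -[[m n] u]; rewrite /pbw /=.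
- by rewrite e_mono memvD ?memvZ ?mono_in.
- by rewrite f_mono mono_in.
- by rewrite k_mono memvZ ?mono_in.
Qed.

Lemma pbw_basis : basis_of {:A}%VS X.
Proof.
rewrite basisEdim pbw_span_full subvv /= size_tuple (uq_dim U).
by rewrite !card_prod !card_ord (Zp_cast (even_root_gt1N H)); lia.
Qed.

Lemma pbw_free (c : I -> F) : \sum_i c i *: pbw i = 0 -> forall i, c i = 0.
Proof.
move=> e0 i; have /freeP fX := basis_free pbw_basis.
have := fX (fun j => c (enum_val j)); rewrite (reindex (fun j : 'I_#|{: I}| => enum_val j)) /= in e0; last first.
  exists enum_rank => j _; [exact: enum_valK|exact: enum_rankK].
rewrite -(enum_rankK i); apply.
by rewrite -[RHS]e0; apply: eq_bigr => j _; rewrite -tnth_nth tnth_mktuple.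
Qed.

Lemma pbw_expand (x : A) : exists c : I -> F, x = \sum_i c i *: pbw i.
Proof.
have xX : x \in <<X>>%VS by rewrite pbw_span_full memvf.
exists (fun i => coord X (enum_rank i) x).
transitivity (\sum_j coord X j x *: X`_j); first exact: coord_span.
rewrite [RHS](reindex (fun j : 'I_#|{: I}| => enum_val j)) /=; last first.
  exists enum_rank => j _; [exact: enum_valK|exact: enum_rankK].
by apply: eq_bigr => j _; rewrite [enum_rank _]enum_valK -[X`_j]tnth_nth tnth_mktuple.
Qed.

Lemma central_gen x : x * e = e * x -> x * f = f * x -> x * k = k * x ->
  forall y, x * y = y * x.
Proof.
move=> xe xf xk y; apply/esym/cent1vP.
have -> : y \in 'C[x]%VS; last by [].
have : (agenv <<[:: e; f; k]>> <= 'C[x])%VS.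
  apply: agenv_sub_modl; first by rewrite -memvE cent1v1.
  apply: prodv_sub => //; apply/span_subvP => z.
  rewrite !inE => /or3P[]/eqP->; apply/cent1vP; exact/esym.
by move/subvP; apply; rewrite (uq_gen U) memvf.
Qed.

End PBWBasis.

(** * Central elements in PBW coordinates *)

Section CenterDescription.
Variables (F : fieldType) (p : nat) (q : F) (A : falgType F) (e f k : A).
Local Notation Z := 'Z_(2 * p).
Local Notation chr := (@chr F p q).
Local Notation sn := (@sn F p q).
Local Notation fac := (@fac F p q).
Local Notation wproj := (@wproj F p q A k).
Local Notation mono := (@mono F p q A e f k).
Local Notation pbw := (@pbw F p q A e f k).
Local Notation I := ('I_p * 'I_p * Z)%type.

Definition diag (c : nat -> Z -> F) : A := \sum_(m < p) \sum_(u : Z) c m u *: mono m m u.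

Definition el (g : nat -> Z -> F) : A := diag (fun m u => g m (u + m%:R + 1) / fac m).

Hypothesis H : even_root p q.
Hypothesis U : uq_generators p q e f k.
Let p0 := even_root_gt0 H.

Lemma mono_ge m n u : (p <= m)%N || (p <= n)%N -> mono m n u = 0.
Proof.
case/orP => h; rewrite /mono; first by rewrite (expf0 U h) !mul0r.
by rewrite (expe0 U h) mulr0 mul0r.
Qed.

Lemma sum_pbw_index (G : I -> A) :
  \sum_(i : I) G i = \sum_(m < p) \sum_(n < p) \sum_(u : Z) G (m, n, u).
Proof.
rewrite (pair_bigA _ (fun m n => \sum_(u : Z) G (m, n, u))) /=.
rewrite (pair_bigA _ (fun x u => G (x.1, x.2, u))) /=.
by apply: eq_bigr => -[[m n] u].
Qed.

Lemma mono_free (s : nat -> nat) (c : nat -> Z -> F) :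
  \sum_(m < p) \sum_(u : Z) c m u *: mono m (s m) u = 0 ->
  forall m u, (m < p)%N -> (s m < p)%N -> c m u = 0.
Proof.
move=> e0 m u mp sp.
pose d (i : I) := if (i.1.2 == s i.1.1 :> nat) then c i.1.1 i.2 else 0.
have -> : c m u = d (Ordinal mp, Ordinal sp, u) by rewrite /d /= eqxx.
apply: (pbw_free H U); rewrite -[RHS]e0.
rewrite sum_pbw_index.
apply: eq_bigr => x _; rewrite exchange_big; apply: eq_bigr => v _ /=.
have [sx|sx] := ltnP (s x) p.
  rewrite (bigD1 (Ordinal sx)) //= [X in _ + X]big1 ?addr0; first by rewrite /d /= eqxx.
  by move=> y; rewrite -val_eqE /d /= => /negPf->; rewrite scale0r.
rewrite mono_ge ?sx ?orbT // scaler0 big1 // => y _.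
rewrite /d /= ifF ?scale0r //; apply/negP => /eqP ey.
by have := ltn_ord y; rewrite ey ltnNge sx.
Qed.

Lemma diagB c d : diag c - diag d = diag (fun m u => c m u - d m u).
Proof.
rewrite /diag -sumrB; apply: eq_bigr => m _; rewrite -sumrB; apply: eq_bigr => u _.
by rewrite scalerBl.
Qed.

Lemma diag_free c : diag c = 0 -> forall m u, (m < p)%N -> c m u = 0.
Proof. by move=> c0 m u mp; apply: (mono_free (s := id)). Qed.

Lemma sum_shift_up (T T' : nat -> A) : T 0%N = 0 -> T' p.-1 = 0 ->
  (forall m, (m.+1 < p)%N -> T m.+1 = T' m) -> \sum_(m < p) T m = \sum_(m < p) T' m.
Proof.
move=> T0 Tp TT; rewrite -!(big_mkord xpredT) big_ltn // T0 add0r.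
rewrite -[in RHS](prednK p0) big_nat_recr //= Tp addr0 big_add1.
by apply: eq_big_nat => m /andP[_ mp]; apply: TT; lia.
Qed.

Lemma e_diag c : e * diag c = \sum_(m < p) \sum_(u : Z)
  (c m u + c m.+1 u * (sn m.+1%:R * sn (u + m.+1%:R + 1))) *: mono m m.+1 u.
Proof.
rewrite /diag mulr_sumr.
transitivity (\sum_(m < p) \sum_(u : Z) c m u *: mono m m.+1 u +
  \sum_(m < p) \sum_(u : Z) (c m u * (sn m%:R * sn (u + m%:R + 1))) *: mono m.-1 m u).
  rewrite -big_split; apply: eq_bigr => m _ /=; rewrite mulr_sumr -big_split /=.
  apply: eq_bigr => u _; rewrite -scalerAr (e_mono H U) scalerDr scalerA.
  by congr (_ + (_ * (_ * sn _)) *: _); ring.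
rewrite (@sum_shift_up (fun m => \sum_(u : Z) (c m u * (sn m%:R * sn (u + m%:R + 1))) *: mono m.-1 m u)
  (fun m => \sum_(u : Z) (c m.+1 u * (sn m.+1%:R * sn (u + m.+1%:R + 1))) *: mono m m.+1 u)) //.
- rewrite -big_split; apply: eq_bigr => m _ /=; rewrite -big_split.
  by apply: eq_bigr => u _ /=; rewrite -scalerDl.
- by rewrite big1 // => u _; rewrite sn0 mul0r mulr0 scale0r.
- by rewrite big1 // => u _; rewrite mono_ge ?scaler0 // prednK // leqnn orbT.
Qed.

Lemma diag_e c : diag c * e = \sum_(m < p) \sum_(u : Z) c m (u + 2%:R) *: mono m m.+1 u.
Proof.
rewrite /diag mulr_suml; apply: eq_bigr => m _; rewrite mulr_suml.
rewrite (reindex_inj (addIr 2%:R)); apply: eq_bigr => u _ /=.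
by rewrite -scalerAl (mono_e H U) addrK.
Qed.

Lemma f_diag c : f * diag c = \sum_(m < p) \sum_(u : Z) c m u *: mono m.+1 m u.
Proof.
rewrite /diag mulr_sumr; apply: eq_bigr => m _; rewrite mulr_sumr.
by apply: eq_bigr => u _; rewrite -scalerAr f_mono.
Qed.

Lemma diag_f c : diag c * f = \sum_(m < p) \sum_(u : Z)
  (c m (u - 2%:R) + c m.+1 (u - 2%:R) * (sn m.+1%:R * sn (u - 2%:R + m.+1%:R + 1)))
    *: mono m.+1 m u.
Proof.
rewrite /diag mulr_suml.
transitivity (\sum_(m < p) \sum_(u : Z) c m (u - 2%:R) *: mono m.+1 m u +
  \sum_(m < p) \sum_(u : Z)
    (c m (u - 2%:R) * (sn m%:R * sn (u - 2%:R + m%:R + 1))) *: mono m m.-1 u).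
  rewrite -big_split; apply: eq_bigr => m _ /=; rewrite mulr_suml -big_split /=.
  rewrite (reindex_inj (addIr (- 2%:R))); apply: eq_bigr => u _ /=.
  by rewrite -scalerAl (mono_f H U) scalerDr scalerA subrK.
rewrite (@sum_shift_up (fun m => \sum_(u : Z) (c m (u - 2%:R) * (sn m%:R * sn (u - 2%:R + m%:R + 1))) *: mono m m.-1 u)
  (fun m => \sum_(u : Z) (c m.+1 (u - 2%:R) * (sn m.+1%:R * sn (u - 2%:R + m.+1%:R + 1))) *: mono m.+1 m u)) //.
- rewrite -big_split; apply: eq_bigr => m _ /=; rewrite -big_split.
  by apply: eq_bigr => u _ /=; rewrite -scalerDl.
- by rewrite big1 // => u _; rewrite sn0 mul0r mulr0 scale0r.
- by rewrite big1 // => u _; rewrite mono_ge ?scaler0 // prednK // leqnn.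
Qed.

Lemma k_diag c : k * diag c = diag c * k.
Proof.
rewrite /diag mulr_sumr mulr_suml; apply: eq_bigr => m _; rewrite mulr_sumr mulr_suml.
by apply: eq_bigr => u _; rewrite -scalerAr -scalerAl (k_mono H U) (mono_k H U) addrK.
Qed.

Definition diag_rel (c : nat -> Z -> F) := forall m u, (m.+1 < p)%N ->
  c m (u + 2%:R) = c m u + c m.+1 u * (sn m.+1%:R * sn (u + m.+1%:R + 1)).

Lemma diag_relE g : diag_rel (fun m u => g m (u + m%:R + 1) / fac m) <-> central_coef q g.
Proof.
have nz k' : (k' < p)%N -> fac k' != 0 by exact: fac_neq0.
have key m u : (m.+1 < p)%N ->
    g m.+1 (u + m.+1%:R + 1) / fac m.+1 * (sn m.+1%:R * sn (u + m.+1%:R + 1)) =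
    sn (u + m%:R + 2%:R) * g m.+1 (u + m%:R + 2%:R) / fac m.
  move=> mp; have -> : u + m.+1%:R + 1 = u + m%:R + 2%:R by rewrite mulrS; ring.
  have s0 : sn m.+1%:R != 0 by exact: sn_nat_neq0.
  by rewrite facS; field; rewrite s0 nz //; lia.
split=> hg m u mp.
  have := hg m (u - m%:R - 2%:R) mp; rewrite key //.
  have -> : u - m%:R - 2%:R + 2%:R + m%:R + 1 = u + 1 by ring.
  have -> : u - m%:R - 2%:R + m%:R + 1 = u - 1 by ring.
  have -> : u - m%:R - 2%:R + m%:R + 2%:R = u by ring.
  by rewrite -mulrDl => /(mulIf (invr_neq0 (nz m (ltnW mp)))) ->; rewrite addrC addKr.
rewrite key // -mulrDl; congr (_ / _).
have := hg m (u + m%:R + 2%:R) mp.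
have -> : u + m%:R + 2%:R + 1 = u + 2%:R + m%:R + 1 by ring.
have -> : u + m%:R + 2%:R - 1 = u + m%:R + 1 by ring.
by move=> <-; rewrite [RHS]addrC subrK.
Qed.

Lemma el_central g : central_coef q g -> forall y, el g * y = y * el g.
Proof.
move=> /diag_relE hg; apply: (central_gen U).
- rewrite /el e_diag diag_e; apply: eq_bigr => m _; apply: eq_bigr => u _.
  have [mp|mp] := ltnP m.+1 p; first by rewrite hg.
  by rewrite mono_ge ?mp ?orbT // !scaler0.
- rewrite /el f_diag diag_f; apply: eq_bigr => m _; apply: eq_bigr => u _.
  have [mp|mp] := ltnP m.+1 p; last by rewrite mono_ge ?mp // !scaler0.
  by rewrite -hg // subrK.
- by rewrite k_diag.
Qed.

(** Commutation with k leaves only monomials with 2(n - m) = 0 in Z/2p, that is m = n as both are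
    below p; commutation with e is then the recursion. *)
Lemma central_el x : (forall y, x * y = y * x) -> exists2 g, central_coef q g & x = el g.
Proof.
move=> cx; have [c ex] := pbw_expand H U x.
have c0 (i : I) : i.1.1 != i.1.2 :> nat -> c i = 0.
  move=> ne.
  have h : \sum_(j : I) (c j * (chr (j.2 + 2%:R * j.1.2%:R - 2%:R * j.1.1%:R) - chr j.2)) *: pbw j = 0.
    transitivity (k * x - x * k); last by rewrite cx subrr.
    rewrite {1 2}ex mulr_sumr mulr_suml -sumrB; apply: eq_bigr => -[[m n] u] _.
    by rewrite -scalerAr -scalerAl /pbw (k_mono H U) (mono_k H U) !scalerA -scalerBl mulrBr.
  have /eqP := pbw_free H U h i.
  rewrite mulf_eq0 subr_eq0 (inj_eq (chr_inj H)) => /orP[/eqP //|/eqP e1].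
  case/eqP: ne; apply: (double_inj H) => //.
  by apply: (addrI (i.2 - 2%:R * i.1.1%:R)); rewrite subrK -[RHS]addrAC e1.
pose d m u := if insub m is Some i then c (i, i, u) else 0.
have xd : x = diag d.
  rewrite ex sum_pbw_index.
  apply: eq_bigr => m _; rewrite (bigD1 m) //= [X in _ + X]big1 ?addr0.
    by apply: eq_bigr => u _; rewrite /d valK.
  move=> n nm; rewrite big1 // => u _; rewrite c0 ?scale0r //=.
  by rewrite eq_sym.
pose g m u := fac m * d m (u - m%:R - 1).
have nz k' : (k' < p)%N -> fac k' != 0 by exact: fac_neq0.
have xg : x = el g.
  rewrite xd; apply: eq_bigr => m _; apply: eq_bigr => u _; congr (_ *: _).
  rewrite /g (_ : u + m%:R + 1 - m%:R - 1 = u); last by ring.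
  by rewrite mulrAC divff ?mul1r // nz.
exists g => //; apply/diag_relE => m u mp.
have : e * x - x * e = 0 by rewrite cx subrr.
rewrite xg /el e_diag diag_e -sumrB => e1.
apply/eqP; rewrite -subr_eq0 -oppr_eq0 opprB; apply/eqP.
pose d' m u := (g m (u + m%:R + 1) / fac m + g m.+1 (u + m.+1%:R + 1) / fac m.+1 *
   (sn m.+1%:R * sn (u + m.+1%:R + 1))) - g m (u + 2%:R + m%:R + 1) / fac m.
apply: (@mono_free succn d' _ m u (ltnW mp) mp).
rewrite -[RHS]e1; apply: eq_bigr => n _; rewrite -sumrB; apply: eq_bigr => v _.
by rewrite -scalerBl.
Qed.

Lemma el_inj g g' : el g = el g' -> forall m u, (m < p)%N -> g m u = g' m u.
Proof.
move=> eg m u mp; have : el g - el g' = 0 by rewrite eg subrr.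
rewrite /el diagB => /diag_free/(_ m (u - m%:R - 1) mp).
rewrite (_ : u - m%:R - 1 + m%:R + 1 = u); last by ring.
rewrite -mulrBl => /eqP; rewrite mulf_eq0 invr_eq0 (negPf (fac_neq0 H mp)) orbF subr_eq0.
by move=> /eqP.
Qed.

Lemma eq_el g g' : (forall m u, (m < p)%N -> g m u = g' m u) -> el g = el g'.
Proof.
by move=> eg; apply: eq_bigr => m _; apply: eq_bigr => u _; rewrite eg.
Qed.

Lemma el_sum (J : Type) (l : seq J) (P : pred J) (c : J -> F) (g : J -> nat -> Z -> F) :
  el (fun m u => \sum_(i <- l | P i) c i * g i m u) = \sum_(i <- l | P i) c i *: el (g i).
Proof.
under [RHS]eq_bigr do rewrite /el scaler_sumr.
rewrite exchange_big; apply: eq_bigr => m _ /=.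
under [RHS]eq_bigr do rewrite scaler_sumr.
rewrite exchange_big; apply: eq_bigr => u _ /=.
rewrite mulr_suml scaler_suml; apply: eq_bigr => i _; rewrite scalerA mulrA //.
Qed.

Lemma el_lin c d g g' : el (fun m u => c * g m u + d * g' m u) = c *: el g + d *: el g'.
Proof.
rewrite /el /diag !scaler_sumr -big_split; apply: eq_bigr => m _.
rewrite !scaler_sumr -big_split; apply: eq_bigr => u _ /=.
by rewrite !scalerA -scalerDl mulrDl !mulrA.
Qed.

Lemma mono_wproj m n u v : mono m n u * wproj v = (u == v)%:R *: mono m n v.
Proof. by rewrite /mono -mulrA (wprojM H U) -scalerAr. Qed.

Lemma el_wproj g u : el g * wproj u = \sum_(m < p) (g m (u + m%:R + 1) / fac m) *: mono m m u.
Proof.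
rewrite /el /diag mulr_suml; apply: eq_bigr => m _; rewrite mulr_suml.
rewrite (bigD1 u) //= [X in _ + X]big1 ?addr0 => [|v vu].
  by rewrite -scalerAl mono_wproj eqxx scale1r.
by rewrite -scalerAl mono_wproj (negPf vu) scale0r scaler0.
Qed.

Lemma el_wproj0 g u : el g * wproj u = 0 -> forall m, (m < p)%N -> g m (u + m%:R + 1) = 0.
Proof.
rewrite el_wproj => e0 m mp.
pose d m v := (v == u)%:R * (g m (v + m%:R + 1) / fac m).
have : d m u = 0.
  apply: (@mono_free id d _ m u mp mp).
  rewrite -[RHS]e0; apply: eq_bigr => n _; rewrite (bigD1 u) //= [X in _ + X]big1 ?addr0 => [|v vu].
    by rewrite /d eqxx mul1r.
  by rewrite /d (negPf vu) mul0r scale0r.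
rewrite /d eqxx mul1r => /eqP; rewrite mulf_eq0 invr_eq0 (negPf (fac_neq0 H mp)) orbF.
by move=> /eqP.
Qed.

End CenterDescription.

(** * The Casimir element and the action of the ribbon element *)

Section Casimir.
Variables (F : fieldType) (p : nat) (q : F) (A : falgType F) (e f k : A).
Local Notation Z := 'Z_(2 * p).
Local Notation pz := (p%:R : Z).
Local Notation sn := (@sn F p q).
Local Notation cs := (@cs F p q).
Local Notation fac := (@fac F p q).
Local Notation wproj := (@wproj F p q A k).
Local Notation mono := (@mono F p q A e f k).
Local Notation el := (@el F p q A e f k).
Local Notation coefY := (@coefY F p q).
Local Notation coefP := (@coefP F p q).
Local Notation coefM := (@coefM F p q).
Local Notation coefK := (@coefK F p q).
Local Notation coefR := (@coefR F p q).
Local Notation central x := (forall y : A, x * y = y * x).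

(* The Casimir element, times (q - q^-1)^2. *)
Definition yhat : A := f * e + \sum_(u : Z) cs (u + 1) *: wproj u.

Hypothesis H : even_root p q.
Hypothesis U : uq_generators p q e f k.
Let p0 := even_root_gt0 H.
Let ellin := @el_lin F p q A e f k.

Lemma wproj_mono m u : wproj u * mono m m u = mono m m u.
Proof.
rewrite /mono -[f ^+ m * _ * _]mulrA (en_wproj H U) !mulrA.
rewrite -[_ * e ^+ m]mulrA.
have -> : wproj u * f ^+ m = f ^+ m * wproj (u + 2%:R * m%:R).
  by rewrite (fn_wproj H U) addrK.
by rewrite mulrA -[_ * wproj _ * wproj _]mulrA (wprojM H U) eqxx scale1r.
Qed.

Lemma wproj_monoE v m u : wproj v * mono m m u = (v == u)%:R *: mono m m u.
Proof.
rewrite -(wproj_mono m u) mulrA (wprojM H U) -scalerAl.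
by rewrite wproj_mono.
Qed.

Lemma yhat_mono m u :
  yhat * mono m m u = mono m.+1 m.+1 u + cs (u + 1 + 2%:R * m%:R) *: mono m m u.
Proof.
rewrite /yhat mulrDl -mulrA (e_mono H U) mulrDr -scalerAr !f_mono.
rewrite mulr_suml (bigD1 u) //= [X in _ + (_ + X)]big1 => [|v vu]; last first.
  by rewrite -scalerAl wproj_monoE (negPf vu) scale0r scaler0.
rewrite addr0 -scalerAl wproj_mono -addrA; congr (_ + _).
case: m => [|m]; first by rewrite sn0 mul0r scale0r add0r mulr0 addr0.
rewrite /= -scalerDl; congr (_ *: _).
have -> : u + 2%:R * m.+1%:R - m.+1%:R + 1 = u + 1 + m.+1%:R by ring.
rewrite mulrC -(cs_subD H).
have -> : u + 1 + m.+1%:R - m.+1%:R = u + 1 by ring.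
by rewrite subrK; congr cs; ring.
Qed.

Lemma yhat_el g : yhat * el g = el (coefY g).
Proof.
rewrite /el /diag mulr_sumr.
transitivity (\sum_(m < p) \sum_(u : Z) (g m (u + m%:R + 1) / fac m) *: mono m.+1 m.+1 u +
  \sum_(m < p) \sum_(u : Z) (cs (u + m%:R + 1 + m%:R) * g m (u + m%:R + 1) / fac m) *: mono m m u).
  rewrite -big_split; apply: eq_bigr => m _ /=; rewrite mulr_sumr -big_split.
  apply: eq_bigr => u _ /=; rewrite -scalerAr yhat_mono scalerDr scalerA; congr (_ + _ *: _).
  by rewrite mulrC mulrA; congr (cs _ * _ * _); ring.
rewrite -(@sum_shift_up _ p q A H
  (fun m => \sum_(u : Z) (sn m%:R * g m.-1 (u + m%:R + 1 - 1) / fac m) *: mono m m u)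
  (fun m => \sum_(u : Z) (g m (u + m%:R + 1) / fac m) *: mono m.+1 m.+1 u)).
- rewrite -big_split; apply: eq_bigr => m _ /=; rewrite -big_split.
  by apply: eq_bigr => u _ /=; rewrite -scalerDl -mulrDl.
- by rewrite big1 // => u _; rewrite sn0 !mul0r scale0r.
- by rewrite big1 // => u _; rewrite (mono_ge U) ?scaler0 // prednK // leqnn.
move=> m mp; apply: eq_bigr => u _ /=; congr (_ *: _).
have s0 : sn m.+1%:R != 0 by exact: sn_nat_neq0.
have f0 : fac m != 0 by apply: fac_neq0 => //; lia.
have -> : u + m.+1%:R + 1 - 1 = u + m%:R + 1 by rewrite mulrS; ring.
by rewrite facS; field; rewrite s0 f0.
Qed.

(** Iterated, this writes f^m e^m 1_u as the Newton polynomial in the Casimir element with nodes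
    [cs (u + 1 + 2i)], i < m, times 1_u. *)
Lemma mono_wproj_rec m u :
  mono m.+1 m.+1 u = (yhat - (cs (u + 1 + 2%:R * m%:R))%:A) * mono m m u.
Proof. by rewrite mulrBl yhat_mono -scalerAl mul1r addrK. Qed.

(** The factor of the node i = 0 maps x to x'; the remaining factors act on x' by scalars. *)
Lemma mono_central x x' (u : Z) m : central x ->
    yhat * x = cs (u + 1) *: x + x' -> yhat * x' = cs (u + 1) *: x' ->
  mono m.+1 m.+1 u * x =
  (\prod_(1 <= i < m.+1) (cs (u + 1) - cs (u + 1 + 2%:R * i%:R))) *: (x' * wproj u).
Proof.
move=> cx yx yx'; elim: m => [|m IH].
  rewrite big_nil scale1r mono_wproj_rec mulr0 addr0 /mono !mul1r -mulrA -cx mulrA.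
  by rewrite mulrBl yx -scalerAl mul1r addrC addKr.
rewrite mono_wproj_rec -mulrA IH -scalerAr mulrA mulrBl yx' -[_%:A * _]scalerAl mul1r -scalerBl.
by rewrite -scalerAl scalerA [in RHS]big_nat_recr.
Qed.

(** On a Jordan block a polynomial acts by its value and its derivative at the eigenvalue. The first
    node equals the eigenvalue, so the value is the constant Newton coefficient and the sum is the
    derivative. *)
Lemma el_mul_wproj g x x' (u : Z) : central x ->
    yhat * x = cs (u + 1) *: x + x' -> yhat * x' = cs (u + 1) *: x' ->
  el g * x * wproj u = g 0%N (u + 1) *: (x * wproj u) +
   (\sum_(1 <= m < p) g m (u + 1 + m%:R) / fac m *
      \prod_(1 <= i < m) (cs (u + 1) - cs (u + 1 + 2%:R * i%:R))) *: (x' * wproj u).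
Proof.
move=> cx yx yx'; rewrite -mulrA cx mulrA (el_wproj H U) mulr_suml.
rewrite -(big_mkord xpredT (fun m => (g m (u + m%:R + 1) / fac m) *: mono m m u * x)).
rewrite big_ltn // addr0 fac0 divr1 /mono !mul1r -scalerAl -cx scaler_suml; congr (_ + _).
apply: eq_big_nat => -[//|m] mp; rewrite -scalerAl (mono_central _ cx yx yx') scalerA.
by congr (_ / _ * _ *: _); congr (g _ _); ring.
Qed.

(** [coefY_eigen_uniq] read in the algebra; it reduces identities between Casimir eigenvectors to
    two weights. *)
Lemma center_eigen_uniq x (t : Z) : central x -> yhat * x = cs t *: x ->
  x * wproj (t - 1) = 0 -> x * wproj (- t - 1) = 0 -> x = 0.
Proof.
move=> cx; have [g cg ->] := central_el H U cx => yx x1 x2.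
have g0 m u : (m < p)%N -> g m u = 0.
  apply: (coefY_eigen_uniq H cg (t := t)) => {m u}.
  - move=> m u mp; apply: (el_inj H U (g := coefY g) (g' := fun m u => cs t * g m u)) => //.
    rewrite -yhat_el yx.
    by have := ellin (cs t) 0 g (fun _ _ => 0); rewrite scale0r addr0 => <-; apply: eq_el => ? ? _; rewrite mul0r addr0.
  - move=> m mp; rewrite (_ : t + m%:R = t - 1 + m%:R + 1); last by ring.
    exact: (el_wproj0 H U x1).
  - move=> m mp; rewrite (_ : - t + m%:R = - t - 1 + m%:R + 1); last by ring.
    exact: (el_wproj0 H U x2).
rewrite /el /diag big1 // => m _; rewrite big1 // => u _.
by rewrite g0 // mul0r scale0r.
Qed.

Lemma centralM x y : central x -> central y -> central (x * y).
Proof. by move=> cx cy z; rewrite -mulrA cy mulrA cx mulrA. Qed.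

Lemma centralZ c x : central x -> central (c *: x).
Proof. by move=> cx z; rewrite -scalerAl cx scalerAr. Qed.

Lemma centralB x y : central x -> central y -> central (x - y).
Proof. by move=> cx cy z; rewrite mulrBl mulrBr cx cy. Qed.

Variables h r : F.
Hypothesis h2 : h ^+ 2 = q.
Hypothesis r2 : r ^+ 2 = (2 * p)%:R.
Local Notation coefV := (@coefV F p q h).
Local Notation coefF := (@coefF F p q r).

Lemma coefV0N t : coefV 0 (- t) = coefV 0 t.
Proof. by rewrite /coefV (sgnN H) (gaussN H h2). Qed.

(** At the weights t - 1 and -t - 1 the first node is the eigenvalue [cs t], so only the constant
    Newton coefficient is left. *)
Lemma ribbon_eigen x (t : Z) : central x -> yhat * x = cs t *: x ->
  el coefV * x = coefV 0 t *: x.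
Proof.
move=> cx yx; have cV := el_central H U (central_coefV H h2).
have ev v : cs (v + 1) = cs t -> coefV 0 (v + 1) = coefV 0 t ->
    (el coefV * x - coefV 0 t *: x) * wproj v = 0.
  move=> et eV; rewrite mulrBl (@el_mul_wproj _ x 0 v cx).
  - by rewrite mul0r scaler0 addr0 eV -scalerAl subrr.
  - by rewrite addr0 et.
  - by rewrite mulr0 scaler0.
apply/eqP; rewrite -subr_eq0; apply/eqP; apply: (@center_eigen_uniq _ t).
- by apply: centralB; [exact: centralM|exact: centralZ].
- by rewrite mulrBr mulrA -cV -mulrA yx -!scalerAr yx scalerBr scalerA mulrC -scalerA.
- by apply: ev; rewrite subrK.
- by apply: ev; rewrite subrK ?csN ?coefV0N.
Qed.

Lemma coefP_vanish t m : (0 < t < p)%N -> (m < p)%N -> coefP t m (- t%:R + m%:R) = 0.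
Proof.
move=> tp mp; rewrite /coefP big1 // => a _; rewrite big1 // => b _.
rewrite /coefB; case: ifP => [/andP[am bm]|]; last by rewrite mul0r.
rewrite /indP; case: eqP => [ab|]; last by rewrite mulr0.
rewrite [_ == _](_ : _ = false) ?mulr0 //=; apply/negP => /eqP e1.
have : (b + m)%:R == (p + a + t)%:R :> Z.
  rewrite !natrD; apply/eqP.
    have -> : m%:R = (p%:R + a%:R - b%:R) + t%:R :> Z by rewrite -e1; ring.
    ring.
by rewrite (eqZ_nat H) eqn_mod_close; have := ltn_ord a; have := ltn_ord b; lia.
Qed.

Lemma coefM_vanish t m : (0 < t < p)%N -> (m < p)%N -> coefM (p - t) m (t%:R + m%:R) = 0.
Proof.
move=> tp mp; rewrite /coefM /twist.
rewrite (_ : t%:R + m%:R + pz = - (p - t)%:R + m%:R).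
  by rewrite coefP_vanish ?mulr0 //; lia.
rewrite natrB; last by lia.
by have := pp0 H => pp; rewrite opprB -[X in _ = X + _]addr0 -pp; ring.
Qed.

Lemma el_coefP_wproj t : (0 < t < p)%N -> el (coefP t) * wproj (- t%:R - 1) = 0.
Proof.
move=> tp; rewrite (el_wproj H U) big1 // => m _.
have -> : - t%:R - 1 + m%:R + 1 = - t%:R + m%:R :> Z by ring.
by rewrite coefP_vanish ?mul0r ?scale0r.
Qed.

Lemma el_coefM_wproj t : (0 < t < p)%N -> el (coefM (p - t)) * wproj (t%:R - 1) = 0.
Proof.
move=> tp; rewrite (el_wproj H U) big1 // => m _.
have -> : t%:R - 1 + m%:R + 1 = t%:R + m%:R :> Z by ring.
by rewrite coefM_vanish ?mul0r ?scale0r.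
Qed.

Lemma el_coefK t : (t <= p)%N ->
  el (coefK t%:R) = el (coefP t) + el (coefM (p - t)).
Proof.
move=> tp; have := ellin 1 1 (coefP t) (coefM (p - t)); rewrite !scale1r => <-.
by apply: eq_el => m u mp; rewrite !mul1r (coefK_nat H).
Qed.

Lemma el_coefR t : (t <= p)%N -> el (coefR t) =
  ((p%:R - t%:R) / p%:R) *: el (coefP t) - (t%:R / p%:R) *: el (coefM (p - t)).
Proof.
move=> tp; rewrite -scaleNr -ellin; apply: eq_el => m u mp.
rewrite /coefR (coefK_nat H) //.
by have pF := p_neq0 H; field.
Qed.

(** The difference of both sides is a Casimir eigenvector, the nilpotent parts cancelling, so it
    suffices to compare at two weights. There the derivative of the ribbon polynomial has to match
    the component of R_t. *)
Lemma ribbon_coefF t : (0 < t < p)%N ->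
  el coefV * el (coefF t) = coefV 0 t%:R *: (el (coefF t) - el (coefR t)).
Proof.
move=> tp; have cV := el_central H U (central_coefV H h2).
have tp' : (t <= p)%N by lia.
have cF := el_central H U (central_coefF r H t).
have cK := el_central H U (central_coefK H t%:R).
have cR := el_central H U (central_coefR H t).
have cP := el_central H U (central_coefP H t).
have cM := el_central H U (central_coefM H (p - t)).
have pF := p_neq0 H.
have s0 : sn t%:R != 0 by apply: sn_nat_neq0.
have yP : yhat * el (coefP t) = cs t%:R *: el (coefP t).
  rewrite yhat_el -[RHS]addr0 -(scale0r (el (coefP t))) -ellin.
  by apply: eq_el => m u mp; rewrite coefY_coefP // mul0r addr0.
have yM : yhat * el (coefM (p - t)) = cs t%:R *: el (coefM (p - t)).
  rewrite yhat_el -[RHS]addr0 -(scale0r (el (coefP t))) -ellin.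
  apply: eq_el => m u mp; rewrite coefY_coefM // mul0r addr0 natrB //.
  by congr (cs _ * _); ring.
have yK : yhat * el (coefK t%:R) = cs t%:R *: el (coefK t%:R).
  by rewrite el_coefK // mulrDr yP yM scalerDr.
have yR : yhat * el (coefR t) = cs t%:R *: el (coefR t).
  by rewrite el_coefR // mulrBr -!scalerAr yP yM scalerBr !scalerA ![cs _ * _]mulrC.
have yF : yhat * el (coefF t) = cs t%:R *: el (coefF t) + (- (sn t%:R / p%:R)) *: el (coefK t%:R).
  by rewrite yhat_el -ellin; apply: eq_el => m u mp; rewrite coefY_coefF // mulNr.
have yVK : el coefV * el (coefK t%:R) = coefV 0 t%:R *: el (coefK t%:R).
  exact: ribbon_eigen.
have vec (a b c : F) (x y : A) : a *: x + b *: y - a *: (x - c *: y) = (b + a * c) *: y.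
  by rewrite scalerBr scalerA opprB [_ - _]addrC addrACA subrr add0r -scalerDl.
have [dd ddE] : exists dd, dd = - (sn t%:R / p%:R) by exists (- (sn t%:R / p%:R)).
rewrite -ddE in yF; set K' := dd *: el (coefK _) in yF.
have VK : el coefV * K' = coefV 0 t%:R *: K'.
  by rewrite -scalerAr yVK !scalerA mulrC.
have yK' : yhat * K' = cs t%:R *: K' by rewrite -scalerAr yK !scalerA mulrC.
apply/eqP; rewrite -subr_eq0; apply/eqP; apply: (@center_eigen_uniq _ t%:R).
- apply: centralB; first exact: centralM.
  by apply: centralZ; exact: centralB.
- rewrite mulrBr mulrA -cV -mulrA yF mulrDr VK -!scalerAr mulrBr yF yR.
  rewrite [_ + K' - _]addrAC -scalerBr scalerDr opprD addrA.
  by rewrite [LHS]addrAC addrK [RHS]scalerBr !scalerA [_ * coefV _ _]mulrC.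
- rewrite mulrBl (@el_mul_wproj _ _ K' _ cF) ?subrK //.
  (* At weight t - 1 the node is written t = p - (p - t), so the derivative carries p - t. The M
     part vanishes at this weight, and R_t reduces to (p - t)/p times the P part. *)
  rewrite (@coefV_derivative _ _ _ H _ h2 _ (p - t) true); last 2 first.
  + lia.
  + by rewrite natrB // mulr1n; ring.
  rewrite el_coefR // /K' el_coefK // -!scalerAl !mulrBl mulrDl -!scalerAl el_coefM_wproj //.
  rewrite addr0 scaler0 subr0 scalerA natrB // vec.
  by rewrite [_ + _](_ : _ = 0) ?scale0r // ddE; field; rewrite s0 pF.
- rewrite mulrBl (@el_mul_wproj _ _ K' _ cF) ?subrK ?csN //.
  (* At weight -t - 1 the node is -t, so the derivative carries t. Here the P part vanishes, and R_t
     reduces to -t/p times the M part. *)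
  rewrite -(csN q t%:R) (@coefV_derivative _ _ _ H _ h2 _ t false); last 2 first.
  + done.
  + by rewrite mulr0n add0r.
  rewrite el_coefR // /K' el_coefK // -!scalerAl !mulrBl mulrDl -!scalerAl el_coefP_wproj //.
  rewrite add0r scaler0 sub0r scalerA coefV0N snN -[X in _ - (_ *: (_ - X))]scaleNr vec.
  by rewrite [_ + _](_ : _ = 0) ?scale0r // ddE; field; rewrite ?oppr_eq0 ?s0 ?pF.
Qed.

End Casimir.

(** * Invariance of the center under the exchange of e and f *)

Section Swap.
Variables (F : fieldType) (p : nat) (q : F) (A : falgType F) (e f k : A).
Local Notation Z := 'Z_(2 * p).
Local Notation pz := (p%:R : Z).
Local Notation chr := (@chr F p q).
Local Notation sn := (@sn F p q).
Local Notation cs := (@cs F p q).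
Local Notation fac := (@fac F p q).
Local Notation wproj_of k := (@wproj F p q A k).
Local Notation mono_of e f k := (@mono F p q A e f k).
Local Notation el_of e f k := (@el F p q A e f k).
Local Notation yhat_of e f k := (@yhat F p q A e f k).
Local Notation wproj := (@wproj F p q A k).
Local Notation mono := (@mono F p q A e f k).
Local Notation el := (@el F p q A e f k).
Local Notation yhat := (@yhat F p q A e f k).
Hypothesis H : even_root p q.
Hypothesis U : uq_generators p q e f k.
Let p0 := even_root_gt0 H.
Let ki := k ^+ (2 * p).-1.
Local Notation el' := (el_of f e ki).

Lemma kkinv : k * ki = 1.
Proof. by rewrite /ki -exprS prednK ?(uq_expk U) // muln_gt0. Qed.

Lemma kinvk : ki * k = 1.
Proof. by rewrite /ki -exprSr prednK ?(uq_expk U) // muln_gt0. Qed.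

Lemma kinv_pred : ki ^+ (2 * p).-1 = k.
Proof.
have e1 : k ^+ (2 * p).-1 * ki ^+ (2 * p).-1 = 1.
  rewrite -exprMn_comm ?kkinv ?expr1n //.
  by rewrite /GRing.comm kkinv kinvk.
by rewrite -[LHS]mul1r -kkinv -mulrA e1 mulr1.
Qed.

Lemma uq_swap : uq_generators p q f e ki.
Proof.
have q0 := q_neq0 H.
split; [|exact: uq_dim U|exact: uq_expf U|exact: uq_expe U| | | |].
- apply/eqP; rewrite eqEsubv subvf /= -(uq_gen U).
  apply: agenv_sub_modl; first exact: sub1_agenv.
  have gen x : x \in [:: f; e; ki] -> x \in agenv <<[:: f; e; ki]>>%VS.
    by move=> xs; apply: (subvP (sub_agenv _)); apply: memv_span.
  have kin : k \in agenv <<[:: f; e; ki]>>%VS.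
    rewrite -kinv_pred; elim: (2 * p).-1 => [|n IH].
      by rewrite expr0 memvE; exact: sub1_agenv.
    by rewrite exprS; apply: memvM => //; apply: gen; rewrite !inE eqxx !orbT.
  apply/prodvP => x y xs ys; apply: memvM => //.
  move: x xs; apply/subvP/span_subvP => x; rewrite !inE => /or3P[]/eqP-> //;
    by apply: gen; rewrite !inE eqxx ?orbT.
- by rewrite /ki -exprM mulnC exprM (uq_expk U) expr1n.
- rewrite -[LHS]mulr1 -kkinv mulrA -[ki * f * k]mulrA.
  have -> : f * k = (q ^+ 2) *: (k * f).
    by rewrite (uq_kf U) scalerA divff ?scale1r // expf_neq0.
  by rewrite -scalerAr -scalerAl mulrA kinvk mul1r.
- rewrite -[LHS]mulr1 -kkinv mulrA -[ki * e * k]mulrA.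
  have -> : e * k = (q ^- 2) *: (k * e).
    by rewrite (uq_ke U) scalerA mulVf ?scale1r // expf_neq0.
  by rewrite -scalerAr -scalerAl mulrA kinvk mul1r.
- rewrite -opprB (uq_ef U) kinv_pred -scalerN opprB //.
Qed.

Lemma wproj_swap u : wproj_of ki u = wproj (- u).
Proof.
rewrite !wprojE; congr (_ *: _); rewrite (reindex_inj oppr_inj).
apply: eq_bigr => j _; congr (chr _ *: _); first by ring.
rewrite /ki (kpowN1 H U) -exprM -(kpow_nat H U); congr (k ^+ nat_of_ord _).
by rewrite natrM !(natrZ H); ring.
Qed.

Lemma yhat_swap : yhat_of f e ki = yhat.
Proof.
rewrite /yhat /(yhat_of _ _ _) (reindex_inj oppr_inj) /=.
have -> : e * f = f * e + \sum_(u : Z) (sn 1 * sn u) *: wproj u.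
  rewrite -[e * f]mulr1 -(sum_wproj H U) mulr_sumr.
  under eq_bigr do rewrite (ef_wproj H U).
  by rewrite big_split -mulr_sumr (sum_wproj H U) mulr1.
rewrite -addrA -big_split; congr (_ + _); apply: eq_bigr => u _ /=.
rewrite wproj_swap opprK -scalerDl; congr (_ *: _).
rewrite mulrC -(cs_subD H) (_ : - u + 1 = - (u - 1)); last by ring.
by rewrite csN subrK.
Qed.

Local Notation mono' := (mono_of f e ki).

Lemma mono_swap_rec m u : mono' m.+1 m.+1 u =
  (yhat - (cs (u + 1 + 2%:R * m%:R))%:A) * mono' m m u.
Proof. by rewrite (mono_wproj_rec H uq_swap) yhat_swap. Qed.

Lemma mono_swap0 u : mono' 0 0 u = mono 0 0 (- u).
Proof. by rewrite /mono /(mono_of _ _ _) !mul1r wproj_swap. Qed.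

Lemma mono_swap_expand m u : exists c : nat -> F,
  mono' m m u = mono m m (- u) + \sum_(i < m) c i *: mono i i (- u).
Proof.
elim: m => [|m [c IH]].
  by exists (fun=> 0); rewrite big_ord0 addr0 mono_swap0.
pose y i := cs (- u + 1 + 2%:R * i%:R); pose x := cs (u + 1 + 2%:R * m%:R).
pose a i := if (i < m)%N then c i else 1.
have IH' : mono' m m u = \sum_(i < m.+1) a i *: mono i i (- u).
  rewrite big_ord_recr /= /a ltnn scale1r IH addrC; congr (_ + _).
  by apply: eq_bigr => i _; rewrite ltn_ord.
exists (fun i => a i * (y i - x) + (if i is j.+1 then a j else 0)).
rewrite mono_swap_rec IH' mulr_sumr -/x.
transitivity (\sum_(i < m.+1) a i *: mono i.+1 i.+1 (- u) +
   \sum_(i < m.+1) (a i * (y i - x)) *: mono i i (- u)).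
  rewrite -big_split; apply: eq_bigr => i _ /=.
  rewrite -scalerAr mulrBl (yhat_mono H U) -scalerAl mul1r -addrA -scalerBl.
  by rewrite scalerDr scalerA.
have am : a m = 1 by rewrite /a ltnn.
rewrite big_ord_recr /= am scale1r.
under [in RHS]eq_bigr do rewrite scalerDl.
rewrite big_split /= [in RHS]addrA addrAC -addrA addrCA addrA -!addrA; congr (_ + _).
by rewrite [RHS]big_ord_recl /= scale0r add0r; apply: eq_bigr => i _; rewrite /bump add1n.
Qed.

Lemma sum_mono_swap (a : nat -> F) n u : exists2 b : nat -> F,
  \sum_(m < n.+1) a m *: mono' m m u = \sum_(m < n.+1) b m *: mono m m (- u) & b n = a n.
Proof.
elim: n => [|n [b IH _]].
  by exists a; rewrite // !big_ord1 mono_swap0.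
have [c ec] := mono_swap_expand n.+1 u.
exists (fun i => if (i <= n)%N then b i + a n.+1 * c i else a n.+1); last by rewrite ltnn.
rewrite big_ord_recr /= IH ec scalerDr [in RHS]big_ord_recr /= ltnn addrC -addrA addrC.
congr (_ + _); rewrite scaler_sumr -big_split; apply: eq_bigr => i _ /=.
by rewrite -ltnS ltn_ord scalerDl scalerA addrC.
Qed.

Lemma mono_swap_at0 m : mono' m m 0 = mono m m 0.
Proof.
elim: m => [|m IH]; first by rewrite mono_swap0 oppr0.
by rewrite mono_swap_rec IH -(mono_wproj_rec H U).
Qed.

(** The swapped monomial has the nodes cs 0, cs 2, ..., cs 2m, and [mono m m 1] has the same nodes
    without cs 0. So it is [yhat - cs 0] times [mono m m 1]. *)
Lemma mono_swap_at1 m : mono' m.+1 m.+1 (-1) =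
  mono m.+1 m.+1 1 + (sn m.+1%:R ^+ 2) *: mono m m 1.
Proof.
have comm (x : A) (a b : F) : (x - a%:A) * (x - b%:A) = (x - b%:A) * (x - a%:A).
  rewrite !mulrBl !mulrBr !mulr_algl !mulr_algr !opprB !scalerA [b * a]mulrC.
  rewrite -!addrA; congr (_ + _); rewrite addrCA [RHS]addrCA; congr (_ + _).
  exact: addrC.
have h n : mono' n.+1 n.+1 (-1) = (yhat - (cs 0)%:A) * mono n n 1.
  elim: n => [|n IH]; first by rewrite mono_swap_rec mono_swap0 opprK addNr mulr0 addr0.
  rewrite mono_swap_rec IH (mono_wproj_rec H U) !mulrA; congr (_ * _).
  have -> : - 1 + 1 + 2%:R * n.+1%:R = 1 + 1 + 2%:R * n%:R :> Z by rewrite mulrS; ring.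
  by rewrite comm.
rewrite h mulrBl (yhat_mono H U) -scalerAl mul1r -addrA -scalerBl; congr (_ + _ *: _).
have -> : 1 + 1 + 2%:R * m%:R = m.+1%:R + m.+1%:R :> Z by rewrite !mulrS; ring.
by rewrite -{1}(subrr m.+1%:R) (cs_subD H).
Qed.

(** Downward induction on the row: if row m + 1 vanishes, the recursion makes row m periodic with
    period 2, so one value of each parity suffices. The prescribed diagonals are the components at
    the weights 0 and 1. *)
Lemma central_coef_top_uniq d : @central_coef F p q d ->
    (forall u, d p.-1 u = 0) -> (forall m, (m < p)%N -> d m (m%:R + 1) = 0) ->
    (forall m, (m < p)%N -> d m (m%:R + 2%:R) = 0) ->
  forall m u, (m < p)%N -> d m u = 0.
Proof.
move=> cd d0 d1 d2 m u mp; have [j ej] : exists j, (j + m = p.-1)%N by exists (p.-1 - m)%N; lia.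
elim: j m mp ej u => [|j IH] m mp ej u; first by rewrite -[m](add0n m) ej d0.
have per v n : d m (v + 2%:R * n%:R) = d m v.
  elim: n => [|n IHn]; first by rewrite mulr0 addr0.
  have ud w : d m.+1 w = 0 by apply: IH; lia.
  have mp' : (m.+1 < p)%N by lia.
  have := cd m (v + 2%:R * n%:R + 1) mp'; rewrite addrK ud mulr0 IHn => /eqP.
  by rewrite subr_eq0 => /eqP <-; congr (d m _); rewrite mulrS; ring.
have dec (w : Z) : w = (odd w)%:R + 2%:R * (w./2)%:R.
  by rewrite -[LHS](natrZ H) -{1}(odd_double_half w) natrD -muln2 natrM mulrC.
have -> : u = m%:R + 1 + (u - m%:R - 1) by ring.
rewrite (dec (u - m%:R - 1)) addrA per; case: odd; last by rewrite addr0 d1.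
by rewrite -addrA d2.
Qed.

(* [el'] exchanges e with f and inverts k; this is the invariance of the center
   under the antipode. *)
Lemma el_swap g : central_coef q g -> el' g = el g.
Proof.
move=> cg; have [g' cg' eg] := central_el H U (el_central H uq_swap cg).
have pm : p.-1%:R = pz - 1 by rewrite -[p.-1]subn1 natrB.
rewrite eg; apply: eq_el => m u mp; apply/eqP; rewrite -subr_eq0; apply/eqP.
have nz i : (i < p)%N -> fac i != 0 by exact: fac_neq0.
pose c (v : Z) m := g m (v + m%:R + 1) / fac m; pose c' (v : Z) m := g' m (v + m%:R + 1) / fac m.
have ew v : el g' * wproj (- v) = \sum_(m < p) c v m *: mono' m m v.
  by rewrite -eg -wproj_swap (el_wproj H uq_swap).
have ew' v : el g' * wproj v = \sum_(m < p) c' v m *: mono m m v.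
  by rewrite (el_wproj H U).
have free (a b : nat -> F) v : \sum_(m < p) a m *: mono m m v = \sum_(m < p) b m *: mono m m v ->
    forall m, (m < p)%N -> a m = b m.
  move=> eab n np; apply/eqP; rewrite -subr_eq0; apply/eqP.
  pose d i w := (w == v)%:R * (a i - b i).
  have : d n v = 0; last by rewrite /d eqxx mul1r.
  apply: (@mono_free _ _ _ _ e f k H U id d _ n v np np).
  transitivity (\sum_(i < p) (a i - b i) *: mono i i v).
    apply: eq_bigr => i _; rewrite (bigD1 v) //= [X in _ + X]big1 ?addr0 => [|w vw].
      by rewrite /d eqxx mul1r.
    by rewrite /d (negPf vw) mul0r scale0r.
  under eq_bigr do rewrite scalerBl.
  by rewrite sumrB eab subrr.
have fdiv (x y : F) i : (i < p)%N -> x / fac i = y / fac i -> x = y.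
  by move=> ip /(mulIf (invr_neq0 (nz i ip))).
apply: (central_coef_top_uniq (d := fun m u => g' m u - g m u)) mp => {m u}.
- by move=> m u mp; rewrite /= mulrBr -(cg' m u mp) -(cg m u mp); ring.
(* The exchange of e and f changes a monomial only by lower ones, so the top coefficients agree up
   to u |-> -u, which evenness absorbs. *)
- move=> u; have [b eb bp] := sum_mono_swap (c (- (u - p.-1%:R - 1))) p.-1 (- (u - p.-1%:R - 1)).
  rewrite (prednK p0) -ew opprK ew' in eb.
  have pp1 : (p.-1 < p)%N by rewrite ltn_predL.
  have := free (c' _) b _ eb p.-1 pp1; rewrite bp => /fdiv-/(_ pp1).
  have -> : u - p.-1%:R - 1 + p.-1%:R + 1 = u by ring.
  have -> : - (u - p.-1%:R - 1) + p.-1%:R + 1 = - u.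
    by rewrite pm -[RHS]addr0 -(pp0 H); ring.
  by move=> ->; rewrite (central_coef_even H cg) ?ltn_predL // subrr.
- move=> m mp; have := ew 0; rewrite oppr0 ew'.
  under [X in _ = X -> _]eq_bigr do rewrite mono_swap_at0.
  by move=> /(free (c' 0) (c 0))/(_ m mp)/fdiv-/(_ mp); rewrite add0r => ->; rewrite subrr.
- move=> m mp; have := ew (-1); rewrite opprK ew' => e1.
  have /(free (c' 1) (c 1))/(_ m mp)/fdiv-/(_ mp) : \sum_(m < p) c' 1 m *: mono m m 1 = \sum_(m < p) c 1 m *: mono m m 1.
    rewrite e1.
    transitivity (\sum_(m < p) (g m m%:R / fac m) *: mono m m 1 +
       \sum_(m < p) (g m m%:R * sn m%:R ^+ 2 / fac m) *: mono m.-1 m.-1 1).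
      rewrite -big_split; apply: eq_bigr => -[[|i] ip] _ /=.
        by rewrite /c sn0 expr0n /= mulr0 mul0r scale0r !addr0 addNr mono_swap0 opprK.
      rewrite /c mono_swap_at1 scalerDr scalerA; congr (_ *: _ + _ *: _).
        by congr (g _ _ / _); ring.
      rewrite mulrAC; congr (g _ _ * _ / _); ring.
    rewrite (@sum_shift_up _ p q A H (fun m => (g m m%:R * sn m%:R ^+ 2 / fac m) *: mono m.-1 m.-1 1)
      (fun m => ((g m (1 + m%:R + 1) - g m m%:R) / fac m) *: mono m m 1)).
    - rewrite -big_split; apply: eq_bigr => i _ /=.
      by rewrite /c -scalerDl -mulrDl addrCA subrr addr0.
    - by rewrite sn0 expr0n /= mulr0 mul0r scale0r.
    - rewrite -(central_coef_even H cg) ?ltn_predL //.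
      have -> : - (1 + p.-1%:R + 1) = p.-1%:R :> Z.
        by rewrite pm -[LHS]addr0 -(pp0 H); ring.
      by rewrite subrr mul0r scale0r.
    move=> i ip /=; congr (_ *: _).
    have -> : g i (1 + i%:R + 1) - g i i%:R = sn i.+1%:R * g i.+1 i.+1%:R.
      by rewrite -cg // mulrS [_ + _ - 1]addrC addKr addrC -addrA addrC.
    rewrite facS; field; rewrite nz; last by lia.
    by rewrite sn_nat_neq0.
  by move=> e2; rewrite (_ : m%:R + 2%:R = 1 + m%:R + 1) ?e2 ?subrr //; ring.
Qed.

End Swap.

(** * Linear forms on the algebra that satisfy the q-character condition *)

Section QuantumTraces.
Variables (F : fieldType) (p : nat) (q : F) (A : falgType F) (e f k : A).
Local Notation Z := 'Z_(2 * p).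
Local Notation pz := (p%:R : Z).
Local Notation chr := (@chr F p q).
Local Notation sn := (@sn F p q).
Local Notation sgn := (@sgn F p q).
Local Notation fac := (@fac F p q).
Local Notation wproj := (@wproj F p q A k).
Local Notation mono_of e f k := (@mono F p q A e f k).
Local Notation mono := (@mono F p q A e f k).
Local Notation pbw := (@pbw F p q A e f k).
Local Notation el := (@el F p q A e f k).
Local Notation I := ('I_p * 'I_p * Z)%type.
Hypothesis H : even_root p q.
Hypothesis U : uq_generators p q e f k.
Let p0 := even_root_gt0 H.

(** The q-character condition for y among the generators, on which S^2 is multiplication by q^2,
    q^-2 and 1. *)
Definition qtrace (beta : 'Hom(A, F^o)) := forall x,
  [/\ beta (x * e) = q ^+ 2 * beta (e * x), beta (x * f) = q ^- 2 * beta (f * x)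
    & beta (x * k) = beta (k * x)].

Definition qtrace_rec (b : nat -> Z -> F) := forall m u, (m.+1 < p)%N ->
  b m.+1 (u - 2%:R) = q ^+ 2 * (b m.+1 u + sn m.+1%:R * sn (u + m%:R) * b m u).

Lemma qtrace_offdiag beta m n u : qtrace beta -> (m < p)%N -> (n < p)%N -> m != n ->
  beta (mono m n u) = 0.
Proof.
move=> qb mp np mn; have [_ _] := qb (mono m n u).
rewrite (mono_k H U) (k_mono H U) !linearZ => /eqP.
rewrite -subr_eq0 -mulrBl mulf_eq0 subr_eq0 (inj_eq (chr_inj H)) => /orP[/eqP e1|/eqP //].
case/eqP: mn; apply: (double_inj H) => //.
apply/esym/eqP; rewrite -subr_eq0; apply/eqP; apply: (addrI u); rewrite addr0 addrA.
exact/esym.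
Qed.

Lemma qtrace_recP beta : qtrace beta -> qtrace_rec (fun m u => beta (mono m m u)).
Proof.
move=> qb m u mp; have [+ _ _] := qb (mono m.+1 m u).
rewrite (mono_e H U) (e_mono H U) linearD linearZ /= => ->.
congr (_ * (_ + _ * sn _ * _)); rewrite mulrS; ring.
Qed.

Let X := [tuple pbw (enum_val j) | j < #|{: I}|].

Lemma pbw_functional (c : I -> F) : exists beta : 'Hom(A, F^o), forall i, beta (pbw i) = c i.
Proof.
pose g (x : A) : F^o := \sum_j c (enum_val j) * coord X j x.
have gl : linear g.
  move=> a x y; rewrite /g scaler_sumr -big_split; apply: eq_bigr => j _ /=.
  by rewrite linearP /= mulrDr; congr (_ + _); exact: mulrCA.
pose gL : {linear A -> F^o} := HB.pack g (GRing.isLinear.Build _ _ _ _ g gl).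
exists (linfun gL) => i; rewrite lfunE /= /g.
have -> : pbw i = X`_(enum_rank i) by rewrite -tnth_nth tnth_mktuple enum_rankK.
rewrite (bigD1 (enum_rank i)) //= [X in _ + X]big1 ?addr0.
  by rewrite enum_rankK coord_free ?eqxx ?mulr1 // (basis_free (pbw_basis H U)).
by move=> j ji; rewrite coord_free ?(basis_free (pbw_basis H U)) // eq_sym (negPf ji) mulr0.
Qed.

(** The form is extended by 0 to the monomials with m != n; the three conditions are then checked on
    the PBW basis. *)
Lemma qtrace_exists b : qtrace_rec b -> exists2 beta, qtrace beta &
  forall m u, (m < p)%N -> beta (mono m m u) = b m u.
Proof.
move=> hb.
have [beta eb] := pbw_functional (fun i => if i.1.1 == i.1.2 then b i.1.1 i.2 else 0).
pose B m n u := if (m == n) && (m < p)%N then b m u else 0.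
have bm m n u : beta (mono m n u) = B m n u.
  rewrite /B; have [mp|mp] := ltnP m p; last by rewrite (mono_ge U) ?mp // linear0 andbF.
  have [np|np] := ltnP n p; last first.
    by rewrite (mono_ge U) ?np ?orbT // linear0 andbT; case: eqP => // mn; rewrite mn ltnNge np in mp.
  by have := eb (Ordinal mp, Ordinal np, u); rewrite /pbw /= => ->; rewrite andbT.
exists beta; last by move=> m u mp; rewrite bm /B eqxx mp.
have q0 := q_neq0 H.
have hb' m u : (m.+1 < p)%N -> b m.+1 u + sn m.+1%:R * sn (u + m%:R) * b m u = q ^- 2 * b m.+1 (u - 2%:R).
  by move=> mp; rewrite hb // mulKf // expf_neq0.
move=> x; have [c ->] := pbw_expand H U x; split.
- rewrite mulr_suml mulr_sumr !linear_sum mulr_sumr; apply: eq_bigr => -[[m n] u] _.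
  rewrite -scalerAl -scalerAr !linearZ /= [RHS]mulrCA; congr (_ * _).
  rewrite /pbw (mono_e H U) (e_mono H U) linearD linearZ /= !bm /B /=.
  case: m n => [[|m] mp] [n np] /=; first by rewrite sn0 mul0r scale0r addr0 /= mulr0.
  rewrite eqSS mp andbT (ltnW mp) andbT; case: eqP => [<-|_]; last by rewrite scaler0 addr0 mulr0.
  by rewrite hb //; congr (_ * (_ + _ * sn _ * _)); rewrite mulrS; ring.
- rewrite mulr_suml mulr_sumr !linear_sum mulr_sumr; apply: eq_bigr => -[[m n] u] _.
  rewrite -scalerAl -scalerAr !linearZ /= [RHS]mulrCA; congr (_ * _).
  rewrite /pbw (mono_f H U) f_mono linearD linearZ /= !bm /B /=.
  case: n => [[|n] np] /=; first by rewrite sn0 mul0r scale0r addr0 /= mulr0.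
  rewrite eqSS; case: eqP => [->|_]; last by rewrite scaler0 addr0 mulr0.
  have := hb' n (u + 2%:R) np; rewrite np /= (ltnW np) addrK => <-.
  by have -> : u + 2%:R + n%:R = u + n.+1%:R + 1 by rewrite mulrS; ring.
- rewrite mulr_suml mulr_sumr !linear_sum; apply: eq_bigr => -[[m n] u] _.
  rewrite -scalerAl -scalerAr !linearZ /=; congr (_ * _).
  rewrite /pbw (mono_k H U) (k_mono H U) !linearZ /= !bm /B.
  by case: eqP => [->|_]; rewrite ?addrK // !scaler0.
Qed.

Variable z0 : F.
Hypothesis z0n : z0 != 0.

(** The coefficients of the Radford image of a form with diagonal values b, where [z0] collects the
    normalisation of the cointegral. *)
Definition coefQ (b : nat -> Z -> F) (m : nat) (w : Z) : F :=
  fac m * z0 * (sgn (m.+1%:R - w) * chr (m.+1%:R - w)) * b (p.-1 - m)%N (m.+1%:R - w).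

Lemma chr2 u : chr (u + 2%:R) = q ^+ 2 * chr u.
Proof. by rewrite (chrD H) (chr_nat H) mulrC. Qed.

Lemma sgnD2 u : sgn (u + 2%:R) = sgn u.
Proof. by rewrite (sgnD H) (sgn_nat H) expr2 mulN1r opprK mulr1. Qed.

(** The central recursion for [coefQ b] in row m is a nonzero multiple of the trace recursion for b
    in row p - 2 - m. This turns q-characters into central families and, through [coefQinv], back
    again. *)
Lemma coefQ_step b (m : nat) (w : Z) : (m.+1 < p)%N -> let M := (p.-1 - m.+1)%N in
  coefQ b m (w + 1) - coefQ b m (w - 1) - sn w * coefQ b m.+1 w =
  fac m * z0 * (sgn (m%:R - w) * chr (m%:R - w)) *
  (b M.+1 (m%:R - w + 2%:R - 2%:R) - q ^+ 2 * (b M.+1 (m%:R - w + 2%:R)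
     + sn M.+1%:R * sn (m%:R - w + 2%:R + M%:R) * b M (m%:R - w + 2%:R))).
Proof.
move=> mp M; rewrite /coefQ -/M.
have -> : (p.-1 - m = M.+1)%N by rewrite /M; lia.
have -> : m.+1%:R - (w + 1) = m%:R - w by rewrite mulrS; ring.
have -> : m.+1%:R - (w - 1) = m%:R - w + 2%:R by rewrite mulrS; ring.
have -> : m.+2%:R - w = m%:R - w + 2%:R by rewrite !mulrS; ring.
have -> : sn M.+1%:R = sn m.+1%:R.
  by rewrite -(sn_compl H (n := m.+1)) ?(ltnW mp) //; congr (sn _%:R); rewrite /M; lia.
have -> : sn (m%:R - w + 2%:R + M%:R) = sn w.
  have -> : M%:R = pz - m%:R - 2%:R.
    have -> : pz = (M + m + 2)%:R by congr _%:R; rewrite /M; lia.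
    by rewrite !natrD; ring.
  have -> : m%:R - w + 2%:R + (pz - m%:R - 2%:R) = pz - w by ring.
  by rewrite snDp // snN opprK.
rewrite chr2 sgnD2 facS addrK; ring.
Qed.

Lemma central_coefQ b : qtrace_rec b -> central_coef q (coefQ b).
Proof.
move=> hb m w mp; apply/eqP; rewrite -subr_eq0 coefQ_step //= hb ?subrr ?mulr0 //.
by lia.
Qed.

Definition coefQinv (g : nat -> Z -> F) (n : nat) (u : Z) : F :=
  g (p.-1 - n)%N (pz - n%:R - u) / (fac (p.-1 - n) * z0 * (sgn u * chr u)).

Lemma coefQinvK g m w : (m < p)%N -> coefQ (coefQinv g) m w = g m w.
Proof.
move=> mp; rewrite /coefQ /coefQinv subKn; last by lia.
have -> : pz - (p.-1 - m)%:R - (m.+1%:R - w) = w.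
  have -> : pz = (p.-1 - m)%:R + m.+1%:R by rewrite -natrD; congr _%:R; lia.
  by ring.
have := fac_neq0 H mp; have := sgn_neq0 H (m.+1%:R - w); have := chr_neq0 H (m.+1%:R - w).
by move=> *; field; do !(apply/andP; split).
Qed.

Lemma qtrace_rec_coefQinv g : central_coef q g -> qtrace_rec (coefQinv g).
Proof.
move=> cg M u Mp; set m := (p.-1 - M.+1)%N.
have mp : (m.+1 < p)%N by rewrite /m; lia.
have mp' : (m < p)%N by lia.
have := coefQ_step (coefQinv g) (m%:R - (u - 2%:R)) mp; rewrite !coefQinvK //.
rewrite cg // subrr /= => /esym/eqP; have -> : (p.-1 - m.+1 = M)%N by rewrite /m; lia.
rewrite !mulf_eq0 (negPf (fac_neq0 H (ltnW mp))) (negPf z0n) (negPf (sgn_neq0 H _)) (negPf (chr_neq0 H _)) /=.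
have -> : m%:R - (m%:R - (u - 2%:R)) + 2%:R = u by ring.
by rewrite subr_eq0 => /eqP.
Qed.

Lemma el_coefQ (b : nat -> Z -> F) :
  \sum_(n < p) \sum_(u : Z) (z0 * (sgn u * chr u) * b n u) *:
     mono (p.-1 - n) (p.-1 - n) (- u) = el (coefQ b).
Proof.
rewrite /el /diag [RHS](reindex_inj rev_ord_inj); apply: eq_bigr => n _ /=.
rewrite (reindex_inj oppr_inj); apply: eq_bigr => u _.
have -> : (p - n.+1 = p.-1 - n)%N by lia.
rewrite opprK /coefQ subKn; last by have := ltn_ord n; lia.
have -> : (p.-1 - n).+1%:R - (u + (p.-1 - n)%:R + 1) = - u by rewrite mulrS; ring.
have nz : fac (p.-1 - n) != 0 by apply: fac_neq0 => //; lia.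
by congr (_ *: _); field.
Qed.

Variable r : F.
Hypothesis r2 : r ^+ 2 = (2 * p)%:R.
Hypothesis z0r : z0 * fac p.-1 ^+ 2 = p%:R * r.

(** The left side is the Drinfeld image, the argument on the right the Radford image. In the second
    tensor factor of the Drinfeld element e stands to the left of f, hence the appeal to
    [el_swap]. *)
Lemma el_coefSQ b : qtrace_rec b ->
  \sum_(m < p) \sum_(l : Z) ((fac m ^+ 2)^-1 *
      \sum_(u : Z) chr ((m%:R + u) * (l - m%:R) - m%:R) * b m u) *:
     (e ^+ m * f ^+ m * wproj l) = el (coefS q r (coefQ b)).
Proof.
move=> hb; rewrite -(el_swap H U); last by apply: central_coefS => //; exact: central_coefQ.
apply: eq_bigr => m _; rewrite [RHS](reindex_inj oppr_inj); apply: eq_bigr => l _.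
have mp := ltn_ord m.
rewrite /(mono_of _ _ _) (wproj_swap H U) opprK /coefS; congr (_ *: _).
rewrite mulr_sumr mulr_sumr mulr_suml.
rewrite [RHS](reindex_inj (inv_inj (fun v => subKr (pz - m%:R) v))).
apply: eq_bigr => u _ /=.
rewrite /coefQ subKn; last by lia.
have -> : (p.-1 - m).+1%:R - (pz - m%:R - u) = u.
  have -> : pz = (p.-1 - m).+1%:R + m%:R by rewrite -natrD; congr _%:R; lia.
  by ring.
have -> : - l + m%:R + 1 + (pz - m%:R - u) + pz + m%:R = - l + m%:R + 1 - u.
  by rewrite -[RHS]addr0 -(pp0 H); ring.
have -> : chr ((- l + m%:R + 1) * (pz - m%:R - u)) =
  sgn (- l + m%:R + 1) * chr (- ((- l + m%:R + 1) * (m%:R + u))).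
  by rewrite /sgn -(chrD H); congr chr; ring.
have -> : chr ((m%:R + u) * (l - m%:R) - m%:R) =
  chr (- ((- l + m%:R + 1) * (m%:R + u))) * chr u by rewrite -(chrD H); congr chr; ring.
rewrite (sgnD H) (sgnN H).
have s2 := sgn2 H (- l + m%:R + 1); have t2 := sgn2 H u.
move: (sgn (- l + m%:R + 1)) s2 (sgn u) t2 (chr u) (chr _) (b m u) => s s2 t t2 c d x.
have f1 : fac p.-1 != 0 by apply: fac_neq0; rewrite // ltn_predL.
have f2 : fac m != 0 by apply: fac_neq0.
have pF := p_neq0 H; have r0 : r != 0 by exact: (r_neq0 H r2).
have f3 := fac_compl H mp.
have f4 : fac (p.-1 - m) = fac p.-1 / fac m by rewrite -f3 mulrC mulKf.
have -> : z0 = p%:R * r / fac p.-1 ^+ 2 by rewrite -z0r mulfK // expf_neq0.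
rewrite f4; transitivity ((fac m ^+ 2)^-1 * (s * s) * (t * t) * (d * c * x)).
  by rewrite s2 t2 !mulr1.
by field; rewrite f1 f2 pF r0.
Qed.

End QuantumTraces.

(** * Drinfeld and Radford maps *)

Section Tensor.
Variables (K : fieldType) (V W : vectType K).
Implicit Types (a : V) (b : W).

Lemma tpureDl a a' b : tpure (a + a') b = tpure a b + tpure a' b.
Proof. by apply/matrixP => i j; rewrite !mxE linearD mulrDl. Qed.

Lemma tpureDr a b b' : tpure a (b + b') = tpure a b + tpure a b'.
Proof. by apply/matrixP => i j; rewrite !mxE linearD mulrDr. Qed.

Lemma tpureZl c a b : tpure (c *: a) b = c *: tpure a b.
Proof. by apply/matrixP => i j; rewrite !mxE linearZ /= mulrA. Qed.

Lemma tpureZr c a b : tpure a (c *: b) = c *: tpure a b.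
Proof. by apply/matrixP => i j; rewrite !mxE linearZ /= mulrCA. Qed.

Lemma eq_tlift (X : lmodType K) (f g : V -> W -> X) t :
  (forall a b, f a b = g a b) -> tlift f t = tlift g t.
Proof. by move=> fg; apply: eq_bigr => i _; apply: eq_bigr => j _; rewrite fg. Qed.

Lemma tlift_linear (X : lmodType K) (f : V -> W -> X) : linear (tlift f).
Proof.
move=> c x y; rewrite /tlift scaler_sumr -big_split; apply: eq_bigr => i _ /=.
rewrite scaler_sumr -big_split; apply: eq_bigr => j _ /=.
by rewrite !mxE scalerDl scalerA.
Qed.

HB.instance Definition _ (X : lmodType K) (f : V -> W -> X) :=
  GRing.isLinear.Build K (tens K V W) X _ (tlift f) (tlift_linear f).

End Tensor.

Section TensorAlgebra.
Variables (K : fieldType) (A : falgType K).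
Implicit Types (x y : tens K A A) (a b : A).

Lemma tmul_linearr x : linear (tmul x).
Proof.
move=> c y y'; rewrite {1}/tmul (eq_tlift (g := fun a b =>
    c *: tlift (fun a' b' => tpure (a * a') (b * b')) y +
    tlift (fun a' b' => tpure (a * a') (b * b')) y')) => [|a b]; last exact: linearP.
rewrite /tmul /tlift -/(tlift _ y) scaler_sumr -big_split; apply: eq_bigr => i _ /=.
rewrite scaler_sumr -big_split; apply: eq_bigr => j _ /=.
by rewrite scalerDr !scalerA mulrC.
Qed.

HB.instance Definition _ x :=
  GRing.isLinear.Build K (tens K A A) (tens K A A) _ (tmul x) (tmul_linearr x).

Lemma tmul_suml (J : Type) (s : seq J) (P : pred J) (x : J -> tens K A A) y :
  tmul (\sum_(i <- s | P i) x i) y = \sum_(i <- s | P i) tmul (x i) y.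
Proof. by rewrite /tmul linear_sum. Qed.

Lemma tmul_sumr (J : Type) (s : seq J) (P : pred J) (x : J -> tens K A A) y :
  tmul y (\sum_(i <- s | P i) x i) = \sum_(i <- s | P i) tmul y (x i).
Proof. exact: (linear_sum (tmul y)). Qed.

Lemma tmulZr c x y : tmul x (c *: y) = c *: tmul x y.
Proof. by have := tmul_linearr x c y 0; rewrite addr0 (linear0 (tmul x)) addr0. Qed.

Lemma tmulZl c x y : tmul (c *: x) y = c *: tmul x y.
Proof. by rewrite /tmul linearZ. Qed.

Lemma tmulDl x x' y : tmul (x + x') y = tmul x y + tmul x' y.
Proof. by rewrite /tmul linearD. Qed.

Lemma tmul_pure a b a' b' : tmul (tpure a b) (tpure a' b') = tpure (a * a') (b * b').
Proof.
rewrite /tmul (eq_tlift (g := fun a b => tpure (a * a') (b * b'))) => [|c d].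
  rewrite tlift_pure // => y c x z; first by rewrite mulrDl -scalerAl tpureDl tpureZl.
  by rewrite mulrDl -scalerAl tpureDr tpureZr.
rewrite tlift_pure // => y l x z; first by rewrite mulrDr -scalerAr tpureDl tpureZl.
by rewrite mulrDr -scalerAr tpureDr tpureZr.
Qed.

Definition contr (beta : 'Hom(A, K^o)) : tens K A A -> A := tlift (fun a b => beta a *: b).

HB.instance Definition _ beta := GRing.Linear.on (contr beta).

Lemma contr_sum beta (J : Type) (s : seq J) (P : pred J) (x : J -> tens K A A) :
  contr beta (\sum_(i <- s | P i) x i) = \sum_(i <- s | P i) contr beta (x i).
Proof. exact: (linear_sum (contr beta)). Qed.

Lemma contrZ beta c x : contr beta (c *: x) = c *: contr beta x.
Proof. by have := tlift_linear (fun a b => beta a *: b) c x 0; rewrite addr0 linear0 addr0. Qed.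

Lemma contr_pure beta a b : contr beta (tpure a b) = beta a *: b.
Proof.
rewrite /contr tlift_pure // => [y|x] c u v; last by rewrite scalerDr !scalerA mulrC.
by rewrite linearP /= scalerDl scalerA.
Qed.

Lemma contr_tmul_sum beta (I J : finType) x (y : I -> tens K A A) (z : J -> tens K A A) :
  contr beta (tmul (tmul x (\sum_i y i)) (\sum_j z j)) =
  \sum_i \sum_j contr beta (tmul (tmul x (y i)) (z j)).
Proof.
have -> : tmul x (\sum_i y i) = \sum_i tmul x (y i) by exact: tmul_sumr.
rewrite tmul_suml contr_sum; apply: eq_bigr => i _.
by rewrite tmul_sumr contr_sum.
Qed.

Lemma contr_tmul_pure beta c c' a b a' b' a'' b'' :
  contr beta (tmul (tmul (c *: tpure a b) (c' *: tpure a' b')) (tpure a'' b'')) =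
  (c * c' * beta (a * a' * a'')) *: (b * b' * b'').
Proof.
rewrite tmulZl tmulZr tmul_pure scalerA tmulZl tmul_pure contrZ contr_pure scalerA //.
Qed.

End TensorAlgebra.

(** * Gaussian binomials for powers of the coproduct *)

Section GaussianBinomial.
Variables (F : fieldType) (p : nat) (q : F).
Local Notation fac := (@fac F p q).
Local Notation sn := (@sn F p q).
Hypothesis H : even_root p q.

(** The coefficient of x^r y^(n-r) in (x + y)^n when y x = q^2 x y; this normalisation is not the
    symmetric one of [qbin]. *)
Fixpoint gbin (n r : nat) : F :=
  if n is n'.+1 then q ^+ (2 * r) * gbin n' r + (if r is j.+1 then gbin n' j else 0)
  else (r == 0)%N%:R.

Lemma gbin_gt n r : (n < r)%N -> gbin n r = 0.
Proof.
elim: n r => [|n IH] [|r] //= nr.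
by rewrite !IH ?mulr0 ?addr0 // ltnW.
Qed.

Lemma gbin_fac n r : (n < p)%N -> (r <= n)%N ->
  gbin n r * (fac r * fac (n - r)) = fac n * q ^+ (r * (n - r)).
Proof.
elim: n r => [|n IH] r np rn.
  by rewrite leqn0 in rn; rewrite (eqP rn) /= !fac0 !mulr1.
have IH' j : (j <= n)%N -> gbin n j * (fac j * fac (n - j)) = fac n * q ^+ (j * (n - j)).
  by move=> jn; rewrite IH // ltnW.
have q0 := q_neq0 H.
have snq m : sn m%:R = q ^+ m - q ^- m by rewrite /sn (chrN H) (chr_nat H).
case: r rn => [|r] rn /=.
  have := IH' 0%N isT; rewrite !subn0 !muln0 !fac0 expr0 !mulr1 !mul1r addr0.
  by rewrite facS !mulrA => ->.
rewrite subSS.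
have [->|rn'] := eqVneq r n.
  have := IH' n (leqnn n); rewrite subnn muln0 fac0 expr0 !mulr1 (gbin_gt (ltnSn n)) mulr0 add0r.
  by rewrite facS !mulrA => ->; rewrite muln0 expr0 mulr1.
have e1 := IH' r.+1 ltac:(lia); have e2 := IH' r ltac:(lia).
have nr : (n - r = (n - r.+1).+1)%N by lia.
set M := (n - r.+1)%N in e1 nr *.
rewrite nr in e2 *.
transitivity (q ^+ (2 * r.+1) * sn M.+1%:R * (gbin n r.+1 * (fac r.+1 * fac M)) +
   sn r.+1%:R * (gbin n r * (fac r * fac M.+1))); first by rewrite !facS; ring.
rewrite e1 e2 [fac n.+1]facS.
have -> : n.+1 = (r.+1 + M.+1)%N by lia.
rewrite !snq; have -> : (2 * r.+1 = r.+1 + r.+1)%N by lia.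
rewrite !mulSn !mulnS.
rewrite !exprD !exprS.
field; do ?(apply/andP; split) => //; exact: expf_neq0.
Qed.

(** For n = p - 1 the factorials cancel by [fac_compl]. *)
Lemma gbin_pred r : (r < p)%N -> gbin p.-1 r = q ^+ (r * (p.-1 - r)).
Proof.
move=> rp; have p0 := even_root_gt0 H.
have := @gbin_fac p.-1 r; rewrite ltn_predL p0 fac_compl // => /(_ isT) h.
have f0 : fac p.-1 != 0 by apply: fac_neq0; rewrite // ltn_predL.
have rp' : (r <= p.-1)%N by lia.
apply: (mulIf f0); rewrite (h rp'); exact: mulrC.
Qed.

Lemma gbin_pascal (X : lmodType F) (T : nat -> X) n :
  \sum_(r < n.+1) (q ^+ (2 * r) * gbin n r) *: T r + \sum_(r < n.+1) gbin n r *: T r.+1 =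
  \sum_(r < n.+2) gbin n.+1 r *: T r.
Proof.
under [RHS]eq_bigr do rewrite /= scalerDl.
rewrite big_split /= [X in _ = X + _]big_ord_recr /= (gbin_gt (ltnSn n)) mulr0 scale0r addr0; congr (_ + _).
by rewrite [RHS]big_ord_recl /= scale0r add0r; apply: eq_bigr => i _; rewrite /bump add1n.
Qed.

End GaussianBinomial.

(** * Coproduct of the cointegral *)

Section HopfContraction.
Variables (F : fieldType) (p : nat) (q : F) (A : falgType F) (e f k : A).
Local Notation Z := 'Z_(2 * p).
Local Notation pz := (p%:R : Z).
Local Notation chr := (@chr F p q).
Local Notation sgn := (@sgn F p q).
Local Notation wproj := (@wproj F p q A k).
Local Notation mono := (@mono F p q A e f k).
Local Notation gbin := (@gbin F q).
Variable h : hopf_algebra A.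
Hypothesis H : even_root p q.
Hypothesis U : uq_generators p q e f k.
Let ki := k ^+ (2 * p).-1.
Hypothesis comul_e : hopf_comul h e = tpure 1 e + tpure e k.
Hypothesis comul_f : hopf_comul h f = tpure ki f + tpure f 1.
Hypothesis comul_k : hopf_comul h k = tpure k k.

Lemma ki_fn n : ki * f ^+ n = (q ^+ (2 * n)) *: (f ^+ n * ki).
Proof.
elim: n => [|n IH]; first by rewrite muln0 !expr0 scale1r mul1r mulr1.
rewrite exprSr mulrA IH -scalerAl -[f ^+ n * ki * f]mulrA.
rewrite (uq_ke (uq_swap H U)) -scalerAr scalerA -exprD !mulrA.
by congr (q ^+ _ *: _); lia.
Qed.

Lemma comul_fn n : hopf_comul h (f ^+ n) =
  \sum_(r < n.+1) gbin n r *: tpure (f ^+ r * ki ^+ (n - r)) (f ^+ (n - r)).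
Proof.
elim: n => [|n IH]; first by rewrite big_ord1 /= scale1r !expr0 mul1r hopf_comul1.
rewrite exprS hopf_comulM IH comul_f tmulDl.
rewrite -(gbin_pascal _ (fun r => tpure (f ^+ r * ki ^+ (n.+1 - r)) (f ^+ (n.+1 - r)))).
rewrite !linear_sum /=; congr (_ + _); apply: eq_bigr => r _; rewrite linearZ /= tmul_pure.
  rewrite mulrA ki_fn -scalerAl tpureZl scalerA [_ * gbin _ _]mulrC -mulrA -!exprS.
  by rewrite subSn // -ltnS.
by rewrite mul1r mulrA -exprS subSS.
Qed.

Lemma comul_en n : hopf_comul h (e ^+ n) =
  \sum_(r < n.+1) gbin n r *: tpure (e ^+ r) (e ^+ (n - r) * k ^+ r).
Proof.
elim: n => [|n IH]; first by rewrite big_ord1 /= scale1r !expr0 mul1r hopf_comul1.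
rewrite exprSr hopf_comulM IH comul_e linearD /=.
rewrite -(gbin_pascal _ (fun r => tpure (e ^+ r) (e ^+ (n.+1 - r) * k ^+ r))).
rewrite !tmul_suml /=; congr (_ + _); apply: eq_bigr => r _; rewrite tmulZl tmul_pure.
  rewrite mulr1 -mulrA (kn_e H U) -scalerAr tpureZr scalerA [_ * gbin _ _]mulrC mulrA -!exprSr.
  by rewrite subSn // -ltnS.
by rewrite -mulrA -!exprSr subSS.
Qed.

Lemma comul_kn n : hopf_comul h (k ^+ n) = tpure (k ^+ n) (k ^+ n).
Proof.
elim: n => [|n IH]; first by rewrite !expr0 hopf_comul1.
by rewrite !exprS hopf_comulM IH comul_k tmul_pure.
Qed.

Lemma fke_wproj r s n u : f ^+ r * ki ^+ n * e ^+ s * wproj u =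
  chr (- (n%:R * (u + 2%:R * s%:R))) *: mono r s u.
Proof.
rewrite -[_ * e ^+ s * wproj u]mulrA (en_wproj H U) mulrA -[_ * ki ^+ n * wproj _]mulrA.
have -> : ki ^+ n * wproj (u + 2%:R * s%:R) = chr (- (n%:R * (u + 2%:R * s%:R))) *: wproj (u + 2%:R * s%:R).
  have := kn_wproj H (uq_swap H U) n (- (u + 2%:R * s%:R)).
  rewrite !(wproj_swap H U) opprK => ->.
  by congr (chr _ *: _); ring.
rewrite -scalerAr -scalerAl /mono; congr (_ *: _).
by rewrite -!mulrA (en_wproj H U).
Qed.

Lemma ek_wproj m n s u : f ^+ m * e ^+ n * k ^+ s * wproj u = chr (u * s%:R) *: mono m n u.
Proof. by rewrite -[_ * wproj u]mulrA (kn_wproj H U) -scalerAr. Qed.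

Let wsum (x : A) : x = \sum_(u : Z) x * wproj u.
Proof. by rewrite -mulr_sumr (sum_wproj H U) mulr1. Qed.

(** The form kills off-diagonal monomials, which leaves equal powers of f and e in the first factor.
    The sum of the k^j tensor k^j pairs the weights u and v to a character sum that selects v =
    -u. *)
Lemma contr_comul_cointegral beta : qtrace q e f k beta ->
  contr beta (hopf_comul h (f ^+ p.-1 * e ^+ p.-1 * \sum_(j : Z) k ^+ j)) =
  \sum_(n < p) \sum_(u : Z) ((2 * p)%:R * (sgn u * chr u) * beta (mono n n u)) *:
     mono (p.-1 - n) (p.-1 - n) (- u).
Proof.
move=> qb; have p0 := even_root_gt0 H.
have comul_ksum : hopf_comul h (\sum_(j : Z) k ^+ j) = \sum_(j : Z) tpure (k ^+ j) (k ^+ j).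
  by rewrite linear_sum; apply: eq_bigr => j _; rewrite /= comul_kn.
rewrite !hopf_comulM comul_fn comul_en (prednK p0) comul_ksum.
pose T (r : 'I_p) := gbin p.-1 r *: tpure (f ^+ r * ki ^+ (p.-1 - r)) (f ^+ (p.-1 - r)).
have -> (y : tens F A A) : tmul (\sum_(r < p) T r) y = \sum_(r < p) tmul (T r) y.
  exact: tmul_suml.
rewrite tmul_suml contr_sum; apply: eq_bigr => r _; rewrite /T.
have M1 : (p.-1 - r < p)%N by lia.
rewrite contr_tmul_sum.
rewrite (bigD1 r) //= [X in _ + X]big1 ?addr0; last first.
  move=> s sr; rewrite big1 // => j _.
  rewrite contr_tmul_pure [_ * k ^+ j]wsum linear_sum big1 ?mulr0 ?scale0r // => u _ /=.
  rewrite -mulrA (kpow_wproj H U) -scalerAr fke_wproj !linearZ /=.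
  by rewrite (qtrace_offdiag H U) ?scaler0 // eq_sym.
under eq_bigr do rewrite contr_tmul_pure (gbin_pred H (ltn_ord r)) -scalerA.
rewrite -scaler_sumr.
set M := (p.-1 - r)%N.
transitivity ((q ^+ (r * M) * q ^+ (r * M)) *: \sum_(j : Z) \sum_(u : Z) \sum_(v : Z)
    (chr (j * (u + v)) * (chr (v * r%:R - M%:R * (u + 2%:R * r%:R)) * beta (mono r r u)))
      *: mono M M v).
  congr (_ *: _); apply: eq_bigr => j _.
  rewrite [X in beta X]wsum linear_sum scaler_suml; apply: eq_bigr => u _ /=.
  rewrite [X in _ *: X]wsum scaler_sumr; apply: eq_bigr => v _ /=.
  rewrite -mulrA (kpow_wproj H U) -scalerAr fke_wproj !linearZ /= !mulrA.
  rewrite -[_ * wproj v]mulrA (kpow_wproj H U) -scalerAr ek_wproj !scalerA.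
  congr (_ *: _); rewrite -[_ *: beta _]/(_ * beta _).
  have -> : chr (j * (u + v)) = chr (u * j) * chr (v * j) by rewrite -(chrD H); congr chr; ring.
  by rewrite (chrD H (v * r%:R)); ring.
rewrite exchange_big scaler_sumr; apply: eq_bigr => u _ /=.
rewrite exchange_big /=.
under eq_bigr => v _ do rewrite -scaler_suml -mulr_suml (chr_sum H).
rewrite (bigD1 (- u)) //= [X in _ *: (_ + X)]big1 ?addr0; last first.
  by move=> v vu; rewrite addrC addr_eq0 (negPf vu) mul0r scale0r.
rewrite subrr eqxx scalerA; congr (_ *: _).
rewrite -exprD -(chr_nat H).
have -> : sgn u * chr u = chr ((r * M + r * M)%:R + (- u * r%:R - M%:R * (u + 2%:R * r%:R))).
  rewrite /sgn -(chrD H); congr chr.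
  have e1 : pz = M%:R + r%:R + 1.
    by rewrite -[1]/(1%:R) -!natrD; congr _%:R; rewrite /M; have := ltn_ord r; lia.
  rewrite !natrD natrM -[LHS](addr0 _) -(mulr0 (- u)) -(pp0 H) e1; ring.
by rewrite (chrD H (r * M + r * M)%:R); ring.
Qed.

End HopfContraction.

(** * The Drinfeld, Radford and ribbon formulas in weight coordinates *)

Section ScaledGenerators.
Variables (F : fieldType) (p : nat) (q : F) (A : falgType F) (E G k : A).
Local Notation Z := 'Z_(2 * p).
Local Notation pz := (p%:R : Z).
Local Notation chr := (@chr F p q).
Local Notation sn := (@sn F p q).
Local Notation sgn := (@sgn F p q).
Local Notation fac := (@fac F p q).
Local Notation th := (q - q^-1).
Local Notation e := (th *: E).
Local Notation f := (th *: G).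
Local Notation wproj := (@wproj F p q A k).
Local Notation mono := (@mono F p q A e f k).
Local Notation el := (@el F p q A e f k).
Hypothesis H : even_root p q.
Hypothesis U : uq_generators p q e f k.
Let p0 := even_root_gt0 H.

Lemma th_sn : th = sn 1.
Proof. by rewrite /sn (chrN H) (chr_nat H 1) expr1. Qed.

Lemma th_neq0 : th != 0.
Proof. by rewrite th_sn (_ : 1 = 1%:R) // (sn_nat_neq0 H) // (even_root_gt1 H). Qed.

Definition qnum (n : nat) : F := (q ^+ n - q ^- n) / (q - q^-1).

Definition qfac (n : nat) : F := \prod_(1 <= i < n.+1) qnum i.

Lemma fac_qfac n : fac n = th ^+ n * qfac n.
Proof.
rewrite /qfac; elim: n => [|n IH]; first by rewrite big_nil fac0 expr0 mulr1.
have t0 := th_neq0.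
rewrite facS big_nat_recr // IH /qnum exprS /sn (chrN H) (chr_nat H) /=.
rewrite [th * _]mulrC -!mulrA; congr (_ * _); rewrite [RHS]mulrCA; congr (_ * _).
by rewrite [RHS]mulrC divfK.
Qed.

Lemma qfac_neq0 n : (n < p)%N -> qfac n != 0.
Proof.
by move=> np; apply: contraNneq (fac_neq0 H np) => e0; rewrite fac_qfac e0 mulr0.
Qed.

Lemma sum_nat_Z (V : nmodType) (g : nat -> V) :
  \sum_(0 <= i < 2 * p) g i = \sum_(i : Z) g i.
Proof. by rewrite -(big_mkord xpredT) (Zp_cast (even_root_gt1N H)). Qed.

Lemma FEK m n j : G ^+ m * E ^+ n * k ^+ j =
  (th ^- (m + n)) *: \sum_(u : Z) chr (u * j%:R) *: mono m n u.
Proof.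
have t0 := th_neq0.
rewrite (kpow_sum H U) mulr_sumr scaler_sumr; apply: eq_bigr => u _.
rewrite /mono !exprZn -!scalerAr -!scalerAl !scalerA; congr (_ *: _).
by rewrite mulrAC -exprD [(n + m)%N]addnC mulVf ?mul1r ?expf_neq0.
Qed.

Lemma EFK m n j : E ^+ m * G ^+ n * k ^+ j =
  (th ^- (m + n)) *: \sum_(u : Z) chr (u * j%:R) *: (e ^+ m * f ^+ n * wproj u).
Proof.
have t0 := th_neq0.
rewrite (kpow_sum H U) mulr_sumr scaler_sumr; apply: eq_bigr => u _.
rewrite !exprZn -!scalerAr -!scalerAl !scalerA; congr (_ *: _).
by rewrite mulrAC -exprD [(n + m)%N]addnC mulVf ?mul1r ?expf_neq0.
Qed.

(** The sum over j is a character sum that selects i = m + u. *)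
Lemma drinfeld_scalar (b : Z -> F) (m l : Z) :
  (2 * p)%:R^-1 * (\sum_(i : Z) \sum_(j : Z) chr (m * j - m - m * i - i * j) *
     (\sum_(u : Z) chr (u * j) * b u) * chr (l * i)) =
  \sum_(u : Z) chr ((m + u) * (l - m) - m) * b u.
Proof.
have N0 := even_root_char H.
apply: (mulfI N0); rewrite mulrA divff // mul1r mulr_sumr.
transitivity (\sum_(i : Z) \sum_(u : Z) (\sum_(j : Z) chr (j * (m - i + u))) *
    (chr (l * i - m - m * i) * b u)).
  apply: eq_bigr => i _.
  under eq_bigr do rewrite mulr_sumr mulr_suml.
  rewrite exchange_big; apply: eq_bigr => u _; rewrite mulr_suml; apply: eq_bigr => j _ /=.
  have -> : chr (m * j - m - m * i - i * j) = chr (j * (m - i + u)) * chr (- m - m * i) * chr (- (u * j)).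
    by rewrite -!(chrD H); congr chr; ring.
  have -> : chr (l * i - m - m * i) = chr (- m - m * i) * chr (l * i).
    by rewrite -!(chrD H); congr chr; ring.
  by rewrite (chrN H (u * j)); field; rewrite (chr_neq0 H).
rewrite exchange_big; apply: eq_bigr => u _ /=.
under eq_bigr do rewrite (chr_sum H).
rewrite (bigD1 (m + u)) //= [X in _ + X]big1 ?addr0 => [|i iu].
  have -> : m - (m + u) + u = 0 by ring.
  by rewrite eqxx; congr (_ * (chr _ * _)); ring.
rewrite ifF ?mul0r //; apply: contraNF iu; rewrite -addrAC subr_eq0 => /eqP->.
by rewrite eqxx.
Qed.

(** The exponent W is prescribed for m = n only, since the form kills F^m E^n K^j otherwise; on the
    diagonal the half-integral powers of q have become integral. *)
Lemma contr_drinfeld (W : nat -> nat -> nat -> nat -> F) beta : qtrace q e f k beta ->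
    (forall m i j, W m m i j = chr (m%:R * j%:R - m%:R - m%:R * i%:R - i%:R * j%:R)) ->
  contr beta ((2%:R * p%:R)^-1 *:
    \sum_(0 <= m < p) \sum_(0 <= n < p) \sum_(0 <= i < 2 * p) \sum_(0 <= j < 2 * p)
      (th ^+ (m + n) / (qfac m * qfac n) * W m n i j) *:
      tpure (G ^+ m * E ^+ n * k ^+ j) (E ^+ m * G ^+ n * k ^+ i)) =
  \sum_(m < p) \sum_(l : Z) ((fac m ^+ 2)^-1 *
      \sum_(u : Z) chr ((m%:R + u) * (l - m%:R) - m%:R) * beta (mono m m u)) *:
     (e ^+ m * f ^+ m * wproj l).
Proof.
move=> qb hW; have t0 := th_neq0.
rewrite contrZ contr_sum big_mkord scaler_sumr.
apply: eq_bigr => m _; have mp := ltn_ord m.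
rewrite contr_sum big_mkord (bigD1 m) //= [X in _ *: (_ + X)]big1 ?addr0; last first.
  move=> n nm; rewrite contr_sum big1 // => i _; rewrite contr_sum big1 // => j _.
  have b0 : beta (G ^+ m * E ^+ n * k ^+ j) = 0.
    rewrite FEK linearZ /= linear_sum big1 ?scaler0 // => u _.
    by rewrite linearZ /= (qtrace_offdiag H U) ?scaler0 // eq_sym.
  by rewrite contrZ contr_pure b0 scale0r scaler0.
rewrite contr_sum sum_nat_Z.
transitivity ((2 * p)%:R^-1 *: \sum_(i : Z) \sum_(j : Z) \sum_(l : Z)
   ((fac m ^+ 2)^-1 * (chr (m%:R * j - m%:R - m%:R * i - i * j) *
     (\sum_(u : Z) chr (u * j) * beta (mono m m u)) * chr (l * i))) *:
     (e ^+ m * f ^+ m * wproj l)).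
  rewrite natrM; congr (_ *: _); apply: eq_bigr => i _; rewrite contr_sum sum_nat_Z; apply: eq_bigr => j _.
  rewrite contrZ contr_pure FEK EFK !scalerA scaler_sumr.
  apply: eq_bigr => l _; rewrite scalerA; congr (_ *: _).
  have -> : beta (th ^- (m + m) *: \sum_(u : Z) chr (u * j%:R) *: mono m m u) =
      th ^- (m + m) * \sum_(u : Z) chr (u * j) * beta (mono m m u).
    rewrite linearZ linear_sum /=; congr (_ * _); apply: eq_bigr => u _.
    by rewrite linearZ /= (natrZ H).
  rewrite hW !(natrZ H) fac_qfac; have f0 := qfac_neq0 mp.
  move: (\sum_(u : Z) _) (chr _) (chr _) => X c d.
  by rewrite exprD; field; rewrite f0 expf_neq0.
under [X in _ *: X = _]eq_bigr => i _ do rewrite exchange_big /=.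
rewrite exchange_big scaler_sumr; apply: eq_bigr => l _ /=.
under [X in _ *: X = _]eq_bigr => i _ do rewrite -scaler_suml.
rewrite -scaler_suml scalerA; congr (_ *: _).
rewrite -drinfeld_scalar [RHS]mulrCA; congr (_ * _).
by rewrite mulr_sumr; apply: eq_bigr => i _; rewrite mulr_sumr.
Qed.

Variable hf : hopf_algebra A.
Hypothesis comul_E : hopf_comul hf E = tpure 1 E + tpure E k.
Hypothesis comul_G : hopf_comul hf G = tpure (k ^+ (2 * p).-1) G + tpure G 1.
Hypothesis comul_k : hopf_comul hf k = tpure k k.

Lemma contr_radford (c : F) beta : c / fac p.-1 ^+ 2 * (2 * p)%:R != 0 -> qtrace q e f k beta ->
  contr beta (hopf_comul hf ((c / qfac p.-1 ^+ 2) *: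
    (G ^+ p.-1 * E ^+ p.-1 * \sum_(0 <= j < 2 * p) k ^+ j))) =
  el (coefQ q (c / fac p.-1 ^+ 2 * (2 * p)%:R) (fun m u => beta (mono m m u))).
Proof.
move=> z0 qb; have t0 := th_neq0.
have -> : G ^+ p.-1 * E ^+ p.-1 * \sum_(0 <= j < 2 * p) k ^+ j =
   (th ^- (p.-1 + p.-1)) *: (f ^+ p.-1 * e ^+ p.-1 * \sum_(j : Z) k ^+ j).
  rewrite sum_nat_Z !exprZn -!scalerAr -!scalerAl !scalerA -exprD mulVf ?scale1r //.
  exact: expf_neq0.
rewrite scalerA linearZ /= contrZ (contr_comul_cointegral H U) //; first last.
- by rewrite linearZ /= comul_G scalerDr tpureZr tpureZl.
- by rewrite linearZ /= comul_E scalerDr tpureZr tpureZl.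
rewrite -(el_coefQ _ _ _ H) //.
rewrite scaler_sumr; apply: eq_bigr => n _.
rewrite scaler_sumr; apply: eq_bigr => u _; rewrite scalerA; congr (_ *: _).
have f1 : qfac p.-1 != 0 by rewrite qfac_neq0 // ltn_predL.
rewrite fac_qfac; move: (beta _) (sgn _) (chr _) (_%:R) => x y z N.
by rewrite exprD; field; rewrite f1 expf_neq0.
Qed.

Variable h : F.
Hypothesis h2 : h ^+ 2 = q.

(** Completing the square: j is shifted by p + 1 + w. *)
Lemma ribbon_scalar (w : Z) :
  \sum_(j : Z) gauss h (j + pz + 1) * chr (w * j) =
  (\sum_(j : Z) gauss h j) * (sgn w / (gauss h w * chr w)).
Proof.
rewrite [in RHS](reindex_inj (addIr (pz + 1 + w))) mulr_suml; apply: eq_bigr => j _.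
have -> : j + (pz + 1 + w) = j + pz + 1 + w by ring.
rewrite (gaussD H h2 _ w).
have -> : chr ((j + pz + 1) * w) = chr (w * j) * sgn w * chr w.
  by rewrite /sgn -!(chrD H); congr chr; ring.
have := sgn2 H w; move: (sgn w) => s s2.
transitivity (gauss h (j + pz + 1) * chr (w * j) * (s * s)); first by rewrite s2 mulr1.
by field; rewrite (gauss_neq0 H h2) (chr_neq0 H).
Qed.

Lemma ribbon_sum (c : F) (W : nat -> nat -> F) :
    (forall m j, W m j = gauss h (j%:R + pz + 1) * chr (m%:R * j%:R) * h ^- m) ->
    c * \sum_(j : Z) gauss h j = 1 ->
  c *: \sum_(0 <= m < p) \sum_(0 <= j < 2 * p)
    (th ^+ m / qfac m * W m j) *: (G ^+ m * E ^+ m * k ^+ j) = el (@coefV F p q h).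
Proof.
move=> hW hc; have t0 := th_neq0; have h0 := h_neq0 H h2.
rewrite big_mkord /el /diag scaler_sumr; apply: eq_bigr => m _.
have mp := ltn_ord m; rewrite sum_nat_Z.
transitivity (c *: \sum_(j : Z) \sum_(u : Z)
  ((gauss h (j + pz + 1) * chr ((m%:R + u) * j)) * (h ^- m / fac m)) *: mono m m u).
  congr (_ *: _); apply: eq_bigr => j _; rewrite FEK !scaler_sumr.
  apply: eq_bigr => u _; rewrite !scalerA !(natrZ H); congr (_ *: _).
  rewrite hW !(natrZ H) mulrDl (chrD H) fac_qfac; have f0 := qfac_neq0 mp.
  move: (gauss _ _) (chr _) (chr _) => x y z.
  by rewrite exprD; field; rewrite f0 !expf_neq0.
rewrite exchange_big scaler_sumr; apply: eq_bigr => u _ /=.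
rewrite -scaler_suml scalerA -mulr_suml ribbon_scalar !mulrA hc mul1r.
congr (_ *: _); rewrite /coefV (_ : u + m%:R + 1 = (m%:R + u) + 1); last by ring.
rewrite (gaussD H h2 _ 1) (gauss1 H h2) mulr1 [sgn (_ + 1)](sgnD H) (_ : sgn 1 = -1); last first.
  by rewrite (sgn_nat H 1) expr1.
have f0 := fac_neq0 H mp; have g0 := gauss_neq0 H h2 (m%:R + u); have c0 := chr_neq0 H (m%:R + u).
move: (gauss _ _) g0 (chr _) c0 (sgn _) => x x0 y y0 z.
by field; rewrite h0 f0 x0 y0 expf_neq0.
Qed.

End ScaledGenerators.

(** * The restricted quantum group and the operator S on its center *)

Section RestrictedUsl2.
Variables (R : realType) (p : nat) (A : falgType R[i]) (U : restricted_Usl2 p A).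
Hypothesis p1 : (1 < p)%N.
Local Notation q := (qroot R p).
Local Notation Z := 'Z_(2 * p).
Local Notation chr := (@chr _ p q).
Local Notation fac := (@fac _ p q).
Local Notation th := (q - q^-1).
Local Notation E := (UE U).
Local Notation G := (UF U).
Local Notation k := (UK U).
Local Notation e := (th *: UE U).
Local Notation f := (th *: UF U).
Local Notation wproj := (@wproj _ p q A k).
Local Notation mono := (@mono _ p q A e f k).
Local Notation el := (@el _ p q A e f k).
Local Notation r := ((Num.sqrt (2 * p%:R : R))%:C%C : R[i]).
Local Notation h := (hroot R p).
Local Notation S := (hopf_antip (Uhopf U)).

Let H : even_root p q := qroot_even_root R p1.
Let h2 : h ^+ 2 = q := hroot_sq R p1.
Let p0 := even_root_gt0 H.

Lemma KK : k * k ^+ (2 * p).-1 = 1.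
Proof. by rewrite -exprS prednK ?(Uexp_K U) // muln_gt0. Qed.

Lemma UK_unit : k \is a GRing.unit.
Proof.
apply/unitrP; exists (k ^+ (2 * p).-1); split; last exact: KK.
by rewrite -exprSr prednK ?(Uexp_K U) // muln_gt0.
Qed.

Lemma UK_inv : k^-1 = k ^+ (2 * p).-1.
Proof. by rewrite -[LHS]mulr1 -KK mulrA mulVr ?mul1r // UK_unit. Qed.

Lemma UK_E : k * E = (q ^+ 2) *: (E * k).
Proof. by rewrite scalerAl -Urel_KE mulrVK // UK_unit. Qed.

Lemma UK_F : k * G = (q ^- 2) *: (G * k).
Proof. by rewrite scalerAl -Urel_KF mulrVK // UK_unit. Qed.

Lemma U_generators : uq_generators p q e f k.
Proof.
have t0 : th != 0 := th_neq0 H; split; [|exact: Udim U| | |exact: Uexp_K U| | |].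
- apply/eqP; rewrite eqEsubv subvf /= -(Ugen U) agenvS //.
  have gen (c : R[i]) (x : A) (s : seq A) : c != 0 -> c *: x \in s -> x \in span s.
    move=> c0 xs; rewrite -[x](scalerK c0) memvZ //; exact: memv_span.
  apply/span_subvP => x; rewrite !inE => /or3P[]/eqP->.
  + by apply: (gen th) => //; rewrite !inE eqxx.
  + by apply: (gen th) => //; rewrite !inE eqxx orbT.
  + by apply: (gen 1); rewrite ?oner_neq0 // scale1r !inE eqxx !orbT.
- by rewrite exprZn (Uexp_E U) scaler0.
- by rewrite exprZn (Uexp_F U) scaler0.
- by rewrite -scalerAr UK_E -!scalerAl !scalerA mulrC.
- by rewrite -scalerAr UK_F -!scalerAl !scalerA mulrC.
- rewrite -!scalerAl -!scalerAr -!scalerBr Urel_EF !scalerA -UK_inv.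
  by rewrite mulfK.
Qed.

Let UG := U_generators.

Lemma antip_K_inv : S k^-1 = k.
Proof.
have : S k^-1 * S k = 1.
  rewrite -hopf_antipM divrr ?hopf_antip1 //; exact: UK_unit.
rewrite Uantip_K => e1.
by rewrite -[LHS]mulr1 -(mulVr UK_unit) mulrA e1 mul1r.
Qed.

Lemma antip2_e : S (S e) = q ^+ 2 *: e.
Proof.
rewrite !linearZ /= Uantip_E !linearN /= hopf_antipM antip_K_inv Uantip_E.
by rewrite mulrN scalerN opprK mulrA Urel_KE !scalerA mulrC.
Qed.

Lemma antip2_f : S (S f) = q ^- 2 *: f.
Proof.
rewrite !linearZ /= Uantip_F !linearN /= hopf_antipM Uantip_K Uantip_F.
by rewrite mulNr scalerN opprK Urel_KF !scalerA mulrC.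
Qed.

Lemma antip2_k : S (S k) = k.
Proof. by rewrite Uantip_K antip_K_inv. Qed.

(** The elements y for which the condition holds against all x are closed under products and linear
    combinations, so the generators carry it to the PBW basis. *)
Lemma qcharactersP beta : qcharacters U beta <-> qtrace q e f k beta.
Proof.
have scal c y x : beta ((c *: y) * x) = c * beta (y * x) by rewrite -scalerAl linearZ.
split=> [qb x|qb].
  split; first by rewrite qb antip2_e scal.
    by rewrite qb antip2_f scal.
  by rewrite qb antip2_k.
pose P y := forall x, beta (x * y) = beta (S (S y) * x).
have Pe : P e by move=> x; have [-> _ _] := qb x; rewrite antip2_e (scal (q ^+ 2)).
have Pf : P f by move=> x; have [_ -> _] := qb x; rewrite antip2_f (scal (q ^- 2)).
have Pk : P k by move=> x; have [_ _ ->] := qb x; rewrite antip2_k.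
have PM y z : P y -> P z -> P (y * z).
  by move=> Py Pz x; rewrite mulrA Pz mulrA Py !hopf_antipM mulrA.
have PX y n : P y -> P (y ^+ n).
  move=> Py; elim: n => [|n IH]; last by rewrite exprS; exact: PM.
  by move=> x; rewrite expr0 !hopf_antip1 mulr1 mul1r.
have PZ c y : P y -> P (c *: y).
  by move=> Py x; rewrite !linearZ -scalerAr -scalerAl !linearZ /= Py.
have Psum (J : finType) (y : J -> A) : (forall j, P (y j)) -> P (\sum_j y j).
  move=> Py x; rewrite mulr_sumr !linear_sum mulr_suml linear_sum.
  by apply: eq_bigr => j _; exact: Py.
move=> x y; move: y x; rewrite -/(P _) => y; have [c ->] := pbw_expand H UG y.
apply: (Psum) => i; apply: (PZ); apply: (PM); first by apply: (PM); exact: (PX).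
by rewrite wprojE; apply: (PZ); apply: (Psum) => j; apply: (PZ); exact: (PX).
Qed.

Lemma qpow_half (a b : nat) : qpow p ((a%:R - b%:R) / 2 : R) = h ^+ a / h ^+ b.
Proof.
rewrite /qpow /hroot -!expi_natr -expiN -expiD; congr expi.
have pR : p%:R != 0 :> R by rewrite pnatr_eq0; lia.
by rewrite natrM; field.
Qed.

Lemma qpow_chr (a b : nat) : qpow p (a%:R - b%:R : R) = chr (a%:R - b%:R).
Proof.
rewrite (chrD H) (chrN H) !(chr_nat H) -h2 -!exprM -qpow_half; congr (qpow p _).
by rewrite !natrM; field.
Qed.

(** The factor 2p comes from the sum over j in the cointegral; the powers of q - q^-1 are absorbed
    by the rescaling of E and F, which turns the factorials into [fac]. *)
Definition radford_const : R[i] :=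
  (Num.sqrt (p%:R / 2 : R))%:C%C / fac p.-1 ^+ 2 * (2 * p)%:R.

Lemma radford_const_sq : radford_const * fac p.-1 ^+ 2 = p%:R * r.
Proof.
have f1 : fac p.-1 != 0 by apply: fac_neq0; rewrite // ltn_predL.
have -> : r = 2 * (Num.sqrt (p%:R / 2 : R))%:C%C :> R[i].
  have -> : (2 * p%:R : R) = 2 ^+ 2 * (p%:R / 2) by field.
  rewrite sqrtrM ?exprn_ge0 // sqrtr_sqr ger0_norm // rmorphM /=.
  by congr (_ * _); rewrite rmorph_nat.
by rewrite /radford_const natrM; field.
Qed.

Lemma r_sq : r ^+ 2 = (2 * p)%:R :> R[i].
Proof.
have r0 : 0 <= 2 * p%:R :> R by rewrite mulr_ge0 ?ler0n.
by rewrite -rmorphXn /= sqr_sqrtr // -natrM rmorph_nat.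
Qed.

Lemma radford_const_neq0 : radford_const != 0.
Proof.
apply/eqP => z0; have := radford_const_sq; rewrite z0 mul0r => /esym/eqP.
rewrite mulf_eq0 (negPf (p_neq0 H)) /= => /eqP r0.
have := r_sq; rewrite r0 expr0n /= => /esym/eqP.
by rewrite (negPf (even_root_char H)).
Qed.

Lemma drinfeldE beta : qtrace q e f k beta -> drinfeld U beta =
  \sum_(m < p) \sum_(l : Z) ((fac m ^+ 2)^-1 *
      \sum_(u : Z) chr ((m%:R + u) * (l - m%:R) - m%:R) * beta (mono m m u)) *:
     (e ^+ m * f ^+ m * wproj l).
Proof.
move=> qb; rewrite -(contr_drinfeld H UG (W := fun m n i j => qpow p (m%:R * (m%:R - 1) / 2 + n%:R * (n%:R - 1) / 2 - m%:R ^+ 2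
             - m%:R * j%:R + 2 * n%:R * j%:R - 2 * n%:R * i%:R
             - i%:R * j%:R + m%:R * i%:R : R)) qb) // => m i j.
transitivity (qpow p ((m * j)%:R - (m + m * i + i * j)%:R : R)).
  by congr (qpow p _); rewrite !natrD !natrM; field.
by rewrite qpow_chr; congr chr; rewrite !natrD !natrM; ring.
Qed.

Lemma radfordE beta : qtrace q e f k beta ->
  radford U beta = el (coefQ q radford_const (fun m u => beta (mono m m u))).
Proof.
move=> qb; apply: (contr_radford H UG _ _ _ radford_const_neq0 qb).
- exact: Ucomul_E.
- by rewrite -UK_inv; exact: Ucomul_F.
- exact: Ucomul_K.
Qed.

Let r2 := r_sq.

(** A form beta with Drinfeld image [el g] exists: it is built by [coefQinv] from the transform of
    g. For whichever such beta the partial inverse selects, S of the Radford image is the Drinfeld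
    image, and S^2 = 1 identifies the Radford image. *)
Lemma modular_SE g : central_coef q g -> modular_S U (el g) = el (coefS q r g).
Proof.
move=> cg; have cSg := central_coefS H r cg.
have [beta0 qb0 eb0] := qtrace_exists H UG (qtrace_rec_coefQinv H radford_const_neq0 cSg).
have drin beta : qtrace q e f k beta -> drinfeld U beta =
    el (coefS q r (coefQ q radford_const (fun m u => beta (mono m m u)))).
  move=> qb; rewrite drinfeldE //; apply: (el_coefSQ H UG radford_const_neq0 r2 radford_const_sq).
  exact: qtrace_recP.
have d0 : drinfeld U beta0 = el g.
  rewrite drin //; apply: eq_el => m u mp.
  rewrite -(coefSK H u r2 cg mp); apply: eq_coefS => // n v np.
  transitivity (coefQ q radford_const (@coefQinv _ p q radford_const (coefS q r g)) n v).
    by rewrite /coefQ eb0 //; lia.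
  exact: (coefQinvK H radford_const_neq0 _ v np).
rewrite /modular_S; set beta := 'pinv_ _ _ _ _.
have [qb db] : qcharacters U beta /\ drinfeld U beta = el g.
  have im : [set drinfeld U b | b in qcharacters U]%classic (el g).
    by exists beta0 => //; apply/qcharactersP.
  split; last by apply: pinvK; rewrite inE.
  have homo : {homo 'pinv_(fun=> 0) (qcharacters U) (drinfeld U) :
      x / [set drinfeld U b | b in qcharacters U]%classic x >-> qcharacters U x}.
    by apply: funS.
  exact: homo.
move/qcharactersP: qb => qb; rewrite radfordE //; apply: eq_el => m u mp.
have cb := central_coefQ H radford_const_neq0 (qtrace_recP H UG qb).
rewrite -(coefSK H u r2 cb mp); apply: eq_coefS => // n v np.
by apply: (el_inj H UG (g := coefS q r _)) np; rewrite -drin.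
Qed.

Lemma ribbonE : ribbon U = el (@coefV _ p q h).
Proof.
apply: (ribbon_sum H UG h2 (W := fun m j => qpow p (- (m%:R / 2) + m%:R * j%:R + (j%:R + p%:R + 1) ^+ 2 / 2 : R))); last exact: ribbon_const.
move=> m j.
transitivity (qpow p (((2 * (m * j) + (j + p + 1) * (j + p + 1))%:R - m%:R) / 2 : R)).
  by congr (qpow p _); rewrite !natrD !natrM !natrD; field.
rewrite qpow_half; congr (_ / _); rewrite exprD exprM h2 mulrC -(gauss_nat H h2) !natrD.
by congr (_ * _); rewrite -(chr_nat H) natrM.
Qed.

End RestrictedUsl2.

Lemma linear_sum3 (K : pzRingType) (V : lmodType K) (c : K) (x y z x' y' z' : V) :
  (c *: x + x') + (c *: y + y') + (c *: z + z') = c *: (x + y + z) + (x' + y' + z').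
Proof. by rewrite !scalerDr [LHS](AC (2*2*2) (1*3*5*(2*4*6))). Qed.

(** * Characters and the modular relations *)

Section CftBasis.
Variables (R : realType) (p : nat).
Local Notation Zc := (Zcft R p).
Local Notation chip := (chip R p).
Local Notation chim := (chim R p).
Local Notation phi := (phi R p).

(** [cft_extend] with an arbitrary target, so that one construction serves S and T on characters as
    well as the map to the center. *)
Definition cft_ext (V : lmodType R[i]) (fp fm ff : nat -> V) (x : Zc) : V :=
  \sum_(j < p) x (inl (true, j)) *: fp j.+1
  + \sum_(j < p) x (inl (false, j)) *: fm j.+1
  + \sum_(j < p.-1) x (inr j) *: ff j.+1.

Variable V : lmodType R[i].
Implicit Types fp fm ff : nat -> V.

Lemma cft_ext_linear fp fm ff : linear (cft_ext fp fm ff).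
Proof.
have aux n (g : Zc -> 'I_n -> R[i]) (w : nat -> V) c x y :
    (forall j, g (c *: x + y) j = c * g x j + g y j) ->
    \sum_(j < n) g (c *: x + y) j *: w j.+1 =
    c *: (\sum_(j < n) g x j *: w j.+1) + \sum_(j < n) g y j *: w j.+1.
  move=> hg; rewrite scaler_sumr -big_split; apply: eq_bigr => j _ /=.
  by rewrite hg scalerDl scalerA.
move=> c x y; rewrite /cft_ext.
rewrite (aux _ (fun x j => x (inl (true, j)))) => [|j]; last by rewrite !ffunE.
rewrite (aux _ (fun x j => x (inl (false, j)))) => [|j]; last by rewrite !ffunE.
rewrite (aux _ (fun x j => x (inr j))) => [|j]; last by rewrite !ffunE.
exact: linear_sum3.
Qed.

HB.instance Definition _ fp fm ff :=
  GRing.isLinear.Build _ _ _ _ (cft_ext fp fm ff) (cft_ext_linear fp fm ff).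

Let sum_delta n (s : nat) (w : nat -> V) : (0 < s <= n)%N ->
  \sum_(j < n) ((j.+1 == s)%:R : R[i]) *: w j.+1 = w s.
Proof.
case: s => // s sn; rewrite (bigD1 (Ordinal sn)) //= eqxx scale1r big1 ?addr0 // => j.
by rewrite -val_eqE /= eqSS => /negPf->; rewrite scale0r.
Qed.

Let sum_zero n (w : nat -> V) (g : 'I_n -> R[i]) : (forall j, g j = 0) ->
  \sum_(j < n) g j *: w j.+1 = 0.
Proof. by move=> g0; rewrite big1 // => j _; rewrite g0 scale0r. Qed.

Lemma cft_ext_chip fp fm ff s : (0 < s <= p)%N -> cft_ext fp fm ff (chip s) = fp s.
Proof.
move=> sp; rewrite /cft_ext [X in _ + X + _]sum_zero => [|j]; last by rewrite ffunE.
rewrite [X in _ + X]sum_zero => [|j]; last by rewrite ffunE.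
rewrite !addr0 -[RHS](@sum_delta p) //.
by apply: eq_bigr => j _; rewrite ffunE /=.
Qed.

Lemma cft_ext_chim fp fm ff s : (0 < s <= p)%N -> cft_ext fp fm ff (chim s) = fm s.
Proof.
move=> sp; rewrite /cft_ext [X in X + _ + _]sum_zero => [|j]; last by rewrite ffunE.
rewrite [X in _ + X]sum_zero => [|j]; last by rewrite ffunE.
rewrite addr0 add0r -[RHS](@sum_delta p) //.
by apply: eq_bigr => j _; rewrite ffunE /=.
Qed.

Lemma cft_ext_phi fp fm ff s : (0 < s < p)%N -> cft_ext fp fm ff (phi s) = ff s.
Proof.
move=> sp; rewrite /cft_ext [X in X + _ + _]sum_zero => [|j]; last by rewrite ffunE.
rewrite [X in _ + X + _]sum_zero => [|j]; last by rewrite ffunE.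
rewrite !add0r -[RHS](@sum_delta p.-1); last by lia.
by apply: eq_bigr => j _; rewrite ffunE /=.
Qed.

Lemma eq_cft_ext fp fm ff fp' fm' ff' x :
    (forall s, (0 < s <= p)%N -> fp s = fp' s) -> (forall s, (0 < s <= p)%N -> fm s = fm' s) ->
    (forall s, (0 < s < p)%N -> ff s = ff' s) ->
  cft_ext fp fm ff x = cft_ext fp' fm' ff' x.
Proof.
move=> h1 h2 h3; rewrite /cft_ext; congr (_ + _ + _); apply: eq_bigr => j _; congr (_ *: _).
- by apply: h1; have := ltn_ord j; lia.
- by apply: h2; have := ltn_ord j; lia.
- by apply: h3; have := ltn_ord j; lia.
Qed.

Lemma linear_cft_ext (W : lmodType R[i]) (g : {linear V -> W}) fp fm ff x :
  g (cft_ext fp fm ff x) = cft_ext (g \o fp) (g \o fm) (g \o ff) x.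
Proof.
rewrite /cft_ext !linearD !linear_sum /=.
by congr (_ + _ + _); apply: eq_bigr => j _; rewrite linearZ.
Qed.

End CftBasis.

Section CftSelf.
Variables (R : realType) (p : nat).
Local Notation Zc := (Zcft R p).

Lemma cft_ext_id (x : Zc) : cft_ext (chip R p) (chim R p) (phi R p) x = x.
Proof.
apply/ffunP => k; rewrite /cft_ext !ffunE !sum_ffunE.
have kill (n : nat) (g : 'I_n -> R[i]) (w : nat -> Zc) : (forall j : 'I_n, w j.+1 k = 0) ->
    \sum_(j < n) (g j *: w j.+1) k = 0.
  by move=> w0; rewrite big1 // => j _; rewrite ffunE w0 scaler0.
case: k kill => [[[] j]|j] kill.
- rewrite [X in _ + X + _]kill ?[X in _ + X]kill => [|i|i]; rewrite ?ffunE // !addr0.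
  rewrite (bigD1 j) //= !ffunE /= eqxx [_ *: _]mulr1 big1 ?addr0 // => i ij.
  by rewrite !ffunE /= eqSS [_ == _](negPf (_ : j != i)) ?[_ *: _]mulr0 // eq_sym.
- rewrite [X in X + _ + _]kill ?[X in _ + X]kill => [|i|i]; rewrite ?ffunE // add0r addr0.
  rewrite (bigD1 j) //= !ffunE /= eqxx [_ *: _]mulr1 big1 ?addr0 // => i ij.
  by rewrite !ffunE /= eqSS [_ == _](negPf (_ : j != i)) ?[_ *: _]mulr0 // eq_sym.
- rewrite [X in X + _ + _]kill ?[X in _ + X + _]kill => [|i|i]; rewrite ?ffunE // !add0r.
  rewrite (bigD1 j) //= !ffunE /= eqxx [_ *: _]mulr1 big1 ?addr0 // => i ij.
  by rewrite !ffunE /= eqSS [_ == _](negPf (_ : j != i)) ?[_ *: _]mulr0 // eq_sym.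
Qed.

Lemma cft_linear_ext (W : lmodType R[i]) (g h : {linear Zc -> W}) :
    (forall s, (0 < s <= p)%N -> g (chip R p s) = h (chip R p s)) ->
    (forall s, (0 < s <= p)%N -> g (chim R p s) = h (chim R p s)) ->
    (forall s, (0 < s < p)%N -> g (phi R p s) = h (phi R p s)) ->
  forall x, g x = h x.
Proof.
by move=> h1 h2 h3 x; rewrite -(cft_ext_id x) !linear_cft_ext; apply: eq_cft_ext.
Qed.

Lemma chip0 : chip R p 0 = 0. Proof. by apply/ffunP => -[[[] j]|j]; rewrite !ffunE. Qed.
Lemma chim0 : chim R p 0 = 0. Proof. by apply/ffunP => -[[[] j]|j]; rewrite !ffunE. Qed.

End CftSelf.

Section LfunArith.
Variables (K : fieldType) (V W : vectType K).

Lemma hom_Z (L : 'Hom(V, W)) c x : L (c *: x) = c *: L x. Proof. exact: linearZ. Qed.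
Lemma hom_D (L : 'Hom(V, W)) x y : L (x + y) = L x + L y. Proof. exact: linearD. Qed.
Lemma hom_B (L : 'Hom(V, W)) x y : L (x - y) = L x - L y. Proof. exact: linearB. Qed.
Lemma hom_N (L : 'Hom(V, W)) x : L (- x) = - L x. Proof. exact: linearN. Qed.
Lemma hom_sum (L : 'Hom(V, W)) (I : Type) (l : seq I) (P : pred I) (c : I -> K) (x : I -> V) :
  L (\sum_(i <- l | P i) c i *: x i) = \sum_(i <- l | P i) c i *: L (x i).
Proof. by rewrite linear_sum; apply: eq_bigr => i _; rewrite linearZ. Qed.

End LfunArith.

(** * S on the central elements of the families *)

Section ModularAction.
Variables (F : fieldType) (p : nat) (q : F) (A : falgType F) (e f k : A) (r : F).
Local Notation Z := 'Z_(2 * p).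
Local Notation pz := (p%:R : Z).
Local Notation chr := (@chr F p q).
Local Notation cs := (@cs F p q).
Local Notation sgn := (@sgn F p q).
Local Notation el := (@el F p q A e f k).
Local Notation coefS := (@coefS F p q r).
Local Notation coefP := (@coefP F p q).
Local Notation coefM := (@coefM F p q).
Local Notation coefK := (@coefK F p q).
Local Notation coefR := (@coefR F p q).
Local Notation coefF := (@coefF F p q r).
Local Notation sineA := (@sineA F p q r).
Hypothesis H : even_root p q.
Hypothesis r2 : r ^+ 2 = (2 * p)%:R.
Let p0 := even_root_gt0 H.
Let elsum := @el_sum F p q A e f k.
Let ellin := @el_lin F p q A e f k.

Lemma el_coefK_even t : el (coefK (- t)) = el (coefK t).
Proof. by apply: eq_el => m u mp; rewrite coefK_even. Qed.

Lemma el_coefSK (s : Z) : el (coefS (coefK s)) =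
  r^-1 *: \sum_(t : Z) (sgn (pz + s + t) * chr (s * t)) *: el (coefK t).
Proof.
rewrite -elsum -[RHS]addr0 -(scale0r (el (coefK 0))) -ellin.
by apply: eq_el => m u mp; rewrite coefS_coefK // mul0r addr0.
Qed.

(** The sum over Z/2p is folded by evenness, after doubling so that the sum over 1 <= t < p occurs
    twice. The substitution t |-> p - t gives the index order of the character formulas. *)
Lemma el_coefSK_nat (s : Z) : el (coefS (coefK s)) =
  r^-1 *: (sgn (pz + s) *: el (coefK 0) + el (coefK pz) +
    \sum_(1 <= t < p) (sgn t%:R * cs (s * t%:R)) *: el (coefK (p - t)%:R)).
Proof.
rewrite el_coefSK; congr (_ *: _).
pose g (t : Z) := (sgn (pz + s + t) * cs (s * t)) *: el (coefK t).
have g2 : (\sum_(t : Z) (sgn (pz + s + t) * chr (s * t)) *: el (coefK t)) *+ 2 = \sum_(t : Z) g t.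
  rewrite mulr2n {2}(reindex_inj oppr_inj) -big_split; apply: eq_bigr => t _ /=.
  rewrite el_coefK_even -scalerDl /g /cs mulrN [sgn (_ - t)](sgnD H) (sgnN H) -(sgnD H).
  by rewrite -mulrDr.
have two := two_neq0 H.
apply: (scalerI two); rewrite !scaler_nat g2.
rewrite (sum_even_zmod H) => [|t]; last first.
  rewrite /g el_coefK_even mulrN csN; congr (_ * _ *: _).
  by rewrite [LHS](sgnD H) (sgnN H) -(sgnD H).
rewrite !mulrnDl; congr (_ + _ + _ *+ 2).
- rewrite /g mulr0 addr0 -scaler_nat scalerA mulrC; congr (_ * _ *: _).
  by rewrite /cs oppr0 chr0.
- rewrite /g -scaler_nat; congr (_ *: _).
  have -> : sgn (pz + s + pz) = sgn s.
    by congr sgn; rewrite -[RHS]addr0 -(pp0 H); ring.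
  have -> : cs (s * pz) = sgn s * 2%:R.
    by rewrite /cs -mulrN (oppp H) [s * _]mulrC -/(sgn s) mulr2n mulrDr mulr1.
  by rewrite mulrA (sgn2 H) mul1r.
rewrite big_nat_rev; apply: eq_big_nat => t tp; rewrite /g.
have -> : (1 + p - t.+1 = p - t)%N by lia.
congr (_ *: _); rewrite natrB; last by lia.
have -> : sgn (pz + s + (pz - t%:R)) = sgn s * sgn t%:R.
  rewrite -[sgn t%:R](sgnN H) -(sgnD H); congr sgn.
  by rewrite -[RHS]addr0 -(pp0 H); ring.
have -> : cs (s * (pz - t%:R)) = sgn s * cs (s * t%:R).
  have e1 : chr (s * pz) = sgn s by rewrite mulrC.
  have e2 : chr (- (s * pz)) = sgn s by rewrite -mulrN (oppp H) mulrC.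
  rewrite /cs mulrBr opprB !(chrD H) e1 e2 [chr _ * sgn _]mulrC.
  by rewrite -mulrDr addrC.
by rewrite mulrACA (sgn2 H) mul1r.
Qed.

Lemma el_coefF (t : nat) :
  el (coefF t) = \sum_(1 <= s < p) sineA t%:R s%:R *: el (coefS (coefR s)).
Proof. by rewrite -elsum. Qed.

Lemma el_coefSF (t : nat) : (0 < t < p)%N ->
  el (coefS (coefF t)) = \sum_(1 <= s < p) sineA t%:R s%:R *: el (coefR s).
Proof.
move=> tp; rewrite -elsum; apply: eq_el => m u mp; rewrite /coefF coefS_sum.
by apply: eq_bigr => s _; rewrite (coefSK H) //; exact: central_coefR.
Qed.

(** The definition of [coefF] inverted by means of [sineA_sq]; the minus sign is that of the squared
    sine matrix. For s = p both sides vanish. *)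
Lemma el_coefSR (s : nat) : (0 < s <= p)%N ->
  el (coefS (coefR s)) = - \sum_(1 <= t < p) sineA s%:R t%:R *: el (coefF t).
Proof.
move=> sp; have [sp'|ps] := ltnP s p; last first.
  have -> : s = p by lia.
  have R0 : el (coefS (coefR p)) = 0.
    rewrite /el /diag big1 // => m _; rewrite big1 // => u _.
    by rewrite coefS0 ?mul0r ?scale0r // => n v np; rewrite coefRp.
  rewrite R0 big1 ?oppr0 // => t _.
  by rewrite [sineA _ _]sn_mulC (sineAp _ H) scale0r.
transitivity (- \sum_(1 <= u < p) (- (s == u)%:R : F) *: el (coefS (coefR u))).
  rewrite (bigD1_seq s) ?mem_index_iota ?iota_uniq //=; last by lia.
  rewrite eqxx scaleN1r big1 ?addr0 ?opprK // => u us.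
  by rewrite eq_sym (negPf us) oppr0 scale0r.
congr (- _).
transitivity (\sum_(1 <= u < p) \sum_(1 <= t < p)
  (sineA s%:R t%:R * sineA t%:R u%:R) *: el (coefS (coefR u))).
  apply: eq_big_nat => u up; rewrite -scaler_suml (sineA_sq H r2) //; lia.
rewrite exchange_big; apply: eq_bigr => t _ /=; rewrite el_coefF scaler_sumr.
by apply: eq_bigr => u _; rewrite scalerA.
Qed.

Lemma el_coefPE s : (s <= p)%N ->
  el (coefP s) = (s%:R / p%:R) *: el (coefK s%:R) + el (coefR s).
Proof.
move=> sp; have := ellin (s%:R / p%:R) 1 (coefK s%:R) (coefR s); rewrite scale1r => <-.
by apply: eq_el => m u mp; rewrite /coefR mul1r addrC subrK.
Qed.

Lemma el_coefSP s : (0 < s <= p)%N -> el (coefS (coefP s)) =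
  (s%:R / p%:R) *: el (coefS (coefK s%:R)) + el (coefS (coefR s)).
Proof.
move=> sp; have := ellin (s%:R / p%:R) 1 (coefS (coefK s%:R)) (coefS (coefR s)).
rewrite scale1r => <-.
by apply: eq_el => m u mp; rewrite coefS_coefR mul1r addrC subrK.
Qed.

Lemma el_coefSM s : (0 < s <= p)%N -> el (coefS (coefM s)) =
  (s%:R / p%:R) *: el (coefS (coefK (p - s)%:R)) - el (coefS (coefR (p - s))).
Proof.
move=> sp; have pF := p_neq0 H.
rewrite -scaleN1r -ellin; apply: eq_el => m u mp.
rewrite -coefSD; apply: eq_coefS => // n v np.
rewrite /coefR !(coefK_nat H) ?leq_subr // subKn; last by lia.
by rewrite natrB; [field|lia].
Qed.

End ModularAction.

(** * Gauss sums behind the relation of S and T *)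

Section GaussRelations.
Variables (F : fieldType) (p : nat) (q r : F).
Local Notation Z := 'Z_(2 * p).
Local Notation pz := (p%:R : Z).
Local Notation chr := (@chr F p q).
Local Notation sn := (@sn F p q).
Local Notation cs := (@cs F p q).
Local Notation sgn := (@sgn F p q).
Local Notation sineA := (@sineA F p q r).
Hypothesis H : even_root p q.
Hypothesis r2 : r ^+ 2 = (2 * p)%:R.
Variables h b : F.
Hypothesis h2 : h ^+ 2 = q.
Local Notation gauss := (@gauss F p h).
Local Notation coefV := (@coefV F p q h).
Hypothesis b3 : b ^+ 3 * \sum_(u : Z) gauss u = - (r * sgn pz * h ^+ 3 * gauss pz).

(** The eigenvalue of T, that is, [b] divided by the ribbon eigenvalue [coefV 0 t]. *)
Definition tau (t : Z) : F := - (b / h) * (sgn t * gauss t).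

Lemma tauV t : tau t * coefV 0 t = b.
Proof.
have h0 := h_neq0 H h2; have g0 := gauss_neq0 H h2 t; have s2 := sgn2 H t.
rewrite /tau /coefV expr0 mulr1.
transitivity (b * (sgn t * sgn t)); last by rewrite s2 mulr1.
by move: (sgn t) (gauss t) g0 => x y y0; field; rewrite h0 y0.
Qed.

Lemma tauN t : tau (- t) = tau t.
Proof. by rewrite /tau (sgnN H) (gaussN H h2). Qed.

Lemma sum_tau w : \sum_(t : Z) chr (t * w) * tau t =
  - (b / h) * ((\sum_(u : Z) gauss u) / gauss (pz + w)).
Proof.
have g0 := gauss_neq0 H h2 (pz + w).
rewrite [in RHS](reindex_inj (addIr (pz + w))) mulr_suml mulr_sumr; apply: eq_bigr => t _ /=.
rewrite (gaussD H h2 t) mulrDr (chrD H) [t * pz]mulrC /tau /sgn [pz * t]mulrC.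
by move: (gauss t) (chr (t * pz)) (chr (t * w)) (gauss _) g0 => x y z g g0; field; rewrite (h_neq0 H h2) g0.
Qed.

(** By [sum_tau] the sum is a Gauss sum over a quadratic exponential, whose square terms cancel
    those of [tau s] and [tau u] and leave the mixed term. The condition [b3] fixes the constant. *)
Lemma tau_gauss (s u : Z) :
  tau s * tau u * \sum_(t : Z) chr (t * (s + u)) * tau t = r * sgn pz * chr (- (s * u)).
Proof.
have h0 := h_neq0 H h2; have gp := gauss_neq0 H h2 pz.
have gs := gauss_neq0 H h2 s; have gu := gauss_neq0 H h2 u.
rewrite sum_tau (gaussDp H h2) (gaussD H h2 s) (sgnD H) (chrN H).
have s2 := sgn2 H s; have u2 := sgn2 H u.
have c0 := chr_neq0 H (s * u).
have ss0 := sgn_neq0 H s; have su0 := sgn_neq0 H u.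
rewrite /tau; move: (\sum_(u : Z) _) b3 => G bG.
transitivity (- (b ^+ 3 * G) / (h ^+ 3 * gauss pz * chr (s * u))).
  move: (gauss s) gs (gauss u) gu (gauss pz) gp (chr _) c0 (sgn s) ss0 (sgn u) su0.
  by move=> x x0 y y0 z z0 c cn v v0 w w0; field; rewrite h0 x0 y0 z0 cn v0 w0.
rewrite bG opprK; move: (gauss pz) gp (chr _) c0 (sgn _) => z z0 c cn x.
by field; rewrite h0 z0 cn.
Qed.

(** The odd part of the preceding identity: the half-range sum of sines is half of a full sum, which
    splits into the cases u and -u of [tau_gauss]. *)
Lemma tau_sine (s u : nat) :
  tau s%:R * tau u%:R * \sum_(1 <= t < p) sineA s%:R t%:R * tau t%:R * sineA t%:R u%:R =
  - sineA s%:R u%:R.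
Proof.
have r0 := r_neq0 H r2.
rewrite (sum_even0 H (f := fun t => sineA s%:R t * tau t * sineA t u%:R)); last 3 first.
- move=> t; have e1 (x y : Z) : sineA x (- y) = - sineA x y by exact: sineAN.
  by rewrite tauN [sineA (- t) _]sn_mulC [sineA t _]sn_mulC !e1 mulNr mulrNN.
- by rewrite sineA0 !mul0r.
- by rewrite (sineAp _ H) !mul0r.
have -> : \sum_(t : Z) sineA s%:R t * tau t * sineA t u%:R =
   r^-1 ^+ 2 * sgn (s%:R + u%:R) * (2%:R * (\sum_(t : Z) chr (t * (s%:R + u%:R)) * tau t) -
     2%:R * (\sum_(t : Z) chr (t * (s%:R - u%:R)) * tau t)).
  have dbl (w : Z) : 2%:R * (\sum_(t : Z) chr (t * w) * tau t) = \sum_(t : Z) cs (t * w) * tau t.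
    rewrite -[2%:R]/(1 + 1) mulrDl !mul1r {2}(reindex_inj oppr_inj) -big_split.
    by apply: eq_bigr => t _ /=; rewrite tauN -mulrDl mulNr.
  rewrite !dbl -sumrB mulr_sumr; apply: eq_bigr => t _; rewrite -mulrBl mulrDr mulrBr (cs_subD H).
  rewrite /sineA.
  have -> : sgn (s%:R + u%:R) = sgn (pz + s%:R + t) * sgn (pz + t + u%:R).
    rewrite -(sgnD H); have := sgn_dbl H (pz + t); move=> e2.
    have -> : pz + s%:R + t + (pz + t + u%:R) = (pz + t + (pz + t)) + (s%:R + u%:R) by ring.
    by rewrite [RHS](sgnD H) e2 mul1r.
  by rewrite [t * s%:R]mulrC; ring.
have e1 := tau_gauss s%:R u%:R; have e2 := tau_gauss s%:R (- u%:R).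
rewrite tauN in e2.
move: e1 e2; move: (\sum_(t : Z) _) (\sum_(t : Z) _) => X Y e1 e2.
have two := two_neq0 H.
transitivity (r^-1 ^+ 2 * sgn (s%:R + u%:R) * (tau s%:R * tau u%:R * Y - tau s%:R * tau u%:R * X)).
  by field; rewrite r0 two.
rewrite e1 e2 mulrN opprK /sineA -addrA (sgnD H pz) (sgnD H s%:R) /sn.
by move: (sgn pz) => w; field.
Qed.

End GaussRelations.

(** * The relation TSTST = S on the three kinds of vectors *)

Section ModularRelation.
Variables (F : fieldType) (p : nat) (q r h b : F) (V : vectType F) (S T : 'End(V)).
Local Notation Z := 'Z_(2 * p).
Local Notation pz := (p%:R : Z).
Local Notation chr := (@chr F p q).
Local Notation sgn := (@sgn F p q).
Local Notation sineA := (@sineA F p q r).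
Local Notation tau := (@tau F p q h b).
Hypothesis H : even_root p q.
Hypothesis r2 : r ^+ 2 = (2 * p)%:R.
Hypothesis h2 : h ^+ 2 = q.
Hypothesis b3 : b ^+ 3 * \sum_(u : Z) gauss h u = - (r * sgn pz * h ^+ 3 * gauss h pz).
Variables (pi : Z -> V) (rho phi : nat -> V).
Hypothesis pi_even : forall t, pi (- t) = pi t.
Hypothesis T_pi : forall t, T (pi t) = tau t *: pi t.
Hypothesis S_pi : forall s, S (pi s) =
  r^-1 *: \sum_(t : Z) (sgn (pz + s + t) * chr (s * t)) *: pi t.
Hypothesis T_rho : forall t, (0 < t < p)%N -> T (rho t) = tau t%:R *: rho t.
Hypothesis T_phi : forall t, (0 < t < p)%N -> T (phi t) = tau t%:R *: (phi t + rho t).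
Hypothesis S_rho : forall s, (0 < s < p)%N ->
  S (rho s) = - \sum_(1 <= t < p) sineA s%:R t%:R *: phi t.
Hypothesis S_phi : forall s, (0 < s < p)%N ->
  S (phi s) = \sum_(1 <= t < p) sineA s%:R t%:R *: rho t.

Lemma TST_pi t : T (S (T (pi t))) = tau t *: (r^-1 *:
  \sum_(u : Z) (sgn (pz + t + u) * chr (t * u)) *: (tau u *: pi u)).
Proof.
rewrite T_pi !hom_Z S_pi hom_Z hom_sum; congr (_ *: (_ *: _)).
by apply: eq_bigr => u _; rewrite T_pi.
Qed.

Lemma modular_relation_pi s : T (S (T (S (T (pi s))))) = S (pi s).
Proof.
have r0 := r_neq0 H r2.
rewrite [T (pi s)]T_pi !hom_Z S_pi !hom_Z !hom_sum.
transitivity (\sum_(t : Z) \sum_(u : Z) (tau s * (r^-1 * (sgn (pz + s + t) * chr (s * t) * (tau t *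
   (r^-1 * (sgn (pz + t + u) * chr (t * u) * tau u)))))) *: pi u).
  rewrite !scaler_sumr; apply: eq_bigr => t _; rewrite TST_pi !scaler_sumr.
  by apply: eq_bigr => u _; rewrite !scalerA; congr (_ *: _); ring.
rewrite exchange_big (reindex_inj oppr_inj) scaler_sumr; apply: eq_bigr => u _ /=.
rewrite -scaler_suml pi_even scalerA; congr (_ *: _).
have e1 := tau_gauss H h2 b3 s (- u); rewrite mulrN opprK in e1.
transitivity (r^-1 ^+ 2 * sgn (s - u) * (tau s * tau (- u) * (\sum_(t : Z) chr (t * (s - u)) * tau t))).
  rewrite !mulr_sumr; apply: eq_bigr => t _.
  have -> : sgn (s - u) = sgn (pz + s + t) * sgn (pz + t - u).
    rewrite -(sgnD H); have := sgn_dbl H (pz + t); move=> e2.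
    have -> : pz + s + t + (pz + t - u) = (pz + t + (pz + t)) + (s - u) by ring.
    by rewrite [RHS](sgnD H) e2 mul1r.
  have -> : chr (t * (s - u)) = chr (s * t) * chr (t * - u) by rewrite -(chrD H); congr chr; ring.
  by ring.
rewrite e1 !(sgnD H) (sgnN H).
by move: (sgn s) (sgn u) (sgn pz) (chr _) => x y z w; field.
Qed.

Lemma sine_convolution (s : nat) (x : nat -> V) : (0 < s < p)%N ->
  \sum_(1 <= t < p) (tau s%:R * (sineA s%:R t%:R * tau t%:R)) *:
    (\sum_(1 <= u < p) sineA t%:R u%:R *: (tau u%:R *: x u)) =
  - \sum_(1 <= u < p) sineA s%:R u%:R *: x u.
Proof.
move=> sp; under eq_bigr do rewrite scaler_sumr.
rewrite exchange_big -sumrN; apply: eq_bigr => u _ /=.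
under eq_bigr do rewrite !scalerA.
rewrite -scaler_suml -scaleNr -(tau_sine H r2 h2 b3) mulr_sumr; congr (_ *: _).
by apply: eq_bigr => t _; ring.
Qed.

Lemma TST_rho t : (0 < t < p)%N -> T (S (T (rho t))) =
  - (tau t%:R *: \sum_(1 <= u < p) sineA t%:R u%:R *: (tau u%:R *: (phi u + rho u))).
Proof.
move=> tp; rewrite T_rho // !hom_Z S_rho // -scalerN; congr (_ *: _); rewrite hom_N hom_sum.
by congr (- _); apply: eq_big_nat => u up; rewrite T_phi.
Qed.

(** The [rho] terms that T adds to the [phi] coming from S cancel the [rho] terms that S makes of
    [phi], so no Jordan part is left. *)
Lemma TST_phi t : (0 < t < p)%N -> T (S (T (phi t))) =
  - (tau t%:R *: \sum_(1 <= u < p) sineA t%:R u%:R *: (tau u%:R *: phi u)).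
Proof.
move=> tp; rewrite T_phi // !hom_Z -scalerN; congr (_ *: _).
rewrite hom_D S_phi // S_rho // hom_D hom_N !hom_sum.
rewrite -sumrB -sumrN; apply: eq_big_nat => u up.
by rewrite T_rho // T_phi // -scalerBr -scalerBr opprD addrCA subrr addr0 !scalerN.
Qed.

Lemma modular_relation_rho s : (0 < s < p)%N -> T (S (T (S (T (rho s))))) = S (rho s).
Proof.
move=> sp; rewrite [T (rho s)]T_rho // !hom_Z S_rho // !hom_N !hom_sum.
rewrite -(sine_convolution _ sp) -sumrN scaler_sumr.
by apply: eq_big_nat => t tp; rewrite TST_phi // !scalerN opprK !scalerA !mulrA.
Qed.

Lemma modular_relation_phi s : (0 < s < p)%N -> T (S (T (S (T (phi s))))) = S (phi s).
Proof.
move=> sp; rewrite [T (phi s)]T_phi // !hom_Z hom_D S_phi // S_rho // !hom_D !hom_N !hom_sum.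
rewrite -sumrB -[RHS]opprK -(sine_convolution _ sp) scaler_sumr -sumrN.
apply: eq_big_nat => t tp; rewrite TST_phi // TST_rho // -scalerBr opprK addrC -scalerBr -sumrB.
rewrite -(scalerA (tau s%:R)) -(scalerA (sineA s%:R t%:R)) -!scalerN -sumrN; congr (_ *: (_ *: (_ *: _))).
apply: eq_bigr => u _; rewrite -scalerBr -scalerBr opprD addrA subrr sub0r.
by rewrite !scalerN.
Qed.

End ModularRelation.

(** * The operators on characters, controlled through an injection onto the center *)

Section CenterModel.
Variables (F : fieldType) (p : nat) (q r h b : F) (A : falgType F) (e f k : A).
Local Notation Z := 'Z_(2 * p).
Local Notation pz := (p%:R : Z).
Hypothesis H : even_root p q.
Hypothesis UG : uq_generators p q e f k.
Hypothesis r2 : r ^+ 2 = (2 * p)%:R.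
Hypothesis h2 : h ^+ 2 = q.
Hypothesis b3 : b ^+ 3 * \sum_(u : Z) gauss h u = - (r * sgn q pz * h ^+ 3 * gauss h pz).
Local Notation el := (@el F p q A e f k).
Local Notation coefP := (@coefP F p q).
Local Notation coefM := (@coefM F p q).
Local Notation coefK := (@coefK F p q).
Local Notation coefR := (@coefR F p q).
Local Notation coefF := (@coefF F p q r).
Local Notation coefS := (@coefS F p q r).
Local Notation coefV := (@coefV F p q h).
Local Notation sineA := (@sineA F p q r).
Local Notation tau := (@tau F p q h b).
Local Notation chr := (@chr F p q).
Local Notation sgn := (@sgn F p q).
Local Notation cs := (@cs F p q).
Let p0 := even_root_gt0 H.

Variables (V : vectType F) (L : 'Hom(V, A)) (S T : 'End(V)) (X Y Phi : nat -> V).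
Let Rho (s : nat) : V := ((p%:R - s%:R) / p%:R) *: X s - (s%:R / p%:R) *: Y (p - s)%N.
Hypothesis L_inj : injective L.
Hypothesis L_X : forall s, (s <= p)%N -> L (X s) = el (coefP s).
Hypothesis L_Y : forall s, (s <= p)%N -> L (Y s) = el (coefM s).
Hypothesis L_Phi : forall s, (0 < s < p)%N -> L (Phi s) = el (coefF s).
Hypothesis L_central : forall x, exists2 g, central_coef q g & L x = el g.
Hypothesis L_onto : forall g, central_coef q g -> exists x, L x = el g.
Hypothesis L_S : forall x g, central_coef q g -> L x = el g -> L (S x) = el (coefS g).
Hypothesis T_X : forall s, (s <= p)%N -> T (X s) = tau s%:R *: X s.
Hypothesis T_Y : forall s, (s <= p)%N -> T (Y s) = tau (p - s)%:R *: Y s.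
Hypothesis T_Phi : forall s, (0 < s < p)%N -> T (Phi s) = tau s%:R *: (Phi s + Rho s).
Hypothesis basis_ext : forall (W : vectType F) (g1 g2 : 'Hom(V, W)),
  (forall s, (0 < s <= p)%N -> g1 (X s) = g2 (X s)) ->
  (forall s, (0 < s <= p)%N -> g1 (Y s) = g2 (Y s)) ->
  (forall s, (0 < s < p)%N -> g1 (Phi s) = g2 (Phi s)) -> g1 = g2.

Lemma el_scale c g : el (fun m u => c * g m u) = c *: el g.
Proof.
rewrite /el /diag scaler_sumr; apply: eq_bigr => m _; rewrite scaler_sumr.
by apply: eq_bigr => u _; rewrite scalerA mulrA.
Qed.

Lemma el_eq0 g : (forall m u, (m < p)%N -> g m u = 0) -> el g = 0.
Proof.
move=> g0; rewrite /el /diag big1 // => m _; rewrite big1 // => u _.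
by rewrite g0 ?mul0r ?scale0r.
Qed.

Lemma L_Rho s : (s <= p)%N -> L (Rho s) = el (coefR s).
Proof. by move=> sp; rewrite (el_coefR e f k H) // /Rho hom_B !hom_Z L_X // L_Y // leq_subr. Qed.

Lemma model_SS : (S \o S)%VF = \1%VF.
Proof.
apply/lfunP => x; rewrite comp_lfunE id_lfunE; apply: L_inj.
have [g cg xg] := L_central x; rewrite (L_S (central_coefS H r cg) (L_S cg xg)) xg.
by apply: eq_el => m u mp; rewrite (coefSK H u r2 cg mp).
Qed.

Let VT : 'Hom(V, A) := (amull (el coefV) \o (L \o T))%VF.

(** On X and Y this is the product of eigenvalues [tauV]. On Phi the ribbon element subtracts R
    where T adds it, so the two Jordan blocks cancel. *)
Lemma model_ribbon x : el coefV * L (T x) = b *: L x.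
Proof.
have bx (W : vectType F) (c : F) (g : 'Hom(V, W)) y : (c *: g)%VF y = c *: g y by rewrite scale_lfunE.
suff E : VT = (b *: L)%VF by have := congr1 (fun g : 'Hom(V, A) => g x) E; rewrite bx !comp_lfunE lfunE.
have VE y : VT y = el coefV * L (T y) by rewrite !comp_lfunE lfunE.
apply: basis_ext => s sp; rewrite bx VE.
- have sp' : (s <= p)%N by lia.
  rewrite T_X // hom_Z L_X // -scalerAr.
  rewrite (ribbon_eigen H UG h2 (t := s%:R)) ?scalerA ?(tauV H) //.
    by apply: (el_central H UG); exact: central_coefP.
  by rewrite (yhat_el H UG) -el_scale; apply: eq_el => m u mp; rewrite (coefY_coefP H).
- have sp' : (s <= p)%N by lia.
  rewrite T_Y // hom_Z L_Y // -scalerAr.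
  rewrite (ribbon_eigen H UG h2 (t := (p - s)%:R)) ?scalerA ?(tauV H) //.
    by apply: (el_central H UG); exact: central_coefM.
  by rewrite (yhat_el H UG) -el_scale; apply: eq_el => m u mp; rewrite (coefY_coefM H) // natrB.
- have sp' : (s <= p)%N by lia.
  rewrite T_Phi // hom_Z hom_D L_Phi // L_Rho // -scalerAr mulrDr (ribbon_coefF H UG h2 r2 sp).
  rewrite (ribbon_eigen H UG h2 (x := el (coefR s)) (t := s%:R)).
  + by rewrite -scalerDr subrK scalerA (tauV H).
  + by apply: (el_central H UG); exact: central_coefR.
  + rewrite (el_coefR e f k H) // mulrBr -!scalerAr.
    rewrite !(yhat_el H UG); set z := el _; set w := el _.
    have -> : z = cs s%:R *: el (coefP s).
      by rewrite -el_scale; apply: eq_el => m u mp; rewrite (coefY_coefP H).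
    have -> : w = cs s%:R *: el (coefM (p - s)).
      rewrite -el_scale; apply: eq_el => m u mp; rewrite (coefY_coefM H) //.
      by rewrite natrB // opprB addrC subrK.
    by rewrite scalerBr !scalerA ![cs _ * _]mulrC.
Qed.

(** K_t pulled back from the center for every t in Z/2p, so that S on these vectors is a Fourier sum
    over the whole group; for t <= p it is X t + Y (p - t). *)
Let pi (t : Z) : V := (L^-1)%VF (el (coefK t)).

Lemma L_pi t : L (pi t) = el (coefK t).
Proof.
have [x xK] := L_onto (central_coefK H t); apply: limg_lfunVK.
by rewrite -xK memv_img // memvf.
Qed.

Lemma pi_nat s : (s <= p)%N -> pi s%:R = X s + Y (p - s)%N.
Proof.
move=> sp; apply: L_inj; rewrite L_pi hom_D L_X // L_Y ?leq_subr //.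
by rewrite (el_coefK e f k H).
Qed.

Lemma pi_even t : pi (- t) = pi t.
Proof. by apply: L_inj; rewrite !L_pi (el_coefK_even e f k H). Qed.

Lemma T_pi t : T (pi t) = tau t *: pi t.
Proof.
have T_nat n : (n <= p)%N -> T (pi n%:R) = tau n%:R *: pi n%:R.
  by move=> np; rewrite pi_nat // hom_D T_X // T_Y ?leq_subr // subKn // scalerDr.
by have [n np [->|->]] := Z_pm H t; rewrite ?pi_even ?(tauN H b h2) T_nat.
Qed.

Lemma S_pi s : S (pi s) = r^-1 *: \sum_(t : Z) (sgn (pz + s + t) * chr (s * t)) *: pi t.
Proof.
apply: L_inj; rewrite (L_S (central_coefK H s) (L_pi s)) hom_Z hom_sum (el_coefSK e f k H r2).
by congr (_ *: _); apply: eq_bigr => t _; rewrite L_pi.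
Qed.

Lemma S_Rho s : (0 < s < p)%N -> S (Rho s) = - \sum_(1 <= t < p) sineA s%:R t%:R *: Phi t.
Proof.
move=> sp; have sp' : (0 < s <= p)%N by lia.
have sp2 : (s <= p)%N by lia.
apply: L_inj; rewrite (L_S (central_coefR H s) (L_Rho sp2)) hom_N hom_sum (el_coefSR e f k H r2) //.
by congr (- _); apply: eq_big_nat => t tp; rewrite L_Phi.
Qed.

Lemma S_Phi s : (0 < s < p)%N -> S (Phi s) = \sum_(1 <= t < p) sineA s%:R t%:R *: Rho t.
Proof.
move=> sp; apply: L_inj; rewrite (L_S (central_coefF r H s) (L_Phi sp)) hom_sum (el_coefSF e f k H r2) //.
by apply: eq_big_nat => t tp; rewrite L_Rho //; lia.
Qed.

Lemma T_Rho s : (0 < s < p)%N -> T (Rho s) = tau s%:R *: Rho s.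
Proof.
move=> sp; have sp' : (s <= p)%N by lia.
rewrite /Rho hom_B !hom_Z T_X // T_Y ?leq_subr // subKn //.
by rewrite scalerBr !scalerA ![tau _ * _]mulrC.
Qed.

(** X s is a combination of pi s and Rho s, and Y s is pi (p - s) - X (p - s), so the relation
    passes to the basis. The ends s = 0 and s = p are covered because Rho vanishes there. *)
Lemma model_TSTST : (T \o (S \o (T \o (S \o T))))%VF = S.
Proof.
have WE y : (T \o (S \o (T \o (S \o T))))%VF y = T (S (T (S (T y)))) by rewrite !comp_lfunE.
have pi_rel := modular_relation_pi H r2 h2 b3 pi_even T_pi S_pi.
have Rho_rel s : (s <= p)%N -> T (S (T (S (T (Rho s))))) = S (Rho s).
  move=> sp; have [/andP[s0 spp]|] := boolP (0 < s < p)%N.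
    by apply: (modular_relation_rho H r2 h2 b3 T_Rho T_Phi S_Rho S_Phi); rewrite s0.
  rewrite negb_and -leqNgt leqn0 -leqNgt => sE; have -> : Rho s = 0; last by rewrite !linear0.
  apply: L_inj; rewrite L_Rho // linear0; apply: el_eq0 => m u mp.
  have [s0|s0] := eqVneq s 0; first by rewrite s0 coefR0.
  have -> : s = p by lia.
  by rewrite (coefRp H).
have X_rel s : (s <= p)%N -> T (S (T (S (T (X s))))) = S (X s).
  move=> sp; have -> : X s = (s%:R / p%:R) *: pi s%:R + Rho s.
    by apply: L_inj; rewrite hom_D hom_Z L_pi L_Rho // L_X // (el_coefPE q e f k sp).
  move: (Rho s) (Rho_rel s sp) => w w_rel; by rewrite !(hom_D, hom_Z) pi_rel w_rel.
apply: basis_ext => s sp; rewrite WE.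
- by apply: X_rel; lia.
- have sp' : (s <= p)%N by lia.
  have -> : Y s = pi (p - s)%:R - X (p - s)%N by rewrite pi_nat ?leq_subr // subKn // addrC addKr.
  by rewrite !hom_B pi_rel X_rel ?leq_subr.
- exact: (modular_relation_phi H r2 h2 b3 T_Rho T_Phi S_Rho S_Phi).
Qed.

Lemma model_STSTST : ((S \o T) \o ((S \o T) \o (S \o T)))%VF = \1%VF.
Proof.
rewrite -model_SS -[X in (_ \o X)%VF = _]comp_lfunA.
rewrite -[LHS]comp_lfunA; congr (_ \o _)%VF.
by rewrite -[RHS]model_TSTST.
Qed.

End CenterModel.

Section LfunComb.
Variables (K : fieldType) (V W : vectType K) (L : 'Hom(V, W)).

Lemma lfun_combB (a c : K) x x' y : x = x' ->
  L (a *: (c *: x - y)) = c *: L (a *: x') - a *: L y.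
Proof.
have LZ b z : L (b *: z) = b *: L z by exact: linearZ.
have LD z z' : L (z - z') = L z - L z' by exact: linearB.
by move=> <-; rewrite LZ LD !LZ scalerBr !scalerA [a * c]mulrC.
Qed.

Lemma lfun_combD (a c : K) x x' y : x = x' ->
  L (a *: (c *: x + y)) = c *: L (a *: x') + a *: L y.
Proof.
have LZ b z : L (b *: z) = b *: L z by exact: linearZ.
have LD z z' : L (z + z') = L z + L z' by exact: linearD.
by move=> <-; rewrite LZ LD !LZ scalerDr !scalerA [a * c]mulrC.
Qed.

Lemma lfun_sumZ (a : K) (n : nat) (c d : nat -> K) (v : nat -> V) (w : nat -> W) :
    (forall t, (0 < t < n)%N -> L (v t) = w t) ->
    (forall t, (0 < t < n)%N -> a * c t = d t) ->
  a *: L (\sum_(1 <= t < n) c t *: v t) = \sum_(1 <= t < n) d t *: w t.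
Proof.
move=> vw cd; rewrite linear_sum scaler_sumr; apply: eq_big_nat => t tn.
by rewrite linearZ /= scalerA vw ?cd.
Qed.

End LfunComb.

(** * Signs of the sine matrix and vanishing from samples *)

Section SineSign.
Variables (F : fieldType) (p : nat) (q : F).
Hypothesis H : even_root p q.
Local Notation Z := 'Z_(2 * p).
Local Notation sn := (@sn F p q).

(** Reconciles the sign in the formula for S chi^-_s with the one of the sine matrix at p - s. *)
Lemma sn_compl_sign (s t : nat) : (s <= p)%N ->
  (-1) ^+ (s + 1) * sn (s * t)%:R = (-1) ^+ (p + (p - s) + t) * sn ((p - s) * t)%:R.
Proof.
move=> sp; have -> : ((p - s) * t)%:R = t%:R * p%:R - (s * t)%:R :> Z.
  by rewrite mulnBl natrB ?leq_mul2r ?sp ?orbT // !natrM [p%:R * _]mulrC.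
have -> : sn (t%:R * p%:R - (s * t)%:R) = - ((-1) ^+ t * sn (s * t)%:R).
  have ct : @chr F p q (t%:R * p%:R) = (-1) ^+ t by rewrite mulr_natl (chrMn H) (chrp H).
  by rewrite /sn opprB !(chrD H) [@chr F p q (- (t%:R * _))](chrN H) ct invr_sign; ring.
have -> : (-1) ^+ (p + (p - s) + t) = (-1) ^+ s * (-1) ^+ t :> F.
  rewrite -!exprD -[LHS]signr_odd -[RHS]signr_odd; congr (_ ^+ nat_of_bool _).
  by rewrite !oddD oddB // addbA addbb.
by rewrite addn1 exprS mulN1r !mulNr !mulrN -!mulrA [_ ^+ t * (_ * _)]mulrA -expr2 sqrr_sign mul1r.
Qed.

Lemma central_coef_sample0 (g : nat -> Z -> F) : central_coef q g ->
    (forall t, (0 < t < p)%N -> g 0%N t%:R = 0) -> (forall m, (m < p)%N -> g m 0 = 0) ->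
    (forall m, (m < p)%N -> g m p%:R = 0) ->
  forall m u, (m < p)%N -> g m u = 0.
Proof.
move=> cg g0 gz gp; have p0 := even_root_gt0 H.
have g0n n : (n <= p)%N -> g 0%N n%:R = 0.
  case: n => [|n] np; first exact: gz.
  by have [np'|np'] := ltnP n.+1 p; [exact: g0 | have -> : n.+1 = p by [lia]; exact: gp].
apply: (central_coef_uniq H cg) => // u.
by have [n np [->|->]] := Z_pm H u; rewrite ?(central_coef_even H cg) ?g0n.
Qed.

End SineSign.

(** * The linear map from extended characters to the center *)

Section Equivalence.
Variables (R : realType) (p : nat) (A : falgType R[i]) (U : restricted_Usl2 p A).
Hypothesis p1 : (1 < p)%N.
Local Notation q := (qroot R p).
Local Notation Z := 'Z_(2 * p).
Local Notation pz := (p%:R : Z).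
Local Notation sn := (@sn _ p q).
Local Notation sgn := (@sgn _ p q).
Local Notation th := (q - q^-1).
Local Notation E := (UE U).
Local Notation k := (UK U).
Local Notation e := (th *: UE U).
Local Notation f := (th *: UF U).
Local Notation el := (@el _ p q A e f k).
Local Notation r := ((Num.sqrt (2 * p%:R : R))%:C%C : R[i]).
Local Notation h := (hroot R p).

Let H : even_root p q := qroot_even_root R p1.
Let h2 : h ^+ 2 = q := hroot_sq R p1.
Let p0 := even_root_gt0 H.

Local Notation coefP := (@coefP _ p q).
Local Notation coefM := (@coefM _ p q).
Local Notation coefK := (@coefK _ p q).
Local Notation coefR := (@coefR _ p q).
Local Notation coefF := (@coefF _ p q r).
Local Notation coefS := (@coefS _ p q r).
Local Notation sineA := (@sineA _ p q r).
Local Notation cs := (@cs _ p q).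
Local Notation Zc := (Zcft R p).
Local Notation chip := (chip R p).
Local Notation chim := (chim R p).
Local Notation phi := (phi R p).
Local Notation rho := (rho_cft R p).

Let UG : uq_generators p q e f k := U_generators U p1.
Let r2 : r ^+ 2 = (2 * p)%:R := r_sq R p.

Definition cmap : 'Hom(Zc, A) :=
  linfun (cft_ext (fun s => el (coefP s)) (fun s => el (coefM s)) (fun s => el (coefF s))).

(** The unit factors give it the shape of a nested linear combination to which [central_coefD],
    [coefSD] and [el_lin] apply directly. *)
Definition csum (g1 g2 g3 : nat -> nat -> Z -> R[i]) (x : Zc) (m : nat) (u : Z) : R[i] :=
  1 * (1 * (\sum_(j < p) x (inl (true, j)) * g1 j.+1 m u) +
       1 * (\sum_(j < p) x (inl (false, j)) * g2 j.+1 m u)) +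
  1 * (\sum_(j < p.-1) x (inr j) * g3 j.+1 m u).

Lemma el_csum g1 g2 g3 x :
  el (csum g1 g2 g3 x) = cft_ext (fun s => el (g1 s)) (fun s => el (g2 s)) (fun s => el (g3 s)) x.
Proof.
rewrite /csum !(@el_lin _ p q A e f k) !scale1r.
by rewrite !(@el_sum _ p q A e f k).
Qed.

Lemma cmapE x : cmap x = el (csum coefP coefM coefF x).
Proof. by rewrite lfunE /= el_csum. Qed.

Lemma central_csum x : central_coef q (csum coefP coefM coefF x).
Proof.
apply: central_coefD; first apply: central_coefD.
- by apply: central_coef_sum => j _; exact: (central_coefP H).
- by apply: central_coef_sum => j _; exact: (central_coefM H).
- by apply: central_coef_sum => j _; exact: (central_coefF _ H).
Qed.

Lemma modular_S_cmap x : modular_S U (cmap x) =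
  cft_ext (fun s => el (coefS (coefP s))) (fun s => el (coefS (coefM s)))
    (fun s => el (coefS (coefF s))) x.
Proof.
rewrite cmapE (modular_SE U p1); last exact: central_csum.
rewrite -(el_csum (fun s => coefS (coefP s)) (fun s => coefS (coefM s)) (fun s => coefS (coefF s))).
by apply: eq_el => m u mp; rewrite /csum !coefSD !coefS_sum.
Qed.

Lemma el_coefP0 : el (coefP 0) = 0.
Proof. by apply: el_eq0 => m u mp; rewrite coefP0. Qed.

Lemma el_coefM0 : el (coefM 0) = 0.
Proof. by apply: el_eq0 => m u mp; rewrite /coefM /twist coefP0 // !mulr0. Qed.

Lemma el_coefSR0 : el (coefS (coefR 0)) = 0.
Proof.
apply: el_eq0 => m u mp; rewrite (coefS0 r H m u) // => n v np.
by rewrite coefR0.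
Qed.

Lemma sineA0_sum (w : nat -> A) (i j : nat) :
  \sum_(i <= t < j) sineA 0%:R t%:R *: w t = 0.
Proof.
have s0 t : sineA 0%:R t%:R = 0 by rewrite /sineA mul0r sn0 mulr0.
by rewrite big1_seq // => t _; rewrite s0 scale0r.
Qed.

Lemma cmap_chip s : (s <= p)%N -> cmap (chip s) = el (coefP s).
Proof.
case: s => [|s] sp; first by rewrite chip0 linear0 el_coefP0.
by rewrite lfunE /= cft_ext_chip.
Qed.

Lemma cmap_chim s : (s <= p)%N -> cmap (chim s) = el (coefM s).
Proof.
case: s => [|s] sp; first by rewrite chim0 linear0 el_coefM0.
by rewrite lfunE /= cft_ext_chim.
Qed.

Lemma cmap_phi s : (0 < s < p)%N -> cmap (phi s) = el (coefF s).
Proof. by move=> sp; rewrite lfunE /= cft_ext_phi. Qed.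

Lemma cmap_rho s : (s <= p)%N -> cmap (rho s) = el (coefR s).
Proof.
move=> sp; rewrite (el_coefR e f k H) // /rho_cft linearB !linearZ /=.
by rewrite cmap_chip // cmap_chim // leq_subr.
Qed.

Lemma sign_sgn n : (-1) ^+ n = sgn n%:R :> R[i].
Proof. by rewrite (sgn_nat H). Qed.

Lemma qplus_cs n : qplus R p n = cs n%:R.
Proof. by rewrite /cs (chrN H) (chr_nat H). Qed.

Lemma qminus_sn n : qminus R p n = sn n%:R.
Proof. by rewrite /sn (chrN H) (chr_nat H). Qed.

Lemma sineA_nat s t : r^-1 * ((-1) ^+ (p + s + t) * qminus R p (s * t)) = sineA s%:R t%:R.
Proof. by rewrite sign_sgn qminus_sn !natrD natrM /sineA mulrA. Qed.

(** The bracket that carries the factor s/p in S chi^+_s is the preimage of the transform of K_s,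
    and the one in S chi^-_s is that of K_(p-s). The constant and middle terms of the folded sum are
    chi^-_p and chi^+_p, as K_0 = M_p and K_p = P_p. *)
Lemma cmap_S_K (s : nat) : (s <= p)%N ->
  cmap (r^-1 *: (chip p + (-1) ^+ (p + s) *: chim p
      + \sum_(1 <= t < p) qplus R p ((p - s) * t) *: (chip (p - t) + chim t))) =
  el (coefS (coefK s%:R)).
Proof.
move=> sp; rewrite (el_coefSK_nat e f k H r2) linearZ /=; congr (_ *: _).
rewrite !linearD linear_sum linearZ /= cmap_chip // cmap_chim //.
have -> : el (coefK 0) = el (coefM p).
  by have := el_coefK e f k H (leq0n p); rewrite el_coefP0 add0r subn0.
have -> : el (coefK p%:R) = el (coefP p).
  by have := el_coefK e f k H (leqnn p); rewrite subnn el_coefM0 addr0.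
rewrite sign_sgn natrD [X in X + _ = _]addrC; congr (_ + _ + _).
apply: eq_big_nat => t tp; rewrite linearZ linearD /= cmap_chip ?leq_subr // cmap_chim; last by lia.
rewrite (el_coefK e f k H) ?leq_subr // subKn; last by lia.
congr (_ *: _); rewrite qplus_cs natrM natrB // mulrBl /cs.
rewrite /sgn mulrDr -!(chrD H).
have -> : - (pz * t%:R - s%:R * t%:R) = pz * t%:R + s%:R * t%:R.
  by rewrite opprB addrC -mulNr (oppp H).
by rewrite addrC.
Qed.

Lemma cmap_S_chip s : (0 < s <= p)%N -> cmap (cft_S_chip R p s) = el (coefS (coefP s)).
Proof.
move=> sp; have sp' : (s <= p)%N by lia.
rewrite (el_coefSP q e f k r sp) -cmap_S_K // (el_coefSR e f k H r2) //.
pose X c : Zc := chip p + c *: chim p + \sum_(1 <= t < p) qplus R p ((p - s) * t) *: (chip (p - t) + chim t).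
pose Y : Zc := \sum_(1 <= t < p) ((-1) ^+ (p + s + t) * qminus R p (s * t)) *: phi t.
have XX : X ((-1) ^+ (p - s)) = X ((-1) ^+ (p + s)).
  by congr X; rewrite !sign_sgn natrB // natrD !(sgnD H) (sgnN H).
apply: (etrans (lfun_combB cmap r^-1 (s%:R / p%:R) Y XX)).
congr (_ - _); apply: (@lfun_sumZ _ _ _ cmap _ p
  (fun t => (-1) ^+ (p + s + t) * qminus R p (s * t)) (fun t => sineA s%:R t%:R)
  (fun t => phi t) (fun t => el (coefF t))) => t tp.
  exact: cmap_phi.
exact: sineA_nat.
Qed.

Lemma sineA_compl s t : (s <= p)%N ->
  r^-1 * ((-1) ^+ (s + 1) * qminus R p (s * t)) = sineA (p - s)%:R t%:R.
Proof. by move=> sp; rewrite -sineA_nat !qminus_sn (sn_compl_sign H). Qed.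

Lemma cmap_S_chim s : (0 < s <= p)%N -> cmap (cft_S_chim R p s) = el (coefS (coefM s)).
Proof.
move=> sp; have sp' : (s <= p)%N by lia.
rewrite (el_coefSM e f k r H sp) -cmap_S_K ?leq_subr // subKn // /cft_S_chim.
pose X c : Zc := chip p + c *: chim p + \sum_(1 <= t < p) qplus R p (s * t) *: (chip (p - t) + chim t).
pose Y : Zc := \sum_(1 <= t < p) ((-1) ^+ (s + 1) * qminus R p (s * t)) *: phi t.
have XX : X ((-1) ^+ s) = X ((-1) ^+ (p + (p - s))).
  by congr X; rewrite !sign_sgn natrD natrB // !(sgnD H) (sgnN H) mulrA (sgn2 H) mul1r.
apply: (etrans (lfun_combD cmap r^-1 (s%:R / p%:R) Y XX)).
congr (_ + _).
apply: (etrans (@lfun_sumZ _ _ _ cmap _ p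
  (fun t => (-1) ^+ (s + 1) * qminus R p (s * t)) (fun t => sineA (p - s)%:R t%:R)
  (fun t => phi t) (fun t => el (coefF t)) _ _)) => [t tp|t tp|].
- exact: cmap_phi.
- exact: sineA_compl.
have [->|sp2] := eqVneq s p.
  rewrite subnn; apply: (etrans (sineA0_sum _ _ _)).
  by apply/esym/eqP; rewrite oppr_eq0; apply/eqP; exact: el_coefSR0.
have spp : (0 < p - s <= p)%N by lia.
have hR := el_coefSR e f k H r2 spp.
exact: (etrans (esym (opprK _)) (congr1 -%R (esym hR))).
Qed.

Lemma cmap_S_phi s : (0 < s < p)%N -> cmap (cft_S_phi R p s) = el (coefS (coefF s)).
Proof.
move=> sp; rewrite (el_coefSF e f k H r2) // /cft_S_phi scaler_sumr linear_sum.
apply: eq_big_nat => t tp; rewrite scalerA linearZ /= sineA_nat cmap_rho //; lia.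
Qed.

Definition Sop : 'End(Zc) := linfun (cft_ext (cft_S_chip R p) (cft_S_chim R p) (cft_S_phi R p)).

Definition Top : 'End(Zc) := linfun (cft_ext (fun s => lambda R p s *: chip s)
  (fun s => lambda R p (p - s) *: chim s) (fun s => lambda R p s *: (phi s + rho s))).

Lemma SopE x : Sop x = cft_S x. Proof. by rewrite lfunE. Qed.

Lemma TopE x : Top x = cft_T x. Proof. by rewrite lfunE. Qed.

Lemma cmap_S x : cmap (Sop x) = modular_S U (cmap x).
Proof.
rewrite modular_S_cmap [Sop x]lfunE /= -[LHS]/((cmap : {linear Zc -> A}) _) linear_cft_ext; apply: eq_cft_ext => s sp /=.
- exact: cmap_S_chip.
- exact: cmap_S_chim.
- exact: cmap_S_phi.
Qed.

Lemma csum_inj (z : Zc) :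
    (forall t, (0 < t < p)%N -> csum coefP coefM coefF z 0 t%:R = 0) ->
    (forall m, (m < p)%N -> csum coefP coefM coefF z m 0 = 0) ->
    (forall m, (m < p)%N -> csum coefP coefM coefF z m pz = 0) -> z = 0.
Proof.
move=> g0 gz gp.
pose a s := if insub s.-1 is Some j then z (inl (true, j)) else 0.
pose b s := if insub s.-1 is Some j then z (inl (false, j)) else 0.
pose c s := if insub s.-1 is Some j then z (inr j) else 0.
have sumE m u : csum coefP coefM coefF z m u =
    \sum_(1 <= s < p.+1) (a s * coefP s m u + b s * coefM s m u) + \sum_(1 <= t < p) c t * coefF t m u.
  rewrite /csum !mul1r !big_add1 /= !big_mkord -big_split /=.
  by congr (_ + _); apply: eq_bigr => j _; rewrite /a /b /c /= ?valK.
have [a0 b0 c0] : [/\ forall s, (0 < s <= p)%N -> a s = 0, forall s, (0 < s <= p)%N -> b s = 0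
    & forall t, (0 < t < p)%N -> c t = 0].
  by apply: (@central_family_free _ _ _ _ H r2 a b c) => [t tp|m mp|m mp];
    rewrite -sumE ?g0 ?gz ?gp.
apply/ffunP => -[[[] j]|j]; rewrite ffunE.
- by have := a0 j.+1 (ltn_ord j); rewrite /a /= valK.
- by have := b0 j.+1 (ltn_ord j); rewrite /b /= valK.
- by have := c0 j.+1; rewrite /c /= valK; apply; have := ltn_ord j; lia.
Qed.

(** An element of the center determines its coefficients, and these determine the character by
    [central_family_free]. *)
Lemma cmap_inj : injective cmap.
Proof.
move=> x y xy; apply/eqP; rewrite -subr_eq0; apply/eqP.
have z0 : el (csum coefP coefM coefF (x - y)) = 0.
  have -> : el (csum coefP coefM coefF (x - y)) = cmap x - cmap y by rewrite -cmapE; exact: linearB.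
  by rewrite xy subrr.
have g0 m u : (m < p)%N -> csum coefP coefM coefF (x - y) m u = 0.
  by move=> mp; apply: (el_inj H UG (g' := fun _ _ => 0)) mp; rewrite z0; apply/esym/el_eq0.
by apply: csum_inj => *; rewrite g0.
Qed.

Definition samples (g : nat -> Z -> R[i]) : Zc :=
  [ffun i : bool * 'I_p + 'I_p.-1 => match i with
    | inl (true, j) => g j 0 | inl (false, j) => g j pz | inr j => g 0%N j.+1%:R end].

Definition cft_samples (x : Zc) : Zc := samples (csum coefP coefM coefF x).

Lemma csum_linear c x y m u : csum coefP coefM coefF (c *: x + y) m u =
  c * csum coefP coefM coefF x m u + csum coefP coefM coefF y m u.
Proof.
have E z : csum coefP coefM coefF z m u = cft_ext (V := R[i]^o) (fun s => coefP s m u)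
    (fun s => coefM s m u) (fun s => coefF s m u) z by rewrite /csum !mul1r.
by rewrite !E (cft_ext_linear (V := R[i]^o)).
Qed.

Lemma cft_samples_linear : linear cft_samples.
Proof. by move=> c x y; apply/ffunP => -[[[] j]|j]; rewrite !ffunE csum_linear. Qed.

HB.instance Definition _ := GRing.isLinear.Build _ _ _ _ cft_samples cft_samples_linear.

Lemma samplesP g : samples g = 0 ->
  [/\ forall t, (0 < t < p)%N -> g 0%N t%:R = 0, forall m, (m < p)%N -> g m 0 = 0
    & forall m, (m < p)%N -> g m pz = 0].
Proof.
move=> s0; have sE i : samples g i = 0 by rewrite s0 ffunE.
split=> [[//|t] tp|m mp|m mp].
- have tp' : (t < p.-1)%N by lia.
  by have := sE (inr (Ordinal tp')); rewrite ffunE.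
- by have := sE (inl (true, Ordinal mp)); rewrite ffunE.
- by have := sE (inl (false, Ordinal mp)); rewrite ffunE.
Qed.

(* The sample values determine a central family, and there are as many of them
   as basis vectors; so a linear map that is injective on samples is onto. *)
Lemma cmap_onto g : central_coef q g -> exists x, cmap x = el g.
Proof.
move=> cg; pose L : 'End(Zc) := linfun cft_samples.
have L0 : lker L == 0%VS.
  apply/lker0P => x y; rewrite !lfunE /= => xy; apply/eqP; rewrite -subr_eq0; apply/eqP.
  have [] := @samplesP (csum coefP coefM coefF (x - y)).
    have sB : cft_samples (x - y) = cft_samples x - cft_samples y by exact: linearB.
    by rewrite -[LHS]/(cft_samples (x - y)) sB xy subrr.
  exact: csum_inj.
have /memv_imgP [x _ xE] : samples g \in limg L by rewrite lker0_limgf // memvf.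
exists x; rewrite cmapE; apply: eq_el => m u mp; apply/eqP; rewrite -subr_eq0; apply/eqP.
pose D m u := 1 * csum coefP coefM coefF x m u + (-1) * g m u.
have DE n v : D n v = csum coefP coefM coefF x n v - g n v by rewrite /D mul1r mulN1r.
have cD : central_coef q D by apply: central_coefD => //; exact: central_csum.
have [] := @samplesP D.
  have xE' : samples g = samples (csum coefP coefM coefF x) by rewrite xE lfunE.
  have E i : samples g i = samples (csum coefP coefM coefF x) i by rewrite xE'.
  apply/ffunP => -[[[] j]|j].
  - by have := E (inl (true, j)); rewrite !ffunE DE => ->; rewrite subrr.
  - by have := E (inl (false, j)); rewrite !ffunE DE => ->; rewrite subrr.
  - by have := E (inr j); rewrite !ffunE DE => ->; rewrite subrr.
by move=> d1 d2 d3; rewrite -(DE m u); exact: (central_coef_sample0 H cD).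
Qed.

End Equivalence.

(** * Representations of SL(2,Z) from the normal form in Z/2 * Z/3 *)

(* The normal form of an element of Z/2 * Z/3 = <s, u | s^2, u^3>: u^i followed by a
   product of factors s u (true) and s u^2 (false), followed by s when the flag is set. *)
Definition nform : Type := 'I_3 * seq bool * bool.

Definition nf_u (x : nform) : nform := (x.1.1 + 1, x.1.2, x.2)%R.

(** With i = 1 or 2 the factor s u^i is pushed onto the word. With i = 0 the new s cancels the
    leading s of the word and exposes u or u^2, or toggles the final s if the word is empty; [1 + 1]
    is the residue 2. *)
Definition nf_s (x : nform) : nform :=
  let: (i, w, y) := x in
  if i == 1 then (0, true :: w, y) else if i == 0 then
    if w is c :: w' then ((if c then 1 else 1 + 1), w', y) else (0, [::], ~~ y)
  else (0, false :: w, y).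

Definition nf_norm (l : seq bool) : nform :=
  foldr (fun c : bool => if c then nf_s else nf_u) (0, [::], false) l.

(** * Evaluation of words and normal forms *)

Section FreeProduct.
Variables (G : Type) (mul : G -> G -> G) (one s u : G) (eqv : G -> G -> Prop).
Hypothesis mulA : associative mul.
Hypothesis mul1g : left_id one mul.
Hypothesis mulg1 : right_id one mul.
Hypothesis eqvxx : forall x, eqv x x.
Hypothesis eqv_trans : forall x y z, eqv x y -> eqv y z -> eqv x z.
Hypothesis eqv_sym : forall x y, eqv x y -> eqv y x.
Hypothesis eqv_mul : forall x x' y y', eqv x x' -> eqv y y' -> eqv (mul x y) (mul x' y').
Hypothesis ss : eqv (mul s s) one.
Hypothesis uuu : eqv (mul u (mul u u)) one.

Definition word_eval (l : seq bool) : G :=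
  foldr (fun c : bool => mul (if c then s else u)) one l.

Definition pos_eval (w : seq bool) (e : G) : G :=
  foldr (fun c : bool => mul (mul s (if c then u else mul u u))) e w.

Definition nf_eval (x : nform) : G :=
  mul (if x.1.1 == 0 then one else if x.1.1 == 1 then u else mul u u)
      (pos_eval x.1.2 (if x.2 then s else one)).

Lemma word_eval_cat l l' : word_eval (l ++ l') = mul (word_eval l) (word_eval l').
Proof. by elim: l => [|c l IH] /=; rewrite ?mul1g // IH mulA. Qed.

Lemma nf_eval_u x : eqv (mul u (nf_eval x)) (nf_eval (nf_u x)).
Proof.
case: x => [[i w] y]; rewrite /nf_eval /nf_u /=; case: i => -[|[|[|//]]] ip /=;
  rewrite ?mul1g ?mulA -?mulA //.
by rewrite -[X in eqv _ X]mul1g !mulA -(mulA u u u); apply: (eqv_mul).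
Qed.

Lemma nf_eval_s x : eqv (mul s (nf_eval x)) (nf_eval (nf_s x)).
Proof.
have sK x' : eqv (mul s (mul s x')) x'.
  by rewrite mulA -[X in eqv _ X]mul1g; exact: (eqv_mul ss (eqvxx _)).
case: x => [[i w] y]; rewrite /nf_eval /nf_s /=; case: i => -[|[|[|//]]] ip /=.
- case: w => [|c w] /=; first by rewrite !mul1g; case: y => //=; rewrite mulg1.
  by rewrite mul1g; case: c => /=; rewrite -[mul (mul s _) _]mulA; exact: sK.
- by rewrite mul1g mulA.
- by rewrite mul1g mulA.
Qed.

(** Multiplication by a generator on the left is mirrored by [nf_s] and [nf_u]. The equivalence is a
    parameter because matrices are compared up to sign and endomorphisms by equality. *)
Lemma word_eval_norm l : eqv (word_eval l) (nf_eval (nf_norm l)).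
Proof.
elim: l => [|c l IH] /=; first by rewrite /nf_eval /= mul1g.
apply: (eqv_trans (y := mul (if c then s else u) (nf_eval (nf_norm l)))).
  exact: eqv_mul.
by case: c; [exact: nf_eval_s|exact: nf_eval_u].
Qed.

Definition word_inv (l : seq bool) : seq bool :=
  foldr (fun (c : bool) l => l ++ (if c then [:: true] else [:: false; false])) [::] l.

Lemma word_invP l : eqv (mul (word_eval (word_inv l)) (word_eval l)) one.
Proof.
elim: l => [|c l IH] /=; first by rewrite mul1g.
apply: (eqv_trans _ IH); rewrite word_eval_cat -mulA; apply: eqv_mul => //.
rewrite mulA -[X in eqv _ X]mul1g; apply: eqv_mul => //.
case: c => /=; first by rewrite -mulA mul1g.
by rewrite -!mulA mul1g.
Qed.

End FreeProduct.

(** * Normal forms and generation in SL(2,Z) *)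

Section ModularMatrices.
Local Notation M2 := 'M[int]_2.

Lemma mx22E (g : M2) : g = mx22 (g 0 0) (g 0 1) (g 1 0) (g 1 1).
Proof.
by apply/matrixP => i j; rewrite mxE; case: i => -[|[|//]] ip; case: j => -[|[|//]] jp;
  rewrite /=; congr (g _ _); apply/val_inj.
Qed.

Lemma mx22M a b c d a' b' c' d' : mx22 a b c d * mx22 a' b' c' d' =
  mx22 (a * a' + b * c') (a * b' + b * d') (c * a' + d * c') (c * b' + d * d').
Proof.
apply/matrixP => i j; rewrite !mxE !big_ord_recl big_ord0 /= !mxE /= addr0.
by case: i => -[|[|//]] ip; case: j => -[|[|//]] jp.
Qed.

Lemma mx22N a b c d : - mx22 a b c d = mx22 (- a) (- b) (- c) (- d).
Proof.
by apply/matrixP => i j; rewrite !mxE; case: ifP; case: ifP.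
Qed.

Lemma mx22_1 : 1 = mx22 1 0 0 1.
Proof.
by apply/matrixP => i j; rewrite !mxE; case: i => -[|[|//]] ip; case: j => -[|[|//]] jp.
Qed.

Lemma mx22_inj a b c d a' b' c' d' : mx22 a b c d = mx22 a' b' c' d' ->
  [/\ a = a', b = b', c = c' & d = d'].
Proof.
move/matrixP => e; split.
- by have := e 0 0; rewrite !mxE.
- by have := e 0 1; rewrite !mxE.
- by have := e 1 0; rewrite !mxE.
- by have := e 1 1; rewrite !mxE.
Qed.

Lemma det_mx22 a b c d : \det (mx22 a b c d) = a * d - b * c.
Proof.
rewrite (expand_det_row _ 0) !big_ord_recl big_ord0 addr0 /cofactor /= !det_mx11 !mxE /=.
by rewrite expr0 expr1; ring.
Qed.

Definition eqpm (x y : M2) : Prop := x = y \/ x = - y.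

Lemma eqpm_refl x : eqpm x x. Proof. by left. Qed.

Lemma eqpm_trans x y z : eqpm x y -> eqpm y z -> eqpm x z.
Proof. by case=> ->; case=> ->; rewrite ?opprK; [left|right|right|left]. Qed.

Lemma eqpm_sym x y : eqpm x y -> eqpm y x.
Proof. by case=> ->; [left|right; rewrite opprK]. Qed.

Lemma eqpm_mul x x' y y' : eqpm x x' -> eqpm y y' -> eqpm (x * y) (x' * y').
Proof.
by case=> ->; case=> ->; rewrite ?mulrNN ?mulrN ?mulNr; [left|right|right|left].
Qed.

Let s : M2 := SL2Z_S.
Definition SL2Z_U : M2 := SL2Z_S * SL2Z_T.
Let u := SL2Z_U.

Lemma SL2Z_UE : u = mx22 0 1 (-1) (-1).
Proof. by rewrite /u /SL2Z_U /SL2Z_S /SL2Z_T mx22M. Qed.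

Lemma SL2Z_SS : eqpm (s * s) 1.
Proof. by right; rewrite /s /SL2Z_S mx22M mx22_1 mx22N. Qed.

Lemma SL2Z_UUU : eqpm (u * (u * u)) 1.
Proof. by left; rewrite SL2Z_UE !mx22M mx22_1. Qed.

Local Notation ev := (word_eval *%R 1 s u).
Local Notation nfev := (nf_eval *%R 1 s u).

Lemma SL2Z_word_norm l : eqpm (ev l) (nfev (nf_norm l)).
Proof.
by apply: word_eval_norm; do ?[exact: mulrA|exact: mul1r|exact: mulr1|exact: eqpm_refl
  |exact: eqpm_trans|exact: eqpm_mul|exact: SL2Z_SS|exact: SL2Z_UUU].
Qed.

Lemma SL2Z_word_inv l : eqpm (ev (word_inv l) * ev l) 1.
Proof.
by apply: word_invP; do ?[exact: mulrA|exact: mul1r|exact: mulr1|exact: eqpm_refl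
  |exact: eqpm_trans|exact: eqpm_mul|exact: SL2Z_SS|exact: SL2Z_UUU].
Qed.

(** Up to sign s u and s u^2 are the elementary matrices with one off-diagonal 1, so a product of
    them has nonnegative entries, and a nonempty product has a positive off-diagonal entry. *)
Lemma pos_evalP w (e : M2) : exists a b c d : int,
  [/\ eqpm (pos_eval *%R s u w e) (mx22 a b c d * e), 1 <= a, 1 <= d, 0 <= b & 0 <= c]
  /\ (w != [::] -> 1 <= b + c).
Proof.
elim: w => [|x w [a [b [c [d [[h a1 d1 b0 c0] _]]]]]].
  by exists 1, 0, 0, 1; split=> //; split=> //=; rewrite -mx22_1 mul1r; left.
have h' (y : M2) z : eqpm (s * y) z -> eqpm (s * y * pos_eval *%R s u w e) (z * mx22 a b c d * e).
  by move=> hy; rewrite -[z * _ * e]mulrA; exact: eqpm_mul.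
case: x => /=.
  exists (a + c), (b + d), c, d; split; last by lia.
  split; try lia; apply: (eqpm_trans (h' _ (mx22 1 1 0 1) _)).
    by right; rewrite SL2Z_UE /s /SL2Z_S mx22M mx22N.
  by left; rewrite mx22M; congr (mx22 _ _ _ _ * _); ring.
exists a, b, (a + c), (b + d); split; last by lia.
split; try lia; apply: (eqpm_trans (h' _ (mx22 1 0 1 1) _)).
  by left; rewrite SL2Z_UE /s /SL2Z_S !mx22M.
by left; rewrite mx22M; congr (mx22 _ _ _ _ * _); ring.
Qed.

(** For each of the six choices of the leading power of u and the final s, the sign pattern of the
    positive part excludes plus or minus the identity, except for the empty form. *)
Lemma nf_eval_eq1 x : eqpm (nfev x) 1 -> x = (0, [::], false).
Proof.
case: x => [[i w] y]; rewrite /nf_eval /= => e1.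
have [a [b [c [d [[h a1 d1 b0 c0] bc]]]]] := pos_evalP w (if y then s else 1).
have {}e1 := eqpm_trans (eqpm_mul (eqpm_refl _) (eqpm_sym h)) e1.
have sE : s = mx22 0 1 (-1) 0 by [].
case: i e1 => -[|[|[|//]]] ip /=; case: y {h};
  rewrite /eqpm ?SL2Z_UE ?sE ?mulr1 ?mul1r ?mx22M mx22_1 ?mx22N => -[]/mx22_inj[]; try lia.
  by case: w bc => [_ _ _ _ _|x w /(_ isT)]; [congr (_, _, _); apply/val_inj|lia].
Qed.

Definition generated (g : M2) := exists l, eqpm g (ev l).

Lemma generatedM g h : generated g -> generated h -> generated (g * h).
Proof.
move=> [l gl] [l' hl]; exists (l ++ l').
by rewrite (word_eval_cat _ _ (@mulrA _) (@mul1r _)); exact: eqpm_mul.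
Qed.

Lemma generatedN g : generated g -> generated (- g).
Proof. by case=> l h; exists l; apply: eqpm_trans h; right. Qed.

Lemma generated_S : generated s.
Proof. by exists [:: true]; rewrite /= mulr1; left. Qed.

Lemma generated_Tn (n : int) : generated (mx22 1 n 0 1).
Proof.
have T1 : generated (mx22 1 1 0 1).
  exists [:: true; false]; right; rewrite /= mulr1 SL2Z_UE /s /SL2Z_S mx22M mx22N.
  by congr mx22.
have T2 : generated (mx22 1 (-1) 0 1).
  exists [:: false; false; true]; left; rewrite /= mulr1 SL2Z_UE /s /SL2Z_S !mx22M.
  by congr mx22.
have pw (x : int) (k : nat) : generated (mx22 1 x 0 1) -> generated (mx22 1 (x *+ k) 0 1).
  move=> gx; elim: k => [|k IH]; first by exists [::]; left; rewrite mulr0n -mx22_1.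
  have := generatedM gx IH; rewrite mx22M mulrS.
  by congr (generated (mx22 _ _ _ _)); ring.
case: n => k; first by have := pw _ k T1; rewrite natz.
by have := pw _ k.+1 T2; rewrite NegzE mulNrn natz.
Qed.

(** The Euclidean algorithm on the first column: with a = k c + a', the factors T^k and S leave a
    matrix of determinant 1 with first column (c, -a'). The next round, with the smaller |a'| in
    place of |c|, is the induction hypothesis. *)
Lemma SL2Z_generated g : \det g = 1 -> generated g.
Proof.
rewrite (mx22E g); move: (g 0 0) (g 0 1) (g 1 0) (g 1 1) => a b c d {g}.
have [n le_n] := ubnP `|c|%N; elim: n a b c d le_n => // n IH a b c d le_n.
rewrite det_mx22 => e1; have [c0|c0] := eqVneq c 0.
  rewrite c0 mulr0 subr0 in e1 *.
  have : a = 1 /\ d = 1 \/ a = -1 /\ d = -1.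
    have : a \is a GRing.unit by apply/unitrPr; exists d.
    by rewrite qualifE /= => /orP[]/eqP ea; rewrite ea in e1 *; lia.
  case=> -[-> ->]; first exact: generated_Tn.
  have := generatedN (generated_Tn (- b)); rewrite mx22N opprK oppr0.
  by [].
pose k := (a %/ c)%Z; pose a' := (a %% c)%Z.
have ea : a = k * c + a' by exact: divz_eq.
have la : (`|a'| < n)%N by have := ltz_mod a c0; have := modz_ge0 a c0; lia.
have e2 : \det (mx22 c d (- a') (- (b - k * d))) = 1.
  by rewrite det_mx22 -[RHS]e1 ea; ring.
have ga := IH c d (- a') (- (b - k * d)) _ e2.
have -> : mx22 a b c d = - (mx22 1 k 0 1 * (s * mx22 c d (- a') (- (b - k * d)))).
  rewrite /s /SL2Z_S !mx22M mx22N ea; congr mx22; ring.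
apply: generatedN; apply: generatedM; first exact: generated_Tn.
by apply: generatedM; [exact: generated_S|apply: ga; rewrite abszN].
Qed.

End ModularMatrices.

(** * From the relations to a representation *)

Section ModularRepresentation.
Variables (K : fieldType) (V : vectType K) (s t : 'End(V)).
Hypothesis ss : (s \o s)%VF = \1%VF.
Hypothesis st3 : ((s \o t) \o ((s \o t) \o (s \o t)))%VF = \1%VF.

Let compA : associative (@comp_lfun K V V V).
Proof. by move=> x y z; rewrite comp_lfunA. Qed.
Let comp1 : left_id \1%VF (@comp_lfun K V V V).
Proof. by move=> x; rewrite comp_lfun1l. Qed.

Let comp1r : right_id \1%VF (@comp_lfun K V V V).
Proof. by move=> x; rewrite comp_lfun1r. Qed.

Local Notation evM := (word_eval *%R 1 SL2Z_S SL2Z_U).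
Local Notation evV := (word_eval (@comp_lfun K V V V) \1%VF s (s \o t)%VF).

(** The relations of the operators reduce the word to its normal form, and this form is empty
    because its matrix value is plus or minus 1. So the two relations are complete for PSL(2,Z). *)
Lemma word_eval_eq1 l : eqpm (evM l) 1 -> evV l = \1%VF.
Proof.
move=> l1.
have hM : eqpm (evM l) (nf_eval *%R 1 SL2Z_S SL2Z_U (nf_norm l)).
  exact: SL2Z_word_norm.
have hV : evV l = nf_eval (@comp_lfun K V V V) \1%VF s (s \o t)%VF (nf_norm l).
  apply: (word_eval_norm (eqv := eq)) => //; [by move=> x y z -> ->|by move=> x x' y y' -> ->].
rewrite hV (nf_eval_eq1 (eqpm_trans (eqpm_sym hM) l1)) /nf_eval /=.
by rewrite comp_lfun1l.
Qed.

Lemma word_eval_inj l l' : eqpm (evM l) (evM l') -> evV l = evV l'.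
Proof.
move=> ll; have e1 : evV (word_inv l ++ l') = \1%VF.
  apply: word_eval_eq1; rewrite (word_eval_cat _ _ (@mulrA _) (@mul1r _)).
  apply: (eqpm_trans (eqpm_mul (eqpm_refl _) (eqpm_sym ll))).
  exact: SL2Z_word_inv.
have e2 : (evV (word_inv l) \o evV l)%VF = \1%VF.
  apply: (word_invP (eqv := eq)) => //; [by move=> x y z -> ->|by move=> x x' y y' -> ->].
have e3 : (evV l \o evV (word_inv l))%VF = \1%VF.
  have inj : lker (evV l) == 0%VS.
    apply/lker0P => x y exy.
    by rewrite -[x]id_lfunE -[y]id_lfunE -e2 !comp_lfunE exy.
  have -> : evV (word_inv l) = (evV l)^-1%VF.
    have := congr1 (fun z => z \o (evV l)^-1)%VF e2.
    by rewrite -comp_lfunA (lker0_compfV inj) comp_lfun1r comp_lfun1l.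
  exact: lker0_compfV.
transitivity (evV l \o (evV (word_inv l) \o evV l'))%VF.
  by rewrite -(word_eval_cat _ _ compA comp1) e1 comp_lfun1r.
by rewrite comp_lfunA e3 comp_lfun1l.
Qed.

(** Each matrix is assigned a chosen word; by [word_eval_inj] the operator does not depend on the
    choice, which gives multiplicativity. *)
Lemma SL2Z_rep_exists : exists rho, [/\ SL2Z_rep rho, rho SL2Z_S = s & rho SL2Z_T = t].
Proof.
have [w hw] : exists w : 'M[int]_2 -> seq bool, forall g, \det g = 1 -> eqpm g (evM (w g)).
  have ch (g : 'M[int]_2) : exists l, \det g = 1 -> eqpm g (evM l).
    have [g1|g1] := eqVneq (\det g) 1; last by exists [::] => e1; rewrite e1 eqxx in g1.
    by have [l gl] := SL2Z_generated g1; exists l.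
  by have [w hw] := boolp.choice ch; exists w.
have dS : \det SL2Z_S = 1 by rewrite det_mx22.
have dT : \det SL2Z_T = 1 by rewrite det_mx22.
have ev g l : \det g = 1 -> eqpm g (evM l) -> evV (w g) = evV l.
  by move=> g1 gl; apply: word_eval_inj; apply: eqpm_trans gl; apply: eqpm_sym; exact: hw.
exists (fun g => evV (w g)); split; first split.
- by rewrite (ev 1 [::]) ?det1 //; left.
- move=> g h g1 h1; rewrite (ev _ (w g ++ w h)).
  + by rewrite (word_eval_cat _ _ compA comp1).
  + by rewrite det_mulmx g1 h1 mulr1.
  + by rewrite (word_eval_cat _ _ (@mulrA _) (@mul1r _)); apply: eqpm_mul; exact: hw.
- by rewrite (ev _ [:: true]) //= ?comp_lfun1r // mulr1; left.
- rewrite (ev _ [:: true; false]) //=.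
    by rewrite comp_lfun1r comp_lfunA ss comp_lfun1l.
  right; rewrite mulr1 SL2Z_UE /SL2Z_S /SL2Z_T mx22M mx22N; congr mx22.
Qed.

End ModularRepresentation.

(** * The equivalence *)

Section CenterTransport.
Variables (K : fieldType) (V : vectType K) (A : falgType K).
Variables (L : 'Hom(V, A)) (S T : 'End(V)) (mS pinv : A -> A) (v : A) (b : K).
Hypothesis L_inj : injective L.
Hypothesis L_center : forall x, L x \in 'Z({:A})%VS.
Hypothesis L_onto : forall z, z \in 'Z({:A})%VS -> exists x, L x = z.
Hypothesis L_S : forall x, mS (L x) = L (S x).
Hypothesis SS : (S \o S)%VF = \1%VF.
Hypothesis ST3 : ((S \o T) \o ((S \o T) \o (S \o T)))%VF = \1%VF.
Hypothesis b0 : b != 0.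
Hypothesis L_T : forall x, v * L (T x) = b *: L x.
Hypothesis pinvE : forall x, pinv (L x) = L (S x).

Let SSx x : S (S x) = x.
Proof. by rewrite -[RHS](@id_lfunE _ V) -SS comp_lfunE. Qed.

Let centerP (z : A) : z \in 'Z({:A})%VS -> forall y, y * z = z * y.
Proof. by rewrite memv_cap => /andP[_ /centvP zc] y; rewrite zc // memvf. Qed.

(** The element 1 is central, hence L x for some x, and L (T x) / b is then an inverse of v. *)
Let v_unit : v \is a GRing.unit.
Proof.
have one_center : 1 \in 'Z({:A})%VS.
  by rewrite memv_cap memvf; apply/centvP => y _; rewrite mul1r mulr1.
have [x x1] := L_onto one_center.
have vr : v * (b^-1 *: L (T x)) = 1 by rewrite -scalerAr L_T scalerA mulVf // scale1r.
apply/unitrP; exists (b^-1 *: L (T x)); split=> //.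
by rewrite -scalerAl -(centerP (L_center _)) scalerAr.
Qed.

Let Phi : 'Hom(V, subvs_of 'Z({:A})%VS) := (linfun (vsproj 'Z({:A})%VS) \o (L \o S))%VF.

Let PhiE x : vsval (Phi x) = L (S x).
Proof. by rewrite comp_lfunE lfunE /= vsprojK comp_lfunE. Qed.

Let Phi_inj : lker Phi == 0%VS.
Proof.
apply/lker0P => x y /(congr1 vsval); rewrite !PhiE => /L_inj /(congr1 S).
by rewrite !SSx.
Qed.

Let PhiK : cancel Phi Phi^-1%VF := lker0_lfunK Phi_inj.

Let PhiVK : cancel Phi^-1%VF Phi.
Proof.
move=> z; apply: limg_lfunVK; have [x xz] := L_onto (subvsP z).
have -> : z = Phi (S x) by apply: val_inj; rewrite /= PhiE SSx xz.
by rewrite memv_img // memvf.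
Qed.

Lemma center_transport :
  exists (rhoC : 'M[int]_2 -> 'End(V)) (rhoZ : 'M[int]_2 -> 'End(subvs_of 'Z({:A})%VS)),
  [/\ [/\ SL2Z_rep rhoC, forall x, rhoC SL2Z_S x = S x & forall x, rhoC SL2Z_T x = T x],
      [/\ SL2Z_rep rhoZ, forall z, vsval (rhoZ SL2Z_S z) = mS (vsval z)
        & forall z, vsval (rhoZ SL2Z_T z) = b *: pinv (v^-1 * mS (vsval z))]
    & SL2Z_equivalent rhoC rhoZ].
Proof.
have [rho [[rho1 rhoM] rhoS rhoT]] := SL2Z_rep_exists SS ST3.
pose rhoZ g := (Phi \o (rho g \o Phi^-1))%VF; exists rho, rhoZ.
have rhoZE g z : rhoZ g z = Phi (rho g (Phi^-1%VF z)) by rewrite !comp_lfunE.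
split.
- by split=> [//|x|x]; rewrite ?rhoS ?rhoT.
- split=> [|z|z].
  + split=> [|g1 g2 d1 d2]; apply/lfunP => z.
      by rewrite rhoZE rho1 !id_lfunE PhiVK.
    transitivity (rhoZ g1 (rhoZ g2 z)); last by rewrite [RHS]comp_lfunE.
    by rewrite !rhoZE rhoM // comp_lfunE PhiK.
  + by rewrite rhoZE rhoS -{2}[z]PhiVK !PhiE L_S.
  (* For z = L (S x), S maps z to L x, multiplication by v^-1 gives L (T x) / b, and the inverse of
     S gives L (S (T x)) / b; the factor b in the definition of T on the center restores the
     scale. *)
  + rewrite rhoZE rhoT -{2}[z]PhiVK !PhiE L_S SSx; set x := Phi^-1%VF z.
    have -> : v^-1 * L x = L (b^-1 *: T x).
      apply: (mulrI v_unit); rewrite mulVKr // linearZ /= -scalerAr L_T scalerA mulVf //.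
      by rewrite scale1r.
    rewrite pinvE; have -> : L (S (b^-1 *: T x)) = b^-1 *: L (S (T x)) by rewrite !linearZ.
    by rewrite scalerA divff // scale1r.
- exists Phi; split; first by exists Phi^-1%VF; [exact: PhiK | exact: PhiVK].
  by move=> g _ x; rewrite rhoZE PhiK.
Qed.

End CenterTransport.

(** * The phases of T *)

Section TwistValues.
Variables (R : realType) (p : nat).
Hypothesis p1 : (1 < p)%N.
Local Notation q := (qroot R p).
Local Notation h := (hroot R p).
Local Notation Z := 'Z_(2 * p).
Local Notation pz := (p%:R : Z).
Let H : even_root p q := qroot_even_root R p1.
Let h2 : h ^+ 2 = q := hroot_sq R p1.
Let pR : p%:R != 0 :> R. Proof. by rewrite pnatr_eq0; lia. Qed.

Definition central_phase : R[i] := expi (pi * ((p%:R + 1) ^+ 2 / (2 * p%:R) - 12^-1) : R).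
Local Notation b := central_phase.

Lemma central_phase_neq0 : b != 0. Proof. exact: expi_neq0. Qed.

Let expi_sign (n : nat) : (-1) ^+ n = expi (- pi * n%:R : R).
Proof. by rewrite expi_natr expiN expi_pi invrN invr1. Qed.

Let h_exp (n : nat) : h ^+ n = expi (pi / (2 * p)%:R * n%:R : R).
Proof. by rewrite expi_natr. Qed.

(** Comparison of exponents in units of pi: (p + 1)^2/(2p) - 1/(2p) + t^2/(2p) - t - 1 equals (p -
    t)^2/(2p). *)
Lemma tau_lambda t : @tau _ p q h b t%:R = lambda R p t.
Proof.
rewrite /tau (sgn_nat H) (gauss_nat H h2) expi_sign h_exp.
rewrite -mulN1r -[- 1](expr1 (-1)) expi_sign -expiN -!expiD /lambda; congr expi.
by rewrite !natrM; field.
Qed.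

(** The summand -1/12 of the phase of b becomes -1/4 in the cube and cancels the phase pi/4 of the
    Gauss sum. *)
Lemma central_phase_cube : b ^+ 3 * \sum_(u : Z) gauss h u =
  - ((Num.sqrt (2 * p%:R : R))%:C%C * sgn q pz * h ^+ 3 * gauss h pz).
Proof.
rewrite (gauss_sum R p1) (sgn_nat H) (gauss_nat H h2) !h_exp -expi_natr.
rewrite -(expi_pi R) -expi_natr.
set s := (_)%:C%C; rewrite -!mulrA -mulrN mulrCA; congr (s * _).
(* The sign is written e^(3 i pi) so that the exponents of both sides agree as real numbers, not
   only modulo 2 pi. *)
have -> x : - x = expi (pi * 3%:R : R) * x :> R[i].
  by rewrite expi_natr expi_pi -signr_odd expr1 mulN1r.
by rewrite -!expiD; congr expi; rewrite !natrM; field.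
Qed.

End TwistValues.

(** * The hypotheses of the transport for the restricted quantum group *)

Section Equivalence.
Variables (R : realType) (p : nat) (A : falgType R[i]) (U : restricted_Usl2 p A).
Hypothesis p1 : (1 < p)%N.
Local Notation q := (qroot R p).
Local Notation Z := 'Z_(2 * p).
Local Notation th := (q - q^-1).
Local Notation k := (UK U).
Local Notation e := (th *: UE U).
Local Notation f := (th *: UF U).
Local Notation el := (@el _ p q A e f k).
Local Notation r := ((Num.sqrt (2 * p%:R : R))%:C%C : R[i]).
Local Notation h := (hroot R p).
Local Notation b := (central_phase R p).
Local Notation Zc := (Zcft R p).
Local Notation cmap := (cmap U).
Local Notation Sop := (Sop R p).
Local Notation Top := (Top R p).
Let H : even_root p q := qroot_even_root R p1.
Let h2 : h ^+ 2 = q := hroot_sq R p1.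
Let UG : uq_generators p q e f k := U_generators U p1.
Let r2 : r ^+ 2 = (2 * p)%:R := r_sq R p.
Let b3 := central_phase_cube R p1.

Let L_chip s : (s <= p)%N -> cmap (chip R p s) = el (@coefP _ p q s) := cmap_chip U (s := s).
Let L_chim s : (s <= p)%N -> cmap (chim R p s) = el (@coefM _ p q s) := cmap_chim U (s := s).
Let L_phi s : (0 < s < p)%N -> cmap (phi R p s) = el (@coefF _ p q r s) := cmap_phi U (s := s).

Let L_central x : exists2 g, central_coef q g & cmap x = el g.
Proof. by eexists; [exact: (central_csum p1 x) | exact: cmapE]. Qed.

Let L_onto g : central_coef q g -> exists x, cmap x = el g := @cmap_onto _ _ _ U p1 g.

Let L_S x g : central_coef q g -> cmap x = el g -> cmap (Sop x) = el (@coefS _ p q r g).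
Proof. by move=> cg xg; rewrite (cmap_S U p1) xg (modular_SE U p1). Qed.

Let T_chip s : (s <= p)%N -> Top (chip R p s) = @tau _ p q h b s%:R *: chip R p s.
Proof.
rewrite (tau_lambda R p1); case: s => [|s] sp; first by rewrite chip0 linear0 scaler0.
by rewrite lfunE /= cft_ext_chip.
Qed.

Let T_chim s : (s <= p)%N -> Top (chim R p s) = @tau _ p q h b (p - s)%:R *: chim R p s.
Proof.
rewrite (tau_lambda R p1); case: s => [|s] sp; first by rewrite chim0 linear0 scaler0.
by rewrite lfunE /= cft_ext_chim.
Qed.

Let T_phi s : (0 < s < p)%N ->
  Top (phi R p s) = @tau _ p q h b s%:R *: (phi R p s + rho_cft R p s).
Proof. by move=> sp; rewrite (tau_lambda R p1) lfunE /= cft_ext_phi. Qed.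

Let basis_ext (W : vectType R[i]) (g1 g2 : 'Hom(Zc, W)) :
  (forall s, (0 < s <= p)%N -> g1 (chip R p s) = g2 (chip R p s)) ->
  (forall s, (0 < s <= p)%N -> g1 (chim R p s) = g2 (chim R p s)) ->
  (forall s, (0 < s < p)%N -> g1 (phi R p s) = g2 (phi R p s)) -> g1 = g2.
Proof. by move=> e1 e2 e3; apply/lfunP => x; exact: (cft_linear_ext (g := g1) (h := g2)). Qed.

Lemma cft_SS : (Sop \o Sop)%VF = \1%VF.
Proof. exact: (model_SS H r2 (@cmap_inj _ _ _ U p1) L_central L_S). Qed.

Lemma cft_ST3 : ((Sop \o Top) \o ((Sop \o Top) \o (Sop \o Top)))%VF = \1%VF.
Proof.
exact: (model_STSTST H r2 h2 b3 (@cmap_inj _ _ _ U p1) L_chip L_chim L_phi L_central L_onto L_S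
  T_chip T_chim T_phi basis_ext).
Qed.

Lemma ribbon_cmap x : ribbon U * cmap (Top x) = b *: cmap x.
Proof.
rewrite (ribbonE U p1).
exact: (model_ribbon H UG r2 h2 L_chip L_chim L_phi T_chip T_chim T_phi basis_ext).
Qed.

Lemma cmap_center x : cmap x \in 'Z({:A})%VS.
Proof.
rewrite memv_cap memvf; apply/centvP => y _.
by have [g cg ->] := L_central x; rewrite (el_central H UG cg).
Qed.

Lemma center_cmap z : z \in 'Z({:A})%VS -> exists x, cmap x = z.
Proof.
rewrite memv_cap => /andP[_ /centvP zc].
have [|g cg ->] := central_el H UG (x := z); last exact: L_onto.
by move=> y; rewrite zc // memvf.
Qed.

(** The partial inverse returns some central y with the prescribed image; as S^2 = 1 on the center,
    S is injective there and y is the S-image. *)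
Lemma pinv_modular_S x :
  'pinv_(fun=> 0) [set z | z \in 'Z({:A})%VS]%classic (modular_S U) (cmap x) = cmap (Sop x).
Proof.
have SSx y : Sop (Sop y) = y by rewrite -[RHS](@id_lfunE _ Zc) -cft_SS comp_lfunE.
pose C : set A := [set z | z \in 'Z({:A})%VS]%classic.
set y := 'pinv_ _ _ _ _.
have [Cy Sy] : C y /\ modular_S U y = cmap x.
  have im : (modular_S U @` C)%classic (cmap x).
    exists (cmap (Sop x)); first exact: cmap_center.
    by rewrite -(cmap_S U p1) SSx.
  split; last by apply: pinvK; rewrite inE.
  have homo : {homo 'pinv_(fun=> 0) C (modular_S U) :
      x / (modular_S U @` C)%classic x >-> C x} by apply: funS.
  exact: homo.
have [x' x'y] := center_cmap Cy.
rewrite -x'y; congr (cmap _); rewrite -[LHS]SSx; congr (Sop _).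
by apply: (@cmap_inj _ _ _ U p1); rewrite (cmap_S U p1) x'y.
Qed.

End Equivalence.

Theorem theorem1p1 (R : realType) (p : nat) (hp : (2 <= p)%N)
    (A : falgType R[i]) (U : restricted_Usl2 p A) :
  exists (rhoC : 'M[int]_2 -> 'End(Zcft R p))
         (rhoZ : 'M[int]_2 -> 'End(subvs_of 'Z({:A})%VS)),
    [/\ cft_SL2Z_rep rhoC, center_SL2Z_rep U rhoZ
      & SL2Z_equivalent rhoC rhoZ].
Proof.
have [rhoC [rhoZ [[C1 C2 C3] [Z1 Z2 Z3] E]]] :=
  center_transport (@cmap_inj _ _ _ U hp) (cmap_center U hp) (@center_cmap _ _ _ U hp)
    (fun x => esym (cmap_S U hp x)) (cft_SS U hp) (cft_ST3 U hp) (central_phase_neq0 R p)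
    (ribbon_cmap U hp) (pinv_modular_S U hp).
exists rhoC, rhoZ; apply: And3; last exact: E.
  apply: And3; first exact: C1.
    by move=> x; exact: (etrans (C2 x) (SopE x)).
  by move=> x; exact: (etrans (C3 x) (TopE x)).
by apply: And3; [exact: Z1 | exact: Z2 | exact: Z3].
Qed.
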